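(* Fix $a\in\mathbb{C}$ and $p,q\in\mathbb{C}$. Let $(e_1,e_2,e_3,t)$ vary in a simply connected domain of $\mathbb{C}^4$ on which $e_1,e_2,e_3,a$ are pairwise distinct and $\theta[p,q](t/\omega_1;\Omega)\neq 0$, and consider the monodromy preserving deformation, with deformation parameters $t,e_1,e_2,e_3$, of $$\frac{dY}{dx}=\left(\frac{B_{-1}}{(x-a)^2}+\frac{B_0}{x-a}+\sum_{\nu=1}^3\frac{A_\nu}{x-e_\nu}\right)Y$$ given by the matrix function $Y(x)$ described in the context. Then its $\tau$ function (defined up to a multiplicative constant by $d\log\tau=\omega$, with $\omega$ the 1-form of the context) is $$\tau(e_1,e_2,e_3,t)=\theta[p,q]\!\left(\frac{t}{\omega_1};\Omega\right)\,\omega_1^{-\frac12}\prod_{1\le\nu<\mu\le3}(e_\nu-e_\mu)^{-\frac18}\,\exp\!\left(\frac{\eta_1t^2}{2\omega_1}\right)\exp\!\left(\frac{t^2}{4}f(e_1,e_2,e_3)\right),$$ where $$f(e_1,e_2,e_3)=-a+\frac13\sum_{\nu=1}^3e_\nu+\frac12\prod_{\nu=1}^3(a-e_\nu)\sum_{\mu=1}^3\frac1{(a-e_\mu)^2}.$$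
   Context: **Elliptic data.** $E$ is the elliptic curve $y^2=4(x-e_1)(x-e_2)(x-e_3)$ with $e_i$ distinct (not assuming $e_1+e_2+e_3=0$); put $s=e_1+e_2+e_3$. $\gamma,\delta$ is a canonical basis of cycles of $E$ ($\gamma$ encircles $e_2,e_3$), $\omega_1=\int_\gamma dx/y$, $\omega_2=\int_\delta dx/y$ (full periods, chosen to vary holomorphically with the $e_i$), $\Omega=\omega_2/\omega_1$, $\operatorname{Im}\Omega>0$. The Abel map is $u=u(P)=\int_\infty^x dx/y$, so that $x-\tfrac{s}{3}=\wp(u)$ and $y=\wp'(u)$, with $\wp,\zeta,\sigma$ the Weierstrass functions of the lattice $\mathbb{Z}\omega_1+\mathbb{Z}\omega_2$; the labelling is such that $\wp(\omega_1/2)=e_1-\tfrac s3$, $\wp((\omega_1+\omega_2)/2)=e_2-\tfrac s3$, $\wp(\omega_2/2)=e_3-\tfrac s3$. The quasi-periods are $\eta_i$: $\zeta(u+\omega_i)=\zeta(u)+\eta_i$, so $\eta_1\omega_2-\eta_2\omega_1=2\pi i$. $\theta[p,q](z;\Omega)=\sum_{n\in\mathbb{Z}}\exp\{\pi i(n+p)^2\Omega+2\pi i(n+p)(z+q)\}$, $\theta_{11}=\theta[\tfrac12,\tfrac12]$, $\theta_{11}'=\partial_z\theta_{11}(0;\Omega)$, and $\sigma[p,q](u)=\exp\!\big(\tfrac{\eta_1}{2\omega_1}u^2\big)\tfrac{\omega_1}{\theta_{11}'}\theta[p,q](\tfrac{u}{\omega_1};\Omega)$. Finally $\alpha=u(a)$,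 so $\wp(\alpha)=a-\tfrac s3$ and $\wp'(\alpha)^2=4\prod_\nu(a-e_\nu)$. **The function $Y$.** For $u_\varphi,u_\psi\in\mathbb{C}$ put $\varphi(u)=\sigma[p,q](u+u_\varphi+t)\,\sigma(u-u_\varphi)\exp\{-\tfrac t2(\zeta(u-\alpha)+\zeta(u+\alpha))\}$, define $\psi(u)$ by the same formula with $u_\psi$ in place of $u_\varphi$, and let $$\Phi(u)=\begin{pmatrix}\varphi(u)&\varphi(-u)\\ \psi(u)&\psi(-u)\end{pmatrix},$$ where $u_\varphi,u_\psi$ are chosen with $\det\Phi\not\equiv0$ (e.g. $u_\varphi=\alpha$, $u_\psi=-\alpha$). Put $T^{(a)}(x)=-\operatorname{diag}\!\big(\tfrac{\wp'(\alpha)t}{2},-\tfrac{\wp'(\alpha)t}{2}\big)\tfrac1{x-a}$, $G^{(a)}=\lim_{u\to\alpha}\Phi(u)\exp(-T^{(a)}(x))$ with $x=\wp(u)+\tfrac s3$, and $$Y=\frac{\sqrt{\det\Phi(\alpha)}}{\sqrt{\det\Phi(u)}}\,(G^{(a)})^{-1}\Phi(u)$$ (the root ratio being $1$ at $u=\alpha$; $\det\Phi$ is holomorphic at $\alpha$). $Y$ is regarded as a multivalued function of $x$; it does not depend on the choice of $u_\varphi,u_\psi$, it solves a linear system of the form in the claim with $B_{-1},B_0,A_\nu\in sl(2,\mathbb{C})$ independent of $x$, and its monodromy data do not depend on $t,e_1,e_2,e_3$. **Local forms.** Near $x=a$ (with $u$ near $\alpha$): $Y=\hat Y^{(a)}(x)\exp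 T^{(a)}(x)$ with $\hat Y^{(a)}$ holomorphic and $\hat Y^{(a)}(a)=1$. Near $x=e_\nu$ ($\nu=1,2,3$): $Y=G^{(\nu)}\hat Y^{(\nu)}(x)\exp(T^{(\nu)}(x))\,C^{(\nu)}$ with $\hat Y^{(\nu)}$ holomorphic, $\hat Y^{(\nu)}(e_\nu)=1$, $T^{(\nu)}(x)=\operatorname{diag}(-\tfrac14,\tfrac14)\log(x-e_\nu)$, and $G^{(\nu)},C^{(\nu)}$ invertible and independent of $x$. **The 1-form and $\tau$.** Let $d$ be exterior differentiation in $t,e_1,e_2,e_3$ (with $a,p,q$ fixed and $x$ held fixed). Then $\omega=\omega_a+\omega_{e_1}+\omega_{e_2}+\omega_{e_3}$, where $$\omega_a=-\operatorname{Res}_{x=a}\operatorname{tr}\Big(\hat Y^{(a)}(x)^{-1}\tfrac{\partial\hat Y^{(a)}}{\partial x}(x)\,dT^{(a)}(x)\Big),$$ $$\omega_{e_\nu}=-\operatorname{Res}_{x=e_\nu}\operatorname{tr}\Big(\hat Y^{(\nu)}(x)^{-1}\tfrac{\partial\hat Y^{(\nu)}}{\partial x}(x)\,dT^{(\nu)}(x)\Big)=\Big[\operatorname{Res}_{x=e_\nu}\tfrac12\operatorname{tr}\big(\tfrac{dY}{dx}Y^{-1}\big)^2\Big]de_\nu .$$ The form $\omega$ is closed and $\tau$ is defined by $d\log\tau=\omega$. *)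

(* Defs.v *)
From HB Require Import structures.
From mathcomp Require Import all_boot all_order all_algebra.
From mathcomp Require Import all_classical all_reals all_analysis.
From mathcomp Require Import complex.

Set Implicit Arguments.
Unset Strict Implicit.
Unset Printing Implicit Defensive.

Import Order.TTheory GRing.Theory Num.Theory.
Import numFieldNormedType.Exports.

Local Open Scope classical_set_scope.
Local Open Scope ring_scope.

(* R[i] under the name of a numClosedFieldType: the topological and normed
   structures of MathComp-Analysis are inferred for Cx R but not for R[i]. *)
Definition Cx (R : realType) : numClosedFieldType := (R[i])%C.

Section Elliptic.
Variable R : realType.
Local Notation C := (Cx R).

Definition cexp (z : C) : C :=
  Complex (expR (complex.Re z) * cos (complex.Im z))
          (expR (complex.Re z) * sin (complex.Im z)).

(* pi * i *)
Definition ipi : C := Complex 0 pi.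

Definition zbox (N : nat) : seq int := [seq k%:Z - N%:Z | k <- iota 0 N.*2.+1].

(* theta[p,q](z; Omega); the series converges absolutely for Im Omega > 0, so
   that the symmetric partial sums give its value. *)
Definition theta (p q z Omega : C) : C :=
  lim ((\sum_(n <- zbox N)
          cexp (ipi * (n%:~R + p) ^+ 2 * Omega
                + 2 * ipi * (n%:~R + p) * (z + q))) @[N --> \oo]).

Definition theta11' (Omega : C) : C :=
  derive1 (fun z : C => theta 2^-1 2^-1 z Omega) 0.

Definition lat (w1 w2 : C) (mn : int * int) : C := mn.1%:~R * w1 + mn.2%:~R * w2.

Definition in_lat (w1 w2 u : C) : Prop := exists mn, u = lat w1 w2 mn.

(* Nonzero indices with |m|, |n| <= N; all the lattice series and products below
   converge absolutely. *)
Definition latbox (N : nat) : seq (int * int) :=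
  [seq mn <- [seq (m, n) | m <- zbox N, n <- zbox N] | mn != (0, 0)].

Definition wp (w1 w2 u : C) : C :=
  u ^- 2 + lim ((\sum_(mn <- latbox N)
    ((u - lat w1 w2 mn) ^- 2 - (lat w1 w2 mn) ^- 2)) @[N --> \oo]).

Definition wzeta (w1 w2 u : C) : C :=
  u^-1 + lim ((\sum_(mn <- latbox N)
    ((u - lat w1 w2 mn)^-1 + (lat w1 w2 mn)^-1
     + u / (lat w1 w2 mn) ^+ 2)) @[N --> \oo]).

Definition wsigma (w1 w2 u : C) : C :=
  u * lim ((\prod_(mn <- latbox N)
    ((1 - u / lat w1 w2 mn)
     * cexp (u / lat w1 w2 mn + (u / lat w1 w2 mn) ^+ 2 / 2))) @[N --> \oo]).

Definition sigma_pq (w1 w2 eta1 p q u : C) : C :=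
  cexp (eta1 / (2 * w1) * u ^+ 2) * (w1 / theta11' (w2 / w1))
  * theta p q (u / w1) (w2 / w1).

(* w1/2, (w1+w2)/2, w2/2, matching e_1, e_2, e_3. *)
Definition half_period (w1 w2 : C) (nu : 'I_3) : C :=
  nth 0 [:: w1 / 2; (w1 + w2) / 2; w2 / 2] nu.

Definition on_curve (e : 'I_3 -> C) (x y : C) : Prop :=
  y ^+ 2 = 4 * \prod_nu (x - e nu).

Definition cderive1 (x : R -> C) (s : R) : C :=
  Complex (derive1 (fun s => complex.Re (x s)) s)
          (derive1 (fun s => complex.Im (x s)) s).

(* (x, y) is a C^1 path on E, with y <> 0 so that dx/y pulls back to
   (x'/y) ds; every homology class has such a representative. *)
Definition curve_path (e : 'I_3 -> C) (I : set R) (x y : R -> C) : Prop :=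
  {within I, continuous y} /\
  forall s, I s ->
    [/\ on_curve e (x s) (y s), y s != 0,
        derivable (fun s => complex.Re (x s)) s 1
        /\ derivable (fun s => complex.Im (x s)) s 1
      & {for s, continuous (derive1 (fun s => complex.Re (x s)))}
        /\ {for s, continuous (derive1 (fun s => complex.Im (x s)))}].

(* The integral of dx/y along the part b <= s <= 1 of the path (x, y). *)
Definition path_int (x y : R -> C) (b : R) : C :=
  Complex
    (\int[lebesgue_measure]_(s in `[b, 1]) complex.Re (cderive1 x s / y s))
    (\int[lebesgue_measure]_(s in `[b, 1]) complex.Im (cderive1 x s / y s)).

Definition is_period (e : 'I_3 -> C) (w : C) : Prop :=
  exists x y : R -> C,
    [/\ curve_path e `[0, 1] x y, x 0 = x 1, y 0 = y 1 & w = path_int x y 0].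

(* w1, w2 are the integrals of dx/y over cycles gamma, delta.  These form a
   basis of H_1(E, Z) since every period is an integral combination of w1, w2
   (the period map is injective on H_1), and Im (w2/w1) > 0 orients it.  The
   labelling of the half-periods expresses that gamma encircles e_2, e_3. *)
Definition canonical_periods (e : 'I_3 -> C) (w1 w2 : C) : Prop :=
  [/\ is_period e w1, is_period e w2,
      (forall w, is_period e w -> in_lat w1 w2 w),
      0 < complex.Im (w2 / w1)
    & forall nu, wp w1 w2 (half_period w1 w2 nu) = e nu - (\sum_mu e mu) / 3].

(* alpha is the integral of dx/y from infinity to a point over x = a. *)
Definition abel_image (e : 'I_3 -> C) (a alpha : C) : Prop :=
  exists x y : R -> C,
    [/\ curve_path e `]0, 1] x y, x 1 = a,
        (x s)^-1 @[s --> (0:R)^'+] --> (0:C)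
      & path_int x y b @[b --> (0:R)^'+] --> alpha].

(* The exponential of a diagonal matrix. *)
Definition mxexp_diag n (M : 'M[C]_n) : 'M[C]_n := diag_mx (\row_j cexp (M j j)).

Definition diag2 (c d : C) : 'M[C]_2 := diag_mx (\row_(j < 2) if j == 0 then c else d).

(* r is the residue of f at the (at most) pole x0. *)
Definition is_residue (f : C -> C) (x0 r : C) : Prop :=
  exists (n : nat) (c : nat -> C) (h : C -> C),
    (\forall x \near x0, derivable h x 1) /\
    (\forall x \near x0^',
       f x = r / (x - x0) + \sum_(k < n) c k / (x - x0) ^+ k.+2 + h x).

Definition residue (f : C -> C) (x0 : C) : C := xget 0 [set r | is_residue f x0 r].

End Elliptic.

Section Domain.
Variables (R : realType) (T : topologicalType).

Definition is_loop (D : set T) (g : R -> T) : Prop :=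
  [/\ {within `[0, 1], continuous g}, g @` `[0, 1] `<=` D & g 0 = g 1].

Definition simply_connected (D : set T) : Prop :=
  [/\ D !=set0,
      (forall x y, D x -> D y -> exists g : R -> T,
        [/\ {within `[0, 1], continuous g}, g @` `[0, 1] `<=` D, g 0 = x & g 1 = y])
    & forall g : R -> T, is_loop D g -> exists H : R * R -> T,
        [/\ {within `[0, 1] `*` `[0, 1], continuous H},
            H @` (`[0, 1] `*` `[0, 1]) `<=` D,
            (forall s : R, 0 <= s <= 1 -> H (s, 0) = g s /\ H (s, 1) = g 0)
          & forall s : R, 0 <= s <= 1 -> H (0, s) = g 0 /\ H (1, s) = g 0]].

End Domain.

Section Deformation.
Variable R : realType.
Local Notation C := (Cx R).
(* Points of C^4 are z = (e_1, e_2, e_3, t). *)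
Local Notation P := 'rV[C]_4.

Definition ebr (z : P) (nu : 'I_3) : C := z ord0 (widen_ord (leqnSn 3) nu).
Definition tpar (z : P) : C := z ord0 ord_max.

Definition partial (V : normedModType C) (j : 'I_4) (f : P -> V) (z : P) : V :=
  'D_(delta_mx 0 j) f z.

Definition holomorphic_on (D : set P) (f : P -> C) : Prop :=
  forall z, D z -> differentiable f z.

(* d log f = df / f, the coefficient of the j-th coordinate differential. *)
Definition dlog (j : 'I_4) (f : P -> C) (z : P) : C := partial j f z / f z.

Variables (a p q : C) (om1 om2 eta1 alpha uphi upsi : P -> C).

Definition xmap (z : P) (u : C) : C := wp (om1 z) (om2 z) u + (\sum_nu ebr z nu) / 3.
Definition wp' (z : P) (u : C) : C := derive1 (wp (om1 z) (om2 z)) u.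

Definition elliptic_data (D : set P) : Prop :=
  [/\ holomorphic_on D om1 /\ holomorphic_on D om2,
      holomorphic_on D alpha,
      (forall z, D z -> canonical_periods (ebr z) (om1 z) (om2 z)),
      (forall z, D z -> forall u, ~ in_lat (om1 z) (om2 z) u ->
         wzeta (om1 z) (om2 z) (u + om1 z) = wzeta (om1 z) (om2 z) u + eta1 z)
    & forall z, D z ->
        [/\ abel_image (ebr z) a (alpha z), ~ in_lat (om1 z) (om2 z) (alpha z)
          & xmap z (alpha z) = a]].

Definition phi (z : P) (v u : C) : C :=
  sigma_pq (om1 z) (om2 z) (eta1 z) p q (u + v + tpar z)
  * wsigma (om1 z) (om2 z) (u - v)
  * cexp (- (tpar z / 2) * (wzeta (om1 z) (om2 z) (u - alpha z)
                            + wzeta (om1 z) (om2 z) (u + alpha z))).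

Definition Phi (z : P) (u : C) : 'M[C]_2 :=
  \matrix_(i < 2, j < 2)
    phi z (if i == 0 then uphi z else upsi z) (if j == 0 then u else - u).

Definition regular_point (z : P) (u : C) : Prop :=
  [/\ ~ in_lat (om1 z) (om2 z) u, ~ in_lat (om1 z) (om2 z) (u - alpha z)
    & ~ in_lat (om1 z) (om2 z) (u + alpha z)].

Definition detPhi_nonzero (z : P) : Prop :=
  exists u, regular_point z u /\ \det (Phi z u) != 0.

Definition Ta (z : P) (x : C) : 'M[C]_2 :=
  - ((x - a)^-1 *: diag2 (wp' z (alpha z) * tpar z / 2)
                         (- (wp' z (alpha z) * tpar z / 2))).

Definition Ga (z : P) : 'M[C]_2 :=
  lim (Phi z u *m mxexp_diag (- Ta z (xmap z u)) @[u --> (alpha z)^']).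

(* The value at alpha of the holomorphic extension of det Phi; Phi itself has an
   essential singularity there. *)
Definition detPhi_alpha (z : P) : C :=
  lim (\det (Phi z u) @[u --> (alpha z)^']).

(* r is one of the two values of sqrt(det Phi(alpha)) / sqrt(det Phi(u)). *)
Definition is_root_ratio (z : P) (u r : C) : Prop :=
  r ^+ 2 = detPhi_alpha z / \det (Phi z u).

(* The value of Y at u, given the value r of the root ratio.  The branches of
   the multivalued function Y of x are obtained by taking for u a branch of the
   inverse of xmap z, and for r a branch of the root ratio. *)
Definition Y (z : P) (r u : C) : 'M[C]_2 := r *: (invmx (Ga z) *m Phi z u).

(* dY/dx = (B1/(x-a)^2 + B0/(x-a) + sum_nu A_nu/(x-e_nu)) Y, in terms of u. *)
Definition solves_system (B1 B0 : 'M[C]_2) (A : 'I_3 -> 'M[C]_2) (z : P) : Prop :=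
  [/\ \tr B1 = 0, \tr B0 = 0, (forall nu, \tr (A nu) = 0)
    & forall (u0 : C) (r : C -> C), regular_point z u0 -> \det (Phi z u0) != 0 ->
        (\forall u \near u0, derivable r u 1 /\ is_root_ratio z u (r u)) ->
        derive1 (fun u => Y z (r u) u) u0
        = wp' z u0 *: (((xmap z u0 - a) ^- 2 *: B1 + (xmap z u0 - a)^-1 *: B0
            + \sum_nu (xmap z u0 - ebr z nu)^-1 *: A nu) *m Y z (r u0) u0)].

Definition local_form_a (z : P) (Yh : C -> 'M[C]_2) : Prop :=
  [/\ (\forall x \near a, derivable Yh x 1), Yh a = 1%:M
    & exists r : C -> C,
        [/\ (\forall u \near alpha z, derivable r u 1), r (alpha z) = 1
          & \forall u \near (alpha z)^', is_root_ratio z u (r u)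
              /\ Y z (r u) u = Yh (xmap z u) *m mxexp_diag (Ta z (xmap z u))]].

(* Near e_nu all branches are single-valued in xi = log (x - e_nu), which ranges
   over a left half-plane. *)
Definition local_form_e (nu : 'I_3) (z : P) (Yh : C -> 'M[C]_2)
    (G Cm : 'M[C]_2) : Prop :=
  [/\ (\forall x \near ebr z nu, derivable Yh x 1), Yh (ebr z nu) = 1%:M,
      G \in unitmx, Cm \in unitmx
    & exists (rho : R) (u r : C -> C), forall xi : C, complex.Re xi < rho ->
        [/\ derivable u xi 1, derivable r xi 1,
            xmap z (u xi) = ebr z nu + cexp xi,
            is_root_ratio z (u xi) (r xi)
          & Y z (r xi) (u xi)
            = G *m Yh (ebr z nu + cexp xi)
                *m mxexp_diag (xi *: diag2 (- 4^-1) 4^-1) *m Cm]].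

(* The coefficient of dT^(nu), for T^(nu) = diag(-1/4,1/4) log(x - e_nu). *)
Definition dTe (nu : 'I_3) (j : 'I_4) (z : P) (x : C) : 'M[C]_2 :=
  dlog j (fun z' => x - ebr z' nu) z *: diag2 (- 4^-1) 4^-1.

Definition omega_a (Ya : P -> C -> 'M[C]_2) (j : 'I_4) (z : P) : C :=
  - residue (fun x => \tr (invmx (Ya z x) *m derive1 (Ya z) x
                           *m partial j (fun z' => Ta z' x) z)) a.

Definition omega_e (nu : 'I_3) (Ye : P -> C -> 'M[C]_2) (j : 'I_4) (z : P) : C :=
  - residue (fun x => \tr (invmx (Ye z x) *m derive1 (Ye z) x *m dTe nu j z x))
            (ebr z nu).

(* The coefficient in omega of de_1, de_2, de_3, dt for j = 0, 1, 2, 3. *)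
Definition omega (Ya : P -> C -> 'M[C]_2) (Ye : 'I_3 -> P -> C -> 'M[C]_2)
    (j : 'I_4) (z : P) : C :=
  omega_a Ya j z + \sum_nu omega_e nu (Ye nu) j z.

Definition is_tau (D : set P) (om : 'I_4 -> P -> C) (tau : P -> C) : Prop :=
  holomorphic_on D tau /\
  forall z, D z -> tau z != 0 /\ forall j, dlog j tau z = om j z.

(* g is a holomorphic branch of f ^ (-1/n) on D. *)
Definition is_inv_root (D : set P) (n : nat) (f g : P -> C) : Prop :=
  holomorphic_on D g /\ forall z, D z -> g z ^+ n = (f z)^-1.

Definition f_tau (z : P) : C :=
  - a + (\sum_nu ebr z nu) / 3
  + 2^-1 * (\prod_nu (a - ebr z nu)) * \sum_mu ((a - ebr z mu) ^+ 2)^-1.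

(* omr is a branch of omega_1^(-1/2), er nu mu one of (e_nu - e_mu)^(-1/8). *)
Definition tau_formula (omr : P -> C) (er : 'I_3 -> 'I_3 -> P -> C) (z : P) : C :=
  theta p q (tpar z / om1 z) (om2 z / om1 z) * omr z
  * (\prod_(nu < 3) \prod_(mu < 3 | (nu < mu)%N) er nu mu z)
  * cexp (eta1 z * tpar z ^+ 2 / (2 * om1 z))
  * cexp (tpar z ^+ 2 / 4 * f_tau z).

End Deformation.

(* Main.v *)
(* The triple product locates the zeros of theta_11, so that sigma, zeta and wp
   are expressed by theta_11 and its derivatives at the period ratio Omega.  By
   the heat equation every derivative in Omega then becomes a derivative in u,
   and differentiating wp(half period) = e_nu - s/3 gives the variation of
   omega_1 and Omega with the branch points.

   Y differs by a constant left factor from a matrix of sections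
   sigma[p,q](u + v + t) sigma(u - v) times an exponential of zeta functions;
   the minors formed from such sections and their derivatives depend on v only
   through a common factor.  Hence the diagonal part of Yhat^-1 dYhat/dx at a,
   and at e_nu, is an expression in the logarithmic derivatives of sigma[p,q] at
   t and in wp(alpha), by the addition theorem.  With the variation formulas,
   d log of the right-hand side equals omega coordinate by coordinate, by an
   identity of rational functions; and two functions with the same d log on a
   path-connected open set are proportional. *)

Require Import Defs.
From HB Require Import structures.
From mathcomp Require Import all_boot all_order all_algebra.
From mathcomp Require Import all_classical all_reals all_analysis.
From mathcomp Require Import complex ring lra zify.

Set Implicit Arguments.
Unset Strict Implicit.
Unset Printing Implicit Defensive.

Import Order.TTheory GRing.Theory Num.Theory.
Import numFieldNormedType.Exports.

Local Open Scope classical_set_scope.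
Local Open Scope ring_scope.

(** * Real modulus and complex derivatives in epsilon form *)

Section Modulus.
Variable R : realType.
Local Notation C := (Cx R).

(** The functions [wp], [wzeta] and [wsigma] are limits of lattice sums and products, while
    [sigma_pq] is a theta series, so the two worlds must first be compared. The comparison rests on
    a distribution relation: the lattice sum for wp' and its theta counterpart both satisfy 8 f(2u)
    = f(u) + the sum of the f(u + half-period). Their difference is bounded, the relation halves any
    bound for it, and so it vanishes. That the numbers e_nu - s/3 add up to 0 then fixes the
    constant of integration of wp. At e_nu only one diagonal trace is wanted, but the matrices [G]
    and [Cm] of the local form are unknown. Taking determinants of derivatives in log (x - e_nu)
    removes them; this brings in the second derivative of sigma[p,q] at t, which the heat equation
    matches with the variation of Omega. The definitions of residue and local form assume no more
    than differentiability near a point. That the derivative is again differentiable is obtained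
    from Goursat's theorem. *)

Definition ofr (x : R) : C := Complex x 0.
(** The norm of [Cx R] takes its values in [Cx R], where the order is partial. This real copy makes
    estimates accessible to [lra] and [nra]; [posC] turns a positive complex radius into a real
    one. *)
Definition cabs (z : C) : R := complex.Re `|z|.

Lemma normE (z : C) : `|z| = ofr (cabs z).
Proof. by rewrite /cabs normc_def. Qed.

Lemma ofr_le (x y : R) : (ofr x <= ofr y) = (x <= y).
Proof. exact: lecR. Qed.
Lemma ofr_lt (x y : R) : (ofr x < ofr y) = (x < y).
Proof. exact: ltcR. Qed.
Lemma ofrD (x y : R) : ofr (x + y) = ofr x + ofr y.
Proof. by apply/eqP; rewrite eq_complex /= addr0 !eqxx. Qed.
Lemma ofrN (x : R) : ofr (- x) = - ofr x.
Proof. by apply/eqP; rewrite eq_complex /= oppr0 !eqxx. Qed.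
Lemma ofrM (x y : R) : ofr (x * y) = ofr x * ofr y.
Proof. by apply/eqP; rewrite eq_complex /= !(mulr0, mul0r) addr0 subr0 !eqxx. Qed.
Lemma ofr0 : ofr 0 = 0. Proof. by []. Qed.
Lemma ofr1 : ofr 1 = 1. Proof. by []. Qed.
Lemma ofr_inj : injective ofr. Proof. by move=> x y []. Qed.
Lemma ofr_nat n : ofr n%:R = n%:R.
Proof. by elim: n => // n IH; rewrite -[n.+1]addn1 !natrD ofrD IH. Qed.
Lemma ofr_eq0 (x : R) : (ofr x == 0) = (x == 0).
Proof. by rewrite -ofr0 (inj_eq ofr_inj). Qed.
Lemma ofrV (x : R) : ofr x^-1 = (ofr x)^-1.
Proof.
have [->|x0] := eqVneq x 0; first by rewrite invr0 ofr0 invr0.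
apply: (@mulfI _ (ofr x)); first by rewrite ofr_eq0.
by rewrite -ofrM !mulfV // ofr_eq0.
Qed.

Lemma cabs_ge0 (z : C) : 0 <= cabs z.
Proof. by rewrite -ofr_le -normE normr_ge0. Qed.
Lemma cabs_eq0 (z : C) : (cabs z == 0) = (z == 0).
Proof. by rewrite -ofr_eq0 -normE normr_eq0. Qed.
Lemma cabs0 : cabs 0 = 0. Proof. by apply/eqP; rewrite cabs_eq0. Qed.
Lemma cabs_gt0 (z : C) : (0 < cabs z) = (z != 0).
Proof. by rewrite lt_neqAle cabs_ge0 andbT eq_sym cabs_eq0. Qed.
Lemma cabsM (z w : C) : cabs (z * w) = cabs z * cabs w.
Proof. by apply: ofr_inj; rewrite ofrM -!normE normrM. Qed.
Lemma cabsV (z : C) : cabs z^-1 = (cabs z)^-1.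
Proof. by apply: ofr_inj; rewrite ofrV -!normE normfV. Qed.
Lemma cabsN (z : C) : cabs (- z) = cabs z.
Proof. by apply: ofr_inj; rewrite -!normE normrN. Qed.
Lemma cabsD (z w : C) : cabs (z + w) <= cabs z + cabs w.
Proof. by rewrite -ofr_le ofrD -!normE ler_normD. Qed.
Lemma cabsB (z w : C) : cabs (z - w) <= cabs z + cabs w.
Proof. by rewrite (le_trans (cabsD _ _)) // cabsN. Qed.
Lemma cabsBC (z w : C) : cabs (z - w) = cabs (w - z).
Proof. by rewrite -cabsN opprB. Qed.
Lemma cabsX (z : C) n : cabs (z ^+ n) = cabs z ^+ n.
Proof.
by elim: n => [|n IH]; [apply: ofr_inj; rewrite -normE normr1|rewrite !exprS cabsM IH].
Qed.
Lemma cabs1 : cabs 1 = 1. Proof. exact: (cabsX 0 0). Qed.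
Lemma cabs_ofr (x : R) : cabs (ofr x) = `|x|.
Proof.
by rewrite /cabs normc_def /= expr0n /= addr0 sqrtr_sqr.
Qed.
Lemma cabs_nat n : cabs n%:R = n%:R.
Proof. by rewrite -ofr_nat cabs_ofr ger0_norm. Qed.
Lemma cabs_int (n : int) : cabs n%:~R = `|n%:~R|.
Proof. by case: n => n; rewrite ?NegzE ?mulrNz ?cabsN ?normrN /= -?pmulrn cabs_nat ger0_norm. Qed.
Lemma cabsDB (z w v : C) : cabs (z - w) <= cabs (z - v) + cabs (v - w).
Proof. by have := cabsD (z - v) (v - w); rewrite addrA subrK. Qed.
Lemma cabs_lowB (z w : C) : cabs z - cabs w <= cabs (z - w).
Proof. by have := cabsD (z - w) w; rewrite subrK; lra. Qed.
Lemma cabs_sum (I : Type) (s : seq I) (f : I -> C) :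
  cabs (\sum_(i <- s) f i) <= \sum_(i <- s) cabs (f i).
Proof.
elim: s => [|i s IH]; first by rewrite !big_nil cabs0.
by rewrite !big_cons (le_trans (cabsD _ _)) // lerD2l.
Qed.

Lemma Re_le (z : C) : `|complex.Re z| <= cabs z.
Proof. by rewrite -ofr_le -normE; exact: (normc_ge_Re z). Qed.
Lemma Im_le (z : C) : `|complex.Im z| <= cabs z.
Proof.
rewrite /cabs normc_def /= -sqrtr_sqr ler_wsqrtr //.
by rewrite lerDr sqr_ge0.
Qed.
Lemma cabs_le (z : C) : cabs z <= `|complex.Re z| + `|complex.Im z|.
Proof.
case: z => a b /=; have -> : Complex a b = ofr a + Complex 0 1 * ofr b :> C.
  by apply/eqP; rewrite eq_complex /= !(mul0r, mulr0, mul1r, addr0, subr0, add0r) !eqxx.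
apply: (le_trans (cabsD _ _)); rewrite cabsM !cabs_ofr lerD2l.
suff -> : cabs (Complex 0 1 : C) = 1 by rewrite mul1r.
by rewrite /cabs normc_def /= expr0n /= add0r expr1n sqrtr1.
Qed.

Lemma cReD (z w : C) : complex.Re (z + w) = complex.Re z + complex.Re w.
Proof. by case: z w => [a b] [c d]. Qed.
Lemma cImD (z w : C) : complex.Im (z + w) = complex.Im z + complex.Im w.
Proof. by case: z w => [a b] [c d]. Qed.
Lemma cReN (z : C) : complex.Re (- z) = - complex.Re z. Proof. by case: z. Qed.
Lemma cImN (z : C) : complex.Im (- z) = - complex.Im z. Proof. by case: z. Qed.
Lemma cReM (z w : C) : complex.Re (z * w) =
  complex.Re z * complex.Re w - complex.Im z * complex.Im w.
Proof. by case: z w => [a b] [c d]. Qed.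
Lemma cImM (z w : C) : complex.Im (z * w) =
  complex.Re z * complex.Im w + complex.Im z * complex.Re w.
Proof. by case: z w => [a b] [c d]. Qed.
Lemma Re_ofrM (x : R) (z : C) : complex.Re (ofr x * z) = x * complex.Re z.
Proof. by rewrite cReM /= mul0r subr0. Qed.
Lemma Im_ofrM (x : R) (z : C) : complex.Im (ofr x * z) = x * complex.Im z.
Proof. by rewrite cImM /= mul0r addr0. Qed.
Lemma cE (z : C) : z = Complex (complex.Re z) (complex.Im z). Proof. by case: z. Qed.
Lemma c_eqP (z w : C) : complex.Re z = complex.Re w -> complex.Im z = complex.Im w -> z = w.
Proof. by case: z w => [a b] [c d] /= -> ->. Qed.
Lemma cabs_sq (z : C) : cabs z ^+ 2 = complex.Re z ^+ 2 + complex.Im z ^+ 2.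
Proof. by rewrite /cabs normc_def /= sqr_sqrtr // addr_ge0 ?sqr_ge0. Qed.

Lemma posC (e : C) : 0 < e -> exists2 r : R, 0 < r & e = ofr r.
Proof.
rewrite ltcE /= => /andP[/eqP h1 h2]; exists (complex.Re e) => //.
by rewrite [LHS]cE h1.
Qed.

Lemma nearC (x : C) (P : C -> Prop) :
  (\forall z \near x, P z) <-> exists2 d : R, 0 < d & forall z, cabs (z - x) < d -> P z.
Proof.
split.
  move=> /nbhs_ballP[e /= /posC[r r0 ->] H]; exists r => // z zx; apply: H.
  by rewrite -ball_normE /= distrC normE ofr_lt.
move=> [d d0 H]; apply/nbhs_ballP; exists (ofr d); first by rewrite /= -ofr0 ofr_lt.
by move=> z; rewrite -ball_normE /= distrC normE ofr_lt; exact: H.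
Qed.

Lemma nearC' (x : C) (P : C -> Prop) :
  (\forall z \near x^', P z) <->
  exists2 d : R, 0 < d & forall z, z != x -> cabs (z - x) < d -> P z.
Proof.
split.
  by move=> /nearC[d d0 H]; exists d => // z zx zd; apply: H.
by move=> [d d0 H]; apply/nearC; exists d => // z zd zx; apply: H.
Qed.

Lemma cvgC (T : Type) (F : set_system T) {FF : Filter F} (f : T -> C) (l : C) :
  f @ F --> l <-> forall e : R, 0 < e -> \forall t \near F, cabs (f t - l) < e.
Proof.
split => [/cvgrPdist_lt H e e0|H].
  have := H (ofr e); rewrite -ofr0 ofr_lt => /(_ e0).
  by apply: filterS => t; rewrite normE ofr_lt cabsBC.
apply/cvgrPdist_lt => e /posC[r r0 ->]; have := H r r0.
by apply: filterS => t; rewrite normE ofr_lt cabsBC.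
Qed.

Definition der (f : C -> C) (x l : C) := is_derive x (1 : C) f l.

(** The increment is not divided by h, so the bound covers h = 0 as well and composes without case
    distinctions. *)
Lemma derP (f : C -> C) (x l : C) : der f x l <->
  forall e : R, 0 < e -> exists2 d : R, 0 < d &
    forall h, cabs h < d -> cabs (f (x + h) - f x - l * h) <= e * cabs h.
Proof.
have key : (h^-1 *: (f (h *: 1 + x) - f x) @[h --> 0^'] --> l) <->
  forall e : R, 0 < e -> exists2 d : R, 0 < d &
    forall h, cabs h < d -> cabs (f (x + h) - f x - l * h) <= e * cabs h.
  split.
    move=> /cvgC H e e0; have /nearC'[d d0 Hd] := H e e0; exists d => // h hd.
    have [->|h0] := eqVneq h 0; first by rewrite addr0 mulr0 subr0 subrr cabs0 mulr0.
    have := Hd h h0; rewrite subr0 => /(_ hd) /ltW.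
    rewrite /GRing.scale /= mulr1 -(ler_pM2r (x := cabs h)) ?cabs_gt0 // -cabsM.
    by rewrite mulrBl mulrAC mulVf // mul1r [h + x]addrC.
  move=> H; apply/cvgC => e e0; apply/nearC'.
  have e20 : 0 < e / 2 by lra.
  have [d d0 Hd] := H _ e20; exists d => // h h0; rewrite subr0 => hd.
  rewrite /GRing.scale /= mulr1; apply: (@le_lt_trans _ _ (e / 2)); last by lra.
  rewrite -(ler_pM2r (x := cabs h)) ?cabs_gt0 // -cabsM.
  by rewrite mulrBl mulrAC mulVf // mul1r [h + x]addrC; exact: Hd.
rewrite -key; split.
  case => h1 h2; move: h1; rewrite /derivable => /cvg_ex[l' hl'].
  have := h2; rewrite /derive => <-.
  by rewrite (cvg_lim _ hl') //; exact: norm_hausdorff.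
move=> H; split; first by apply/cvg_ex; exists l.
by rewrite /derive; apply: cvg_lim => //; exact: norm_hausdorff.
Qed.

Lemma der_eq (f : C -> C) (x : C) l l' : der f x l -> l = l' -> der f x l'.
Proof. by move=> h <-. Qed.
Lemma der_uniq (f : C -> C) (x : C) l l' : der f x l -> der f x l' -> l = l'.
Proof. by move=> [_ h] [_ h']; rewrite -h h'. Qed.
Lemma der_derive1 (f : C -> C) (x : C) l : der f x l -> derive1 f x = l.
Proof. by move=> [_ h]; rewrite derive1E. Qed.
Lemma der_derivable (f : C -> C) (x : C) l : der f x l -> derivable f x 1.
Proof. by case. Qed.
Lemma derivable_der (f : C -> C) (x : C) : derivable f x 1 -> der f x (derive1 f x).
Proof. by move=> h; rewrite /der derive1E; exact: derivableP. Qed.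

Lemma der_cst (a x : C) : der (fun=> a) x 0. Proof. exact: is_derive_cst. Qed.
Lemma der_id (x : C) : der (fun u => u) x 1. Proof. exact: is_derive_id. Qed.
Lemma derD (f g : C -> C) (x : C) l m : der f x l -> der g x m -> der (fun u => f u + g u) x (l + m).
Proof. exact: is_deriveD. Qed.
Lemma derN (f : C -> C) (x : C) l : der f x l -> der (fun u => - f u) x (- l).
Proof. exact: is_deriveN. Qed.
Lemma derB (f g : C -> C) (x : C) l m : der f x l -> der g x m -> der (fun u => f u - g u) x (l - m).
Proof. exact: is_deriveB. Qed.
Lemma derM (f g : C -> C) (x : C) l m : der f x l -> der g x m ->
  der (fun u => f u * g u) x (f x * m + l * g x).
Proof.
move=> hf hg; have := @is_deriveM _ _ f g x 1 l m hf hg.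
by move/is_derive_eq; apply; rewrite /GRing.scale /= [g x * l]mulrC.
Qed.
Lemma derMc (f : C -> C) (a x : C) l : der f x l -> der (fun u => f u * a) x (l * a).
Proof. by move=> h; apply: der_eq; [exact: derM h (der_cst a x)|rewrite /=; ring]. Qed.
Lemma dercM (f : C -> C) (a x : C) l : der f x l -> der (fun u => a * f u) x (a * l).
Proof. by move=> h; apply: der_eq; [exact: derM (der_cst a x) h|rewrite /=; ring]. Qed.
Lemma derV (f : C -> C) (x : C) l : f x != 0 -> der f x l -> der (fun u => (f u)^-1) x (- l / f x ^+ 2).
Proof.
move=> f0 [h1 h2]; split; first exact: derivableV.
by rewrite (deriveV f0 h1) h2 /GRing.scale /=; field.
Qed.
Lemma der_div (f g : C -> C) (x : C) l m : g x != 0 -> der f x l -> der g x m ->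
  der (fun u => f u / g u) x ((l * g x - f x * m) / g x ^+ 2).
Proof.
move=> g0 hf hg; apply: der_eq; first exact: derM hf (derV g0 hg).
by rewrite /=; field.
Qed.
Lemma der_near (f g : C -> C) (x : C) l : (\forall u \near x, f u = g u) -> der f x l -> der g x l.
Proof.
move=> h; apply: near_eq_is_derive.
exact: h.
Qed.

Lemma der_ext (f g : C -> C) (x l : C) : (forall u, f u = g u) -> der f x l -> der g x l.
Proof. by move=> /funext ->. Qed.
Lemma derX (f : C -> C) n (x : C) l : der f x l -> der (fun u => f u ^+ n) x (n%:R * f x ^+ n.-1 * l).
Proof.
move=> hf; elim: n => [|n IH].
  apply: der_eq; first exact: der_cst.
  by rewrite !mul0r.
apply: (@der_ext (fun u => f u * f u ^+ n)).
  by move=> u; rewrite exprS.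
apply: der_eq; first exact: derM hf IH.
case: n IH => [|n] IH /=; first by rewrite !expr0; ring.
by rewrite -[n.+2]addn1 natrD exprS; ring.
Qed.
Lemma der_comp (f g : C -> C) (x : C) l m : der g x m -> der f (g x) l -> der (fun u => f (g u)) x (l * m).
Proof.
move=> /derP hg /derP hf; apply/derP => e e0.
have m0 : 0 < cabs m + 1 by rewrite ltr_wpDl ?cabs_ge0.
have l0 : 0 < cabs l + 1 by rewrite ltr_wpDl ?cabs_ge0.
have [d2 d20 h2] := hf (e / 2 / (cabs m + 1)) (divr_gt0 (divr_gt0 e0 (@ltr0Sn R 1)) m0).
(* The bound 1 gives |k| <= (|m| + 1) |h|; the second bound keeps the inner error, multiplied by l,
   below half of e. *)
pose e1 := Num.min 1 (e / 2 / (cabs l + 1)).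
have e10 : 0 < e1 by rewrite lt_min ltr01 !divr_gt0 ?ltr0Sn.
have [d1 d10 h1] := hg e1 e10.
exists (Num.min d1 (d2 / (cabs m + 1))); first by rewrite lt_min d10 divr_gt0.
move=> h; rewrite lt_min => /andP[hd1]; rewrite ltr_pdivlMr // => hd2.
have {}h1 := h1 h hd1; set k := g (x + h) - g x in h1.
have gk : g (x + h) = g x + k by rewrite /k; ring.
have a1 : e1 <= 1 by rewrite ge_min lexx.
have a2 : e1 * (cabs l + 1) <= e / 2 by rewrite -ler_pdivlMr // ge_min lexx orbT.
have H0 := cabs_ge0 h.
have kb : cabs k <= (cabs m + 1) * cabs h.
  have := cabsD (k - m * h) (m * h); rewrite subrK cabsM; nra.
have {}h2 := h2 k (le_lt_trans kb _); rewrite mulrC in hd2.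
have {}h2 := h2 hd2.
rewrite gk.
have -> : f (g x + k) - f (g x) - l * m * h = (f (g x + k) - f (g x) - l * k) + l * (k - m * h) by ring.
apply: (le_trans (cabsD _ _)); rewrite cabsM.
have b1 : e / 2 / (cabs m + 1) * cabs k <= e / 2 * cabs h.
  rewrite -mulrA ler_pM2l; last by lra.
  by rewrite mulrC ler_pdivrMr // mulrC.
have b2 : cabs l * cabs (k - m * h) <= e / 2 * cabs h.
  apply: (@le_trans _ _ (cabs l * (e1 * cabs h))); first by rewrite ler_wpM2l ?cabs_ge0.
  rewrite mulrA ler_wpM2r //; apply: le_trans a2; rewrite mulrC ler_wpM2l ?(ltW e10) //.
  by rewrite lerDl.
lra.
Qed.

Lemma der_cont (f : C -> C) (x : C) l : der f x l -> {for x, continuous f}.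
Proof. by case=> h _; apply: differentiable_continuous; apply/derivable1_diffP; exact: h. Qed.

Lemma contC (f : C -> C) x : {for x, continuous f} <->
  forall e : R, 0 < e -> exists2 d : R, 0 < d & forall u, cabs (u - x) < d -> cabs (f u - f x) < e.
Proof.
have FF : Filter (nbhs x) by exact: nbhs_filter.
split => [/(cvgC (F := nbhs x)) H e e0|H].
  by have /nearC := H e e0.
by apply/(cvgC (F := nbhs x)) => e e0; apply/nearC; exact: H.
Qed.

Lemma der_addl (a x : C) : der ( +%R a) x 1.
Proof. by apply: der_eq; [exact: derD (der_cst a x) (der_id x)|rewrite add0r]. Qed.
Lemma der_mull (a x : C) : der ( *%R a) x a.
Proof. by apply: der_eq; [exact: dercM (der_id x)|rewrite mulr1]. Qed.
Lemma der_oppf (x : C) : der -%R x (-1).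
Proof. exact: derN (der_id x). Qed.

End Modulus.

#[global] Opaque der.

(** [dt] differentiates by recursion on the syntax of the function and tries to close nonvanishing
    side conditions from the context. Constant factors are recognized first, to keep the values
    short. [dleaf] is the extension point, redefined below whenever new functions have acquired
    derivatives. *)
Ltac dleaf := fail.
Ltac dt := lazymatch goal with
  | |- der (fun _ => ?a) _ _ => exact: der_cst
  | |- der (fun u => u) _ _ => exact: der_id
  | |- der (fun u => (@?f u) - (@?g u)) _ _ => apply: derB; dt
  | |- der (fun u => (@?f u) + (@?g u)) _ _ => apply: derD; dt
  | |- der (fun u => - (@?f u)) _ _ => apply: derN; dt
  | |- der (fun u => (@?f u) / (@?g u)) _ _ => apply: der_div; [try eassumption|dt|dt]
  | |- der (fun u => (@?f u) * (@?g u)) _ _ =>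
      lazymatch f with
      | (fun _ => ?a) => apply: dercM; dt
      | _ => lazymatch g with
             | (fun _ => ?a) => apply: derMc; dt
             | _ => apply: derM; dt
             end
      end
  | |- der (fun u => (@?f u)^-1) _ _ => apply: derV; [try eassumption|dt]
  | |- der (fun u => (@?f u) ^+ ?n) _ _ => apply: derX; dt
  | |- der ( *%R _) _ _ => exact: der_mull
  | |- der ( +%R _) _ _ => exact: der_addl
  | |- der -%R _ _ => exact: der_oppf
  | |- der id _ _ => exact: der_id
  | |- _ => first [eassumption|dleaf]
  end.

(** * Mean value inequality along segments *)

Section RealSlice.
Variable R : realType.
Local Notation C := (Cx R).

Lemma is_derive_realP (f : R -> R) (x l : R) :
  (forall e : R, 0 < e -> exists2 d : R, 0 < d &
    forall h, `|h| < d -> `|f (x + h) - f x - l * h| <= e * `|h|) ->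
  is_derive x 1 f l.
Proof.
move=> H; have key : h^-1 *: (f (h *: 1 + x) - f x) @[h --> 0^'] --> l.
  apply/cvgrPdist_lt => e e0.
  have e20 : 0 < e / 2 by lra.
  have [d d0 Hd] := H _ e20; apply/nbhs_ballP; exists d => // h.
  rewrite -ball_normE /= sub0r normrN => hd h0.
  rewrite /GRing.scale /= mulr1; apply: (@le_lt_trans _ _ (e / 2)); last by lra.
  rewrite distrC -(ler_pM2r (x := `|h|)) ?normr_gt0 // -normrM.
  by rewrite mulrBl mulrAC mulVf // mul1r [h + x]addrC; exact: Hd.
split; first by apply/cvg_ex; exists l.
by rewrite /derive; apply: cvg_lim.
Qed.

Lemma is_derive_realE (f : R -> R) (x l : R) : is_derive x 1 f l ->
  forall e : R, 0 < e -> exists2 d : R, 0 < d &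
    forall h, `|h| < d -> `|f (x + h) - f x - l * h| <= e * `|h|.
Proof.
move=> [/cvg_ex [l' /= hl']]; rewrite /derive (cvg_lim _ hl') // => <- e e0.
move/cvgrPdist_lt: hl' => /(_ e e0) /nbhs_ballP[d /= d0 Hd].
exists d => // h hd; have [->|h0] := eqVneq h 0.
  by rewrite addr0 subrr mulr0 subr0 normr0 mulr0.
have := Hd h; rewrite -ball_normE /= sub0r normrN => /(_ hd h0) /ltW.
rewrite /GRing.scale /= mulr1 distrC -(ler_pM2r (x := `|h|)) ?normr_gt0 // -normrM.
by rewrite mulrBl mulrAC mulVf // mul1r [h + x]addrC.
Qed.

Definition pt (a b : C) (s : R) : C := a + ofr s * (b - a).

Lemma pt0 a b : pt a b 0 = a. Proof. by rewrite /pt ofr0 mul0r addr0. Qed.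
Lemma pt1 a b : pt a b 1 = b. Proof. by rewrite /pt ofr1 mul1r addrC subrK. Qed.

Lemma slice_derive (f : C -> C) (a b w l : C) (s : R) : der f (pt a b s) l ->
  is_derive s 1 (fun s => complex.Re (w * f (pt a b s))) (complex.Re (w * (l * (b - a)))).
Proof.
move=> /derP H; apply: is_derive_realP => e e0.
pose K := cabs w * cabs (b - a) + 1.
have K0 : 0 < K by rewrite ltr_wpDl // mulr_ge0 ?cabs_ge0.
have [d d0 Hd] := H (e / K) (divr_gt0 e0 K0).
exists (d / (cabs (b - a) + 1)) => [|h hd]; first by rewrite divr_gt0 // ltr_wpDl ?cabs_ge0.
have ptD : pt a b (s + h) = pt a b s + ofr h * (b - a) by rewrite /pt ofrD; ring.
have hb : cabs (ofr h * (b - a)) < d.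
  rewrite cabsM cabs_ofr; move: hd; rewrite ltr_pdivlMr ?ltr_wpDl ?cabs_ge0 //.
  by apply: le_lt_trans; rewrite ler_wpM2l // lerDl.
have := Hd _ hb; rewrite -ptD => H2.
have -> : complex.Re (w * f (pt a b (s + h))) - complex.Re (w * f (pt a b s))
   - complex.Re (w * (l * (b - a))) * h =
   complex.Re (w * (f (pt a b (s + h)) - f (pt a b s) - l * (ofr h * (b - a)))).
  have -> : w * (f (pt a b (s + h)) - f (pt a b s) - l * (ofr h * (b - a))) =
     w * f (pt a b (s + h)) - w * f (pt a b s) - ofr h * (w * (l * (b - a))) by ring.
  by rewrite !(cReD, cReN) Re_ofrM [h * _]mulrC.
apply: (le_trans (Re_le _)); rewrite cabsM.
apply: (le_trans (ler_wpM2l (cabs_ge0 _) H2)).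
rewrite cabsM cabs_ofr.
have -> : cabs w * (e / K * (`|h| * cabs (b - a))) =
  e * `|h| * ((cabs w * cabs (b - a)) / K) by field; rewrite gt_eqF.
rewrite ler_piMr ?mulr_ge0 ?(ltW e0) // ler_pdivrMr // mul1r /K.
by rewrite lerDl.
Qed.

Lemma slice_cont (f : C -> C) (a b w : C) (s : R) : {for pt a b s, continuous f} ->
  {for s, continuous (fun s => complex.Re (w * f (pt a b s)))}.
Proof.
move=> /contC H; apply/cvgrPdist_lt => e e0.
have K0 : 0 < cabs w + 1 by rewrite ltr_wpDl ?cabs_ge0.
have [d d0 Hd] := H (e / (cabs w + 1)) (divr_gt0 e0 K0).
have L0 : 0 < cabs (b - a) + 1 by rewrite ltr_wpDl ?cabs_ge0.
apply/nbhs_ballP; exists (d / (cabs (b - a) + 1)) => [|h]; first by rewrite /= divr_gt0.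
rewrite /ball_ /= ltr_pdivlMr // => hd.
have hb : cabs (pt a b h - pt a b s) < d.
  have -> : pt a b h - pt a b s = ofr (h - s) * (b - a) by rewrite /pt ofrD ofrN; ring.
  rewrite cabsM cabs_ofr distrC; apply: le_lt_trans hd.
  by rewrite ler_wpM2l // lerDl.
have := Hd _ hb; rewrite ltr_pdivlMr // => H2.
have -> : complex.Re (w * f (pt a b s)) - complex.Re (w * f (pt a b h)) =
  complex.Re (- w * (f (pt a b h) - f (pt a b s))).
  by rewrite mulNr mulrBr !(cReN, cReD); ring.
apply: (le_lt_trans (Re_le _)); rewrite cabsM cabsN; apply: le_lt_trans H2.
by rewrite [leRHS]mulrC ler_wpM2r ?cabs_ge0 // lerDl.
Qed.

Lemma conjM (z : C) : (z^*)%C * z = ofr (cabs z ^+ 2).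
Proof. by apply: c_eqP; rewrite /= ?cabs_sq; case: z => x y /=; ring. Qed.

(** The unit number w rotates f b - f a onto the positive axis, so the real mean value theorem can
    be applied to Re (w f) along the segment. *)
Lemma seg_bound (f f' : C -> C) (a b : C) (M : R) :
  (forall s : R, 0 <= s <= 1 -> {for pt a b s, continuous f}) ->
  (forall s : R, 0 < s < 1 -> der f (pt a b s) (f' (pt a b s))) ->
  (forall s : R, 0 < s < 1 -> cabs (f' (pt a b s) * (b - a)) <= M) ->
  cabs (f b - f a) <= M.
Proof.
move=> hc hd hM; pose v := f b - f a.
have [v0|v0] := eqVneq v 0.
  have I : 0 < (2^-1 : R) < 1 by lra.
  by rewrite -/v v0 cabs0; apply: le_trans (cabs_ge0 _) (hM _ I).
pose w := (v^*)%C * ofr (cabs v)^-1.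
have v1 : 0 < cabs v by rewrite cabs_gt0.
have w1 : cabs w = 1.
  rewrite cabsM cabs_ofr normfV (ger0_norm (cabs_ge0 _)).
  have -> : cabs ((v^*)%C : C) = cabs v by rewrite /cabs normcJ.
  by rewrite mulfV // gt_eqF.
have wv : w * v = ofr (cabs v).
  rewrite /w mulrAC conjM -ofrM expr2 mulfK // gt_eqF //.
have [||c cI H] := @MVT R (fun s => complex.Re (w * f (pt a b s)))
  (fun s => complex.Re (w * (f' (pt a b s) * (b - a)))) 0 1 ltr01.
- move=> s; rewrite in_itv /= => sI; apply: slice_derive; exact: hd.
- apply: continuous_in_subspaceT => s; rewrite inE /= in_itv /= => sI.
  by apply: slice_cont; exact: hc.
move: H; rewrite pt0 pt1 subr0 mulr1.
have -> : complex.Re (w * f b) - complex.Re (w * f a) = complex.Re (w * v).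
  by rewrite /v mulrBr cReD cReN.
rewrite wv /= => ->; apply: (le_trans (ler_norm _)); apply: (le_trans (Re_le _)).
by rewrite cabsM w1 mul1r; apply: hM; move: cI; rewrite in_itv.
Qed.

Lemma pt_dist (x a b : C) (r : R) s : 0 <= s <= 1 -> cabs (a - x) < r -> cabs (b - x) < r ->
  cabs (pt a b s - x) < r.
Proof.
move=> /andP[s0 s1] ha hb.
have -> : pt a b s - x = ofr (1 - s) * (a - x) + ofr s * (b - x).
  by rewrite /pt ofrD ofrN ofr1; ring.
apply: (le_lt_trans (cabsD _ _)); rewrite !cabsM !cabs_ofr !ger0_norm ?subr_ge0 //.
have [->|sn0] := eqVneq s 0; first by rewrite subr0 mul1r mul0r addr0.
have sp : 0 < s by rewrite lt_def sn0.
by nra.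
Qed.

Lemma ball_bound (f f' : C -> C) (x a b : C) (r M : R) :
  (forall u, cabs (u - x) < r -> der f u (f' u)) ->
  (forall u, cabs (u - x) < r -> cabs (f' u) <= M) ->
  cabs (a - x) < r -> cabs (b - x) < r ->
  cabs (f b - f a) <= M * cabs (b - a).
Proof.
move=> hd hM ha hb; apply: (@seg_bound f f').
- by move=> s sI; apply: der_cont; apply: hd; exact: pt_dist.
- by move=> s sI; apply: hd; apply: pt_dist => //; lra.
move=> s sI; rewrite cabsM ler_wpM2r ?cabs_ge0 //; apply: hM; apply: pt_dist => //; lra.
Qed.

(** The mean value inequality is used twice, for f minus its linear part and for f'; hence the
    constant M instead of M / 2. *)
Lemma taylor2 (f f' f'' : C -> C) (x h : C) (r M : R) :
  (forall u, cabs (u - x) < r -> der f u (f' u)) ->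
  (forall u, cabs (u - x) < r -> der f' u (f'' u)) ->
  (forall u, cabs (u - x) < r -> cabs (f'' u) <= M) ->
  cabs h < r ->
  cabs (f (x + h) - f x - f' x * h) <= M * cabs h ^+ 2.
Proof.
move=> hd hd2 hM hr.
have hx : x + h - x = h by rewrite addrAC subrr add0r.
have r0 : 0 < r by exact: le_lt_trans (cabs_ge0 h) hr.
have -> : f (x + h) - f x - f' x * h = (f (x + h) - f' x * (x + h)) - (f x - f' x * x) by ring.
have dg u : cabs (u - x) < r -> der (fun u => f u - f' x * u) u (f' u - f' x).
  move=> hu; apply: der_eq; first by apply: derB; [exact: hd|apply: dercM; exact: der_id].
  by rewrite mulr1.
apply: (@seg_bound (fun u => f u - f' x * u) (fun u => f' u - f' x) x (x + h)).
- move=> s sI; apply: der_cont; apply: dg.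
  by apply: pt_dist => //; rewrite ?subrr ?cabs0 ?hx.
- by move=> s sI; apply: dg; apply: pt_dist; rewrite ?subrr ?cabs0 ?hx //; lra.
move=> s sI; rewrite hx cabsM expr2 mulrA ler_wpM2r ?cabs_ge0 //.
have M0 : 0 <= M by apply: le_trans (hM x _); rewrite ?cabs_ge0 // subrr cabs0.
have hin : cabs (pt x (x + h) s - x) <= cabs h.
  have -> : pt x (x + h) s - x = ofr s * h by rewrite /pt; ring.
  rewrite cabsM cabs_ofr ger0_norm; last by lra.
  by rewrite ler_piMl ?cabs_ge0 //; lra.
apply: le_trans (ler_wpM2l M0 hin).
apply: (@ball_bound f' f'' x _ _ r) => //; first by rewrite subrr cabs0.
exact: le_lt_trans hin hr.
Qed.

Lemma seg_const (f : C -> C) (a b : C) :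
  (forall s : R, 0 <= s <= 1 -> der f (pt a b s) 0) -> f a = f b.
Proof.
move=> h; apply/eqP; rewrite eq_sym -subr_eq0 -cabs_eq0 eq_le cabs_ge0 andbT.
apply: (@seg_bound f (fun=> 0)).
- by move=> s sI; apply: der_cont; exact: h.
- by move=> s sI; apply: h; lra.
by move=> s _; rewrite mul0r cabs0.
Qed.

End RealSlice.

(** * The complex exponential: kernel, surjectivity, derivative *)

Section Exponential.
Variable R : realType.
Local Notation C := (Cx R).
Implicit Types z w : C.

Lemma cexp0 : cexp 0 = 1 :> C.
Proof. by rewrite /cexp /= expR0 cos0 sin0 mulr1 mulr0. Qed.

Lemma cexpD z w : cexp (z + w) = cexp z * cexp w.
Proof.
case: z w => [a b] [c d]; rewrite /cexp /=; apply: c_eqP => /=.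
  by rewrite expRD cosD; ring.
by rewrite expRD sinD; ring.
Qed.

Lemma cabs_cexp z : cabs (cexp z) = expR (complex.Re z).
Proof.
rewrite /cabs normc_def /= !exprMn -mulrDr cos2Dsin2 mulr1 sqrtr_sqr.
by rewrite ger0_norm // expR_ge0.
Qed.

Lemma cexp_neq0 z : cexp z != 0.
Proof. by rewrite -cabs_gt0 cabs_cexp expR_gt0. Qed.

Lemma cexpN z : cexp (- z) = (cexp z)^-1.
Proof.
apply: (mulfI (cexp_neq0 z)); by rewrite -cexpD subrr cexp0 mulfV ?cexp_neq0.
Qed.

Lemma cexpB z w : cexp (z - w) = cexp z / cexp w.
Proof. by rewrite cexpD cexpN. Qed.

Lemma cexp_nat z n : cexp (n%:R * z) = cexp z ^+ n.
Proof.
elim: n => [|n IH]; first by rewrite mul0r cexp0.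
by rewrite -[n.+1]add1n natrD mulrDl mul1r cexpD IH exprS.
Qed.

Lemma cexp_ipi : cexp (ipi R) = -1.
Proof. by rewrite /cexp /= expR0 cospi sinpi; apply: c_eqP => /=; rewrite ?mulr0 ?mul1r ?oppr0. Qed.

Lemma cexp_2ipi_int (n : int) : cexp (2 * ipi R * n%:~R) = 1.
Proof.
have h (m : nat) : cexp (2 * ipi R * m%:R) = 1.
  by rewrite mulrC cexp_nat -[2 * _]/(2%:R * _) cexp_nat cexp_ipi expr2 mulrNN mulr1 expr1n.
case: n => n; first exact: h.
by rewrite NegzE mulrNz mulrN cexpN -pmulrn h invr1.
Qed.

Lemma ipi_neq0 : ipi R != 0.
Proof. by rewrite eq_complex /= eqxx /= gt_eqF // pi_gt0. Qed.

Lemma cos_period_int (y : R) (k : int) : cos (y + (pi *+ 2) * k%:~R) = cos y /\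
  sin (y + (pi *+ 2) * k%:~R) = sin y.
Proof.
have h := cexp_2ipi_int k.
have e : 2 * ipi R * k%:~R = Complex 0 ((pi *+ 2) * k%:~R).
  have -> : (k%:~R : C) = ofr k%:~R.
    by case: k {h} => n; rewrite ?NegzE ?mulrNz /= -?pmulrn ?ofrN ofr_nat.
  by rewrite -[2]/(1 + 1); apply: c_eqP; rewrite /= !(mul0r, mulr0, addr0, add0r, subr0); ring.
have h1 := h; rewrite e in h1.
have : cexp (Complex 0 y + Complex 0 ((pi *+ 2) * k%:~R)) = cexp (Complex 0 y) :> C.
  by rewrite cexpD h1 mulr1.
rewrite /cexp /= !addr0 expR0 !mul1r; by case=> -> ->.
Qed.

(** After reduction the argument lies in [0, 2 pi[. On [0, pi] the cosine is injective, and the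
    upper half is reflected into that interval. *)
Lemma cos_eq1 (y : R) : cos y = 1 -> exists k : int, y = (pi *+ 2) * k%:~R.
Proof.
move=> h; have pi2 : 0 < (pi : R) *+ 2 by rewrite pmulrn_lgt0 // pi_gt0.
pose k := Num.floor (y / (pi *+ 2)); exists k.
pose z := y - (pi *+ 2) * k%:~R.
have z0 : 0 <= z.
  by rewrite subr_ge0 -ler_pdivlMl // mulrC; exact: ge_floor.
have z1 : z < pi *+ 2.
  rewrite ltrBlDr -{1}[pi *+ 2]mulr1 -mulrDr -ltr_pdivrMl // mulrC.
  by have := @floorD1_gt R (y / (pi *+ 2)); rewrite intrD addrC.
have cz : cos z = 1.
  have := cos_period_int y (- k); rewrite mulrNz mulrN => -[-> _]; exact: h.
suff : z = 0 by move/eqP; rewrite subr_eq0 => /eqP.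
have [zp|zp] := leP z pi.
  apply: (@cos_inj R); rewrite ?in_itv /= ?z0 ?zp ?lexx ?ltW ?pi_gt0 //.
  by rewrite cz cos0.
have : cos (pi *+ 2 - z) = 1.
  have := cos_period_int (- z) 1; rewrite mulr1 addrC => -[-> _]; by rewrite cosN.
rewrite -(@cos0 R) => /(@cos_inj R); rewrite !in_itv /=.
have e0 : 0 <= pi *+ 2 - z by rewrite subr_ge0 ltW.
have e1 : pi *+ 2 - z <= pi by rewrite mulr2n; lra.
rewrite e0 e1 lexx (ltW (pi_gt0 R)) => /(_ isT isT) /eqP.
by rewrite subr_eq0 => /eqP e; move: z1; rewrite e ltxx.
Qed.

Lemma cexp_eq1 z : cexp z = 1 -> exists k : int, z = 2 * ipi R * k%:~R.
Proof.
move=> h; have a0 : complex.Re z = 0.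
  by have := cabs_cexp z; rewrite h cabs1 -(@expR0 R) => /expR_inj.
have : cexp z = 1 by []; rewrite /cexp a0 expR0 !mul1r => -[/cos_eq1[k hk] _].
exists k; have -> : (k%:~R : C) = ofr k%:~R.
  by case: k {hk} => n; rewrite ?NegzE ?mulrNz /= -?pmulrn ?ofrN ofr_nat.
rewrite [z]cE a0 hk -[2]/(1 + 1).
by apply: c_eqP; rewrite /= !(mul0r, mulr0, addr0, add0r, subr0); ring.
Qed.

Lemma cexp_surj w : w != 0 -> exists z, cexp z = w.
Proof.
move=> w0; have r0 : 0 < cabs w by rewrite cabs_gt0.
have [x hx] := expR_total r0.
pose c := complex.Re w / cabs w; pose s := complex.Im w / cabs w.
have cs : c ^+ 2 + s ^+ 2 = 1.
  by rewrite !exprMn -mulrDl -cabs_sq exprVn mulfV // expf_neq0 // gt_eqF.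
have cI : -1 <= c <= 1.
  have := sqr_ge0 s; rewrite -ler_norml => h.
  by rewrite -(@ler_pXn2r _ 2) ?nnegrE // real_normK ?num_real // expr1n; lra.
have sE : s ^+ 2 = 1 - c ^+ 2 by rewrite -cs; ring.
have [y [cy sy]] : exists y, cos y = c /\ sin y = s.
  have [s0|s0] := leP 0 s.
    exists (acos c); split; first by apply: acosK; rewrite in_itv.
    by rewrite sin_acos // -sE sqrtr_sqr ger0_norm.
  exists (- acos c); split; first by rewrite cosN; apply: acosK; rewrite in_itv.
  by rewrite sinN sin_acos // -sE sqrtr_sqr ltr0_norm // opprK.
exists (Complex x y); rewrite /cexp /= hx cy sy; apply: c_eqP => /=.
  by rewrite /c mulrC divfK // gt_eqF.
by rewrite /s mulrC divfK // gt_eqF.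
Qed.

Lemma der_cexp0 : der (@cexp R) 0 1.
Proof.
apply/derP => e e0.
have e3 : 0 < e / 8 by lra.
have [d1 d10 h1] := is_derive_realE (is_derive_expR (0 : R)) e3.
have [d2 d20 h2] := is_derive_realE (is_derive_cos (0 : R)) e3.
have [d3 d30 h3] := is_derive_realE (is_derive_sin (0 : R)) e3.
(* The bound e / 12 on |h| takes care of the product of the real and imaginary parts, which no
   first-order expansion covers. *)
pose d := Num.min (Num.min d1 1) (Num.min (Num.min d2 d3) (e / 12)).
have d0 : 0 < d by rewrite !lt_min d10 ltr01 d20 d30 /=; lra.
exists d => // h; rewrite !lt_min => /andP[/andP[hd1 hd0] /andP[/andP[hd2 hd3] hd4]].
have ha := Re_le h; have hb := Im_le h.
have := h1 _ (le_lt_trans ha hd1); have := h2 _ (le_lt_trans hb hd2).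
have := h3 _ (le_lt_trans hb hd3).
rewrite !add0r expR0 cos0 sin0 oppr0 mul0r !subr0 !mul1r => k3 k2 k1.
rewrite cexp0; apply: (le_trans (cabs_le _)).
case: h ha hb hd1 hd0 hd2 hd3 hd4 k1 k2 k3 => a b /=.
set H := cabs _; move=> ha hb hd1 hd0 hd2 hd3 hd4 k1 k2 k3.
rewrite ?(subr0, oppr0, addr0) in k3 *.
set A := expR a in k1 *; set B := cos b in k2 *; set S := sin b in k3 *.
have HH : 0 <= H by exact: le_trans (normr_ge0 _) ha.
have ep : 0 <= e / 8 by lra.
have k1' : `|A - 1 - a| <= e / 8 * H by apply: le_trans k1 _; rewrite ler_wpM2l.
have k2' : `|B - 1| <= e / 8 * H by apply: le_trans k2 _; rewrite ler_wpM2l.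
have k3' : `|S - b| <= e / 8 * H by apply: le_trans k3 _; rewrite ler_wpM2l.
have B1 : `|B| <= 1 by exact: cos_max.
have S1 : `|S| <= 1 by exact: sin_max.
have -> : A * B - 1 - a = (A - 1 - a) * B + (1 + a) * (B - 1) by ring.
have -> : A * S - b = (A - 1 - a) * S + (S - b) + a * (S - b) + a * b by ring.
have a1 : `|a| <= 1 by lra.
have p1 : `|(A - 1 - a) * B| <= e / 8 * H.
  by rewrite normrM; apply: le_trans k1'; rewrite ler_piMr.
have p2 : `|(1 + a) * (B - 1)| <= 2 * (e / 8 * H).
  rewrite normrM ler_pM //; apply: (le_trans (ler_normD _ _)); rewrite normr1; lra.
have p3 : `|(A - 1 - a) * S| <= e / 8 * H.
  by rewrite normrM; apply: le_trans k1'; rewrite ler_piMr.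
have p4 : `|a * (S - b)| <= e / 8 * H.
  by rewrite normrM; apply: le_trans k3'; rewrite ler_piMl.
have p5 : `|a * b| <= e / 12 * H.
  by rewrite normrM ler_pM //; lra.
have q1 := ler_normD ((A - 1 - a) * B) ((1 + a) * (B - 1)).
have q2 := ler_normD ((A - 1 - a) * S + (S - b) + a * (S - b)) (a * b).
have q3 := ler_normD ((A - 1 - a) * S + (S - b)) (a * (S - b)).
have q4 := ler_normD ((A - 1 - a) * S) (S - b).
have eH : 0 <= e * H by rewrite mulr_ge0 // ltW.
lra.
Qed.

Lemma der_cexp z : der (@cexp R) z (cexp z).
Proof.
apply: (@der_ext _ (fun u => cexp z * cexp (u - z))).
  by move=> u; rewrite -cexpD addrC subrK.
apply: der_eq; first apply: dercM.
  apply: (@der_comp _ (@cexp R) (fun u => u - z)).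
    by apply: derB; [exact: der_id|exact: der_cst].
  by rewrite subrr; exact: der_cexp0.
by rewrite subr0 !mulr1.
Qed.

Lemma der_cexpf (f : C -> C) x l : der f x l -> der (fun u => cexp (f u)) x (cexp (f x) * l).
Proof. by move=> h; apply: (@der_comp _ (@cexp R) f); [exact: h|exact: der_cexp]. Qed.

(** Valid for every w: the factor [expR (cabs w)] is later absorbed by the Gaussian decay of the
    theta terms. *)
Lemma cexp_taylor w : cabs (cexp w - 1 - w) <= expR (cabs w) * cabs w ^+ 2.
Proof.
have := @seg_bound R (fun u => cexp u - u) (fun u => cexp u - 1) 0 w
  (expR (cabs w) * cabs w ^+ 2).
rewrite /= cexp0 !subr0.
have -> : cexp w - w - 1 = cexp w - 1 - w by ring.
have dd u : der (fun u : C => cexp u - u) u (cexp u - 1).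
  by apply: derB; [exact: der_cexp|exact: der_id].
apply => [s _|s _|s sI]; [apply: der_cont; exact: dd|exact: dd|].
rewrite ?subr0 cabsM expr2 mulrA ler_wpM2r ?cabs_ge0 //.
have h u : cabs u <= cabs w -> cabs (cexp u - 1) <= expR (cabs w) * cabs w.
  move=> uw; have := @seg_bound R (@cexp R) (@cexp R) 0 u (expR (cabs w) * cabs w).
  rewrite /= cexp0 !subr0; apply => [s' _|s' _|s' sI'].
  - by apply: der_cont; exact: der_cexp.
  - exact: der_cexp.
  rewrite cabsM cabs_cexp; apply: ler_pM; rewrite ?expR_ge0 ?cabs_ge0 // ler_expR.
  apply: (le_trans (ler_norm _)); apply: (le_trans (Re_le _)).
  rewrite /pt add0r ?subr0 cabsM cabs_ofr; apply: le_trans uw.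
  by rewrite ler_piMl ?cabs_ge0 // ger0_norm; lra.
apply: h; rewrite /pt add0r ?subr0 cabsM cabs_ofr.
by rewrite ler_piMl ?cabs_ge0 // ger0_norm; lra.
Qed.

End Exponential.

Ltac dleaf ::= lazymatch goal with
  | |- der (fun u => cexp (@?f u)) _ _ => apply: der_cexpf; dt
  | |- der (@cexp _) _ _ => exact: der_cexp
  end.

(** * Unconditional summation of series *)

Section Summation.
Variable R : realType.
Local Notation C := (Cx R).

(** Convergence along the finite subsets of the index set, listed without repetition. This notion is
    invariant under bijections of the indices and compatible with products, as the rearrangements of
    theta and lattice series require. *)
Definition has_sum (I : eqType) (f : I -> C) (S : C) := forall e : R, 0 < e ->
  exists s0 : seq I, forall s, uniq s -> {subset s0 <= s} ->
    cabs (\sum_(i <- s) f i - S) < e.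

Definition sum_le (I : eqType) (g : I -> R) (M : R) :=
  forall s : seq I, uniq s -> \sum_(i <- s) g i <= M.

Lemma sum_leW (I : eqType) (g h : I -> R) M : (forall i, g i <= h i) -> sum_le h M -> sum_le g M.
Proof. by move=> gh hM s us; apply: le_trans (hM s us); apply: ler_sum => i _. Qed.

Lemma sum_le_ge0 (I : eqType) (g : I -> R) M : sum_le g M -> 0 <= M.
Proof. by move=> /(_ [::] isT); rewrite big_nil. Qed.

Lemma sum_leZ (I : eqType) (g : I -> R) (c M : R) : 0 <= c -> sum_le g M ->
  sum_le (fun i => c * g i) (c * M).
Proof. by move=> c0 gM s us; rewrite -mulr_sumr ler_wpM2l //; exact: gM. Qed.

Lemma ler_sum_sub (I : eqType) (g : I -> R) (s t : seq I) : (forall i, 0 <= g i) ->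
  uniq s -> uniq t -> {subset s <= t} -> \sum_(i <- s) g i <= \sum_(i <- t) g i.
Proof.
move=> g0 us ut st; have p : perm_eq t (s ++ [seq i <- t | i \notin s]).
  apply: uniq_perm => //.
    rewrite cat_uniq us filter_uniq // andbT; apply/hasPn => i.
    by rewrite mem_filter => /andP[].
  move=> i; rewrite mem_cat mem_filter; case: (boolP (i \in s)) => //= /st ->.
  by [].
by rewrite (perm_big _ p) big_cat /= lerDl sumr_ge0.
Qed.

Lemma big_subD (I : eqType) (f : I -> C) (s t : seq I) : uniq s -> uniq t ->
  {subset s <= t} -> \sum_(i <- t) f i = \sum_(i <- s) f i + \sum_(i <- [seq i <- t | i \notin s]) f i.
Proof.
move=> us ut st; have p : perm_eq t (s ++ [seq i <- t | i \notin s]).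
  apply: uniq_perm => //.
    rewrite cat_uniq us filter_uniq // andbT; apply/hasPn => i.
    by rewrite mem_filter => /andP[].
  move=> i; rewrite mem_cat mem_filter; case: (boolP (i \in s)) => //= /st ->.
  by [].
by rewrite (perm_big _ p) big_cat.
Qed.

Lemma sum_tail (I : eqType) (g : I -> R) M (e : R) : (forall i, 0 <= g i) -> sum_le g M ->
  0 < e -> exists2 s0 : seq I, uniq s0 & forall s, uniq s -> (forall i, i \in s -> i \notin s0) ->
    \sum_(i <- s) g i < e.
Proof.
move=> g0 gM e0; pose E := [set x : R | exists2 s : seq I, uniq s & x = \sum_(i <- s) g i].
have hE : has_sup E.
  split; first by exists 0, [::]; rewrite ?big_nil.
  by exists M => _ [s us ->]; exact: gM.
have [_ [s0 us0 ->] h] := sup_adherent e0 hE.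
exists s0 => // s us hs; have u : uniq (s0 ++ s).
  by rewrite cat_uniq us0 us andbT; apply/hasPn => i /hs.
have : \sum_(i <- s0 ++ s) g i <= sup E by apply: ub_le_sup; [exact: hE.2|exists (s0 ++ s)].
by rewrite big_cat /=; lra.
Qed.

Lemma real_has_sum (I : eqType) (g : I -> R) M : (forall i, 0 <= g i) -> sum_le g M ->
  exists S : R, has_sum (fun i => ofr (g i)) (ofr S).
Proof.
move=> g0 gM; pose E := [set x : R | exists2 s : seq I, uniq s & x = \sum_(i <- s) g i].
have hE : has_sup E.
  split; first by exists 0, [::]; rewrite ?big_nil.
  by exists M => _ [s us ->]; exact: gM.
exists (sup E) => e e0; have [_ [s0 us0 ->] h] := sup_adherent e0 hE.
exists s0 => s us hs.
have -> : \sum_(i <- s) ofr (g i) = ofr (\sum_(i <- s) g i).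
  by elim: (s) => [|i t IH]; rewrite ?big_nil // !big_cons IH ofrD.
rewrite -ofrN -ofrD cabs_ofr.
have h1 : \sum_(i <- s) g i <= sup E by apply: ub_le_sup; [exact: hE.2|exists s].
have h2 := ler_sum_sub g0 us0 us hs.
by rewrite ler0_norm; lra.
Qed.

Lemma has_sumZ (I : eqType) (f : I -> C) S c : has_sum f S -> has_sum (fun i => c * f i) (c * S).
Proof.
move=> h e e0; have c0 : 0 < cabs c + 1 by rewrite ltr_wpDl ?cabs_ge0.
have [s0 H] := h _ (divr_gt0 e0 c0); exists s0 => s us hs.
rewrite -mulr_sumr -mulrBr cabsM; have := H s us hs; rewrite ltr_pdivlMr //.
apply: le_lt_trans; rewrite mulrC ler_wpM2l ?cabs_ge0 // lerDl //.
Qed.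

Lemma has_sumD (I : eqType) (f g : I -> C) S T : has_sum f S -> has_sum g T ->
  has_sum (fun i => f i + g i) (S + T).
Proof.
move=> hf hg e e0; have e2 : 0 < e / 2 by lra.
have [s1 H1] := hf _ e2; have [s2 H2] := hg _ e2; exists (s1 ++ s2) => s us hs.
rewrite big_split /= opprD addrACA; apply: (le_lt_trans (cabsD _ _)).
have h1 : cabs (\sum_(i <- s) f i - S) < e / 2.
  by apply: H1 => // i hi; apply: hs; rewrite mem_cat hi.
have h2 : cabs (\sum_(i <- s) g i - T) < e / 2.
  by apply: H2 => // i hi; apply: hs; rewrite mem_cat hi orbT.
lra.
Qed.

Lemma has_sum_eq (I : eqType) (f g : I -> C) S T :
  (forall i, f i = g i) -> S = T -> has_sum f S -> has_sum g T.
Proof. by move=> /funext -> ->. Qed.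

Lemma has_sumB (I : eqType) (f g : I -> C) S T : has_sum f S -> has_sum g T ->
  has_sum (fun i => f i - g i) (S - T).
Proof.
move=> hf hg; have := has_sumD hf (has_sumZ (-1) hg).
by apply: has_sum_eq => [i|]; rewrite mulN1r.
Qed.

Definition csummable (I : eqType) (f : I -> C) := exists M, sum_le (fun i => cabs (f i)) M.

Lemma summableW (I : eqType) (f : I -> C) g M : (forall i, cabs (f i) <= g i) -> sum_le g M ->
  csummable f.
Proof. by move=> fg gM; exists M; apply: sum_leW gM. Qed.

(** Each of the real and imaginary parts r is written |r| - (|r| - r), a difference of nonnegative
    families whose finite sums are bounded. *)
Lemma summable_has_sum (I : eqType) (f : I -> C) : csummable f -> exists S, has_sum f S.
Proof.
move=> [M hM].
have key (r : C -> R) : (forall z, `|r z| <= cabs z) ->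
  exists S, has_sum (fun i => ofr (r (f i))) S.
  move=> rz; have [S1 h1] := @real_has_sum _ (fun i => `|r (f i)|) M (fun i => normr_ge0 _)
    (sum_leW (fun i => rz (f i)) hM).
  have [||S2 h2] := @real_has_sum _ (fun i => `|r (f i)| - r (f i)) (2 * M).
  - by move=> i; rewrite subr_ge0 ler_norm.
  - move=> s us; apply: (@le_trans _ _ (\sum_(i <- s) 2 * cabs (f i))).
      apply: ler_sum => i _; have := rz (f i); have := ler_norm (- r (f i)).
      by rewrite normrN; lra.
    by rewrite -mulr_sumr ler_wpM2l //; exact: hM.
  exists (ofr S1 - ofr S2); apply: has_sum_eq (has_sumB h1 h2) => // i.
  by rewrite -ofrN -ofrD; congr ofr; ring.
have [S1 h1] := key (@complex.Re R) (@Re_le R).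
have [S2 h2] := key (@complex.Im R) (@Im_le R).
exists (S1 + Complex 0 1 * S2); apply: has_sum_eq (has_sumD h1 (has_sumZ (Complex 0 1) h2)) => // i.
case: (f i) => x y; apply: c_eqP => /=; ring.
Qed.

Lemma has_sum_uniq (I : eqType) (f : I -> C) S T : has_sum f S -> has_sum f T -> S = T.
Proof.
move=> hS hT; apply/eqP; rewrite -subr_eq0 -cabs_eq0; apply/negPn/negP => n0.
have p : 0 < cabs (S - T) by rewrite lt_def n0 cabs_ge0.
have e0 : 0 < cabs (S - T) / 2 by lra.
have [s1 H1] := hS _ e0; have [s2 H2] := hT _ e0.
pose s := undup (s1 ++ s2).
have h1 : cabs (\sum_(i <- s) f i - S) < cabs (S - T) / 2.
  by apply: H1; [exact: undup_uniq|move=> i hi; rewrite mem_undup mem_cat hi].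
have h2 : cabs (\sum_(i <- s) f i - T) < cabs (S - T) / 2.
  by apply: H2; [exact: undup_uniq|move=> i hi; rewrite mem_undup mem_cat hi orbT].
have := cabsDB S T (\sum_(i <- s) f i); rewrite (cabsBC S (\sum_(i <- s) f i)); lra.
Qed.

Lemma has_sum_bound (I : eqType) (f : I -> C) g M S : has_sum f S ->
  (forall i, cabs (f i) <= g i) -> sum_le g M -> cabs S <= M.
Proof.
move=> hS fg gM; apply/ler_addgt0Pr => e e0; have [s0 H] := hS e e0.
have us := undup_uniq s0.
have hb : cabs (\sum_(i <- undup s0) f i) <= M.
  apply: le_trans (cabs_sum _ _) _; apply: le_trans (gM _ us).
  by apply: ler_sum => i _.
have h : cabs (S - \sum_(i <- undup s0) f i) < e.
  by rewrite cabsBC; apply: H => // i; rewrite mem_undup.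
have := cabsD (S - \sum_(i <- undup s0) f i) (\sum_(i <- undup s0) f i).
by rewrite subrK; lra.
Qed.

(** The bound by g is asked only off [s1]. This suits the zeta series, where the uniform estimate
    concerns only lattice points far from the origin. *)
Lemma has_sum_tail (I : eqType) (f : I -> C) g M (e : R) (s0 s1 : seq I) S :
  has_sum f S -> (forall i, i \notin s1 -> cabs (f i) <= g i) ->
  (forall s, uniq s -> (forall i, i \in s -> i \notin s0) -> \sum_(i <- s) g i < e) ->
  uniq s1 -> {subset s0 <= s1} -> sum_le g M -> cabs (\sum_(i <- s1) f i - S) <= e.
Proof.
move=> hS fg h0 us1 s01 _; apply/ler_addgt0Pr => d d0; have [s2 H] := hS d d0.
pose s := undup (s1 ++ s2); have us : uniq s by exact: undup_uniq.
have hs : cabs (\sum_(i <- s) f i - S) < d.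
  by apply: H => // i hi; rewrite mem_undup mem_cat hi orbT.
have ss1 : {subset s1 <= s} by move=> i hi; rewrite mem_undup mem_cat hi.
move: hs; rewrite (big_subD f us1 us ss1) => hs.
have h2 : cabs (\sum_(i <- [seq i <- s | i \notin s1]) f i) <= e.
  apply: le_trans (cabs_sum _ _) _; apply: (@le_trans _ _ (\sum_(i <- [seq i <- s | i \notin s1]) g i)).
    by rewrite !big_filter; apply: ler_sum => i; exact: fg.
  apply/ltW/h0; first exact: filter_uniq.
  by move=> i; rewrite mem_filter => /andP[hi _]; apply: contra hi => /s01.
have -> : \sum_(i <- s1) f i - S = (\sum_(i <- s1) f i + \sum_(i <- [seq i <- s | i \notin s1]) f i - S)
   - \sum_(i <- [seq i <- s | i \notin s1]) f i by ring.
by apply: (le_trans (cabsB _ _)); lra.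
Qed.

Lemma has_sum_reindex (I J : eqType) (f : I -> C) (g : J -> I) (h : I -> J) S :
  cancel g h -> cancel h g -> has_sum f S -> has_sum (fun j => f (g j)) S.
Proof.
move=> gh hg hS e e0; have [s0 H] := hS e e0; exists (map h s0) => s us hs.
have -> : \sum_(j <- s) f (g j) = \sum_(i <- map g s) f i by rewrite big_map.
apply: H; first by rewrite map_inj_uniq //; exact: can_inj gh.
move=> i hi; rewrite -(hg i); apply: map_f; apply: hs; exact: map_f.
Qed.

Lemma has_sum_bool (J : eqType) (f : J * bool -> C) S T :
  has_sum (fun j => f (j, true)) S -> has_sum (fun j => f (j, false)) T -> has_sum f (S + T).
Proof.
move=> hS hT e e0; have e2 : 0 < e / 2 by lra.
have [s1 H1] := hS _ e2; have [s2 H2] := hT _ e2.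
exists (map (fun j => (j, true)) s1 ++ map (fun j => (j, false)) s2) => s us hs.
pose t b := [seq p.1 | p <- s & p.2 == b].
have tb b : \sum_(j <- t b) f (j, b) = \sum_(p <- s | p.2 == b) f p.
  rewrite big_map big_filter; apply: eq_bigr => -[j b'] /= /eqP <-; by [].
have ut b : uniq (t b).
  rewrite map_inj_in_uniq ?filter_uniq // => -[j1 b1] [j2 b2].
  by rewrite !mem_filter /= => /andP[/eqP -> _] /andP[/eqP -> _] ->.
have -> : \sum_(p <- s) f p = \sum_(j <- t true) f (j, true) + \sum_(j <- t false) f (j, false).
  rewrite !tb (bigID (fun p => p.2 == true)) /=; congr (_ + _).
  by apply: eq_bigl => -[j []].
have mt b j : (j, b) \in s -> j \in t b.
  by move=> h; apply/mapP; exists (j, b) => //; rewrite mem_filter eqxx.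
rewrite opprD addrACA; apply: (le_lt_trans (cabsD _ _)).
have h1 : cabs (\sum_(j <- t true) f (j, true) - S) < e / 2.
  by apply: H1 => // j hj; apply: mt; apply: hs; rewrite mem_cat map_f.
have h2 : cabs (\sum_(j <- t false) f (j, false) - T) < e / 2.
  by apply: H2 => // j hj; apply: mt; apply: hs; rewrite mem_cat map_f ?orbT.
lra.
Qed.

Lemma allpairs_big (I J : eqType) (f : I -> C) (g : J -> C) s t :
  \sum_(p <- [seq (i, j) | i <- s, j <- t]) f p.1 * g p.2 =
  (\sum_(i <- s) f i) * (\sum_(j <- t) g j).
Proof.
rewrite big_allpairs_dep /= mulr_suml; apply: eq_bigr => i _.
by rewrite mulr_sumr.
Qed.

Lemma sum_le_pair (I J : eqType) (F : I * J -> R) (B : I -> R) M : (forall p, 0 <= F p) ->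
  (forall i, sum_le (fun j => F (i, j)) (B i)) -> sum_le B M -> sum_le F M.
Proof.
move=> F0 h1 h2 s us; pose s1 := undup (map fst s); pose s2 := undup (map snd s).
apply: (@le_trans _ _ (\sum_(p <- [seq (i, j) | i <- s1, j <- s2]) F p)).
  apply: ler_sum_sub => //; first by rewrite allpairs_uniq ?undup_uniq // => -[? ?] [? ?] _ _ [-> ->].
  move=> [i j] h; apply/allpairsP; exists (i, j) => /=; split=> //; rewrite mem_undup.
    by apply/mapP; exists (i, j).
  by apply/mapP; exists (i, j).
rewrite big_allpairs_dep /=; apply: le_trans (h2 s1 (undup_uniq _)).
by apply: ler_sum => i _; apply: h1; exact: undup_uniq.
Qed.

Lemma summable_prod (I J : eqType) (f : I -> C) (g : J -> C) : csummable f -> csummable g ->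
  csummable (fun p : I * J => f p.1 * g p.2).
Proof.
move=> [M hM] [N hN]; exists (N * M).
apply: (@sum_le_pair _ _ _ (fun i => N * cabs (f i))); first by move=> p; exact: cabs_ge0.
  move=> i s us /=; under eq_bigr do rewrite cabsM.
  by rewrite -mulr_sumr mulrC ler_wpM2r ?cabs_ge0 //; exact: hN.
by apply: sum_leZ => //; exact: sum_le_ge0 hN.
Qed.

(** The product family has some sum U. On a rectangle large enough for S, T and U at once the finite
    sum factors, which identifies U with S T. *)
Lemma has_sum_prod (I J : eqType) (f : I -> C) (g : J -> C) S T : csummable f -> csummable g ->
  has_sum f S -> has_sum g T -> has_sum (fun p : I * J => f p.1 * g p.2) (S * T).
Proof.
move=> sf sg hS hT; have [U hU] := summable_has_sum (summable_prod sf sg).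
suff -> : S * T = U by [].
apply/eqP; rewrite -subr_eq0 -cabs_eq0 eq_le cabs_ge0 andbT.
apply/ler_addgt0Pr => e e0; rewrite add0r.
pose K := cabs S + cabs T + 2.
have K0 : 0 < K by have := cabs_ge0 S; have := cabs_ge0 T; rewrite /K; lra.
pose d := Num.min 1 (e / 2 / K).
have d0 : 0 < d by rewrite lt_min ltr01 !divr_gt0.
have d1 : d <= 1 by rewrite ge_min lexx.
have dK : d * K <= e / 2 by rewrite -ler_pdivlMr // ge_min lexx orbT.
have e2 : 0 < e / 2 by lra.
have [s1 H1] := hS _ d0; have [s2 H2] := hT _ d0; have [s3 H3] := hU _ e2.
pose t1 := undup (s1 ++ map fst s3); pose t2 := undup (s2 ++ map snd s3).
have h1 : cabs (\sum_(i <- t1) f i - S) < d.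
  by apply: H1; rewrite ?undup_uniq // => i hi; rewrite mem_undup mem_cat hi.
have h2 : cabs (\sum_(i <- t2) g i - T) < d.
  by apply: H2; rewrite ?undup_uniq // => i hi; rewrite mem_undup mem_cat hi.
have h3 : cabs (\sum_(p <- [seq (i, j) | i <- t1, j <- t2]) f p.1 * g p.2 - U) < e / 2.
  apply: H3; first by rewrite allpairs_uniq ?undup_uniq // => -[? ?] [? ?] _ _ [-> ->].
  move=> [i j] h; apply/allpairsP; exists (i, j) => /=; split=> //; rewrite mem_undup mem_cat.
    by apply/orP; right; apply/mapP; exists (i, j).
  by apply/orP; right; apply/mapP; exists (i, j).
move: h3; rewrite allpairs_big; set X := \sum_(i <- t1) f i in h1 *.
set Y := \sum_(j <- t2) g j in h2 * => h3.
have -> : S * T - U = (X * Y - U) - ((X - S) * (Y - T) + (X - S) * T + S * (Y - T)) by ring.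
apply: (le_trans (cabsB _ _)).
have q1 := cabsD ((X - S) * (Y - T) + (X - S) * T) (S * (Y - T)).
have q2 := cabsD ((X - S) * (Y - T)) ((X - S) * T).
move: q1 q2; rewrite !cabsM => q1 q2.
have := cabs_ge0 (X - S); have := cabs_ge0 (Y - T); have := cabs_ge0 S; have := cabs_ge0 T.
by rewrite /K in dK; nra.
Qed.

(** Termwise differentiation: the quadratic remainders of the terms have summable coefficients M, so
    the sum has a quadratic remainder too. *)
Lemma has_sum_der (I : eqType) (f f' : I -> C -> C) (x : C) (r B : R) (M : I -> R)
    (S : C -> C) (S' : C) : 0 < r -> sum_le M B ->
  (forall i h, cabs h < r -> cabs (f i (x + h) - f i x - f' i x * h) <= M i * cabs h ^+ 2) ->
  (forall u, cabs (u - x) < r -> has_sum (f ^~ u) (S u)) ->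
  has_sum (fun i => f' i x) S' -> der S x S'.
Proof.
move=> r0 hM ht hS hS'; apply/derP => e e0; have B0 := sum_le_ge0 hM.
have B1 : 0 < B + 1 by lra.
exists (Num.min r (e / (B + 1))); first by rewrite lt_min r0 divr_gt0.
move=> h; rewrite lt_min ltr_pdivlMr // => /andP[hr he].
have a1 : has_sum (f ^~ (x + h)) (S (x + h)) by apply: hS; rewrite addrAC subrr add0r.
have a2 : has_sum (f ^~ x) (S x) by apply: hS; rewrite subrr cabs0.
have a3 := has_sumB (has_sumB a1 a2) (has_sumZ h hS').
apply: (@le_trans _ _ (B * cabs h ^+ 2)); last by have := cabs_ge0 h; nra.
rewrite [S' * h]mulrC; apply: has_sum_bound a3 _ _; last first.
  rewrite [B * _]mulrC; apply: sum_leZ hM; exact: exprn_ge0 (cabs_ge0 _).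
move=> i /=; rewrite [h * _]mulrC [_ ^+ 2 * _]mulrC; exact: ht.
Qed.

Lemma has_sum_der2 (I : eqType) (f f' f'' : I -> C -> C) (x : C) (r B : R) (M : I -> R)
    (S : C -> C) (S' : C) : 0 < r -> sum_le M B ->
  (forall i u, cabs (u - x) < r -> der (f i) u (f' i u)) ->
  (forall i u, cabs (u - x) < r -> der (f' i) u (f'' i u)) ->
  (forall i u, cabs (u - x) < r -> cabs (f'' i u) <= M i) ->
  (forall u, cabs (u - x) < r -> has_sum (f ^~ u) (S u)) ->
  has_sum (fun i => f' i x) S' -> der S x S'.
Proof.
move=> r0 hM d1 d2 hb hS hS'; apply: (has_sum_der r0 hM _ hS hS').
by move=> i h hr; apply: (@taylor2 _ (f i) (f' i) (f'' i) x h r (M i)); auto.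
Qed.

Definition usum (I : eqType) (f : I -> C) : C := xget 0 [set S | has_sum f S].

Lemma usumP (I : eqType) (f : I -> C) : csummable f -> has_sum f (usum f).
Proof.
move=> /summable_has_sum[S hS]; rewrite /usum.
by case: xgetP => [T _ //|/(_ S)].
Qed.

Lemma nat_sum_le (k : R) : 1 <= k -> sum_le (fun n : nat => (k + n%:R) ^- 2) (2 / k).
Proof.
move=> k1 s us; pose N := (\max_(n <- s) n).+1.
have sN : {subset s <= iota 0 N}.
  by move=> n hn; rewrite mem_iota /= add0n ltnS /N; apply: leq_bigmax_seq.
apply: le_trans (ler_sum_sub _ us (iota_uniq 0 N) sN) _.
  by move=> n; rewrite invr_ge0 sqr_ge0.
(* Telescoping: with y = k + m >= 1, y^-2 is at most twice 1/y - 1/(y + 1), since y + 1 <= 2 y. *)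
suff h : forall m, \sum_(n <- iota 0 m) (k + n%:R) ^- 2 <= 2 * (k^-1 - (k + m%:R)^-1).
  apply: le_trans (h N) _; rewrite ler_wpM2l // gerBl invr_ge0.
  by rewrite addr_ge0 // (le_trans _ k1).
elim=> [|m IH]; first by rewrite big_nil addr0 subrr mulr0.
rewrite -addn1 iotaD big_cat /= add0n big_cons big_nil addr0 natrD.
set y := k + m%:R; have y1 : 1 <= y by rewrite ler_wpDr.
have y0 : 0 < y by lra.
rewrite addrA -/y; have -> : 2 * (k^-1 - (y + 1)^-1) = 2 * (k^-1 - y^-1) + 2 / (y * (y + 1)).
  field; rewrite ?gt_eqF //; lra.
rewrite lerD // -(@ler_pM2r _ (y ^+ 2 * (y + 1))); last by rewrite mulr_gt0 ?exprn_gt0 //; lra.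
have -> : y ^- 2 * (y ^+ 2 * (y + 1)) = y + 1 by field; rewrite gt_eqF.
have -> : 2 / (y * (y + 1)) * (y ^+ 2 * (y + 1)) = 2 * y by field; rewrite ?gt_eqF //; lra.
lra.
Qed.

(** The integers are two copies of the naturals. On the negative copy the absolute value of [Negz n]
    is n + 1, and monotonicity replaces a (n + 1) by a n. *)
Lemma int_sum_le (a : nat -> R) M : (forall n, 0 <= a n) -> (forall n, a n.+1 <= a n) ->
  sum_le a M -> sum_le (fun n : int => a `|n|%N) (2 * M).
Proof.
move=> a0 ad hM s us; pose N := (\max_(n <- s) `|n|%N).+1.
have sN : {subset s <= map Posz (iota 0 N) ++ map Negz (iota 0 N)}.
  move=> n hn; have hb : (`|n|%N < N)%N.
    by rewrite /N ltnS; apply: (@leq_bigmax_seq _ _ _ (fun n : int => `|n|%N)).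
  case: n hn hb => n hn hb; rewrite mem_cat; apply/orP; [left|right]; apply: map_f.
    by rewrite mem_iota.
  by rewrite mem_iota /=; move: hb; rewrite NegzE abszN /=; lia.
apply: (@le_trans _ _ (\sum_(n <- map Posz (iota 0 N) ++ map Negz (iota 0 N)) a `|n|%N)).
  apply: (@ler_sum_sub int (fun n => a `|n|%N)) => //.
  have uP : uniq (map Posz (iota 0 N)) by rewrite map_inj_uniq ?iota_uniq // => x y [].
  have uN : uniq (map Negz (iota 0 N)) by rewrite map_inj_uniq ?iota_uniq // => x y [].
  rewrite cat_uniq uP uN andbT; apply/hasPn => n /mapP[m _ ->].
  by apply/negP => /mapP[].
rewrite big_cat !big_map mulr_natl mulr2n lerD //; first exact: (hM _ (iota_uniq 0 N)).
apply: le_trans (hM _ (iota_uniq 0 N)).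
by apply: ler_sum => n _; rewrite NegzE abszN; exact: ad.
Qed.

Lemma int_sq_sum_le (k : R) : 1 <= k ->
  sum_le (fun n : int => (k + `|n|%N%:R) ^- 2) (4 / k).
Proof.
move=> k1; have -> : 4 / k = 2 * (2 / k) by ring.
apply: (@int_sum_le (fun n => (k + n%:R) ^- 2)); last exact: nat_sum_le.
  by move=> n; rewrite invr_ge0 sqr_ge0.
move=> n; have n0 : 0 <= n%:R :> R by [].
rewrite lef_pV2 ?posrE ?exprn_gt0 //; try (rewrite -?natr1; lra).
Qed.

Definition size2 (mn : int * int) : R := 1 + (`|mn.1|%N + `|mn.2|%N)%:R.

Lemma size2_ge1 mn : 1 <= size2 mn.
Proof. by rewrite /size2 lerDl. Qed.

(** For fixed m and k = 1 + |m|, the term (k + |n|)^-3 is at most k^-1 (k + |n|)^-2; summing over n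
    and then over m uses the one-dimensional bound twice, whence 16 = 4 * 4. *)
Lemma lattice_sum_le : sum_le (fun mn : int * int => size2 mn ^- 3) 16.
Proof.
apply: (@sum_le_pair _ _ _ (fun m : int => 4 * (1 + `|m|%N%:R) ^- 2)).
- by move=> mn; rewrite invr_ge0 exprn_ge0 // (le_trans _ (size2_ge1 _)).
- move=> m; set k : R := 1 + `|m|%N%:R; have k1 : 1 <= k by rewrite lerDl.
  have k0 : 0 < k by lra.
  have -> : 4 * k ^- 2 = k^-1 * (4 / k) by field; rewrite gt_eqF.
  have h := sum_leZ (ltW (etrans (invr_gt0 k) k0)) (int_sq_sum_le k1).
  apply: sum_leW h => n; rewrite /size2 /= natrD addrA -/k.
  have y0 : 0 <= `|n|%N%:R :> R by [].
  rewrite -invfM lef_pV2 ?posrE; try (by rewrite ?mulr_gt0 ?exprn_gt0 //; lra).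
  by rewrite [leRHS]exprS ler_wpM2r ?exprn_ge0; lra.
have -> : 16 = 4 * (4 / 1) :> R by rewrite divr1 -natrM.
by apply: sum_leZ => //; exact: int_sq_sum_le.
Qed.

Lemma zbox_uniq N : uniq (zbox N).
Proof. by rewrite map_inj_uniq ?iota_uniq // => x y /addIr []. Qed.

Lemma mem_zbox N n : (n \in zbox N) = (`|n|%N <= N)%N.
Proof.
apply/mapP/idP => [[k]|h].
  by rewrite mem_iota => /andP[_ h] ->; lia.
exists (absz ((n : int) + N%:Z)%R); last by lia.
by rewrite mem_iota; lia.
Qed.

Lemma has_sum_zbox (f : int -> C) S : has_sum f S ->
  (\sum_(n <- zbox N) f n) @[N --> \oo] --> S.
Proof.
move=> h; apply/cvgC => e e0; have [s0 H] := h e e0.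
near=> N; apply: H; first exact: zbox_uniq.
move=> n hn; rewrite mem_zbox.
have hN : (\max_(n <- s0) `|n|%N <= N)%N by near: N; exact: nbhs_infty_ge.
by apply: leq_trans hN; apply: (@leq_bigmax_seq _ _ _ (fun n : int => `|n|%N)).
Unshelve. all: by end_near. Qed.

Definition boxes (N : nat) : seq (int * int) := [seq (m, n) | m <- zbox N, n <- zbox N].

Lemma boxes_uniq N : uniq (boxes N).
Proof. by rewrite allpairs_uniq ?zbox_uniq // => -[? ?] [? ?] _ _ [-> ->]. Qed.

Lemma mem_boxes N mn : (mn \in boxes N) = (`|mn.1|%N <= N)%N && (`|mn.2|%N <= N)%N.
Proof.
case: mn => m n; apply/allpairsP/idP => [[[a b] /= [ha hb [-> ->]]]|/andP[h1 h2]].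
  by rewrite -!mem_zbox ha hb.
by exists (m, n); rewrite !mem_zbox.
Qed.

Lemma boxes_exhaust (s : seq (int * int)) : exists N0, forall N, (N0 <= N)%N ->
  {subset s <= boxes N}.
Proof.
exists (\max_(p <- s) (`|p.1| + `|p.2|))%N => N hN p hp; rewrite mem_boxes.
have h : (`|p.1| + `|p.2| <= \max_(p <- s) (`|p.1| + `|p.2|))%N.
  exact: (@leq_bigmax_seq _ _ _ (fun p : int * int => (`|p.1| + `|p.2|)%N)).
lia.
Qed.

Lemma has_sum_latbox (f : int * int -> C) S :
  has_sum (fun mn => if mn == (0, 0) then 0 else f mn) S ->
  (\sum_(mn <- latbox N) f mn) @[N --> \oo] --> S.
Proof.
move=> h; apply/cvgC => e e0; have [s0 H] := h e e0.
have [N0 hN0] := boxes_exhaust s0.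
near=> N; have -> : \sum_(mn <- latbox N) f mn =
    \sum_(mn <- boxes N) (if mn == (0, 0) then 0 else f mn).
  rewrite /latbox big_filter [RHS](bigID (fun mn => mn == (0, 0))).
  rewrite [X in _ = X + _]big1 ?add0r; last by move=> i /= ->.
  by apply: eq_bigr => i /= /negbTE ->.
apply: H; first exact: boxes_uniq.
by apply: hN0; near: N; exact: nbhs_infty_ge.
Unshelve. all: by end_near. Qed.

End Summation.

(** * Theta series with characteristics, their derivatives, and the heat equation *)

Section ThetaSeries.
Variable R : realType.
Local Notation C := (Cx R).
Local Notation ipi := (ipi R).

(** The term of degree K + 1 of the exponential series leaves y^(- K - 2), which is at most y^-2 for
    y >= 1. *)
Lemma gauss_bound (c a : R) (K : nat) : 0 < c -> exists2 M : R, 0 <= M &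
  forall y : R, 1 <= y -> y ^+ K * expR (a - c * y ^+ 2) <= M * y ^- 2.
Proof.
move=> c0; exists (expR a * (K.+1)`!%:R / c ^+ K.+1).
  by rewrite divr_ge0 ?mulr_ge0 ?expR_ge0 // exprn_ge0 // ltW.
move=> y y1; have y0 : 0 < y by lra.
have cy : 0 < c * y ^+ 2 by rewrite mulr_gt0 // exprn_gt0.
have e0 : (c * y ^+ 2) ^+ K.+1 / (K.+1)`!%:R <= expR (c * y ^+ 2).
  by apply: le_trans (expR_ge1Dxn K (ltW cy)); rewrite lerDr.
have f0 : 0 < (K.+1)`!%:R :> R by rewrite ltr0n fact_gt0.
rewrite expRD expRN.
have h1 : (expR (c * y ^+ 2))^-1 <= (K.+1)`!%:R / (c * y ^+ 2) ^+ K.+1.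
  rewrite -[leRHS]invrK lef_pV2 ?posrE ?expR_gt0 ?invr_gt0 ?divr_gt0 ?exprn_gt0 //.
  by rewrite invf_div.
apply: (@le_trans _ _ (y ^+ K * (expR a * ((K.+1)`!%:R / (c * y ^+ 2) ^+ K.+1)))).
  by rewrite ler_wpM2l ?exprn_ge0 ?(ltW y0) // ler_wpM2l ?expR_ge0.
rewrite exprMn -exprM.
have -> : y ^+ (2 * K.+1) = y ^+ K * (y ^+ K * y ^+ 2) by rewrite -!exprD; congr (_ ^+ _); lia.
set F := (_)`!%:R; set E := expR a; set D := c ^+ _; set Z := y ^+ K.
have D0 : D != 0 by rewrite expf_neq0 // gt_eqF.
have Z1 : 1 <= Z by rewrite exprn_ege1.
have -> : Z * (E * (F / (D * (Z * (Z * y ^+ 2))))) = (E * F / D * y ^- 2) * Z^-1.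
  by field; rewrite D0 /= !gt_eqF //; lra.
rewrite ler_piMr //.
  by rewrite !mulr_ge0 ?expR_ge0 ?invr_ge0 ?exprn_ge0 ?(ltW c0) ?(ltW y0) // ltW.
by rewrite invf_le1 //; lra.
Qed.

Definition tfreq (p : C) (n : int) : C := 2 * ipi * (n%:~R + p).
Definition texp (p q : C) (n : int) (z Om : C) : C :=
  ipi * (n%:~R + p) ^+ 2 * Om + 2 * ipi * (n%:~R + p) * (z + q).
Definition tterm (k : nat) (p q z Om : C) (n : int) : C :=
  tfreq p n ^+ k * cexp (texp p q n z Om).
(* The k-th derivative of theta[p,q] in the first variable. *)
Definition Th (k : nat) (p q z Om : C) : C := usum (tterm k p q z Om).

Definition wt (n : int) : R := 1 + `|n|%N%:R.

Lemma wt_ge1 n : 1 <= wt n. Proof. by rewrite lerDl. Qed.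

Lemma wt_ge0 n : 0 <= wt n. Proof. by rewrite (le_trans _ (wt_ge1 n)). Qed.

Lemma cabs_ipi : cabs ipi = pi.
Proof.
by rewrite /cabs normc_def /= expr0n add0r sqrtr_sqr ger0_norm // ltW // pi_gt0.
Qed.

Lemma int_ofr (n : int) : (n%:~R : C) = ofr n%:~R.
Proof. by case: n => n; rewrite ?NegzE ?mulrNz /= -?pmulrn ?ofrN ofr_nat. Qed.

Lemma cabs_intE (n : int) : cabs (n%:~R : C) = `|n|%N%:R.
Proof. by rewrite cabs_int -intr_norm -abszE. Qed.

Definition Kf (p : C) : R := 2 * pi * (1 + cabs p).

Lemma Kf_ge0 p : 0 <= Kf p.
Proof. by rewrite !mulr_ge0 ?(ltW (pi_gt0 R)) // addr_ge0 ?cabs_ge0. Qed.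

Lemma np_le (p : C) (n : int) : cabs (n%:~R + p) <= (1 + cabs p) * wt n.
Proof.
apply: (le_trans (cabsD _ _)); rewrite cabs_intE /wt.
have := cabs_ge0 p; have : 0 <= `|n|%N%:R :> R by []; nra.
Qed.

Lemma tfreq_le p n : cabs (tfreq p n) <= Kf p * wt n.
Proof.
rewrite /tfreq !cabsM cabs_ipi cabs_nat /Kf -[leRHS]mulrA.
by rewrite ler_wpM2l ?np_le // mulr_ge0 // ltW // pi_gt0.
Qed.

(** The quadratic part is - pi Im(Om) n^2. Completing the square spends part of it on the linear
    term, and another part on replacing |n| by [wt n] = 1 + |n|; a quarter of the rate survives. *)
Lemma texp_le (p q z Om : C) : 0 < complex.Im Om -> exists a : R, exists2 c : R, 0 < c &
  forall n, complex.Re (texp p q n z Om) <= a - c * wt n ^+ 2.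
Proof.
move=> O0; pose P : R := pi; have P0 : 0 < P := pi_gt0 R.
pose d := P * complex.Im Om; have d0 : 0 < d by rewrite mulr_gt0.
pose B := complex.Re (2 * ipi * p * Om + 2 * ipi * (z + q) : C).
pose A := complex.Re (ipi * p ^+ 2 * Om + 2 * ipi * p * (z + q) : C).
exists (A + d + B ^+ 2 / d); exists (d / 4) => [|n]; first by rewrite divr_gt0.
have -> : texp p q n z Om = ofr (n%:~R ^+ 2) * (ipi * Om)
   + ofr n%:~R * (2 * ipi * p * Om + 2 * ipi * (z + q))
   + (ipi * p ^+ 2 * Om + 2 * ipi * p * (z + q)).
  by rewrite /texp int_ofr expr2 ofrM; ring.
rewrite !cReD !Re_ofrM -/A -/B.
have -> : complex.Re (ipi * Om : C) = - d by rewrite cReM /= mul0r sub0r.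
have hn : `|n%:~R : R| = wt n - 1.
  by rewrite -intr_norm -abszE /wt addrAC subrr add0r.
have hy := wt_ge1 n; set y := wt n in hn hy *.
have e2 : (n%:~R : R) ^+ 2 = (y - 1) ^+ 2 by rewrite -hn real_normK // num_real.
have hB : n%:~R * B <= (y - 1) * `|B|.
  by rewrite -hn -normrM ler_norm.
have B2 : `|B| ^+ 2 = B ^+ 2 by rewrite real_normK // num_real.
rewrite e2 -B2; move: hB; set b := `|B|; have b0 : 0 <= b by exact: normr_ge0.
move=> hB; have k1 : y * b <= d / 4 * y ^+ 2 + b ^+ 2 / d.
  have -> : d / 4 * y ^+ 2 + b ^+ 2 / d = y * b + (d / 2 * y - b) ^+ 2 / d.
    by field; rewrite gt_eqF.
  by rewrite lerDl divr_ge0 ?sqr_ge0 // ltW.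
have k2 : - (y - 1) ^+ 2 <= 1 - y ^+ 2 / 2.
  rewrite -subr_ge0; have -> : 1 - y ^+ 2 / 2 - - (y - 1) ^+ 2 = 2^-1 * (y - 2) ^+ 2 by field.
  by rewrite mulr_ge0 // sqr_ge0.
nra.
Qed.

Lemma tterm_le (k : nat) (p q z Om : C) : 0 < complex.Im Om ->
  exists M : R, forall n, cabs (tterm k p q z Om n) <= M * wt n ^- 2.
Proof.
move=> O0; have [a [c c0 h]] := texp_le p q z O0.
have [M M0 hM] := gauss_bound a k c0; exists (Kf p ^+ k * M) => n.
rewrite cabsM cabsX cabs_cexp.
apply: (@le_trans _ _ ((Kf p * wt n) ^+ k * expR (a - c * wt n ^+ 2))).
  apply: ler_pM; rewrite ?exprn_ge0 ?cabs_ge0 ?expR_ge0 ?ler_expR //.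
  apply: lerXn2r; [by rewrite nnegrE cabs_ge0|by rewrite nnegrE mulr_ge0 ?Kf_ge0 ?wt_ge0|exact: tfreq_le].
rewrite exprMn -!mulrA ler_wpM2l ?exprn_ge0 ?Kf_ge0 //.
exact: hM (wt_ge1 n).
Qed.

Lemma wt_sum_le : sum_le (fun n : int => wt n ^- 2) 4.
Proof. by have := @int_sq_sum_le R 1 (lexx _); rewrite divr1. Qed.

Lemma tterm_summable k (p q z Om : C) : 0 < complex.Im Om -> csummable (tterm k p q z Om).
Proof.
move=> O0; have [M hM] := tterm_le k p q z O0.
have M0 : 0 <= M.
  by have := le_trans (cabs_ge0 _) (hM 0); rewrite /wt /= addr0 expr1n invr1 mulr1.
exact: (summableW hM (sum_leZ M0 wt_sum_le)).
Qed.

Lemma ThP k (p q z Om : C) : 0 < complex.Im Om ->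
  has_sum (tterm k p q z Om) (Th k p q z Om).
Proof. by move=> O0; apply: usumP; exact: tterm_summable. Qed.

Lemma thetaE (p q z Om : C) : 0 < complex.Im Om -> theta p q z Om = Th 0 p q z Om.
Proof.
move=> O0; rewrite /theta.
have -> : (fun N => \sum_(n <- zbox N) cexp (ipi * (n%:~R + p) ^+ 2 * Om
    + 2 * ipi * (n%:~R + p) * (z + q))) = (fun N => \sum_(n <- zbox N) tterm 0 p q z Om n).
  by apply/funext => N; apply: eq_bigr => n _; rewrite /tterm expr0 mul1r.
by apply: cvg_lim; [exact: norm_hausdorff|exact: has_sum_zbox (ThP 0 p q z O0)].
Qed.

(** A joint expansion in (z, Omega). The increment w of Omega multiplies the n-th term by pi i (n +
    p)^2 = tfreq^2 / (4 pi i) to first order, so its coefficient is [Th k.+2] / (4 pi i): this is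
    the heat equation, read off from the exponents. *)
Lemma Th_taylor k (p q z Om : C) : 0 < complex.Im Om -> exists2 r : R, 0 < r & exists2 B : R, 0 <= B &
  forall h w, cabs h + cabs w < r -> 0 < complex.Im (Om + w) /\
    cabs (Th k p q (z + h) (Om + w) - Th k p q z Om
      - (Th k.+1 p q z Om * h + Th k.+2 p q z Om / (4 * ipi) * w))
    <= B * (cabs h + cabs w) ^+ 2.
Proof.
move=> O0; have [a [c c0 hE]] := texp_le p q z O0.
pose L := Kf p + Kf p ^+ 2 + 1.
have K0 := Kf_ge0 p; have L0 : 0 < L by rewrite /L; have := sqr_ge0 (Kf p); lra.
have c20 : 0 < c / 2 by lra.
(* The power k comes from the frequencies and 4 from the square of the increment l of the exponent,
   which is of order y^2. Half of the decay rate pays for [expR (cabs l)]. *)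
have [M M0 hM] := gauss_bound a (k + 4) c20.
exists (Num.min (complex.Im Om) (c / 2 / L)); first by rewrite lt_min O0 divr_gt0.
exists (Kf p ^+ k * L ^+ 2 * M * 4).
  by rewrite !mulr_ge0 ?exprn_ge0 // ltW.
move=> h w; rewrite lt_min => /andP[hr1 hr2].
have h0 := cabs_ge0 h; have w0 := cabs_ge0 w.
have Ow : 0 < complex.Im (Om + w).
  by rewrite cImD; have := ler_norm (- complex.Im w); have := Im_le w; rewrite normrN; lra.
split=> //; set rho := cabs h + cabs w in hr1 hr2 *.
have rho0 : 0 <= rho by rewrite addr_ge0.
have S1 := has_sumB (has_sumB (ThP k p q (z + h) Ow) (ThP k p q z O0))
  (has_sumD (has_sumZ h (ThP k.+1 p q z O0)) (has_sumZ (w / (4 * ipi)) (ThP k.+2 p q z O0))).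
have -> : Th k.+1 p q z Om * h + Th k.+2 p q z Om / (4 * ipi) * w =
  h * Th k.+1 p q z Om + w / (4 * ipi) * Th k.+2 p q z Om by ring.
have Q : sum_le (fun n => Kf p ^+ k * L ^+ 2 * M * rho ^+ 2 * wt n ^- 2)
    (Kf p ^+ k * L ^+ 2 * M * rho ^+ 2 * 4).
  by apply: sum_leZ wt_sum_le; rewrite !mulr_ge0 ?exprn_ge0 // ltW.
have -> : Kf p ^+ k * L ^+ 2 * M * 4 * rho ^+ 2 = Kf p ^+ k * L ^+ 2 * M * rho ^+ 2 * 4 by ring.
apply: (has_sum_bound S1 _ Q) => n; rewrite /tterm.
pose l := tfreq p n * h + tfreq p n ^+ 2 / (4 * ipi) * w.
have el : texp p q n (z + h) (Om + w) = texp p q n z Om + l.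
  rewrite /texp /l /tfreq; have := @ipi_neq0 R; set I := Defs.ipi R => I0.
  by field; rewrite I0.
have -> : tfreq p n ^+ k * cexp (texp p q n (z + h) (Om + w)) -
   tfreq p n ^+ k * cexp (texp p q n z Om) -
   (h * (tfreq p n ^+ k.+1 * cexp (texp p q n z Om)) +
    w / (4 * ipi) * (tfreq p n ^+ k.+2 * cexp (texp p q n z Om))) =
   tfreq p n ^+ k * cexp (texp p q n z Om) * (cexp l - 1 - l).
  by rewrite el cexpD /l !exprS; ring.
have y1 := wt_ge1 n; set y := wt n in y1 *; have y0 : 0 < y by lra.
have fl : cabs (tfreq p n) <= Kf p * y := tfreq_le p n.
have ll : cabs l <= L * y ^+ 2 * rho.
  rewrite /l; move: fl; generalize (tfreq p n) => F fl.
  apply: (le_trans (cabsD _ _)); rewrite (cabsM F h) (cabsM (F ^+ 2 / (4 * ipi)) w).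
  rewrite (cabsM (F ^+ 2)) cabsX cabsV (cabsM 4 ipi) cabs_nat cabs_ipi.
  have f2 : cabs F ^+ 2 <= (Kf p * y) ^+ 2.
    by rewrite ler_pXn2r ?nnegrE ?cabs_ge0 // mulr_ge0 // ltW.
  have pi4 : (4 * pi)^-1 <= 1 :> R.
    by rewrite invf_le1 ?mulr_gt0 ?pi_gt0 //; have := @pi_ge2 R; lra.
  have t1 : cabs F * cabs h <= L * y ^+ 2 * cabs h.
    rewrite ler_wpM2r //; apply: (le_trans fl).
    have K1 : Kf p <= L by rewrite /L; have := sqr_ge0 (Kf p); lra.
    apply: (@le_trans _ _ (L * y)); first by rewrite ler_wpM2r // ltW.
    by rewrite expr2 mulrA ler_peMr // mulr_ge0 // ltW.
  have t2 : cabs F ^+ 2 * (4 * pi)^-1 * cabs w <= L * y ^+ 2 * cabs w.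
    rewrite ler_wpM2r //; apply: (@le_trans _ _ ((Kf p * y) ^+ 2 * 1)).
      by rewrite ler_pM ?sqr_ge0 // invr_ge0 mulr_ge0 // ltW // pi_gt0.
    by rewrite mulr1 exprMn ler_wpM2r ?sqr_ge0 // /L; lra.
  rewrite /rho [leRHS]mulrDr; exact: (lerD t1 t2).
rewrite !cabsM cabsX cabs_cexp.
have ct := cexp_taylor l.
have e1 : expR (complex.Re (texp p q n z Om)) * expR (cabs l) <= expR (a - c / 2 * y ^+ 2).
  rewrite -expRD ler_expR; have := hE n; rewrite -/y.
  have : L * y ^+ 2 * rho <= c / 2 * y ^+ 2.
    have -> : L * y ^+ 2 * rho = y ^+ 2 * (L * rho) by ring.
    rewrite [leRHS]mulrC ler_wpM2l ?sqr_ge0 //.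
    by move: hr2; rewrite ltr_pdivlMr // mulrC => /ltW.
  lra.
apply: (@le_trans _ _ ((Kf p * y) ^+ k * expR (complex.Re (texp p q n z Om)) *
   (expR (cabs l) * (L * y ^+ 2 * rho) ^+ 2))).
  apply: ler_pM; rewrite ?mulr_ge0 ?exprn_ge0 ?cabs_ge0 ?expR_ge0 //.
    apply: ler_pM; rewrite ?exprn_ge0 ?cabs_ge0 ?expR_ge0 //.
    by apply: lerXn2r; rewrite ?nnegrE ?cabs_ge0 // mulr_ge0 // ltW.
  apply: (le_trans ct); rewrite ler_wpM2l ?expR_ge0 //.
  by rewrite ler_pXn2r ?nnegrE ?cabs_ge0 // !mulr_ge0 // ltW // ?exprn_gt0.
have -> : (Kf p * y) ^+ k * expR (complex.Re (texp p q n z Om)) *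
   (expR (cabs l) * (L * y ^+ 2 * rho) ^+ 2) =
   Kf p ^+ k * L ^+ 2 * rho ^+ 2 * (y ^+ (k + 4) *
     (expR (complex.Re (texp p q n z Om)) * expR (cabs l))).
  by rewrite exprMn exprD; ring.
have -> : Kf p ^+ k * L ^+ 2 * M * rho ^+ 2 * y ^- 2 =
  Kf p ^+ k * L ^+ 2 * rho ^+ 2 * (M * y ^- 2) by ring.
rewrite ler_wpM2l ?mulr_ge0 ?exprn_ge0 // ?(ltW L0) //.
apply: le_trans (hM y y1); rewrite ler_wpM2l ?exprn_ge0 // ltW //.
Qed.

Lemma der_Th2 k (p q : C) (f g : C -> C) x a b : 0 < complex.Im (g x) ->
  der f x a -> der g x b ->
  der (fun u => Th k p q (f u) (g u)) x
    (Th k.+1 p q (f x) (g x) * a + Th k.+2 p q (f x) (g x) / (4 * ipi) * b).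
Proof.
move=> g0 df dg; have [r r0 [B B0 hB]] := Th_taylor k p q (f x) g0.
pose c1 := Th k.+1 p q (f x) (g x); pose c2 := Th k.+2 p q (f x) (g x) / (4 * ipi).
pose rem u := Th k p q (f u) (g u) - (c1 * (f u - f x) + c2 * (g u - g x)).
suff dr : der rem x 0.
  apply: (@der_ext _ (fun u => rem u + (c1 * (f u - f x) + c2 * (g u - g x)))).
    by move=> u; rewrite /rem subrK.
  by apply: der_eq; [dt|rewrite add0r !subr0].
apply/derP => e e0.
pose K := (cabs a + 1) + (cabs b + 1).
have K0 : 0 < K by have := cabs_ge0 a; have := cabs_ge0 b; rewrite /K; lra.
have [d1 d10 h1] := (iffLR (derP f x a) df) 1 ltr01.
have [d2 d20 h2] := (iffLR (derP g x b) dg) 1 ltr01.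
pose E := e / (B + 1) / K ^+ 2.
have B1 : 0 < B + 1 by lra.
have E0 : 0 < E by rewrite !divr_gt0 // exprn_gt0.
exists (Num.min (Num.min d1 d2) (Num.min (r / K) E)).
  by rewrite !lt_min d10 d20 E0 divr_gt0.
move=> h; rewrite !lt_min => /andP[/andP[hd1 hd2] /andP[hr hE]].
have {}h1 := h1 h hd1; have {}h2 := h2 h hd2.
set u := f (x + h) - f x in h1; set v := g (x + h) - g x in h2.
have ub : cabs u <= (cabs a + 1) * cabs h.
  have := cabsD (u - a * h) (a * h); rewrite subrK cabsM; lra.
have vb : cabs v <= (cabs b + 1) * cabs h.
  have := cabsD (v - b * h) (b * h); rewrite subrK cabsM; lra.
have uv : cabs u + cabs v <= K * cabs h by rewrite /K; lra.
have uvr : cabs u + cabs v < r.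
  by apply: (le_lt_trans uv); move: hr; rewrite ltr_pdivlMr // mulrC.
have [_ hT] := hB u v uvr.
have fE : f (x + h) = f x + u by rewrite /u; ring.
have gE : g (x + h) = g x + v by rewrite /v; ring.
have -> : rem (x + h) - rem x - 0 * h = Th k p q (f x + u) (g x + v) - Th k p q (f x) (g x)
  - (c1 * u + c2 * v).
  by rewrite /rem fE gE; ring.
apply: (le_trans hT); apply: (@le_trans _ _ (B * (K * cabs h) ^+ 2)).
  rewrite ler_wpM2l // ler_pXn2r ?nnegrE ?addr_ge0 ?cabs_ge0 //.
  by rewrite mulr_ge0 ?cabs_ge0 // ltW.
have hh := cabs_ge0 h.
have : (B + 1) * K ^+ 2 * cabs h <= e.
  have -> : e = (B + 1) * K ^+ 2 * E by rewrite /E; field; rewrite ?gt_eqF.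
  by rewrite ler_wpM2l ?(ltW hE) // mulr_ge0 ?sqr_ge0 // ltW.
rewrite exprMn; have := sqr_ge0 K; nra.
Qed.

Lemma der_Th k (p q : C) (f : C -> C) (Om : C) x a : 0 < complex.Im Om -> der f x a ->
  der (fun u => Th k p q (f u) Om) x (Th k.+1 p q (f x) Om * a).
Proof.
move=> O0 df; apply: der_eq; first exact: (@der_Th2 k p q f (fun=> Om) x a 0 O0 df (der_cst _ _)).
by rewrite mulr0 addr0.
Qed.

(** The increment is little-o of h, so the differential is 0. Other functions are brought to this
    case by subtracting a map already known to be differentiable. *)
Lemma differentiable_small (V : normedModType C) (rem : V -> C) (x : V) :
  (forall e : R, 0 < e -> \forall h \near (0 : V), `|rem (h + x) - rem x| <= ofr e * `|h|) ->
  differentiable rem x.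
Proof.
move=> H; have key : continuous (0 : V -> C) /\
   rem \o shift x = cst (rem x) + \0 +o_ 0 id.
  split; first exact: cst_continuous.
  apply/eqaddoE; rewrite addr0; apply/eqaddoP => e /posC[e' e'0 ->].
  by apply: filterS (H e' e'0) => h /=; rewrite !fctE.
have [k1 k2] := key; have E : 'd rem x = (\0 : V -> C) :> (V -> C) by exact: diff_unique.
by apply/diff_locallyP; rewrite E.
Qed.

Lemma differentiable_Th (V : normedModType C) k (p q : C) (f g : V -> C) (x : V) :
  0 < complex.Im (g x) -> differentiable f x -> differentiable g x ->
  differentiable (fun y => Th k p q (f y) (g y)) x.
Proof.
move=> g0 df dg; have [r r0 [B B0 hB]] := Th_taylor k p q (f x) g0.
pose c1 := Th k.+1 p q (f x) (g x); pose c2 := Th k.+2 p q (f x) (g x) / (4 * ipi).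
pose F (z : C * C) := Th k p q z.1 z.2.
suff dF : differentiable F (f x, g x).
  exact: (differentiable_comp (differentiable_pair df dg) dF).
pose rem (z : C * C) := F z - (c1 * z.1 + c2 * z.2).
have dfst : differentiable (fst : C * C -> C) (f x, g x).
  by apply: (@linear_differentiable C (C * C)%type C fst) => z; exact: cvg_fst.
have dsnd : differentiable (snd : C * C -> C) (f x, g x).
  by apply: (@linear_differentiable C (C * C)%type C snd) => z; exact: cvg_snd.
have dlin : differentiable (fun z : C * C => c1 * z.1 + c2 * z.2) (f x, g x).
  apply: differentiableD; apply: differentiableM => //; exact: differentiable_cst.
suff dr : differentiable rem (f x, g x).
  have -> : F = (rem + (fun z : C * C => c1 * z.1 + c2 * z.2)).
    by apply/funext => z; rewrite /rem fctE subrK.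
  exact: differentiableD.
apply: differentiable_small => e e0.
have B1 : 0 < B + 1 by rewrite ltr_wpDl.
pose d := Num.min (r / 2) (e / (B + 1) / 4).
have d0 : 0 < d by rewrite lt_min !divr_gt0.
apply/nbhs_normP; exists (ofr d); first by rewrite /= -ofr0 ofr_lt.
move=> [h w] /=; rewrite sub0r normrN => hd.
have nn : `|(h, w)| = ofr (Num.max (cabs h) (cabs w)).
  rewrite prod_normE /= !normE; have [a|a] := leP (cabs h) (cabs w).
    by rewrite max_r // ofr_le.
  by rewrite max_l // ofr_le ltW.
rewrite nn ofr_lt in hd.
rewrite nn normE -ofrM ofr_le.
set m := Num.max _ _ in hd *.
have hm : cabs h <= m by rewrite le_max lexx.
have wm : cabs w <= m by rewrite le_max lexx orbT.
have d1 : d <= r / 2 by rewrite ge_min lexx.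
have d2 : d <= e / (B + 1) / 4 by rewrite ge_min lexx orbT.
have [|_ hT] := hB h w; first by lra.
rewrite /rem /F /= ![_ + f x]addrC ![_ + g x]addrC.
have -> : Th k p q (f x + h) (g x + w) - (c1 * (f x + h) + c2 * (g x + w)) -
  (Th k p q (f x) (g x) - (c1 * f x + c2 * g x)) =
  Th k p q (f x + h) (g x + w) - Th k p q (f x) (g x) - (c1 * h + c2 * w) by ring.
apply: (le_trans hT).
have h0 := cabs_ge0 h; have w0 := cabs_ge0 w.
have m2 : (cabs h + cabs w) ^+ 2 <= 4 * m ^+ 2 by nra.
apply: (@le_trans _ _ ((B + 1) * (4 * m ^+ 2))).
  by apply: ler_pM; rewrite ?sqr_ge0 // lerDl.
have : (B + 1) * 4 * m <= e.
  have -> : e = (B + 1) * 4 * (e / (B + 1) / 4) by field; rewrite gt_eqF.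
  by rewrite ler_wpM2l //; lra.
have m0 : 0 <= m by lra.
rewrite expr2; nra.
Qed.

End ThetaSeries.

(** * Quasi-periodicity, parity and the bilinear identity of theta functions *)

Section ThetaIdentities.
Variable R : realType.
Local Notation C := (Cx R).
Local Notation ipi := (ipi R).

Lemma cexp_2ipiD (w : C) (n : int) : cexp (w + 2 * ipi * n%:~R) = cexp w.
Proof. by rewrite cexpD cexp_2ipi_int mulr1. Qed.

Lemma Th_sumE k (p q z Om S : C) : 0 < complex.Im Om -> has_sum (tterm k p q z Om) S ->
  Th k p q z Om = S.
Proof. by move=> O0; apply: has_sum_uniq; exact: ThP. Qed.

Lemma Th_period k (p q z Om : C) : 0 < complex.Im Om ->
  Th k p q (z + 1) Om = cexp (2 * ipi * p) * Th k p q z Om.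
Proof.
move=> O0; apply: Th_sumE => //.
apply: has_sum_eq (erefl _) (has_sumZ (cexp (2 * ipi * p)) (ThP k p q z O0)) => n.
rewrite /tterm; have -> : texp p q n (z + 1) Om = texp p q n z Om + 2 * ipi * p + 2 * ipi * n%:~R.
  by rewrite /texp; ring.
by rewrite cexp_2ipiD cexpD; ring.
Qed.

Lemma Th_quasi (p q z Om : C) : 0 < complex.Im Om ->
  Th 0 p q (z + Om) Om = cexp (- (ipi * Om) - 2 * ipi * (z + q)) * Th 0 p q z Om.
Proof.
move=> O0; apply: Th_sumE => //.
set E := cexp _; have := has_sumZ E (ThP 0 p q z O0).
move=> /(has_sum_reindex (g := fun n => n + 1) (h := fun n => n - 1)
  (fun n => addrK 1 n) (fun n => subrK 1 n)).
apply: has_sum_eq => // n; rewrite /tterm !expr0 !mul1r /E -cexpD; congr cexp.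
by rewrite /texp intrD; ring.
Qed.

(** The substitution n -> - 1 - n changes the sign of n + 1/2. Each derivative contributes a sign
    through the frequency, and the characteristic q = 1/2 contributes one more. *)
Lemma Th_parity k (z Om : C) : 0 < complex.Im Om ->
  Th k 2^-1 2^-1 (- z) Om = (-1) ^+ k.+1 * Th k 2^-1 2^-1 z Om.
Proof.
move=> O0; apply: Th_sumE => //.
have inv : cancel (fun n : int => - 1 - n) (fun n : int => - 1 - n) by move=> n; lia.
have := has_sumZ ((-1) ^+ k.+1) (ThP k 2^-1 2^-1 z O0).
move=> /(has_sum_reindex inv inv); apply: has_sum_eq => // n; rewrite /tterm.
have -> : tfreq 2^-1 (-1 - n) = - tfreq (2^-1 : C) n.
  by rewrite /tfreq intrD mulrNz intrN; field.
have -> : texp (2^-1 : C) 2^-1 (-1 - n) z Om = texp 2^-1 2^-1 n (- z) Om - ipi + 2 * ipi * (- n)%:~R.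
  by rewrite /texp !intrD !mulrNz; field.
rewrite cexp_2ipiD cexpB cexp_ipi (exprNn (tfreq _ _)) exprS invrN1.
have hs : (-1) ^+ k * (-1) ^+ k = 1 :> C by rewrite -exprMn mulrNN mulr1 expr1n.
set E := cexp _; set F := tfreq _ _ ^+ k; set s := (-1) ^+ k in hs *.
transitivity (s * s * (F * E)); first by ring.
by rewrite hs mul1r.
Qed.

Lemma Th_shift (p q p' q' z Om : C) : 0 < complex.Im Om ->
  Th 0 p q z Om = cexp (ipi * (p - p') ^+ 2 * Om + 2 * ipi * (p - p') * (z + q))
    * Th 0 p' q' (z + ((p - p') * Om + (q - q'))) Om.
Proof.
move=> O0; apply: Th_sumE => //; set E := cexp _; set z' := z + _.
apply: has_sum_eq (has_sumZ E (ThP 0 p' q' z' O0)) => // n; rewrite /E /z'.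
rewrite /tterm !expr0 !mul1r -cexpD; congr cexp.
by rewrite /texp; ring.
Qed.

(** With [be], the theta functions of period ratio 2 Omega at the doubled argument, in which the
    products theta_11(a + b) theta_11(a - b) become bilinear. *)
Definition al (Om a : C) : C := Th 0 0 0 (2 * a) (2 * Om).
Definition be (Om a : C) : C := Th 0 2^-1 0 (2 * a) (2 * Om).

Lemma Im2 (Om : C) : 0 < complex.Im Om -> 0 < complex.Im (2 * Om : C).
Proof. by move=> O0; rewrite -ofr_nat Im_ofrM mulr_gt0. Qed.

(** The difference of the two entries is 2 j + b, so that division by 2 recovers j and b, and then
    i. *)
Definition half_idx (ijb : int * int * bool) : int * int :=
  (ijb.1.1 + ijb.1.2, ijb.1.1 - ijb.1.2 - (ijb.2 : nat)%:Z).
Definition half_inv (mn : int * int) : int * int * bool :=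
  let d := mn.1 - mn.2 in let b := ((d %% 2)%Z != 0) in
  let j := (d %/ 2)%Z in (mn.1 - j, j, b).

Lemma half_idxK : cancel half_idx half_inv.
Proof.
move=> [[i j] b]; rewrite /half_idx /half_inv /=.
have -> : i + j - (i - j - (b : nat)%:Z) = j * 2 + (b : nat)%:Z by ring.
have b2 : ((b : nat)%:Z < `|2|%N)%R by case: b.
rewrite modzMDl divzMDl // modz_small ?divz_small //; try by case: b.
by rewrite addr0; congr (_, _, _); [ring|case: (b)].
Qed.

Lemma half_invK : cancel half_inv half_idx.
Proof.
move=> [m n]; rewrite /half_idx /half_inv /=.
have E := divz_eq (m - n) 2.
have B : ((m - n) %% 2)%Z = (((m - n) %% 2)%Z != 0 : nat)%:Z.
  have h1 := modz_ge0 (m - n) (isT : (2 : int) != 0).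
  have h2 := ltz_pmod (m - n) (isT : (0 : int) < 2).
  by move: h1 h2; case: (_ %% _)%Z => [[|[|k]]|k].
rewrite -B; congr (_, _); first by ring.
by move: E; set j := (_ %/ _)%Z; set r := (_ %% _)%Z => E; have := E; lia.
Qed.

(* Substituting k = m + n + 1, l = m - n separates the double series according to parity. *)
Lemma theta_W (Om a b : C) : 0 < complex.Im Om ->
  Th 0 2^-1 2^-1 (a + b) Om * Th 0 2^-1 2^-1 (a - b) Om =
  al Om a * be Om b - be Om a * al Om b.
Proof.
move=> O0; have O2 := Im2 O0.
have h1 := has_sum_prod (tterm_summable 0 2^-1 2^-1 (a + b) O0)
  (tterm_summable 0 2^-1 2^-1 (a - b) O0)
  (ThP 0 2^-1 2^-1 (a + b) O0) (ThP 0 2^-1 2^-1 (a - b) O0).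
have h2 := has_sum_reindex half_idxK half_invK h1.
apply: has_sum_uniq h2 _.
apply: has_sum_bool => /=.
  apply: has_sum_eq (has_sum_prod (tterm_summable 0 0 0 (2 * a) O2)
    (tterm_summable 0 2^-1 0 (2 * b) O2) (ThP 0 0 0 (2 * a) O2) (ThP 0 2^-1 0 (2 * b) O2)) => // -[i j] /=.
  rewrite /tterm !expr0 !mul1r -!cexpD /texp /= !intrD !intrN.
  rewrite -(cexp_2ipiD _ i); congr cexp.
  by field.
apply: has_sum_eq (has_sumZ (-1) (has_sum_prod (tterm_summable 0 2^-1 0 (2 * a) O2)
  (tterm_summable 0 0 0 (2 * b) O2) (ThP 0 2^-1 0 (2 * a) O2) (ThP 0 0 0 (2 * b) O2))) => [[i j] /=|]; last by rewrite mulN1r.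
rewrite /tterm !expr0 !mul1r -!cexpD /texp /= !intrD !intrN subr0.
rewrite -(@cexp_ipi R) -cexpD -(cexp_2ipiD _ i); congr cexp.
by field.
Qed.

End ThetaIdentities.

(** * Two-sided bounds for partial products *)

Section Products.
Variable R : realType.
Local Notation C := (Cx R).

Lemma geom_sum_le (rho : R) : 0 <= rho < 1 -> sum_le (fun k : nat => rho ^+ k) (1 - rho)^-1.
Proof.
move=> /andP[r0 r1] s us; pose N := (\max_(n <- s) n).+1.
have sN : {subset s <= iota 0 N}.
  by move=> n hn; rewrite mem_iota /= add0n ltnS /N; apply: leq_bigmax_seq.
apply: le_trans (ler_sum_sub _ us (iota_uniq 0 N) sN) _; first by move=> n; exact: exprn_ge0.
have h m : \sum_(n <- iota 0 m) rho ^+ n = (1 - rho ^+ m) / (1 - rho).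
  elim: m => [|m IH]; first by rewrite big_nil expr0 subrr mul0r.
  rewrite -addn1 iotaD big_cat /= add0n big_cons big_nil addr0 IH addn1 exprS.
  by field; rewrite subr_eq0 eq_sym lt_eqF.
rewrite h ler_pdivrMr ?subr_gt0 // mulVf ?gt_eqF ?subr_gt0 //.
by rewrite gerBl exprn_ge0.
Qed.

Lemma finite_min (I : eqType) (f : I -> R) (s : seq I) : (forall i, 0 < f i) ->
  exists2 m, 0 < m & forall i, i \in s -> m <= f i.
Proof.
move=> f0; elim: s => [|i s [m m0 H]]; first by exists 1.
exists (Num.min m (f i)); first by rewrite lt_min m0 f0.
move=> j; rewrite in_cons ge_min => /orP[/eqP ->|/H ->] //.
by rewrite lexx orbT.
Qed.

(** For the lower bound, 1/|1 + x| <= 1 + |x|/|1 + x| <= exp(|x| / m1), where m1 is a common lower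
    bound of the |1 + x k|. It exists because |x k| <= 1/2 for all but finitely many k. *)
Lemma prod_bounds (x : nat -> C) (G rho : R) : 0 <= rho < 1 ->
  (forall k, cabs (x k) <= G * rho ^+ k) -> (forall k, 1 + x k != 0) ->
  exists2 d : R, 0 < d & exists K : R, forall N,
    d <= cabs (\prod_(k < N) (1 + x k)) <= K.
Proof.
move=> hr hx hn0; have G0 : 0 <= G by have := le_trans (cabs_ge0 _) (hx 0%N); rewrite expr0 mulr1.
have hs := sum_leZ G0 (geom_sum_le hr); set S := G / (1 - rho) in hs.
have g0 k : 0 <= G * rho ^+ k by rewrite mulr_ge0 // exprn_ge0 //; case/andP: hr.
have h2 : (0 : R) < 2^-1 by lra.
have [s0 us0 ht] := sum_tail g0 hs h2.
have [m m0 hm] := finite_min s0 (f := fun k => cabs (1 + x k)) (fun k => etrans (cabs_gt0 _) (hn0 k)).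
pose m1 := Num.min m 2^-1; have m10 : 0 < m1 by rewrite lt_min m0.
have hm1 k : m1 <= cabs (1 + x k).
  rewrite ge_min; case: (boolP (k \in s0)) => [/hm -> //|ks0].
  apply/orP; right; have := ht [:: k] isT; rewrite big_seq1 => /(_ _)/ltW h.
  have {}h : G * rho ^+ k <= 2^-1 by apply: h => i; rewrite inE => /eqP ->.
  have := cabsB (1 + x k) (x k); rewrite addrK cabs1; have := hx k; lra.
have sN N : \sum_(k < N) cabs (x k) <= S.
  rewrite -(big_mkord xpredT (fun k => cabs (x k))).
  apply: le_trans (hs _ (iota_uniq 0 (N - 0))); apply: ler_sum => k _; exact: hx.
have cp N : cabs (\prod_(k < N) (1 + x k)) = \prod_(k < N) cabs (1 + x k).
  elim: N => [|N IH]; first by rewrite !big_ord0 cabs1.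
  by rewrite !big_ord_recr /= cabsM IH.
exists (expR (- (S / m1))); first exact: expR_gt0.
exists (expR S) => N; rewrite cp; apply/andP; split.
  apply: (@le_trans _ _ (\prod_(k < N) expR (- (cabs (x k) / m1)))).
    rewrite -expR_sum ler_expR sumrN -mulr_suml lerN2 ler_wpM2r ?invr_ge0 ?(ltW m10) //.
  apply: ler_prod => k _; rewrite expR_ge0 /= expRN.
  have p0 : 0 < cabs (1 + x k) by exact: lt_le_trans m10 (hm1 k).
  rewrite -[leRHS]invrK lef_pV2 ?posrE ?invr_gt0 ?expR_gt0 //.
  apply: le_trans (expR_ge1Dx _).
  apply: (@le_trans _ _ (1 + cabs (x k) / cabs (1 + x k))).
    have -> : 1 + cabs (x k) / cabs (1 + x k) = (cabs (1 + x k) + cabs (x k)) / cabs (1 + x k).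
      by field; rewrite gt_eqF.
    rewrite ler_pdivlMr // mulVf ?gt_eqF //.
    by have := cabsB (1 + x k) (x k); rewrite addrK cabs1.
  by rewrite lerD2l ler_wpM2l ?cabs_ge0 // lef_pV2 ?posrE.
apply: (@le_trans _ _ (\prod_(k < N) expR (cabs (x k)))).
  apply: ler_prod => k _; rewrite cabs_ge0 /=.
  by apply: (le_trans (cabsD _ _)); rewrite cabs1 expR_ge1Dx.
by rewrite -expR_sum ler_expR.
Qed.

End Products.

(** * The triple product in finite form *)

Section TripleProduct.
Variable R : realType.
Local Notation C := (Cx R).
Local Notation ipi := (ipi R).
Variables (Om zt : C).
Hypothesis O0 : 0 < complex.Im Om.

Let qe (x : int) : C := cexp (2 * ipi * Om * x%:~R).
Let A (m : nat) : C := \prod_(k < m) (1 - qe (k.+1)%:Z).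
(** The reciprocal of (q)_m, extended by 0 to negative m. With this convention the recurrence
    [ra_rec] holds for all integers: at m = 0 its factor 1 - q^0 vanishes. *)
Let ra (m : int) : C := if m is Posz n then (A n)^-1 else 0.
Let ee (j : int) : C := cexp (ipi * Om * j%:~R ^+ 2 + 2 * ipi * zt * j%:~R).
Let s1 (N : nat) : C := cexp (ipi * Om * (2 * N%:~R + 1) + 2 * ipi * zt).
Let s2 (N : nat) : C := cexp (ipi * Om * (2 * N%:~R + 1) - 2 * ipi * zt).
Let PP (N : nat) : C := \prod_(k < N) ((1 + s1 k) * (1 + s2 k)).
Let rho : R := cabs (qe 1).

Let qeD x y : qe (x + y) = qe x * qe y.
Proof. by rewrite /qe intrD mulrDr cexpD. Qed.

Let qe_nat (n : nat) : qe n%:Z = qe 1 ^+ n.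
Proof.
elim: n => [|n IH]; first by rewrite /qe mulr0 cexp0.
by rewrite -addn1 PoszD qeD IH exprD expr1.
Qed.

Let rho_lt1 : 0 <= rho < 1.
Proof.
rewrite /rho cabs_ge0 /= /qe mulr1 cabs_cexp expR_lt1.
have -> : complex.Re (2 * ipi * Om) = - (2 * pi * complex.Im Om).
  have -> : 2 * ipi * Om = ofr 2 * (ipi * Om) by rewrite ofr_nat; ring.
  by rewrite Re_ofrM cReM /= mul0r sub0r; ring.
by rewrite oppr_lt0 !mulr_gt0 ?pi_gt0.
Qed.

Let qe_norm (n : nat) : cabs (qe n%:Z) = rho ^+ n.
Proof. by rewrite qe_nat cabsX. Qed.

Let qe_neq1 (n : nat) : 1 - qe (n.+1)%:Z != 0.
Proof.
rewrite subr_eq0; apply/eqP => h; have := qe_norm n.+1; rewrite -h cabs1 => h2.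
have /andP[r0 r1] := rho_lt1.
by have := exprn_ilt1 n.+1 r0 r1; rewrite -h2 ltxx.
Qed.

Let A_bounds : exists2 d : R, 0 < d & exists K : R, forall N, d <= cabs (A N) <= K.
Proof.
have [|k|d d0 [K H]] := @prod_bounds R (fun k => - qe (k.+1)%:Z) 1 rho rho_lt1.
- move=> k; rewrite cabsN mul1r qe_norm exprS ler_piMl ?exprn_ge0 //; case/andP: rho_lt1 => //.
  by move=> _ /ltW.
- exact: qe_neq1.
by exists d => //; exists K => N; exact: H.
Qed.

Let A_neq0 n : A n != 0.
Proof.
have [d d0 [K H]] := A_bounds; rewrite -cabs_gt0.
by have /andP[h _] := H n; exact: lt_le_trans d0 h.
Qed.

Let ra_rec (m : int) : ra (m - 1) = (1 - qe m) * ra m.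
Proof.
case: m => [[|n]|n].
- by have -> : 0%:Z - 1 = Negz 0 by []; rewrite /qe mulr0 cexp0 subrr mul0r.
- have -> : n.+1%:Z - 1 = n%:Z by lia.
  rewrite /ra; have -> : A n.+1 = A n * (1 - qe n.+1%:Z) by rewrite /A big_ord_recr.
  have h1 := qe_neq1 n; have h2 := A_neq0 n; field.
  by rewrite h1 h2.
have -> : Negz n - 1 = Negz n.+1 by lia. by rewrite /ra mulr0.
Qed.

(** The q-binomial coefficient (q)_2N / ((q)_(N-j) (q)_(N+j)), zero for |j| > N. *)
Let cf (N : nat) (j : int) : C := A (2 * N) * (ra (N%:Z - j) * ra (N%:Z + j)).

(* Finite form of the triple product: the q-binomial expansion of PP. *)
Let finite_triple (N : nat) : has_sum (fun j => cf N j * ee j) (PP N).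
Proof.
elim: N => [|N IH].
  rewrite /PP big_ord0 => e e0; exists [:: 0] => s us hs.
  have h0 : 0 \in s by apply: hs; rewrite inE.
  rewrite (big_rem 0 h0) /= big1_seq.
    have c0 : cf 0 0 = 1 by rewrite /cf muln0 subr0 ?addr0 /ra /A !big_ord0 invr1 !mulr1.
    have e1 : ee 0 = 1 by rewrite /ee mulr0z expr0n !mulr0 addr0 cexp0.
    by rewrite addr0 c0 e1 mulr1 subrr cabs0.
  move=> j /andP[_]; rewrite mem_rem_uniq // inE => /andP[j0 _].
  rewrite /cf; case: j j0 => [[|n]|n] // _.
    have -> : 0%N%:Z - n.+1%:Z = Negz n by lia.
    by rewrite /ra !(mul0r, mulr0).
  have -> : 0%N%:Z + Negz n = Negz n by lia.
  by rewrite /ra !(mul0r, mulr0).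
have h1 := has_sum_reindex (g := fun n : int => n - 1) (h := fun n => n + 1)
  (fun n => subrK 1 n) (fun n => addrK 1 n) IH.
have h2 := has_sum_reindex (g := fun n : int => n + 1) (h := fun n => n - 1)
  (fun n => addrK 1 n) (fun n => subrK 1 n) IH.
have := has_sumD (has_sumD (has_sumZ (1 + s1 N * s2 N) IH) (has_sumZ (s1 N) h1)) (has_sumZ (s2 N) h2).
apply: has_sum_eq => [j|]; last by rewrite /PP big_ord_recr /=; ring.
pose u := qe (N.+1%:Z - j); pose v := qe (N.+1%:Z + j); pose w := qe (-1).
have e12 : s1 N * s2 N = u * v * w.
  rewrite /s1 /s2 /u /v /w /qe -!cexpD; congr cexp.
  by rewrite !intrD !mulrNz; ring.
have e1 : s1 N * ee (j - 1) = u * ee j.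
  by rewrite /s1 /u /ee /qe -!cexpD; congr cexp; rewrite !intrD !mulrNz; ring.
have e2 : s2 N * ee (j + 1) = v * ee j.
  by rewrite /s2 /v /ee /qe -!cexpD; congr cexp; rewrite !intrD; ring.
pose U := ra (N.+1%:Z - j); pose V := ra (N.+1%:Z + j).
have r1 : ra (N%:Z - j) = (1 - u) * U.
  by rewrite /U /u -ra_rec; congr ra; lia.
have r2 : ra (N%:Z + j) = (1 - v) * V.
  by rewrite /V /v -ra_rec; congr ra; lia.
have r3 : ra (N%:Z - (j - 1)) = U by rewrite /U; congr ra; lia.
have r4 : ra (N%:Z + (j + 1)) = V by rewrite /V; congr ra; lia.
have r5 : ra (N%:Z + (j - 1)) = (1 - v * w) * ((1 - v) * V).
  rewrite -r2 -qeD; have -> : N.+1%:Z + j + -1 = N%:Z + j by lia.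
  by rewrite -ra_rec; congr ra; lia.
have r6 : ra (N%:Z - (j + 1)) = (1 - u * w) * ((1 - u) * U).
  rewrite -r1 -qeD; have -> : N.+1%:Z - j + -1 = N%:Z - j by lia.
  by rewrite -ra_rec; congr ra; lia.
have a2 : A (2 * N.+1) = A (2 * N) * (1 - u * v * w) * (1 - u * v).
  have -> : (2 * N.+1 = (2 * N).+2)%N by lia.
  rewrite /A !big_ord_recr /=; congr (_ * _ * _); congr (1 - _); rewrite -!qeD; congr qe; lia.
rewrite /cf r1 r2 r3 r4 r5 r6 a2 -/U -/V e12.
transitivity ((1 + u * v * w) * (A (2 * N) * ((1 - u) * U * ((1 - v) * V)) * ee j) +
  A (2 * N) * (U * ((1 - v * w) * ((1 - v) * V))) * (s1 N * ee (j - 1)) +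
  A (2 * N) * ((1 - u * w) * ((1 - u) * U) * V) * (s2 N * ee (j + 1))); first by ring.
rewrite e1 e2; ring.
Qed.

Let ee_Th : has_sum ee (Th 0 0 0 zt Om).
Proof.
apply: has_sum_eq (ThP 0 0 0 zt O0) => // j.
by rewrite /tterm expr0 mul1r /texp /ee !addr0; congr cexp; ring.
Qed.

Let ee_sum : csummable ee.
Proof.
have [M hM] := tterm_summable 0 0 0 zt O0; exists M; apply: sum_leW hM => j.
rewrite /tterm expr0 mul1r /texp /ee !addr0.
by rewrite [2 * ipi * zt * _]mulrAC [ipi * Om * _]mulrAC.
Qed.

Let P_bound : (forall k, 1 + s1 k != 0) -> (forall k, 1 + s2 k != 0) ->
  exists2 d : R, 0 < d & forall N, d <= cabs (PP N).
Proof.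
move=> n1 n2.
have key (s : nat -> C) (c : C) : (forall k, s k = qe k%:Z * c) -> (forall k, 1 + s k != 0) ->
    exists2 d : R, 0 < d & forall N, d <= cabs (\prod_(k < N) (1 + s k)).
  move=> hs hn; have [|d d0 [K H]] := @prod_bounds R s (cabs c) rho rho_lt1 _ hn.
    by move=> k; rewrite hs cabsM qe_norm mulrC.
  by exists d => // N; case/andP: (H N).
have [d1 d10 h1] : exists2 d : R, 0 < d & forall N, d <= cabs (\prod_(k < N) (1 + s1 k)).
  apply: (key s1 (cexp (ipi * Om + 2 * ipi * zt))) => // k.
  by rewrite /s1 /qe -cexpD; congr cexp; ring.
have [d2 d20 h2] : exists2 d : R, 0 < d & forall N, d <= cabs (\prod_(k < N) (1 + s2 k)).
  apply: (key s2 (cexp (ipi * Om - 2 * ipi * zt))) => // k.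
  by rewrite /s2 /qe -cexpD; congr cexp; ring.
exists (d1 * d2) => [|N]; first exact: mulr_gt0.
rewrite /PP big_split /= cabsM; apply: ler_pM; [by rewrite ltW|by rewrite ltW|exact: h1|exact: h2].
Qed.

(** By [ra_rec] the increment of [ra] between k and k + 1 is q^(k+1) times a bounded quantity, hence
    dominated by a geometric series. *)
Let ra_cauchy : exists L : C, forall e : R, 0 < e -> exists N0, forall n, (N0 <= n)%N ->
  cabs (ra n%:Z - L) < e.
Proof.
have [d d0 [K H]] := A_bounds.
have rb n : cabs (ra n) <= d^-1.
  case: n => n /=; last by rewrite cabs0 invr_ge0 ltW.
  by have /andP[h _] := H n; rewrite cabsV lef_pV2 ?posrE // (lt_le_trans d0 h).
have hx k : cabs (ra k.+1%:Z - ra k%:Z) <= d^-1 * rho ^+ k.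
  have -> : k%:Z = k.+1%:Z - 1 by lia.
  rewrite ra_rec; have -> : ra k.+1%:Z - (1 - qe k.+1%:Z) * ra k.+1%:Z = qe k.+1%:Z * ra k.+1%:Z by ring.
  rewrite cabsM qe_norm mulrC; apply: ler_pM; rewrite ?cabs_ge0 ?exprn_ge0 //; try by case/andP: rho_lt1.
  by rewrite exprS ler_piMl ?exprn_ge0 //; case/andP: rho_lt1 => // _ /ltW.
have di : 0 <= d^-1 by rewrite invr_ge0 ltW.
have [S hS] := summable_has_sum (summableW hx (sum_leZ di (geom_sum_le rho_lt1))).
exists (S + ra 0) => e e0; have [s0 hs0] := hS e e0.
exists (\max_(k <- s0) k.+1)%N => n hn.
have := hs0 (index_iota 0 n) (iota_uniq 0 _).
have -> : \sum_(k <- index_iota 0 n) (ra k.+1%:Z - ra k%:Z) = ra n%:Z - ra 0.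
  by rewrite (@telescope_sumr _ 0 n (fun k => ra k%:Z)).
have -> : ra n%:Z - (S + ra 0) = ra n%:Z - ra 0 - S by ring.
apply => k hk; rewrite mem_index_iota /=; apply: leq_trans hn.
exact: (@leq_bigmax_seq _ _ _ (fun k => k.+1)).
Qed.

(** If no factor vanished, the products [PP N] would stay above some d > 0. But [PP N] is the sum of
    the [cf N j * ee j], and as the [ee j] sum to 0 the constant [cf N 0] may be subtracted from
    each coefficient. The new coefficients are small on any given finite set for large N and bounded
    elsewhere, so [PP N] becomes smaller than d. *)
Lemma Th00_zero : Th 0 0 0 zt Om = 0 ->
  (exists k : nat, 1 + s1 k = 0) \/ (exists k : nat, 1 + s2 k = 0).
Proof.
move=> T0; have [[k hk]|h1] := pselect (exists k : nat, 1 + s1 k = 0); first by left; exists k.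
have [[k hk]|h2] := pselect (exists k : nat, 1 + s2 k = 0); first by right; exists k.
exfalso; have [||d d0 hd] := P_bound.
- by move=> k; apply/eqP => hk; apply: h1; exists k.
- by move=> k; apply/eqP => hk; apply: h2; exists k.
have [dA dA0 [KA HA]] := A_bounds; have [M hM] := ee_sum.
have M0 := sum_le_ge0 hM.
have KA0 : 0 <= KA by have /andP[a b] := HA 0; lra.
have [L hL] := ra_cauchy.
pose B := KA * (dA^-1 * dA^-1).
have dAi : 0 <= dA^-1 by rewrite invr_ge0 ltW.
have B0 : 0 <= B by rewrite !mulr_ge0.
have rb n : cabs (ra n) <= dA^-1.
  case: n => n /=; last by rewrite cabs0.
  by have /andP[h _] := HA n; rewrite cabsV lef_pV2 ?posrE // (lt_le_trans dA0 h).
have cb N j : cabs (cf N j) <= B.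
  rewrite /cf !cabsM; apply: ler_pM; rewrite ?mulr_ge0 ?cabs_ge0 //.
    by case/andP: (HA (2 * N)).
  by apply: ler_pM; rewrite ?cabs_ge0.
(* The tail, with coefficients at most 2 B, contributes at most d / 2; the finite part will
   contribute d / 4, and the total stays below d. *)
pose e := d / 4 / (B + 1).
have e0 : 0 < e by rewrite !divr_gt0 //; lra.
have [s0 us0 ht] := sum_tail (fun j => cabs_ge0 (ee j)) hM e0.
pose e' := d / 8 / ((M + 1) * (KA + 1) * (dA^-1 + 1)).
have e'0 : 0 < e' by rewrite !divr_gt0 ?mulr_gt0 //; lra.
have e'2 : 0 < e' / 2 by lra.
have [N1 hN1] := hL _ e'2.
have [J hJ] : exists J : nat, forall j, j \in s0 -> (`|j| <= J)%N.
  by exists (\max_(j <- s0) `|j|%N) => j hj; apply: (@leq_bigmax_seq _ _ _ (fun j : int => `|j|%N)).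
(* For |j| <= J both N - j and N + j are at least N1, where [ra] is within e' / 2 of its limit. *)
have [N eN] : exists N, N = (N1 + J)%N by exists (N1 + J)%N.
have near_ra (j : int) : j \in s0 -> cabs (ra (N%:Z + j) - ra N%:Z) <= e' /\
    cabs (ra (N%:Z - j) - ra N%:Z) <= e'.
  move=> /hJ jJ.
  have q (m : int) : (`|m| <= J)%N -> cabs (ra (N%:Z + m) - ra N%:Z) <= e'.
    move=> mJ; have [M' eM] : exists M' : nat, N%:Z + m = M'%:Z.
      by exists (absz (N%:Z + m)); clear -mJ eN; lia.
    rewrite eM; have k1 : cabs (ra M'%:Z - L) < e' / 2 by apply: hN1; clear -mJ eN eM; lia.
    have k2 : cabs (ra N%:Z - L) < e' / 2 by apply: hN1; clear -eN; lia.
    have := cabsDB (ra M'%:Z) (ra N%:Z) L; rewrite (cabsBC L); lra.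
  by split; apply: q; rewrite ?abszN.
have cd j : j \in s0 -> cabs (cf N j - cf N 0) <= d / 4 / (M + 1).
  move=> hj; have [k1 k2] := near_ra j hj.
  have -> : cf N 0 = A (2 * N) * (ra N%:Z * ra N%:Z).
    by rewrite /cf; congr (_ * (ra _ * ra _)); clear; lia.
  rewrite /cf -mulrBr.
  have -> : ra (N%:Z - j) * ra (N%:Z + j) - ra N%:Z * ra N%:Z =
    (ra (N%:Z - j) - ra N%:Z) * ra (N%:Z + j) + ra N%:Z * (ra (N%:Z + j) - ra N%:Z) by ring.
  rewrite cabsM.
  have k3 : cabs ((ra (N%:Z - j) - ra N%:Z) * ra (N%:Z + j) + ra N%:Z * (ra (N%:Z + j) - ra N%:Z))
     <= 2 * e' * (dA^-1 + 1).
    apply: (le_trans (cabsD _ _)); rewrite !cabsM.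
    have := rb (N%:Z + j); have := rb N%:Z; move: k1 k2.
    set a := cabs _; set b := cabs _; set c := cabs (ra N%:Z); set f := cabs (ra (N%:Z + j)).
    have : 0 <= a := cabs_ge0 _; have : 0 <= b := cabs_ge0 _.
    have : 0 <= c := cabs_ge0 _; have : 0 <= f := cabs_ge0 _; nra.
  apply: (@le_trans _ _ ((KA + 1) * (2 * e' * (dA^-1 + 1)))).
    apply: ler_pM; rewrite ?cabs_ge0 //; have /andP[_ h] := HA (2 * N)%N; lra.
  rewrite le_eqVlt; apply/orP; left; apply/eqP; rewrite /e'.
  by field; rewrite !gt_eqF //; lra.
have S1 := has_sumB (finite_triple N) (has_sumZ (cf N 0) ee_Th).
rewrite T0 mulr0 subr0 in S1.
have : cabs (PP N) <= d / 4 + d / 2.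
  pose t := s0.
  have g1 (s : seq int) : uniq s -> \sum_(j <- s) cabs (cf N j * ee j - cf N 0 * ee j) <= d / 4 + d / 2.
    move=> us; rewrite (bigID (mem s0)) /=; apply: lerD.
      apply: (@le_trans _ _ (\sum_(j <- s | j \in s0) d / 4 / (M + 1) * cabs (ee j))).
        by apply: ler_sum => j js; rewrite -mulrBl cabsM ler_wpM2r ?cabs_ge0 // cd.
      rewrite -mulr_sumr -big_filter.
      apply: (@le_trans _ _ (d / 4 / (M + 1) * M)).
        rewrite ler_wpM2l //; first by rewrite !divr_ge0 //; lra.
        by apply: hM; exact: filter_uniq.
      rewrite mulrAC ler_pdivrMr; last by lra.
      nra.
    apply: (@le_trans _ _ (\sum_(j <- s | j \notin s0) (2 * B) * cabs (ee j))).
      apply: ler_sum => j js; rewrite -mulrBl cabsM ler_wpM2r ?cabs_ge0 //.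
      apply: (le_trans (cabsB _ _)); have := cb N j; have := cb N 0; lra.
    rewrite -mulr_sumr -big_filter.
    have := ht [seq j <- s | j \notin s0] (filter_uniq _ us).
    have hin : forall i, i \in [seq j <- s | j \notin s0] -> i \notin s0.
      by move=> i; rewrite mem_filter => /andP[].
    move=> /(_ hin); set X := \sum_(_ <- _) _ => hX.
    have : (B + 1) * X <= d / 4.
      have -> : d / 4 = (B + 1) * e by rewrite /e; field; rewrite gt_eqF //; lra.
      by rewrite ler_wpM2l ?(ltW hX) //; lra.
    have X0 : 0 <= X by apply: sumr_ge0 => j _; exact: cabs_ge0.
    lra.
  exact: (has_sum_bound S1 (fun j => lexx _) g1).
have := hd N; lra.
Qed.

End TripleProduct.

(** * Zeros of theta_11 *)

Section ThetaZeros.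
Variable R : realType.
Local Notation C := (Cx R).
Local Notation ipi := (ipi R).

(** After a shift of the characteristic to 0 the triple product applies. A vanishing factor 1 + exp
    w means w = pi i modulo 2 pi i, a linear equation for z. *)
Lemma theta11_zero (z Om : C) : 0 < complex.Im Om -> Th 0 2^-1 2^-1 z Om = 0 ->
  exists m n : int, z = m%:~R + n%:~R * Om.
Proof.
move=> O0; rewrite (@Th_shift R _ _ 0 0) // => /eqP; rewrite mulf_eq0 (negbTE (cexp_neq0 _)) /= => /eqP.
have I0 := @ipi_neq0 R.
have half : 2 * (2^-1 : C) = 1 by rewrite mulfV.
have key (w : C) : 1 + cexp w = 0 -> exists k : int, w = 2 * ipi * k%:~R + ipi.
  move=> h; have h2 : cexp w = -1 by apply/eqP; rewrite -addr_eq0 addrC h.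
  have /cexp_eq1[k hk] : cexp (w - ipi) = 1.
    by rewrite cexpB cexp_ipi h2 divff // oppr_eq0 oner_neq0.
  by exists k; rewrite -hk subrK.
move=> /(Th00_zero O0) [[k /key[m hm]]|[k /key[m hm]]].
  exists m, (- (k.+1)%:Z).
  apply: (@mulfI _ (2 * ipi)); first by rewrite mulf_neq0 // pnatr_eq0.
  move: hm; rewrite mulrNz !subr0.
  have -> : (k.+1%:Z)%:~R = k%:~R + 1 :> C by rewrite -addn1 PoszD intrD.
  set K : C := k%:~R; set W : C := m%:~R => hm.
  have -> : 2 * ipi * z = (ipi * Om * (2 * K + 1) + 2 * ipi * (z + (2^-1 * Om + 2^-1)))
     - ipi * Om * (2 * K + 1) - 2 * ipi * (2^-1 * Om + 2^-1) by ring.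
  rewrite hm; by field.
exists (- m - 1), k%:Z.
apply: (@mulfI _ (2 * ipi)); first by rewrite mulf_neq0 // pnatr_eq0.
move: hm; rewrite !intrD !mulrNz !subr0.
set K : C := k%:~R; set W : C := m%:~R => hm.
have -> : 2 * ipi * z = - (ipi * Om * (2 * K + 1) - 2 * ipi * (z + (2^-1 * Om + 2^-1)))
   + ipi * Om * (2 * K + 1) - 2 * ipi * (2^-1 * Om + 2^-1) by ring.
rewrite hm; by field.
Qed.

End ThetaZeros.

(** * Real coordinates with respect to the periods, and the complement of the lattice *)

Section LatticeGeometry.
Variable R : realType.
Local Notation C := (Cx R).
Variables (w1 w2 : C).
Hypothesis O0 : 0 < complex.Im (w2 / w1).

Lemma w1_neq0 : w1 != 0.
Proof. by apply/eqP => w10; move: O0; rewrite w10 invr0 mulr0 ltxx. Qed.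

Definition cy (u : C) : R := complex.Im (u / w1) / complex.Im (w2 / w1).
Definition cx (u : C) : R := complex.Re (u / w1) - cy u * complex.Re (w2 / w1).
Definition plan (x y : R) : C := ofr x * w1 + ofr y * w2.

Lemma plan_c u : plan (cx u) (cy u) = u.
Proof.
have h := w1_neq0; rewrite /plan; apply: (mulIf (invr_neq0 h)).
rewrite mulrDl mulfK // -mulrA; apply: c_eqP.
  by rewrite cReD Re_ofrM /cx /=; ring.
rewrite cImD Im_ofrM /cy /= add0r divfK //.
by rewrite gt_eqF.
Qed.

Lemma plan_cy x y : cy (plan x y) = y.
Proof.
rewrite /cy /plan mulrDl mulfK ?w1_neq0 // -mulrA cImD Im_ofrM /= add0r mulfK //.
by rewrite gt_eqF.
Qed.

Lemma plan_cx x y : cx (plan x y) = x.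
Proof.
by rewrite /cx plan_cy /plan mulrDl mulfK ?w1_neq0 // -mulrA cReD Re_ofrM /= addrK.
Qed.

Lemma planB x y x' y' : plan x y - plan x' y' = plan (x - x') (y - y').
Proof. by rewrite /plan !ofrD !ofrN; ring. Qed.

Lemma latE mn : lat w1 w2 mn = plan mn.1%:~R mn.2%:~R.
Proof. by rewrite /lat /plan !int_ofr. Qed.

Lemma in_latP u : in_lat w1 w2 u <-> exists m n : int, cx u = m%:~R /\ cy u = n%:~R.
Proof.
split => [[[m n] ->]|[m [n [hx hy]]]].
  by exists m, n; rewrite latE plan_cx plan_cy.
by exists (m, n); rewrite latE /= -hx -hy plan_c.
Qed.

Lemma in_latN u : in_lat w1 w2 u -> in_lat w1 w2 (- u).
Proof. by move=> [mn ->]; exists (- mn.1, - mn.2); rewrite /lat /= !mulrNz; ring. Qed.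
Lemma in_latD u v : in_lat w1 w2 u -> in_lat w1 w2 v -> in_lat w1 w2 (u + v).
Proof.
by move=> [mn ->] [kl ->]; exists (mn.1 + kl.1, mn.2 + kl.2); rewrite /lat /= !intrD; ring.
Qed.
Lemma in_lat0 : in_lat w1 w2 0.
Proof. by exists (0, 0); rewrite /lat /= !mul0r addr0. Qed.
Lemma in_lat_lat mn : in_lat w1 w2 (lat w1 w2 mn). Proof. by exists mn. Qed.
Lemma nlatN u : ~ in_lat w1 w2 u -> ~ in_lat w1 w2 (- u).
Proof. by move=> h /in_latN; rewrite opprK. Qed.
Lemma nlatD u v : ~ in_lat w1 w2 u -> in_lat w1 w2 v -> ~ in_lat w1 w2 (u + v).
Proof. by move=> h hv /in_latD/(_ (in_latN hv)); rewrite addrK. Qed.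

(** The constant of [plan_ge]: the imaginary part of x + y Omega controls |y|, and then |x| <= |x +
    y Omega| + |y| |Omega|. *)
Definition ldel : R := cabs w1 * Num.min (complex.Im (w2 / w1) / 2)
  (complex.Im (w2 / w1) / (2 * (cabs (w2 / w1) + 1))).

Lemma ldel_gt0 : 0 < ldel.
Proof.
rewrite mulr_gt0 ?cabs_gt0 ?w1_neq0 // lt_min !divr_gt0 // mulr_gt0 // ltr_wpDl ?cabs_ge0 //.
Qed.

Lemma plan_ge x y : ldel * (`|x| + `|y|) <= cabs (plan x y).
Proof.
have h := w1_neq0; have -> : plan x y = w1 * (ofr x + ofr y * (w2 / w1)).
  by rewrite /plan; field.
rewrite cabsM /ldel -mulrA ler_wpM2l ?cabs_ge0 //.
set t := w2 / w1; have t0 : 0 < complex.Im t := O0.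
set i := complex.Im t in t0 *; set m := cabs t.
have im : i <= m by apply: le_trans (ler_norm _) (Im_le t).
have hy : `|y| * i <= cabs (ofr x + ofr y * t).
  have := Im_le (ofr x + ofr y * t); rewrite cImD Im_ofrM /= add0r normrM.
  by rewrite (gtr0_norm t0).
have hx : `|x| <= cabs (ofr x + ofr y * t) + `|y| * m.
  rewrite -cabs_ofr; have := cabsB (ofr x + ofr y * t) (ofr y * t).
  by rewrite addrK cabsM !cabs_ofr.
set Z := cabs (ofr x + ofr y * t) in hx hy *.
have m1 : 0 < m + 1 by lra.
set k := Num.min _ _.
have k1 : k <= i / 2 by rewrite ge_min lexx.
have k2 : k * (2 * (m + 1)) <= i.
  by rewrite -ler_pdivlMr ?mulr_gt0 // ge_min lexx orbT.
have k0 : 0 < k by rewrite lt_min !divr_gt0 // mulr_gt0.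
have y0 := normr_ge0 y; have x0 := normr_ge0 x.
have Z0 : 0 <= Z by exact: cabs_ge0.
have e1 : k * `|x| <= k * (Z + `|y| * m) by rewrite ler_wpM2l // ltW.
have e2 : k * (m + 1) * `|y| <= i / 2 * `|y| by rewrite ler_wpM2r //; lra.
have e3 : k <= 2^-1.
  have : k * (2 * (m + 1)) <= m + 1 by lra.
  have -> : k * (2 * (m + 1)) = 2 * k * (m + 1) by ring.
  by rewrite -[leRHS]mul1r ler_pM2r //; lra.
have e4 : k * Z <= 2^-1 * Z by rewrite ler_wpM2r.
nra.
Qed.

Lemma plan_le x y : cabs (plan x y) <= (cabs w1 + cabs w2) * (`|x| + `|y|).
Proof.
apply: (le_trans (cabsD _ _)); rewrite !cabsM !cabs_ofr.
have := normr_ge0 x; have := normr_ge0 y; have := cabs_ge0 w1; have := cabs_ge0 w2; nra.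
Qed.

Lemma real_int_gap (a : R) : exists2 d : R, 0 < d & forall m : int, a != m%:~R -> d <= `|a - m%:~R|.
Proof.
pose f : R := (Num.floor a)%:~R; have f1 : f <= a by exact: ge_floor.
have f2 : a < f + 1 by have := @floorD1_gt R a; rewrite intrD.
have g1 (m : int) : m%:~R <= f - 1 \/ m%:~R = f \/ m%:~R >= f + 1.
  have [h|[h|h]] : (m <= Num.floor a - 1)%R \/ m = Num.floor a \/ (m >= Num.floor a + 1)%R by lia.
  - by left; move: h; rewrite -(ler_int R) intrD.
  - by right; left; rewrite h.
  by right; right; move: h; rewrite -(ler_int R) intrD.
have [e|n] := eqVneq a f.
  exists 1 => // m am; have [h|[h|h]] := g1 m.
  - have := ler_norm (a - m%:~R); lra.
  - by move: am; rewrite h e eqxx.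
  by have := ler_norm (- (a - m%:~R)); rewrite normrN; lra.
have af : f < a by rewrite lt_neqAle f1 eq_sym n.
exists (Num.min (a - f) (f + 1 - a)); first by rewrite lt_min; lra.
move=> m am; rewrite ge_min; have [h|[h|h]] := g1 m; apply/orP.
- left; have := ler_norm (a - m%:~R); lra.
- left; have := ler_norm (a - m%:~R); lra.
by right; have := ler_norm (- (a - m%:~R)); rewrite normrN; lra.
Qed.

(** The estimate is uniform both in the lattice point and in u near x. It gives all lattice series
    locally uniform majorants, the lattice point at x itself being set aside. *)
Lemma lat_dist (x : C) : exists2 k : R, 0 < k & exists2 r : R, 0 < r &
  forall mn, lat w1 w2 mn != x -> forall u, cabs (u - x) < r ->
    k * size2 R mn <= cabs (u - lat w1 w2 mn).
Proof.
pose a := cx x; pose b := cy x; have xE : x = plan a b by rewrite plan_c.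
have [d1 d10 h1] := real_int_gap a; have [d2 d20 h2] := real_int_gap b.
pose d := Num.min d1 d2; have d0 : 0 < d by rewrite lt_min d10.
pose K := (1 + `|a| + `|b|) / d + 1.
have K0 : 0 < K.
  by rewrite ltr_wpDl // divr_ge0 ?(ltW d0) // !addr_ge0.
have D0 := ldel_gt0.
exists (ldel / K / 2); first by rewrite divr_gt0 // divr_gt0.
exists (ldel * d / 2); first by rewrite divr_gt0 // mulr_gt0.
move=> [m n] hmn u ux; set N := `|a - m%:~R| + `|b - n%:~R|.
have Nd : d <= N.
  have [ea|na] := eqVneq a m%:~R.
    have [eb|nb] := eqVneq b n%:~R.
      by move: hmn; rewrite latE /= -ea -eb -xE eqxx.
    have : d <= `|b - n%:~R| by apply: le_trans (h2 _ nb); rewrite ge_min lexx orbT.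
    by rewrite /N; have := normr_ge0 (a - m%:~R); lra.
  have : d <= `|a - m%:~R| by apply: le_trans (h1 _ na); rewrite ge_min lexx.
  by rewrite /N; have := normr_ge0 (b - n%:~R); lra.
have sN : size2 R (m, n) <= K * N.
  have e1 : (`|m|%N%:R : R) <= `|a| + `|a - m%:~R|.
    have -> : (`|m|%N%:R : R) = `|m%:~R| by rewrite -intr_norm -abszE.
    by have := ler_normB a (a - m%:~R); rewrite opprB addrC subrK.
  have e2 : (`|n|%N%:R : R) <= `|b| + `|b - n%:~R|.
    have -> : (`|n|%N%:R : R) = `|n%:~R| by rewrite -intr_norm -abszE.
    by have := ler_normB b (b - n%:~R); rewrite opprB addrC subrK.
  have e3 : 1 + `|a| + `|b| <= (1 + `|a| + `|b|) / d * N.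
    rewrite -mulrA ler_peMr ?addr_ge0 // mulrC ler_pdivlMr // mul1r //.
  by rewrite /size2 /= natrD /K mulrDl mul1r; rewrite /N in e3 *; lra.
have xl : ldel * N <= cabs (x - lat w1 w2 (m, n)).
  by rewrite latE xE planB; exact: plan_ge.
have ul : ldel * N / 2 <= cabs (u - lat w1 w2 (m, n)).
  have := cabsDB x (lat w1 w2 (m, n)) u; rewrite (cabsBC x u).
  have : ldel * d <= ldel * N by rewrite ler_wpM2l // ltW.
  lra.
apply: le_trans ul; have -> : ldel * N / 2 = ldel / K / 2 * (K * N) by field; rewrite gt_eqF.
by rewrite ler_wpM2l // !divr_ge0 // ltW.
Qed.

Lemma lat_discrete (x : C) : exists2 r : R, 0 < r &
  forall u, cabs (u - x) < r -> u != x -> ~ in_lat w1 w2 u.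
Proof.
have [k k0 [r r0 h]] := lat_dist x; exists r => // u ux nx [mn e].
have := h mn _ u ux; rewrite -e subrr cabs0 => /(_ nx).
by rewrite leNgt mulr_gt0 //; exact: lt_le_trans ltr01 (size2_ge1 _ _).
Qed.

Lemma lat_eq (mn kl : int * int) : lat w1 w2 mn = lat w1 w2 kl -> mn = kl.
Proof.
rewrite !latE => h.
have hx := congr1 cx h; have hy := congr1 cy h; rewrite !plan_cx in hx; rewrite !plan_cy in hy.
by case: mn kl hx hy {h} => [a b] [c d] /= /intr_inj -> /intr_inj ->.
Qed.

Lemma plan_pt (x y x' y' s : R) : pt (plan x y) (plan x' y') s =
  plan (x + s * (x' - x)) (y + s * (y' - y)).
Proof. by rewrite /pt planB /plan !(ofrD, ofrM, ofrN); ring. Qed.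

Lemma half_nint (n : int) : (2^-1 : R) != n%:~R.
Proof.
apply/eqP => h; have : ((2 * n)%:~R : R) = 1%:~R.
  by rewrite intrM -h mulfV // pnatr_eq0.
by move/intr_inj; lia.
Qed.

Definition lat_center : C := plan 2^-1 2^-1.

Lemma center_nlat : ~ in_lat w1 w2 lat_center.
Proof. by move=> /in_latP[m [n []]]; rewrite plan_cx => /eqP; rewrite (negbTE (half_nint m)). Qed.

Lemma offlat_path (u : C) : ~ in_lat w1 w2 u -> exists v : C,
  (forall s : R, 0 <= s <= 1 -> ~ in_lat w1 w2 (pt lat_center v s)) /\
  (forall s : R, 0 <= s <= 1 -> ~ in_lat w1 w2 (pt v u s)).
Proof.
move=> hu; have uE := plan_c u.
have [[n hn]|hy] := pselect (exists n : int, cy u = n%:~R).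
  have hx (m : int) : cx u <> m%:~R by move=> hm; apply: hu; apply/in_latP; exists m, n.
  exists (plan (cx u) 2^-1); split => s sI; [rewrite /lat_center plan_pt|rewrite -[X in pt _ X _]uE plan_pt].
    by move=> /in_latP[m [k [_]]]; rewrite plan_cy subrr mulr0 addr0 => /eqP; rewrite (negbTE (half_nint k)).
  by move=> /in_latP[m [k []]]; rewrite plan_cx subrr mulr0 addr0 => /hx.
exists (plan 2^-1 (cy u)); split => s sI; [rewrite /lat_center plan_pt|rewrite -[X in pt _ X _]uE plan_pt].
  by move=> /in_latP[m [k []]]; rewrite plan_cx subrr mulr0 addr0 => /eqP; rewrite (negbTE (half_nint m)).
by move=> /in_latP[m [k [_]]]; rewrite plan_cy subrr mulr0 addr0 => h; apply: hy; exists k.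
Qed.

(** The tool for identities between elliptic functions: differentiate the difference, then evaluate
    it at one convenient place. *)
Lemma offlat_const (f : C -> C) : (forall u, ~ in_lat w1 w2 u -> der f u 0) ->
  forall u v, ~ in_lat w1 w2 u -> ~ in_lat w1 w2 v -> f u = f v.
Proof.
move=> h; suff key u : ~ in_lat w1 w2 u -> f u = f lat_center by move=> u v /key -> /key ->.
move=> /offlat_path[v [h1 h2]].
have -> : f lat_center = f v by apply: seg_const => s sI; apply: h; exact: h1.
by apply/esym; apply: seg_const => s sI; apply: h; exact: h2.
Qed.

Lemma nlat_open u : ~ in_lat w1 w2 u -> exists2 r : R, 0 < r &
  forall v, cabs (v - u) < r -> ~ in_lat w1 w2 v.
Proof.
move=> hu; have [r r0 h] := lat_discrete u; exists r => // v vu.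
by have [->//|] := eqVneq v u; exact: h.
Qed.

End LatticeGeometry.

Ltac dleaf ::= lazymatch goal with
  | |- der (fun u => cexp (@?f u)) _ _ => apply: der_cexpf; dt
  | |- der (@cexp _) _ _ => exact: der_cexp
  end.

(** * Zeros, three-term relation and differential equation of theta_11 *)

Section ThetaElliptic.
Variable R : realType.
Local Notation C := (Cx R).
Local Notation ipi := (ipi R).
Variable Om : C.
Hypothesis O0 : 0 < complex.Im Om.

Definition th11 (k : nat) (v : C) : C := Th k 2^-1 2^-1 v Om.

Lemma der_thf k (f : C -> C) x l : der f x l -> der (fun u => th11 k (f u)) x (th11 k.+1 (f x) * l).
Proof. exact: der_Th. Qed.

Lemma der_th k v : der (th11 k) v (th11 k.+1 v).
Proof. by apply: der_eq; [exact: der_thf (der_id v)|rewrite mulr1]. Qed.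

Lemma th_opp k v : th11 k (- v) = (-1) ^+ k.+1 * th11 k v.
Proof. exact: Th_parity. Qed.

Lemma th_ev0 k : ~~ odd k -> th11 k 0 = 0.
Proof.
move=> hk; have := th_opp k 0; rewrite oppr0 -signr_odd /= hk expr1 mulN1r => /eqP.
by rewrite -addr_eq0 -mulr2n -mulr_natl mulf_eq0 pnatr_eq0 => /eqP.
Qed.

Lemma th00 : th11 0 0 = 0. Proof. exact: th_ev0. Qed.
Lemma th20 : th11 2 0 = 0. Proof. exact: th_ev0. Qed.
Lemma th40 : th11 4 0 = 0. Proof. exact: th_ev0. Qed.
Lemma th60 : th11 6 0 = 0. Proof. exact: th_ev0. Qed.

Lemma th_add1 k v : th11 k (v + 1) = - th11 k v.
Proof.
rewrite /th11 Th_period // -[RHS]mulN1r; congr (_ * _).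
by rewrite mulrAC mulfV ?mul1r ?cexp_ipi // pnatr_eq0.
Qed.

Definition qm (v : C) : C := - cexp (- (ipi * Om) - 2 * ipi * v).

Lemma qm_neq0 v : qm v != 0. Proof. by rewrite oppr_eq0 cexp_neq0. Qed.

Lemma th_addOm v : th11 0 (v + Om) = qm v * th11 0 v.
Proof.
rewrite /th11 Th_quasi //; congr (_ * _).
have -> : - (ipi * Om) - 2 * ipi * (v + 2^-1) = - (ipi * Om) - 2 * ipi * v - ipi by field.
by rewrite /qm cexpB cexp_ipi invrN1 mulrN1.
Qed.

Lemma der_qm v : der qm v (- (2 * ipi) * qm v).
Proof.
by apply: der_eq; [rewrite /qm; dt|rewrite /= /qm; ring].
Qed.

Lemma der_funeq (f g : C -> C) x l m : (forall u, f u = g u) -> der f x l -> der g x m -> l = m.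
Proof. by move=> fg df dg; apply: der_uniq df _; apply: der_ext dg. Qed.

Lemma th1_addOm v : th11 1 (v + Om) = qm v * (th11 1 v - 2 * ipi * th11 0 v).
Proof.
apply: (der_funeq (f := fun u => th11 0 (u + Om)) (g := fun u => qm u * th11 0 u) (x := v)).
- exact: th_addOm.
- by apply: der_eq; [apply: der_thf; dt|rewrite addr0 mulr1].
by apply: der_eq; [apply: derM; [exact: der_qm|exact: der_th]|ring].
Qed.

Lemma th2_addOm v : th11 2 (v + Om) =
  qm v * (th11 2 v - 4 * ipi * th11 1 v + (2 * ipi) ^+ 2 * th11 0 v).
Proof.
apply: (der_funeq (f := fun u => th11 1 (u + Om))
  (g := fun u => qm u * (th11 1 u - 2 * ipi * th11 0 u)) (x := v)).
- exact: th1_addOm.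
- by apply: der_eq; [apply: der_thf; dt|rewrite addr0 mulr1].
have h0 := der_th 0 v; have h1 := der_th 1 v; have hq := der_qm v.
by apply: der_eq; [dt|rewrite /=; ring].
Qed.

Local Notation inL := (in_lat (1 : C) Om).

Lemma th_zeroP v : th11 0 v = 0 <-> inL v.
Proof.
split => [h|[[m n] ->]].
  have [m [n e]] := theta11_zero O0 h; exists (m, n); by rewrite /lat /= mulr1.
rewrite /lat /= mulr1.
have hn (k : nat) w : th11 0 w = 0 -> th11 0 (w + k%:R * Om) = 0 /\ th11 0 (w - k%:R * Om) = 0.
  move=> hw; elim: k => [|k [IH1 IH2]]; first by rewrite mul0r subr0 addr0.
  rewrite -natr1 mulrDl mul1r; split; first by rewrite addrA th_addOm IH1 mulr0.
  have := th_addOm (w - (k%:R * Om + Om)); rewrite opprD addrA subrK IH2 => /esym/eqP.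
  by rewrite mulf_eq0 (negbTE (qm_neq0 _)) => /eqP.
have hm (k : nat) : th11 0 k%:R = 0 /\ th11 0 (- k%:R) = 0.
  elim: k => [|k [IH1 IH2]]; first by rewrite oppr0 th00.
  rewrite -natr1; split; first by rewrite th_add1 IH1 oppr0.
  have := th_add1 0 (- (k%:R + 1)); rewrite opprD subrK IH2 => /eqP.
  by rewrite eq_sym oppr_eq0 => /eqP.
have hm' : th11 0 m%:~R = 0.
  by case: m => k; rewrite ?NegzE ?mulrNz -pmulrn; case: (hm k); case: (hm k.+1).
by case: n => k; rewrite ?NegzE ?mulrNz ?mulNr -pmulrn;
  case: (hn k _ hm'); case: (hn k.+1 _ hm').
Qed.

Lemma th_neq0 v : ~ inL v -> th11 0 v != 0.
Proof. by move=> h; apply/eqP => /th_zeroP. Qed.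

Let ak (j : nat) (b : C) : C := 2 ^+ j * Th j 0 0 (2 * b) (2 * Om).
Let bk (j : nat) (b : C) : C := 2 ^+ j * Th j 2^-1 0 (2 * b) (2 * Om).

Let der_ak j b : der (ak j) b (ak j.+1 b).
Proof.
have O2 := Im2 O0; apply: der_eq.
  by apply: dercM; apply: (der_Th _ _ _ O2); apply: dercM; exact: der_id.
by rewrite /ak exprS /=; ring.
Qed.

Let der_bk j b : der (bk j) b (bk j.+1 b).
Proof.
have O2 := Im2 O0; apply: der_eq.
  by apply: dercM; apply: (der_Th _ _ _ O2); apply: dercM; exact: der_id.
by rewrite /bk exprS /=; ring.
Qed.

(** The product is the determinant of the plane vectors (ak 0, bk 0) at a and at b. Differentiating
    in b, setting b = 0 and then differentiating in a expresses theta jets by determinants of jets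
    of one plane vector, and such determinants satisfy the Plucker relations. *)
Let W0 a b : th11 0 (a + b) * th11 0 (a - b) = ak 0 a * bk 0 b - bk 0 a * ak 0 b.
Proof. by rewrite /ak /bk !expr0 !mul1r; exact: theta_W. Qed.

Ltac dleaf ::= lazymatch goal with
  | |- der (fun u => cexp (@?f u)) _ _ => apply: der_cexpf; dt
  | |- der (fun u => th11 ?k (@?f u)) _ _ => apply: der_thf; dt
  | |- der (th11 _) _ _ => exact: der_th
  | |- der (ak _) _ _ => exact: der_ak
  | |- der (bk _) _ _ => exact: der_bk
  end.
Ltac dtr := apply: der_eq; [dt|rewrite /=; ring].

Let W1 a b : th11 1 (a + b) * th11 0 (a - b) - th11 0 (a + b) * th11 1 (a - b) =
  ak 0 a * bk 1 b - bk 0 a * ak 1 b.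
Proof. by apply: (der_funeq (W0 a) (x := b)); dtr. Qed.

Let W2 a b : th11 2 (a + b) * th11 0 (a - b) - 2 * (th11 1 (a + b) * th11 1 (a - b))
   + th11 0 (a + b) * th11 2 (a - b) = ak 0 a * bk 2 b - bk 0 a * ak 2 b.
Proof. by apply: (der_funeq (W1 a) (x := b)); dtr. Qed.

Let W3 a b : th11 3 (a + b) * th11 0 (a - b) - 3 * (th11 2 (a + b) * th11 1 (a - b))
   + 3 * (th11 1 (a + b) * th11 2 (a - b)) - th11 0 (a + b) * th11 3 (a - b)
   = ak 0 a * bk 3 b - bk 0 a * ak 3 b.
Proof. by apply: (der_funeq (W2 a) (x := b)); dtr. Qed.

Let W4 a b : th11 4 (a + b) * th11 0 (a - b) - 4 * (th11 3 (a + b) * th11 1 (a - b))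
   + 6 * (th11 2 (a + b) * th11 2 (a - b)) - 4 * (th11 1 (a + b) * th11 3 (a - b))
   + th11 0 (a + b) * th11 4 (a - b)
   = ak 0 a * bk 4 b - bk 0 a * ak 4 b.
Proof. by apply: (der_funeq (W3 a) (x := b)); dtr. Qed.

(* theta^2 times the second logarithmic derivative of theta *)
Definition TT11 (v : C) : C := th11 2 v * th11 0 v - th11 1 v ^+ 2.

Let X0 a : th11 0 a ^+ 2 = ak 0 a * bk 0 0 - bk 0 a * ak 0 0.
Proof. by rewrite -W0 addr0 subr0 expr2. Qed.
Let X2 a : 2 * TT11 a = ak 0 a * bk 2 0 - bk 0 a * ak 2 0.
Proof. by rewrite -W2 addr0 subr0 /TT11; ring. Qed.
Let X4 a : 2 * (th11 4 a * th11 0 a - 4 * (th11 3 a * th11 1 a) + 3 * th11 2 a ^+ 2) =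
  ak 0 a * bk 4 0 - bk 0 a * ak 4 0.
Proof. by rewrite -W4 addr0 subr0; ring. Qed.

Let X0_2 a : 2 * th11 1 a ^+ 2 + 2 * (th11 0 a * th11 2 a) = ak 2 a * bk 0 0 - bk 2 a * ak 0 0.
Proof.
have h u : 2 * (th11 0 u * th11 1 u) = ak 1 u * bk 0 0 - bk 1 u * ak 0 0.
  by apply: (der_funeq X0 (x := u)); dtr.
by apply: (der_funeq h (x := a)); dtr.
Qed.

Let X0_4 a : 6 * th11 2 a ^+ 2 + 8 * (th11 1 a * th11 3 a) + 2 * (th11 0 a * th11 4 a) =
  ak 4 a * bk 0 0 - bk 4 a * ak 0 0.
Proof.
have h u : 6 * (th11 1 u * th11 2 u) + 2 * (th11 0 u * th11 3 u) = ak 3 u * bk 0 0 - bk 3 u * ak 0 0.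
  by apply: (der_funeq X0_2 (x := u)); dtr.
by apply: (der_funeq h (x := a)); dtr.
Qed.

Let X2_4 a : 2 * (2 * (th11 1 a * th11 5 a) + th11 0 a * th11 6 a - th11 2 a * th11 4 a - 2 * th11 3 a ^+ 2) =
  ak 4 a * bk 2 0 - bk 4 a * ak 2 0.
Proof.
have h1 u : 2 * (th11 0 u * th11 3 u - th11 1 u * th11 2 u) = ak 1 u * bk 2 0 - bk 1 u * ak 2 0.
  by apply: (der_funeq X2 (x := u)); rewrite /TT11; dtr.
have h2 u : 2 * (th11 0 u * th11 4 u - th11 2 u ^+ 2) = ak 2 u * bk 2 0 - bk 2 u * ak 2 0.
  by apply: (der_funeq h1 (x := u)); dtr.
have h3 u : 2 * (th11 1 u * th11 4 u + th11 0 u * th11 5 u - 2 * (th11 2 u * th11 3 u)) =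
    ak 3 u * bk 2 0 - bk 3 u * ak 2 0.
  by apply: (der_funeq h2 (x := u)); dtr.
by apply: (der_funeq h3 (x := a)); dtr.
Qed.

(** The Plucker relation for four vectors of the plane, which is Weierstrass's three-term relation
    for sigma. *)
Lemma three_term a b c d :
  (th11 0 (a + b) * th11 0 (a - b)) * (th11 0 (c + d) * th11 0 (c - d))
  - (th11 0 (a + c) * th11 0 (a - c)) * (th11 0 (b + d) * th11 0 (b - d))
  + (th11 0 (a + d) * th11 0 (a - d)) * (th11 0 (b + c) * th11 0 (b - c)) = 0.
Proof. by rewrite !W0; ring. Qed.

Lemma theta_mul a b : th11 1 0 ^+ 2 * (th11 0 (a + b) * th11 0 (a - b)) =
  TT11 a * th11 0 b ^+ 2 - th11 0 a ^+ 2 * TT11 b.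
Proof.
have h := X0_2 0; rewrite th00 mul0r mulr0 addr0 in h.
apply: (@mulfI _ 4); first by rewrite pnatr_eq0.
have -> : 4 * (th11 1 0 ^+ 2 * (th11 0 (a + b) * th11 0 (a - b))) =
  2 * (2 * th11 1 0 ^+ 2) * (th11 0 (a + b) * th11 0 (a - b)) by ring.
have -> : 4 * (TT11 a * th11 0 b ^+ 2 - th11 0 a ^+ 2 * TT11 b) =
   2 * ((2 * TT11 a) * th11 0 b ^+ 2 - th11 0 a ^+ 2 * (2 * TT11 b)) by ring.
by rewrite h W0 !X0 !X2; ring.
Qed.

(** The jets of order 0, 2, 4 at 0 are three vectors of a plane, hence dependent, with 2 x 2 minors
    as coefficients. Pairing this dependence with the vector at v gives [E]. The result is the
    equation wp'' = 6 wp^2 - g2/2 in disguise. *)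
Lemma theta_quartic v : th11 1 0 ^+ 2 * (th11 4 v * th11 0 v - 4 * (th11 3 v * th11 1 v) + 3 * th11 2 v ^+ 2) =
  4 * th11 1 0 * th11 3 0 * TT11 v - (th11 1 0 * th11 5 0 - th11 3 0 ^+ 2) * th11 0 v ^+ 2.
Proof.
have h02 := X0_2 0; have h04 := X0_4 0; have h24 := X2_4 0.
rewrite th00 th20 ?th40 ?th60 !(mul0r, mulr0, addr0, add0r, expr0n, subr0) /= in h02 h04 h24.
have E : (2 * th11 1 0 ^+ 2) * (2 * (th11 4 v * th11 0 v - 4 * (th11 3 v * th11 1 v) + 3 * th11 2 v ^+ 2))
   - (8 * (th11 1 0 * th11 3 0)) * (2 * TT11 v)
   + (2 * (2 * (th11 1 0 * th11 5 0) - 2 * th11 3 0 ^+ 2)) * th11 0 v ^+ 2 = 0.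
  by rewrite h02 h04 h24 X4 X2 X0; ring.
apply: (@mulfI _ 4); first by rewrite pnatr_eq0.
apply/eqP; rewrite -subr_eq0; apply/eqP; rewrite -[RHS]E; ring.
Qed.

End ThetaElliptic.

(** * Half-periods *)

Section HalfPeriods.
Variable R : realType.
Local Notation C := (Cx R).
Variables (w1 w2 : C).
Hypothesis O0 : 0 < complex.Im (w2 / w1).
Local Notation hp := (half_period w1 w2).

Definition hpx (nu : 'I_3) : R := nth 0 [:: 2^-1; 2^-1; 0] nu.
Definition hpy (nu : 'I_3) : R := nth 0 [:: 0; 2^-1; 2^-1] nu.

Lemma half_plan nu : hp nu = plan w1 w2 (hpx nu) (hpy nu).
Proof.
have H : ofr (2^-1 : R) = 2^-1 by rewrite ofrV ofr_nat.
have Z : ofr (0 : R) = 0 by [].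
by case: nu => [[|[|[|//]]] i]; rewrite /half_period /plan /hpx /hpy /= ?H ?Z; ring.
Qed.

Lemma in_lat_plan (x y : R) : in_lat w1 w2 (plan w1 w2 x y) <->
  exists m n : int, x = m%:~R /\ y = n%:~R.
Proof. by rewrite in_latP // plan_cx // plan_cy. Qed.

Lemma half_nint' (n : int) : - (2^-1 : R) != n%:~R.
Proof.
apply/eqP => h; have /eqP := half_nint O0 (- n); apply.
by rewrite mulrNz -h opprK.
Qed.

Lemma half_nlat nu : ~ in_lat w1 w2 (hp nu).
Proof.
rewrite half_plan in_lat_plan => -[m [n [h k]]]; move: h k.
have /eqP A1 := half_nint O0 m; have /eqP A2 := half_nint O0 n.
by case: nu => [[|[|[|//]]] i]; rewrite /hpx /hpy.
Qed.

Lemma half_dbl nu : in_lat w1 w2 (hp nu + hp nu).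
Proof.
case: nu => [[|[|[|//]]] i]; rewrite /half_period /=.
- by exists (1, 0); rewrite /lat /=; field.
- by exists (1, 1); rewrite /lat /=; field.
by exists (0, 1); rewrite /lat /=; field.
Qed.

Lemma half_diff nu mu : nu != mu -> ~ in_lat w1 w2 (hp nu - hp mu).
Proof.
move=> nm; rewrite !half_plan planB in_lat_plan => -[m [n []]].
have /eqP A1 := half_nint O0 m; have /eqP A2 := half_nint O0 n.
have /eqP A3 := half_nint' m; have /eqP A4 := half_nint' n.
case: nu mu nm => [[|[|[|//]]] i] [[|[|[|//]]] j] //; rewrite /hpx /hpy /= ?subrr ?subr0 ?sub0r //.
Qed.

Lemma half_sum nu mu : nu != mu -> ~ in_lat w1 w2 (hp nu + hp mu).
Proof.
move=> nm; have -> : hp nu + hp mu = (hp nu - hp mu) + (hp mu + hp mu) by ring.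
by apply: nlatD => //; [exact: half_diff|exact: half_dbl].
Qed.

End HalfPeriods.

(** * The Weierstrass function of theta_11: addition, duplication and distribution *)

Section ThetaWeierstrass.
Variable R : realType.
Local Notation C := (Cx R).
Local Notation ipi := (ipi R).
Variable Om : C.
Hypothesis O0 : 0 < complex.Im Om.
Local Notation th := (th11 Om).
Local Notation TT := (TT11 Om).
Local Notation inL := (in_lat (1 : C) Om).
Hypothesis T1 : th 1 0 != 0.

(** The constant term of (log theta_11)'' at 0, so that [pp] = cc - (log theta_11)'' has none. With
    [AA] below, 12 cc^2 + 2 AA is the invariant g2 of the lattice Z + Z Omega. *)
Definition cc : C := th 3 0 / (3 * th 1 0).
Definition AA : C := (th 3 0 ^+ 2 - th 1 0 * th 5 0) / th 1 0 ^+ 2.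
Definition logder11 (v : C) : C := th 1 v / th 0 v.
Definition pp (v : C) : C := cc - TT v / th 0 v ^+ 2.
Definition TT' (v : C) : C := th 3 v * th 0 v - th 1 v * th 2 v.
Definition pd11 (v : C) : C := - (TT' v * th 0 v - 2 * TT v * th 1 v) / th 0 v ^+ 3.
Definition pdd (v : C) : C := 6 * pp v ^+ 2 - 6 * cc ^+ 2 - AA.

Ltac dleaf ::= lazymatch goal with
  | |- der (fun u => cexp (@?f u)) _ _ => apply: der_cexpf; dt
  | |- der (fun u => th11 _ ?k (@?f u)) _ _ => apply: (der_thf O0); dt
  | |- der (th11 _ _) _ _ => exact: (der_th O0)
  end.
Ltac dtr := apply: der_eq; [dt|rewrite /=; ring].

Lemma three_neq0 : 3 != 0 :> C. Proof. by rewrite pnatr_eq0. Qed.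
Lemma two_neq0 : 2 != 0 :> C. Proof. by rewrite pnatr_eq0. Qed.

Lemma der_TT v : der TT v (TT' v).
Proof. by rewrite /TT11 /TT'; dtr. Qed.

Lemma der_L1 v : th 0 v != 0 -> der logder11 v (cc - pp v).
Proof.
move=> h; rewrite /logder11; apply: der_eq; first by dt.
by rewrite /pp /TT11; field.
Qed.

Lemma der_pp v : th 0 v != 0 -> der pp v (pd11 v).
Proof.
move=> h; have h2 : th 0 v ^+ 2 != 0 by rewrite expf_neq0.
have hT := der_TT v; rewrite /pp; apply: der_eq.
  by apply: derB; [exact: der_cst|apply: der_div => //; dt].
by rewrite /pd11 /TT' /TT11 /=; field.
Qed.

Lemma th4_eq v : th 0 v != 0 -> th 4 v =
  (4 * th 3 v * th 1 v - 3 * th 2 v ^+ 2 + 12 * cc * TT v + AA * th 0 v ^+ 2) / th 0 v.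
Proof.
move=> h; have q := theta_quartic O0 v; apply: (mulIf h); rewrite divfK //.
apply: (@mulfI _ (th 1 0 ^+ 2)); first by rewrite expf_neq0.
have -> : th 1 0 ^+ 2 * (th 4 v * th 0 v) = th 1 0 ^+ 2 *
   (th 4 v * th 0 v - 4 * (th 3 v * th 1 v) + 3 * th 2 v ^+ 2)
   + th 1 0 ^+ 2 * (4 * (th 3 v * th 1 v) - 3 * th 2 v ^+ 2) by ring.
rewrite q /cc /AA; have h3 := three_neq0; field.
by rewrite T1.
Qed.

Lemma der_pd v : th 0 v != 0 -> der pd11 v (pdd v).
Proof.
move=> h; have h2 : th 0 v ^+ 3 != 0 by rewrite expf_neq0.
have hT := der_TT v.
have hT' : der TT' v (th 4 v * th 0 v - th 2 v ^+ 2) by rewrite /TT'; dtr.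
rewrite /pd11; apply: der_eq.
  by apply: der_div => //; [apply: derN; apply: derB; [apply: derM; dt|apply: derM; [dt|dt]]|dt].
rewrite /= (th4_eq h) /pdd /pp /TT11 /TT'; field.
by rewrite h.
Qed.

Lemma der_pdd v : th 0 v != 0 -> der pdd v (12 * pp v * pd11 v).
Proof.
move=> h; have hp := der_pp h; rewrite /pdd; apply: der_eq; first by dt.
by rewrite /=; ring.
Qed.

Lemma theta_pp a b : th 0 a != 0 -> th 0 b != 0 ->
  th 1 0 ^+ 2 * (th 0 (a + b) * th 0 (a - b)) = th 0 a ^+ 2 * th 0 b ^+ 2 * (pp b - pp a).
Proof. by move=> ha hb; rewrite theta_mul // /pp; field; rewrite ha hb. Qed.

Lemma pp_neq a b : ~ inL a -> ~ inL b -> ~ inL (a + b) -> ~ inL (a - b) -> pp b - pp a != 0.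
Proof.
move=> /(th_neq0 O0) ha /(th_neq0 O0) hb /(th_neq0 O0) hp /(th_neq0 O0) hm.
apply/eqP => e; have := theta_pp ha hb; rewrite e mulr0 => /eqP.
by apply/negP; rewrite !mulf_neq0 // expf_neq0.
Qed.

Lemma near_nlat (w1 w2 a c : C) : 0 < complex.Im (w2 / w1) -> ~ in_lat w1 w2 (a + c) ->
  \forall u \near a, ~ in_lat w1 w2 (u + c).
Proof.
move=> h /(nlat_open h)[r r0 H]; apply/nearC; exists r => // u ua; apply: H.
by rewrite opprD addrACA subrr addr0.
Qed.

Let OR : 0 < complex.Im (Om / 1). Proof. by rewrite divr1. Qed.

Lemma der_funeq_near (f g : C -> C) x l m : (\forall u \near x, f u = g u) ->
  der f x l -> der g x m -> l = m.
Proof. by move=> fg df dg; apply: der_uniq dg; apply: der_near df. Qed.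

(** The logarithmic derivative of [theta_pp] in a; [add_formula_b] is the one in b, and
    [pp_add_formula] the next derivative in a. *)
Lemma add_formula_a a b : ~ inL a -> ~ inL b -> ~ inL (a + b) -> ~ inL (a - b) ->
  logder11 (a + b) + logder11 (a - b) = 2 * logder11 a - pd11 a / (pp b - pp a).
Proof.
move=> la lb lp lm; have n0 := pp_neq la lb lp lm.
have ha := th_neq0 O0 la; have hb := th_neq0 O0 lb.
have hp := th_neq0 O0 lp; have hm := th_neq0 O0 lm.
have dp := der_pp ha.
have E : th 1 0 ^+ 2 * (th 1 (a + b) * th 0 (a - b) + th 0 (a + b) * th 1 (a - b)) =
   th 0 b ^+ 2 * (2 * th 0 a * th 1 a * (pp b - pp a) - th 0 a ^+ 2 * pd11 a).
  apply: (der_funeq_near (x := a)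
    (f := fun u => th 1 0 ^+ 2 * (th 0 (u + b) * th 0 (u - b)))
    (g := fun u => th 0 b ^+ 2 * (th 0 u ^+ 2 * (pp b - pp u)))).
  - have h0 : ~ inL (a + 0) by rewrite addr0.
    apply: filterS (near_nlat OR h0) => u; rewrite addr0 => /(th_neq0 O0) hu.
    by rewrite theta_pp //; ring.
  - by dtr.
  by dtr.
have Q := theta_pp ha hb; have T2 : th 1 0 ^+ 2 != 0 by rewrite expf_neq0.
apply: (@mulfI _ (th 1 0 ^+ 2 * (th 0 (a + b) * th 0 (a - b)))); first by rewrite !mulf_neq0.
rewrite /logder11; transitivity (th 1 0 ^+ 2 * (th 1 (a + b) * th 0 (a - b) + th 0 (a + b) * th 1 (a - b))).
  by field; rewrite hp hm.
rewrite E Q; field.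
by rewrite n0 ha.
Qed.

Lemma add_formula_b a b : ~ inL a -> ~ inL b -> ~ inL (a + b) -> ~ inL (a - b) ->
  logder11 (a + b) - logder11 (a - b) = 2 * logder11 b + pd11 b / (pp b - pp a).
Proof.
move=> la lb lp lm; have n0 := pp_neq la lb lp lm.
have ha := th_neq0 O0 la; have hb := th_neq0 O0 lb.
have hp := th_neq0 O0 lp; have hm := th_neq0 O0 lm.
have dp := der_pp hb.
have E : th 1 0 ^+ 2 * (th 1 (a + b) * th 0 (a - b) - th 0 (a + b) * th 1 (a - b)) =
   th 0 a ^+ 2 * (2 * th 0 b * th 1 b * (pp b - pp a) + th 0 b ^+ 2 * pd11 b).
  apply: (der_funeq_near (x := b)
    (f := fun u => th 1 0 ^+ 2 * (th 0 (a + u) * th 0 (a - u)))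
    (g := fun u => th 0 a ^+ 2 * (th 0 u ^+ 2 * (pp u - pp a)))).
  - have h0 : ~ inL (b + 0) by rewrite addr0.
    apply: filterS (near_nlat OR h0) => u; rewrite addr0 => /(th_neq0 O0) hu.
    by rewrite theta_pp //; ring.
  - by dtr.
  by dtr.
have Q := theta_pp ha hb; have T2 : th 1 0 ^+ 2 != 0 by rewrite expf_neq0.
apply: (@mulfI _ (th 1 0 ^+ 2 * (th 0 (a + b) * th 0 (a - b)))); first by rewrite !mulf_neq0.
rewrite /logder11; transitivity (th 1 0 ^+ 2 * (th 1 (a + b) * th 0 (a - b) - th 0 (a + b) * th 1 (a - b))).
  by field; rewrite hp hm.
rewrite E Q; field.
by rewrite n0 hb.
Qed.

Lemma pp_add_formula a b : ~ inL a -> ~ inL b -> ~ inL (a + b) -> ~ inL (a - b) ->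
  pp (a + b) + pp (a - b) = 2 * pp a + pdd a / (pp b - pp a) + pd11 a ^+ 2 / (pp b - pp a) ^+ 2.
Proof.
move=> la lb lp lm; have n0 := pp_neq la lb lp lm.
have ha := th_neq0 O0 la; have hb := th_neq0 O0 lb.
have hp := th_neq0 O0 lp; have hm := th_neq0 O0 lm.
have dp := der_pp ha; have dd := der_pd ha; have dl := der_L1 ha.
have E : (cc - pp (a + b)) + (cc - pp (a - b)) = 2 * (cc - pp a) -
    (pdd a * (pp b - pp a) - pd11 a * (- pd11 a)) / (pp b - pp a) ^+ 2.
  apply: (der_funeq_near (x := a) (f := fun u => logder11 (u + b) + logder11 (u - b))
    (g := fun u => 2 * logder11 u - pd11 u / (pp b - pp u))).
  - have h0 : ~ inL (a + 0) by rewrite addr0.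
    move: (near_nlat OR h0) (near_nlat OR lp) (near_nlat OR lm); apply: filterS3 => u.
    by rewrite addr0; move=> *; exact: add_formula_a.
  - apply: der_eq.
      apply: derD; [apply: (der_comp (f := logder11) (g := fun u => u + b))|
        apply: (der_comp (f := logder11) (g := fun u => u - b))]; try (by dt); exact: der_L1.
    by rewrite /=; ring.
  by apply: der_eq; [dt|rewrite /=; ring].
have -> : pp (a + b) + pp (a - b) = 2 * cc - ((cc - pp (a + b)) + (cc - pp (a - b))) by ring.
rewrite E; field.
by rewrite n0.
Qed.

Lemma th_opp0 v : th 0 (- v) = - th 0 v. Proof. by rewrite th_opp // expr1 mulN1r. Qed.
Lemma th_opp1 v : th 1 (- v) = th 1 v. Proof. by rewrite th_opp // sqrrN expr1n mul1r. Qed.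
Lemma th_opp2 v : th 2 (- v) = - th 2 v.
Proof. by rewrite th_opp // exprS sqrrN expr1n mulr1 mulN1r. Qed.
Lemma th_opp3 v : th 3 (- v) = th 3 v.
Proof. by rewrite th_opp // (exprM (-1) 2 2) sqrrN !expr1n mul1r. Qed.
Lemma TT_opp v : TT (- v) = TT v.
Proof. by rewrite /TT11 th_opp0 th_opp1 th_opp2; ring. Qed.
Lemma L1_opp v : logder11 (- v) = - logder11 v.
Proof. by rewrite /logder11 th_opp0 th_opp1 invrN mulrN. Qed.
Lemma pp_opp v : pp (- v) = pp v.
Proof. by rewrite /pp TT_opp th_opp0 sqrrN. Qed.
Lemma pd_opp v : pd11 (- v) = - pd11 v.
Proof.
rewrite /pd11 TT_opp /TT' th_opp0 th_opp1 th_opp2 th_opp3.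
have -> : (- th 0 v) ^+ 3 = - th 0 v ^+ 3 by ring.
by rewrite invrN mulrN; congr (- (_ / _)); ring.
Qed.

Lemma L1_add1 v : logder11 (v + 1) = logder11 v.
Proof. by rewrite /logder11 !th_add1 // invrN mulrNN. Qed.
Lemma pp_add1 v : pp (v + 1) = pp v.
Proof. by rewrite /pp /TT11 !th_add1 // sqrrN mulrNN sqrrN. Qed.
Lemma pp_addOm v : pp (v + Om) = pp v.
Proof.
rewrite /pp /TT11 th2_addOm // th1_addOm // th_addOm //; congr (_ - _).
have q := qm_neq0 Om v; have [->|h] := eqVneq (th 0 v) 0.
  by rewrite !mulr0 expr0n /= invr0 !mulr0.
by field; rewrite h q.
Qed.
(** At lattice points the denominator is 0, whose inverse is 0. Thanks to this value the periodicity
    of [pd11] holds at every point. *)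
Lemma pd_lat v : inL v -> pd11 v = 0.
Proof. by move=> /(th_zeroP O0) h; rewrite /pd11 h expr0n /= invr0 mulr0. Qed.

Lemma pd_shift (w : C) : inL w -> (forall v, pp (v + w) = pp v) -> forall v, pd11 (v + w) = pd11 v.
Proof.
move=> lw h v; have [lv|lv] := pselect (inL v).
  by rewrite !pd_lat //; exact: in_latD.
have hv := th_neq0 O0 lv; have hw := th_neq0 O0 (nlatD lv lw).
apply: (der_funeq (f := fun u => pp (u + w)) (g := pp) (x := v)) => //; last exact: der_pp.
apply: der_eq; first by apply: (der_comp (f := pp) (g := fun u => u + w)); [dt|exact: der_pp].
by rewrite addr0 mulr1.
Qed.

Lemma lat_period (f : C -> C) : (forall v, f (v + 1) = f v) -> (forall v, f (v + Om) = f v) ->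
  forall v w, inL w -> f (v + w) = f v.
Proof.
move=> h1 h2 v w [[m n] ->]; rewrite /lat /= mulr1.
have hn (c : C) (hc : forall v, f (v + c) = f v) (k : int) u : f (u + k%:~R * c) = f u.
  have hk (j : nat) x : f (x + j%:R * c) = f x.
    elim: j x => [|j IH] x; first by rewrite mul0r addr0.
    by rewrite -natr1 mulrDl mul1r addrA hc IH.
  case: k => j; first exact: hk.
  rewrite NegzE mulrNz -pmulrn -(hk j.+1 (u + _)); congr f.
  by rewrite mulNr subrK.
by rewrite addrA hn // -[m%:~R]mulr1 hn.
Qed.

Lemma pp_per v w : inL w -> pp (v + w) = pp v.
Proof. exact: (lat_period pp_add1 pp_addOm). Qed.
Lemma pd_per v w : inL w -> pd11 (v + w) = pd11 v.
Proof. by move=> lw; apply: pd_shift => // u; exact: pp_per. Qed.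

Local Notation hp := (half_period (1 : C) Om).
Definition EE (nu : 'I_3) : C := pp (hp nu).

Lemma nL (nu : 'I_3) : ~ inL (hp nu). Proof. exact: half_nlat. Qed.

Lemma pd_hp nu : pd11 (hp nu) = 0.
Proof.
have /eqP : pd11 (hp nu) = - pd11 (hp nu).
  by rewrite -pd_opp -(pd_per (- hp nu) (half_dbl _ _ nu)); congr pd11; ring.
by rewrite -subr_eq0 opprK -mulr2n -mulr_natl mulf_eq0 (negbTE two_neq0) => /eqP.
Qed.

Lemma EE_inj nu mu : nu != mu -> EE nu - EE mu != 0.
Proof.
move=> nm; apply: pp_neq; [exact: nL|exact: nL| |]; last by apply: half_diff; rewrite // eq_sym.
by apply: half_sum; rewrite // eq_sym.
Qed.

(** A first integral of [der_pd]: the derivative is 2 pd11 (pdd - 6 pp^2 + g2/2) = 0 off the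
    lattice. *)
Lemma pd_sq_const u v : ~ inL u -> ~ inL v ->
  pd11 u ^+ 2 - 4 * pp u ^+ 3 + (12 * cc ^+ 2 + 2 * AA) * pp u =
  pd11 v ^+ 2 - 4 * pp v ^+ 3 + (12 * cc ^+ 2 + 2 * AA) * pp v.
Proof.
apply: (offlat_const OR (f := fun u => pd11 u ^+ 2 - 4 * pp u ^+ 3 + (12 * cc ^+ 2 + 2 * AA) * pp u)) => w lw.
have hw := th_neq0 O0 lw; have d1 := der_pp hw; have d2 := der_pd hw.
by apply: der_eq; [dt|rewrite /pdd /=; ring].
Qed.

Notation E0 := (EE ord0).
Notation E1 := (EE (Ordinal (isT : (1 < 3)%N))).
Notation E2 := (EE (Ordinal (isT : (2 < 3)%N))).

(** The half-period values are roots of one cubic 4 x^3 - g2 x - const, since [pd11] vanishes there.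
    Dividing the difference of two such equations by the difference of the roots gives the quadratic
    relation; comparing two quadratic relations gives the zero sum. *)
Lemma EE_rel : E0 + E1 + E2 = 0 /\ 12 * cc ^+ 2 + 2 * AA = 4 * (E0 ^+ 2 + E0 * E1 + E1 ^+ 2).
Proof.
have K nu mu : - 4 * EE nu ^+ 3 + (12 * cc ^+ 2 + 2 * AA) * EE nu = - 4 * EE mu ^+ 3 + (12 * cc ^+ 2 + 2 * AA) * EE mu.
  by have := pd_sq_const (@nL nu) (@nL mu); rewrite !pd_hp -!/(EE _) expr0n /= !add0r !mulNr.
have H nu mu : nu != mu -> 12 * cc ^+ 2 + 2 * AA = 4 * (EE nu ^+ 2 + EE nu * EE mu + EE mu ^+ 2).
  move=> nm; have n0 := EE_inj nm; apply: (mulIf n0).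
  have /eqP := K nu mu; rewrite -subr_eq0 => /eqP k.
  by apply/eqP; rewrite -subr_eq0; apply/eqP; rewrite -[RHS]k; ring.
have h1 : 12 * cc ^+ 2 + 2 * AA = 4 * (E0 ^+ 2 + E0 * E1 + E1 ^+ 2) by exact: H.
have h2 : 12 * cc ^+ 2 + 2 * AA = 4 * (E0 ^+ 2 + E0 * E2 + E2 ^+ 2) by exact: H.
split => //; have n0 : E1 - E2 != 0 by exact: EE_inj.
move: h1 h2 n0; move: E0 E1 E2 => e0 e1 e2 h1 h2 n0.
apply: (mulIf n0); rewrite mul0r.
apply: (@mulfI _ 4); first by rewrite pnatr_eq0.
transitivity (4 * (e0 ^+ 2 + e0 * e1 + e1 ^+ 2) - 4 * (e0 ^+ 2 + e0 * e2 + e2 ^+ 2)); first by ring.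
by rewrite -h1 -h2 subrr mulr0.
Qed.

Lemma pd_sq u : ~ inL u -> pd11 u ^+ 2 = 4 * ((pp u - E0) * (pp u - E1) * (pp u - E2)).
Proof.
move=> lu; have := pd_sq_const lu (@nL ord0); rewrite pd_hp -/(EE _).
have [s ->] := EE_rel; have -> : E2 = - E0 - E1.
  by have -> : E2 = (E0 + E1 + E2) - E0 - E1; [ring|rewrite s sub0r].
move=> /eqP; rewrite -subr_eq0 => /eqP h.
by apply/eqP; rewrite -subr_eq0; apply/eqP; rewrite -[RHS]h; ring.
Qed.

Lemma pddE u : pdd u = 6 * pp u ^+ 2 - 2 * (E0 ^+ 2 + E0 * E1 + E1 ^+ 2).
Proof.
have [_ h] := EE_rel; rewrite /pdd.
have -> : 6 * pp u ^+ 2 - 6 * cc ^+ 2 - AA = 6 * pp u ^+ 2 - (12 * cc ^+ 2 + 2 * AA) / 2 by field.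
by rewrite h; field.
Qed.

(** The derivative of [theta_pp] in its second argument on the diagonal, where theta_11(a - u)
    vanishes. *)
Lemma th_dbl a : ~ inL a -> th 1 0 ^+ 3 * th 0 (a + a) = - th 0 a ^+ 4 * pd11 a.
Proof.
move=> la; have ha := th_neq0 O0 la; have dp := der_pp ha.
apply: oppr_inj.
apply: (der_funeq_near (x := a)
    (f := fun u => th 1 0 ^+ 2 * (th 0 (a + u) * th 0 (a - u)))
    (g := fun u => th 0 a ^+ 2 * (th 0 u ^+ 2 * (pp u - pp a)))).
- have h0 : ~ inL (a + 0) by rewrite addr0.
  apply: filterS (near_nlat OR h0) => u; rewrite addr0 => /(th_neq0 O0) hu.
  by rewrite theta_pp //; ring.
- apply: der_eq; first by dt.
  by rewrite /= subrr th00 //; ring.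
by dtr.
Qed.

Lemma pd_neq0 a : ~ inL a -> ~ inL (a + a) -> pd11 a != 0.
Proof.
move=> la /(th_neq0 O0) h; apply/eqP => e; have := th_dbl la.
rewrite e mulr0 => /eqP; apply/negP.
by rewrite mulf_neq0 // expf_neq0.
Qed.

Lemma nlat_near2 a : ~ inL (a + a) -> \forall u \near a, ~ inL (u + u).
Proof.
move=> /(nlat_open OR)[r r0 H]; apply/nearC; exists (r / 2); first by rewrite divr_gt0.
move=> u ua; apply: H; have -> : u + u - (a + a) = (u - a) + (u - a) by ring.
apply: le_lt_trans (cabsD _ _) _; rewrite [r]splitr; exact: ltrD.
Qed.

(** The logarithmic derivative of [th_dbl]; [pp_dbl] and [pd_dbl] are the two derivatives that
    follow. *)
Lemma L1_dbl a : ~ inL a -> ~ inL (a + a) -> logder11 (a + a) = 2 * logder11 a + pdd a / (2 * pd11 a).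
Proof.
move=> la l2; have ha := th_neq0 O0 la; have h2 := th_neq0 O0 l2.
have n0 := pd_neq0 la l2; have dp := der_pd ha.
have E : th 1 0 ^+ 3 * (2 * th 1 (a + a)) = - (4 * th 0 a ^+ 3 * th 1 a * pd11 a + th 0 a ^+ 4 * pdd a).
  apply: (der_funeq_near (x := a) (f := fun u => th 1 0 ^+ 3 * th 0 (u + u))
    (g := fun u => - th 0 u ^+ 4 * pd11 u)).
  - have h0 : ~ inL (a + 0) by rewrite addr0.
    apply: filterS (near_nlat OR h0) => u; rewrite addr0; exact: th_dbl.
  - by dtr.
  by dtr.
have Q := th_dbl la; have T3 : th 1 0 ^+ 3 != 0 by rewrite expf_neq0.
apply: (@mulfI _ (2 * (th 1 0 ^+ 3 * th 0 (a + a)))).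
  by rewrite mulf_neq0 ?two_neq0 // mulf_neq0.
rewrite /logder11; transitivity (th 1 0 ^+ 3 * (2 * th 1 (a + a))); first by field.
rewrite E Q; field.
by rewrite n0 ha.
Qed.

Lemma pp_dbl a : ~ inL a -> ~ inL (a + a) -> pp (a + a) = - (2 * pp a) + 4^-1 * (pdd a / pd11 a) ^+ 2.
Proof.
move=> la l2; have ha := th_neq0 O0 la; have h2 := th_neq0 O0 l2.
have n0 := pd_neq0 la l2; have d1 := der_pp ha; have d2 := der_pd ha; have d3 := der_pdd ha.
have dl := der_L1 ha; have n2 : 2 * pd11 a != 0 by rewrite mulf_neq0 ?two_neq0.
have E : (cc - pp (a + a)) * 2 = 2 * (cc - pp a) +
   (12 * pp a * pd11 a * (2 * pd11 a) - pdd a * (2 * pdd a)) / (2 * pd11 a) ^+ 2.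
  apply: (der_funeq_near (x := a) (f := fun u => logder11 (u + u))
    (g := fun u => 2 * logder11 u + pdd u / (2 * pd11 u))).
  - have h0 : ~ inL (a + 0) by rewrite addr0.
    move: (near_nlat OR h0) (nlat_near2 l2); apply: filterS2 => u; rewrite addr0; exact: L1_dbl.
  - apply: der_eq; first by apply: (der_comp (f := logder11) (g := fun u => u + u)); [dt|exact: der_L1].
    by rewrite /=; ring.
  apply: der_eq; first by apply: derD; [dt|apply: (der_div (f := pdd) (g := fun u => 2 * pd11 u)); [exact: n2|exact: d3|dt]].
  by rewrite /=; field.
have -> : pp (a + a) = cc - (cc - pp (a + a)) * 2 / 2 by field.
by rewrite E; field.
Qed.

Lemma pd_dbl a : ~ inL a -> ~ inL (a + a) ->
  8 * pd11 (a + a) = - (8 * pd11 a) + 2 * (pdd a / pd11 a) * (12 * pp a * pd11 a * pd11 a - pdd a ^+ 2) / pd11 a ^+ 2.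
Proof.
move=> la l2; have ha := th_neq0 O0 la; have h2 := th_neq0 O0 l2.
have n0 := pd_neq0 la l2; have d1 := der_pp ha; have d2 := der_pd ha; have d3 := der_pdd ha.
have E : pd11 (a + a) * 2 = - (2 * pd11 a) +
   2^-1 * (pdd a / pd11 a) * ((12 * pp a * pd11 a * pd11 a - pdd a * pdd a) / pd11 a ^+ 2).
  apply: (der_funeq_near (x := a) (f := fun u => pp (u + u))
    (g := fun u => - (2 * pp u) + 4^-1 * (pdd u / pd11 u) ^+ 2)).
  - have h0 : ~ inL (a + 0) by rewrite addr0.
    move: (near_nlat OR h0) (nlat_near2 l2); apply: filterS2 => u; rewrite addr0; exact: pp_dbl.
  - apply: der_eq; first by apply: (der_comp (f := pp) (g := fun u => u + u)); [dt|exact: der_pp].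
    by rewrite /=; ring.
  have dq := der_div n0 d3 d2.
  apply: der_eq; first by dt.
  by rewrite /=; field.
have -> : 8 * pd11 (a + a) = 4 * (pd11 (a + a) * 2) by ring.
by rewrite E; field.
Qed.

Lemma pp_hp_neq a nu : ~ inL a -> ~ inL (a + a) -> pp a - EE nu != 0.
Proof.
move=> la l2; have l3 : ~ inL (a - hp nu).
  move=> l; apply: l2.
  have -> : a + a = (a - hp nu) + (a - hp nu) + (hp nu + hp nu) by ring.
  by apply: in_latD => //; [apply: in_latD|exact: half_dbl].
apply: pp_neq => //; first exact: nL.
  have -> : hp nu + a = (a - hp nu) + (hp nu + hp nu) by ring.
  by apply: nlatD => //; exact: half_dbl.
by rewrite -opprB; apply: nlatN.
Qed.

(** The addition formula with a half-period as first argument: [pd11] vanishes there, and the two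
    values on the left coincide by evenness and periodicity. *)
Lemma pp_hp a nu : ~ inL a -> ~ inL (a + a) ->
  pp (a + hp nu) = EE nu + 2^-1 * (pdd (hp nu) / (pp a - EE nu)).
Proof.
move=> la l2; have n0 := pp_hp_neq nu la l2.
have l3 : ~ inL (a - hp nu).
  move=> l; apply: l2.
  have -> : a + a = (a - hp nu) + (a - hp nu) + (hp nu + hp nu) by ring.
  by apply: in_latD => //; [apply: in_latD|exact: half_dbl].
have l4 : ~ inL (a + hp nu).
  have -> : a + hp nu = (a - hp nu) + (hp nu + hp nu) by ring.
  by apply: nlatD => //; exact: half_dbl.
have l5 : ~ inL (hp nu + a) by rewrite addrC.
have l6 : ~ inL (hp nu - a) by rewrite -opprB; apply: nlatN.
have := pp_add_formula (@nL nu) la l5 l6; rewrite pd_hp expr0n /= mul0r addr0.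
have -> : pp (hp nu - a) = pp (a + hp nu).
  have -> : hp nu - a = - (a + hp nu) + (hp nu + hp nu) by ring.
  by rewrite (pp_per _ (half_dbl _ _ nu)) pp_opp.
rewrite (addrC (hp nu)) -/(EE nu) => h.
have -> : pp (a + hp nu) = (pp (a + hp nu) + pp (a + hp nu)) / 2 by field.
by rewrite h; field.
Qed.

Lemma pd_hp_shift a nu : ~ inL a -> ~ inL (a + a) ->
  pd11 (a + hp nu) = - (2^-1 * pdd (hp nu) * pd11 a / (pp a - EE nu) ^+ 2).
Proof.
move=> la l2; have ha := th_neq0 O0 la; have n0 := pp_hp_neq nu la l2; have d1 := der_pp ha.
have l4 : ~ inL (a + hp nu).
  move=> l; apply: l2.
  have -> : a + a = (a + hp nu) + (a + hp nu) - (hp nu + hp nu) by ring.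
  by apply: in_latD => //; [apply: in_latD|apply: in_latN => //; exact: half_dbl].
apply: (der_funeq_near (x := a) (f := fun u => pp (u + hp nu))
    (g := fun u => EE nu + 2^-1 * (pdd (hp nu) / (pp u - EE nu)))).
- have h0 : ~ inL (a + 0) by rewrite addr0.
  move: (near_nlat OR h0) (nlat_near2 l2); apply: filterS2 => u; rewrite addr0; exact: pp_hp.
- apply: der_eq; first by apply: (der_comp (f := pp) (g := fun u => u + hp nu)); [dt|apply: der_pp; exact: th_neq0].
  by rewrite /=; ring.
apply: der_eq; first by apply: derD; [dt|apply: dercM; apply: (der_div (g := fun u => pp u - EE nu)); [exact: n0|dt|dt]].
by rewrite /=; field.
Qed.

(** The distribution relation on the theta side. Duplication and translation formulas express every
    term by pp a and pd11 a; once pd11^2 is replaced by the cubic, an identity of rational functions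
    in pp a is left. *)
Lemma pd_distr a : ~ inL a -> ~ inL (a + a) ->
  8 * pd11 (a + a) = pd11 a + \sum_nu pd11 (a + hp nu).
Proof.
move=> la l2; rewrite !big_ord_recl big_ord0 addr0 !pd_hp_shift // (pd_dbl la l2).
have -> : lift ord0 (lift ord0 ord0) = Ordinal (isT : (2 < 3)%N) by apply: val_inj.
have -> : lift ord0 ord0 = Ordinal (isT : (1 < 3)%N) :> 'I_3 by apply: val_inj.
have n0 := pp_hp_neq ord0 la l2; have n1 := pp_hp_neq (Ordinal (isT : (1 < 3)%N)) la l2.
have n2 := pp_hp_neq (Ordinal (isT : (2 < 3)%N)) la l2.
have nd := pd_neq0 la l2; have q := pd_sq la; have [s _] := EE_rel.
rewrite !pddE -!/(EE _); move: n0 n1 n2 nd q s; move: (pp a) (pd11 a) E0 E1 E2 => P d e0 e1 e2 n0 n1 n2 nd q s.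
have s2 : e2 = - e0 - e1.
  by have -> : e2 = (e0 + e1 + e2) - e0 - e1; [ring|rewrite s sub0r].
subst e2; apply: (mulIf nd); apply/eqP; rewrite -subr_eq0; apply/eqP.
set X := (P - e0) * (P - e1) * (P - (- e0 - e1)) in q.
have nX : X != 0 by rewrite /X !mulf_neq0.
set N := 6 * P ^+ 2 - 2 * (e0 ^+ 2 + e0 * e1 + e1 ^+ 2).
transitivity (- 8 * d ^+ 2 + 2 * N * (12 * P * d ^+ 2 - N ^+ 2) / d ^+ 2 - d ^+ 2 *
  (1 - 2^-1 * (6 * e0 ^+ 2 - 2 * (e0 ^+ 2 + e0 * e1 + e1 ^+ 2)) / (P - e0) ^+ 2
   - 2^-1 * (6 * e1 ^+ 2 - 2 * (e0 ^+ 2 + e0 * e1 + e1 ^+ 2)) / (P - e1) ^+ 2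
   - 2^-1 * (6 * (- e0 - e1) ^+ 2 - 2 * (e0 ^+ 2 + e0 * e1 + e1 ^+ 2)) / (P - (- e0 - e1)) ^+ 2)).
  by field; rewrite nd n0 n1 n2.
by rewrite q /X /N; field; rewrite n0 n1 n2.
Qed.

End ThetaWeierstrass.

(** * Lattice sums for wp, wp' and zeta *)

Section LatticeSums.
Variable R : realType.
Local Notation C := (Cx R).
Variables (w1 w2 : C).
Hypothesis O0 : 0 < complex.Im (w2 / w1).
Local Notation l := (lat w1 w2).
Local Notation inL := (in_lat w1 w2).

Lemma lat00 : l (0, 0) = 0. Proof. by rewrite /lat /= !mul0r addr0. Qed.
Lemma latD mn kl : l (mn.1 + kl.1, mn.2 + kl.2) = l mn + l kl.
Proof. by rewrite /lat /= !intrD; ring. Qed.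
Lemma latN mn : l (- mn.1, - mn.2) = - l mn.
Proof. by rewrite /lat /= !intrN; ring. Qed.
Lemma lat_eq0 mn : (l mn == 0) = (mn == (0, 0)).
Proof.
apply/eqP/eqP => [h|->]; last exact: lat00.
by apply: (lat_eq O0); rewrite h lat00.
Qed.

Lemma has_sum_single (I : eqType) (i0 : I) (c : C) :
  has_sum (fun i => if i == i0 then c else 0) c.
Proof.
move=> e e0; exists [:: i0] => s us h; rewrite (bigD1_seq i0) ?h ?mem_head //= eqxx.
by rewrite big1 ?addr0 ?subrr ?cabs0 // => i /negbTE ->.
Qed.

Lemma has_sum_latbox_full (f : int * int -> C) S : has_sum f S ->
  (\sum_(mn <- latbox N) f mn) @[N --> \oo] --> S - f (0, 0).
Proof.
move=> h; apply: has_sum_latbox.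
have := has_sumB h (has_sum_single (0, 0) (f (0, 0))).
by apply: has_sum_eq => // mn; case: eqP => [->|_]; rewrite ?subrr ?subr0.
Qed.

Lemma inv_bound (x : C) : exists2 K : R, 0 < K & exists2 r : R, 0 < r &
  forall mn, l mn != x -> forall u, cabs (u - x) < r ->
    cabs ((u - l mn)^-1) <= K / size2 R mn.
Proof.
have [k k0 [r r0 H]] := lat_dist O0 x; exists k^-1; first by rewrite invr_gt0.
exists r => // mn hmn u hu; rewrite cabsV -invfM.
have s0 : 0 < size2 R mn by apply: lt_le_trans (size2_ge1 _ _).
have kp : 0 < k * size2 R mn by rewrite mulr_gt0.
by rewrite lef_pV2 ?posrE //; [exact: H|apply: lt_le_trans (H _ hmn _ hu)].
Qed.

Lemma inv_pow (a K s : R) j : 0 <= a -> a <= K / s -> 1 <= s ->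
  a ^+ j.+3 <= K ^+ j.+3 * s ^- 3.
Proof.
move=> a0 aK s1; have s0 : 0 < s by apply: lt_le_trans s1.
have K0 : 0 <= K / s by apply: le_trans aK.
have H : a ^+ j.+3 <= (K / s) ^+ j.+3 by apply: lerXn2r.
apply: le_trans H _; rewrite exprMn exprVn ler_wpM2l //.
  by rewrite exprn_ge0 //; move: K0; rewrite pmulr_lge0 // invr_gt0.
rewrite lef_pV2 ?posrE ?exprn_gt0 //.
exact: ler_weXn2l.
Qed.

Definition g3 (k : nat) (mn : int * int) (u : C) : C := (u - l mn) ^- k.
Definition g2 (mn : int * int) (u : C) : C := (u - l mn) ^- 2 - (l mn) ^- 2.
Definition gz (mn : int * int) (u : C) : C := (u - l mn)^-1 + (l mn)^-1 + u / (l mn) ^+ 2.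
(** The sum runs over the whole lattice. If u is itself a lattice point, the term at u is 0 since
    the inverse of 0 is 0, so the periodicity holds for every u. *)
Definition Z3 (u : C) : C := usum (fun mn => g3 3 mn u).

Lemma g3_bound (x : C) : exists2 K : R, 0 < K & exists2 r : R, 0 < r &
  forall j mn, l mn != x -> forall u, cabs (u - x) < r ->
    cabs (g3 j.+3 mn u) <= K ^+ j.+3 * size2 R mn ^- 3.
Proof.
have [K K0 [r r0 H]] := inv_bound x; exists K => //; exists r => // j mn hmn u hu.
rewrite /g3 -exprVn cabsX; apply: inv_pow; [exact: cabs_ge0|exact: H|exact: size2_ge1].
Qed.

Lemma size2_sum (k : R) : 0 <= k -> sum_le (fun mn : int * int => k * size2 R mn ^- 3) (k * 16).
Proof. by move=> k0; apply: sum_leZ => //; exact: lattice_sum_le. Qed.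

Lemma nlat_neq u mn : ~ inL u -> l mn != u.
Proof. by move=> h; apply/eqP => e; apply: h; exists mn. Qed.

Lemma g3_summable j u : csummable (fun mn => g3 j.+3 mn u).
Proof.
have [K K0 [r r0 H]] := g3_bound u.
apply: (summableW _ (@size2_sum (K ^+ j.+3) _)); last by rewrite exprn_ge0 // ltW.
move=> mn; have [<-|e] := eqVneq (l mn) u; last by apply: H => //; rewrite subrr cabs0.
rewrite /g3 subrr expr0n /= invr0 cabs0 mulr_ge0 ?exprn_ge0 ?ltW // invr_gt0 exprn_gt0 //.
exact: lt_le_trans (size2_ge1 _ _).
Qed.

Lemma Z3P u : has_sum (fun mn => g3 3 mn u) (Z3 u).
Proof. exact/usumP/g3_summable. Qed.

Lemma Z3_per u kl : Z3 (u + l kl) = Z3 u.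
Proof.
have := Z3P u.
move=> /(has_sum_reindex (g := fun mn => (mn.1 - kl.1, mn.2 - kl.2))
  (h := fun mn => (mn.1 + kl.1, mn.2 + kl.2))) H.
apply: has_sum_uniq (Z3P _) _; apply: has_sum_eq (H _ _) => //.
- move=> mn; rewrite /g3; congr (_ ^- 3).
  by rewrite (latD mn (- kl.1, - kl.2)) latN; ring.
- by move=> [m n] /=; rewrite !subrK.
by move=> [m n] /=; rewrite !addrK.
Qed.

(** Every pair of integers is 2 (m, n) - (i, j) for unique bits i, j. The four parity classes of the
    lattice sum at 2u are the sums at u and at its three translates by half-periods, each divided by
    8. *)
Definition par_idx (p : (int * int) * bool * bool) : int * int :=
  let: (mn, i, j) := p in (2 * mn.1 - i%:Z, 2 * mn.2 - j%:Z).
Definition par_inv (mn : int * int) : (int * int) * bool * bool :=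
  let i := (mn.1 %% 2)%Z != 0 in let j := (mn.2 %% 2)%Z != 0 in
  (((mn.1 + i%:Z) %/ 2)%Z, ((mn.2 + j%:Z) %/ 2)%Z, i, j).

Lemma par_invK : cancel par_inv par_idx.
Proof.
move=> [m n]; rewrite /par_inv /par_idx /=.
have Bm : (m %% 2)%Z = (((m %% 2)%Z != 0 : nat))%:Z.
  by have [] : (m %% 2)%Z = 0 \/ (m %% 2)%Z = 1 by [lia| |] => ->.
have Bn : (n %% 2)%Z = (((n %% 2)%Z != 0 : nat))%:Z.
  by have [] : (n %% 2)%Z = 0 \/ (n %% 2)%Z = 1 by [lia| |] => ->.
by congr (_, _); lia.
Qed.

Lemma par_idxK : cancel par_idx par_inv.
Proof.
move=> [[[m n] i] j]; rewrite /par_inv /par_idx /=.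
have Bi : ((2 * m - i%:Z) %% 2)%Z != 0 = i by case: i; lia.
have Bj : ((2 * n - j%:Z) %% 2)%Z != 0 = j by case: j; lia.
by rewrite Bi Bj; congr (_, _, _, _); lia.
Qed.

Lemma Z3_distr u : 8 * Z3 (u + u) = Z3 u + \sum_nu Z3 (u + half_period w1 w2 nu).
Proof.
have h1 := has_sumZ 8 (Z3P (u + u)).
have := has_sum_reindex par_idxK par_invK h1 => h2.
apply: (has_sum_uniq h2); rewrite !big_ord_recl big_ord0 addr0 /half_period /=.
have -> : Z3 u + (Z3 (u + w1 / 2) + (Z3 (u + (w1 + w2) / 2) + Z3 (u + w2 / 2))) =
  ((Z3 (u + (w1 + w2) / 2) + Z3 (u + w2 / 2)) + (Z3 (u + w1 / 2) + Z3 u)) by ring.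
have E (i j : bool) mn : 8 * g3 3 (par_idx (mn, i, j)) (u + u) =
   g3 3 mn (u + (i%:R * w1 + j%:R * w2) / 2).
  rewrite /g3 /lat /par_idx /= !intrD !intrM !intrN.
  have -> : u + u - ((2%:~R * mn.1%:~R - (i%:Z)%:~R) * w1 + (2%:~R * mn.2%:~R - (j%:Z)%:~R) * w2)
    = 2 * (u + (i%:R * w1 + j%:R * w2) / 2 - (mn.1%:~R * w1 + mn.2%:~R * w2)).
    by rewrite -!pmulrn; field.
  have E8 : 8 * (2 ^+ 3)^-1 = 1 :> C by field.
  by rewrite exprMn invfM mulrA E8 mul1r.
apply: has_sum_bool; apply: has_sum_bool.
- apply: has_sum_eq (Z3P (u + (w1 + w2) / 2)) => // mn; rewrite E; congr g3; rewrite /=; ring.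
- apply: has_sum_eq (Z3P (u + w2 / 2)) => // mn; rewrite E; congr g3; rewrite /=; ring.
- apply: has_sum_eq (Z3P (u + w1 / 2)) => // mn; rewrite E; congr g3; rewrite /=; ring.
apply: has_sum_eq (Z3P u) => // mn; rewrite E; congr g3; rewrite /=; ring.
Qed.

(** With a = 1/(x - l) and b = 1/l one has a + b = x a b. Hence the two terms are x a b (a - b) and
    x^2 a b^2, both of order size^-3. The index (0, 0), where b reads 0, is bounded apart. *)
Lemma g2_bound (x : C) : exists2 B : R, 0 <= B & forall mn, l mn != x ->
  cabs (g2 mn x) <= B * size2 R mn ^- 3 /\ cabs (gz mn x) <= B * size2 R mn ^- 3.
Proof.
have [K K0 [r r0 H]] := inv_bound x; have [k k0 [r' r'0 H']] := inv_bound 0.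
pose M := K + k; have M0 : 0 < M by rewrite addr_gt0.
pose c := cabs x; have c0 : 0 <= c by exact: cabs_ge0.
exists (2 * c * M ^+ 3 + c ^+ 2 * M ^+ 3 + M ^+ 2 + M).
  by rewrite !addr_ge0 ?mulr_ge0 ?exprn_ge0 // ltW.
move=> mn hmn; have s1 := size2_ge1 R mn; have s0 : 0 < size2 R mn by apply: lt_le_trans s1.
set s := size2 R mn in s1 s0 *.
have i0 : 0 <= s ^- 3 by rewrite invr_ge0 exprn_ge0 // ltW.
have a1 : cabs ((x - l mn)^-1) <= M / s.
  apply: le_trans (H mn hmn x _) _; first by rewrite subrr cabs0.
  by apply: ler_wpM2r; [rewrite invr_ge0 ltW|rewrite /M lerDl ltW].
have aN : x - l mn != 0 by rewrite subr_eq0 eq_sym.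
have [z|z] := eqVneq mn (0, 0).
  have s11 : s = 1 by rewrite /s z /size2 /= addr0.
  have l0 : l mn = 0 by rewrite z lat00.
  move: a1; rewrite /g2 /gz l0 subr0 expr0n /= invr0 mulr0 !subr0 !addr0 s11 invr1 mulr1 => a1.
  rewrite expr1n invr1 mulr1 -exprVn cabsX; split.
    apply: (@le_trans _ _ (M ^+ 2)); first by apply: lerXn2r; rewrite ?nnegrE ?cabs_ge0 // ltW.
    by rewrite -addrA -[leLHS]add0r lerD ?addr_ge0 ?mulr_ge0 ?exprn_ge0 ?lerDl // ltW.
  by apply: le_trans a1 _; rewrite lerDr !addr_ge0 ?mulr_ge0 ?exprn_ge0 // ltW.
have lN : l mn != 0 by rewrite lat_eq0.
have b1 : cabs ((l mn)^-1) <= M / s.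
  have := H' mn lN 0; rewrite subrr cabs0 => /(_ r'0); rewrite sub0r invrN cabsN => h.
  apply: le_trans h _.
  by apply: ler_wpM2r; [rewrite invr_ge0 ltW|rewrite /M lerDr ltW].
pose a := (x - l mn)^-1; pose b := (l mn)^-1.
have P j : j = (M / s) ^+ 3 -> j = M ^+ 3 * s ^- 3 by move=> ->; rewrite exprMn exprVn.
have a0 : 0 <= cabs a by exact: cabs_ge0. have b0 : 0 <= cabs b by exact: cabs_ge0.
have m0 : 0 <= M / s by rewrite divr_ge0 // ltW.
have ab : cabs a * cabs b <= (M / s) ^+ 2 by rewrite expr2 ler_pM.
have E2 : (M / s) ^+ 3 = M ^+ 3 * s ^- 3 by rewrite exprMn exprVn.
have big (t : R) : 0 <= t -> t * s ^- 3 <= (t + M ^+ 2 + M) * s ^- 3.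
  by move=> t0; rewrite ler_wpM2r // -addrA lerDl addr_ge0 ?exprn_ge0 // ltW.
split.
  have -> : g2 mn x = x * (a * b * (a - b)) by rewrite /g2 /a /b; field; rewrite aN lN.
  apply: (@le_trans _ _ (2 * c * M ^+ 3 * s ^- 3)).
    rewrite -(mulrA (2 * c)) -E2 !cabsM -/c.
    have h : cabs (a - b) <= M / s + M / s by apply: le_trans (cabsB _ _) _; exact: lerD.
    have -> : 2 * c * (M / s) ^+ 3 = c * ((M / s) ^+ 2 * (M / s + M / s)) by ring.
    by apply: ler_wpM2l => //; apply: ler_pM => //; rewrite ?mulr_ge0 ?cabs_ge0.
  apply: le_trans (big _ _); last by rewrite !addr_ge0 ?mulr_ge0 ?exprn_ge0 // ltW.
  by rewrite ler_wpM2r // lerDl mulr_ge0 ?exprn_ge0 // ltW.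
have -> : gz mn x = x ^+ 2 * (a * b * b) by rewrite /gz /a /b; field; rewrite aN lN.
apply: (@le_trans _ _ (c ^+ 2 * M ^+ 3 * s ^- 3)).
  rewrite -(mulrA (c ^+ 2)) -E2 cabsM cabsX -/c !cabsM (exprSr (M / s)).
  apply: ler_wpM2l; first by rewrite sqr_ge0.
  by apply: ler_pM; rewrite ?mulr_ge0.
apply: le_trans (big _ _); last by rewrite !addr_ge0 ?mulr_ge0 ?exprn_ge0 // ltW.
by rewrite ler_wpM2r // lerDr !mulr_ge0 ?exprn_ge0 // ltW.
Qed.

(** At the index (0, 0) the convention for the inverse of 0 leaves u^-2, so the sum over all indices
    contains the polar term of [wp]. In [gz_sum] the same index yields 1/u. *)
Lemma g2_sum u : ~ inL u -> has_sum (fun mn => g2 mn u) (wp w1 w2 u).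
Proof.
move=> lu; have [B B0 H] := g2_bound u.
have [|S hS] := @summable_has_sum _ _ (fun mn => g2 mn u).
  apply: summableW (size2_sum B0) => mn; by case: (H mn (nlat_neq mn lu)).
suff -> : wp w1 w2 u = S by [].
have := has_sum_latbox_full hS => /cvg_lim; rewrite /wp => -> //.
by rewrite /g2 lat00 subr0 expr0n /= invr0 subr0 addrC subrK.
Qed.

Lemma gz_sum u : ~ inL u -> has_sum (fun mn => gz mn u) (wzeta w1 w2 u).
Proof.
move=> lu; have [B B0 H] := g2_bound u.
have [|S hS] := @summable_has_sum _ _ (fun mn => gz mn u).
  apply: summableW (size2_sum B0) => mn; by case: (H mn (nlat_neq mn lu)).
suff -> : wzeta w1 w2 u = S by [].
have := has_sum_latbox_full hS => /cvg_lim; rewrite /wzeta => -> //.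
by rewrite /gz lat00 subr0 expr0n /= invr0 mulr0 !addr0 addrC subrK.
Qed.

Lemma wzeta_opp u : ~ inL u -> wzeta w1 w2 (- u) = - wzeta w1 w2 u.
Proof.
move=> lu; have lu' := nlatN lu.
have := gz_sum lu => /(has_sum_reindex (g := fun mn => (- mn.1, - mn.2))
  (h := fun mn => (- mn.1, - mn.2))) H.
have K : cancel (fun mn : int * int => (- mn.1, - mn.2)) (fun mn => (- mn.1, - mn.2)).
  by move=> [m n]; rewrite /= !opprK.
apply: has_sum_uniq (gz_sum lu') _.
apply: has_sum_eq (has_sumZ (-1) (H K K)) => [mn|]; last by rewrite mulN1r.
rewrite /gz latN sqrrN; have -> : u - - l mn = - (- u - l mn) by ring.
by rewrite !invrN; ring.
Qed.

Lemma der_g3 k mn u : l mn != u -> der (g3 k.+1 mn) u (- k.+1%:R * g3 k.+2 mn u).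
Proof.
move=> h; have n0 : u - l mn != 0 by rewrite subr_eq0 eq_sym.
have n1 : (u - l mn) ^+ k.+1 != 0 by rewrite expf_neq0.
rewrite /g3; apply: der_eq.
  apply: derV => //; apply: derX; dt.
rewrite /= subr0 mulr1; set x := u - l mn in n0 *.
have -> : (x ^+ k.+1) ^+ 2 = x ^+ k * x ^+ k.+2 by rewrite -exprM -exprD; congr (_ ^+ _); lia.
have : x ^+ k != 0 by rewrite expf_neq0.
have : x ^+ k.+2 != 0 by rewrite expf_neq0.
move: (x ^+ k) (x ^+ k.+2) (k.+1%:R : C) => A B c nB nA; field.
by rewrite nA nB.
Qed.

Lemma der_wp u : ~ inL u -> der (wp w1 w2) u (- 2 * Z3 u).
Proof.
move=> lu; have [K K0 [r r0 H]] := g3_bound u; have [r' r'0 H'] := nlat_open O0 lu.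
pose d := Num.min r r'; have d0 : 0 < d by rewrite lt_min r0.
have dr v : cabs (v - u) < d -> cabs (v - u) < r by rewrite lt_min => /andP[].
have dL v : cabs (v - u) < d -> ~ inL v by rewrite lt_min => /andP[_ /H'].
apply: (has_sum_der2 (f := g2) (f' := fun mn v => - 2 * g3 3 mn v)
  (f'' := fun mn v => 6 * g3 4 mn v) d0 (@size2_sum (6 * K ^+ 4) _)).
- by rewrite mulr_ge0 ?exprn_ge0 // ltW.
- move=> mn v hv; have := der_g3 1 (nlat_neq mn (dL v hv)) => hd.
  by rewrite /g2; apply: der_eq; [apply: derB; [exact: hd|exact: der_cst]|rewrite /= subr0].
- move=> mn v hv; have := der_g3 2 (nlat_neq mn (dL v hv)) => hd.
  by apply: der_eq; [apply: dercM; exact: hd|rewrite /=; ring].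
- move=> mn v hv; rewrite cabsM cabs_nat -mulrA ler_wpM2l //.
  by apply: (H 1); [exact: nlat_neq|exact: dr].
- by move=> v hv; apply: g2_sum; exact: dL.
exact: has_sumZ (Z3P u).
Qed.

Lemma der_wzeta u : ~ inL u -> der (wzeta w1 w2) u (- wp w1 w2 u).
Proof.
move=> lu; have [K K0 [r r0 H]] := g3_bound u; have [r' r'0 H'] := nlat_open O0 lu.
pose d := Num.min r r'; have d0 : 0 < d by rewrite lt_min r0.
have dr v : cabs (v - u) < d -> cabs (v - u) < r by rewrite lt_min => /andP[].
have dL v : cabs (v - u) < d -> ~ inL v by rewrite lt_min => /andP[_ /H'].
apply: (has_sum_der2 (f := gz) (f' := fun mn v => - g2 mn v)
  (f'' := fun mn v => 2 * g3 3 mn v) d0 (@size2_sum (2 * K ^+ 3) _)).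
- by rewrite mulr_ge0 ?exprn_ge0 // ltW.
- move=> mn v hv; have := der_g3 0 (nlat_neq mn (dL v hv)) => hd.
  apply: (der_ext (f := fun v => g3 1 mn v + (l mn)^-1 + v * (l mn) ^- 2)).
    by move=> w; rewrite /g3 expr1.
  apply: der_eq; first by apply: derD; [apply: derD; [exact: hd|exact: der_cst]|apply: derMc; dt].
  by rewrite /g2 /g3 /=; ring.
- move=> mn v hv; have := der_g3 1 (nlat_neq mn (dL v hv)) => hd.
  apply: der_eq; first by rewrite /g2; apply: derN; apply: derB; [exact: hd|exact: der_cst].
  by rewrite /=; ring.
- move=> mn v hv; rewrite cabsM cabs_nat -mulrA ler_wpM2l //.
  by apply: (H 0); [exact: nlat_neq|exact: dr].
- by move=> v hv; apply: gz_sum; exact: dL.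
apply: has_sum_eq (has_sumZ (-1) (g2_sum lu)) => [mn|]; by rewrite mulN1r.
Qed.

End LatticeSums.

(** * Uniform bounds on the unit square *)

Section BoxBound.
Variable R : realType.

(** Compactness in its near-covering form, with the filter of large M as parameter: the local bounds
    are dominated by a single one. *)
Lemma box_bound (B : R -> R -> R -> Prop) :
  (forall M M' x y, M <= M' -> B M x y -> B M' x y) ->
  (forall x y : R, exists M : R, exists2 r : R, 0 < r &
     forall x' y', `|x' - x| < r -> `|y' - y| < r -> B M x' y') ->
  exists M : R, forall x y, 0 <= x <= 1 -> 0 <= y <= 1 -> B M x y.
Proof.
move=> mono loc.
have cpt : compact (`[0 : R, 1] `*` `[0 : R, 1]).
  by apply: compact_setX; exact: segment_compact.
move/compact_near_coveringP : cpt => /(_ R (pinfty_nbhs R) (fun M p => B M p.1 p.2) _).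
case=> [[x y] _|M [Mr H]].
  have [M [r r0 H]] := loc x y.
  exists ([set p | `|p.1 - x| < r /\ `|p.2 - y| < r], [set M' | M < M']).
    split; last by exists M; split => //; exact: num_real.
    exists (ball x r, ball y r); first by split; exact: nbhsx_ballx.
    by move=> [x' y'] [/= h1 h2]; rewrite distrC (distrC y'); split.
  by move=> [[x' y'] M'] [[/= h1 h2] MM']; apply: mono (ltW MM') _; exact: H.
exists (M + 1) => x y hx hy; apply: (H (M + 1) _ (x, y)); first by rewrite ltrDl.
by split => /=; rewrite in_itv.
Qed.

End BoxBound.

(** * Identification of wp and zeta with their theta expressions *)

Section Weierstrass.
Variable R : realType.
Local Notation C := (Cx R).
Variables (w1 w2 : C).
Hypothesis O0 : 0 < complex.Im (w2 / w1).
Local Notation l := (lat w1 w2).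
Local Notation inL := (in_lat w1 w2).
Local Notation Om := (w2 / w1).
Local Notation th := (th11 Om).
Local Notation hp := (half_period w1 w2).
Hypothesis T1 : th 1 0 != 0.
Local Notation pp := (pp Om).
Local Notation pd := (pd11 Om).
Local Notation L1 := (logder11 Om).
Local Notation cc := (cc Om).
Let w10 : w1 != 0 := w1_neq0 O0.

Ltac dleaf ::= lazymatch goal with
  | |- der (fun u => cexp (@?f u)) _ _ => apply: der_cexpf; dt
  | |- der (fun u => th11 _ ?k (@?f u)) _ _ => apply: (der_thf O0); dt
  | |- der (th11 _ _) _ _ => exact: (der_th O0)
  end.

Lemma in_lat_scale u : in_lat w1 w2 u <-> in_lat 1 Om (u / w1).
Proof.
split => -[[m n] h]; exists (m, n).
  by rewrite h /lat /=; field.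
by rewrite -[u](divfK w10) h /lat /=; field.
Qed.

Lemma nlat_scale u : ~ inL u -> ~ in_lat 1 Om (u / w1).
Proof. by move=> h /in_lat_scale. Qed.

Lemma half_scale nu : hp nu / w1 = half_period 1 Om nu.
Proof. by case: nu => [[|[|[|//]]] i]; rewrite /half_period /=; field. Qed.

(** The defect between wp' as a lattice sum and its theta expression. Both parts are periodic and
    satisfy the distribution relation, which forces the defect to vanish. *)
Definition D1 (u : C) : C := - 2 * Z3 w1 w2 u - w1 ^- 3 * pd (u / w1).

Lemma D1_per u kl : D1 (u + l kl) = D1 u.
Proof.
rewrite /D1 Z3_per // mulrDl (pd_per O0) //; apply/in_lat_scale.
exact: in_lat_lat.
Qed.

Lemma D1_distr u : ~ inL (u + u) -> 8 * D1 (u + u) = D1 u + \sum_nu D1 (u + hp nu).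
Proof.
move=> l2; have lu : ~ inL u by move=> h; apply: l2; exact: in_latD.
have h1 := Z3_distr O0 u; have l2' := nlat_scale l2; rewrite mulrDl in l2'.
have h2 := pd_distr O0 T1 (nlat_scale lu) l2'.
rewrite /D1.
transitivity (- 2 * (8 * Z3 w1 w2 (u + u)) - w1 ^- 3 * (8 * pd (u / w1 + u / w1))).
  by rewrite (mulrDl u u); ring.
rewrite h1 h2.
rewrite !big_ord_recl !big_ord0 !mulrDl !half_scale; ring.
Qed.

Lemma half_nlatD u nu : ~ inL (u + u) -> ~ inL (u + hp nu).
Proof.
move=> l2 h; apply: l2.
have -> : u + u = (u + hp nu) + (u + hp nu) - (hp nu + hp nu) by ring.
by apply: in_latD => //; [exact: in_latD|apply: in_latN => //; exact: half_dbl].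
Qed.

Lemma Z3_bound (x : C) : exists M : R, exists2 r : R, 0 < r &
  forall u, cabs (u - x) < r -> (forall mn, l mn != x) -> cabs (Z3 w1 w2 u) <= M.
Proof.
have [K K0 [r r0 H]] := g3_bound O0 x; exists (K ^+ 3 * 16); exists r => // u hu hx.
apply: (has_sum_bound (Z3P O0 u) (g := fun mn => K ^+ 3 * size2 R mn ^- 3)).
  by move=> mn; apply: (H 0%N).
by have K3 : 0 <= K ^+ 3; [rewrite exprn_ge0 // ltW|exact: (size2_sum K3)].
Qed.

Lemma D1_locbd (x : C) : ~ inL x -> exists M : R, exists2 r : R, 0 < r &
  forall u, cabs (u - x) < r -> cabs (D1 u) <= M.
Proof.
move=> lx; have [M [r r0 H]] := Z3_bound x.
have dp : der (fun u => w1 ^- 3 * pd (u / w1)) x (w1 ^- 3 * (pdd Om (x / w1) * w1^-1)).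
  apply: dercM; apply: (der_comp (f := pd) (g := fun u => u / w1)).
    by apply: der_eq; [apply: derMc; dt|rewrite mul1r].
  by apply: (der_pd O0 T1); apply: (th_neq0 O0); exact: nlat_scale.
have /contC /(_ 1 ltr01)[d d0 Hd] := der_cont dp.
exists (2 * M + (1 + cabs (w1 ^- 3 * pd (x / w1)))); exists (Num.min r d); first by rewrite lt_min r0.
move=> u; rewrite lt_min => /andP[ur ud]; rewrite /D1.
apply: le_trans (cabsB _ _) _; apply: lerD.
  rewrite cabsM cabsN cabs_nat ler_wpM2l //; apply: H => // mn.
  exact: nlat_neq.
rewrite -lerBlDr; apply: le_trans (cabs_lowB _ _) _; apply: ltW; exact: Hd.
Qed.

(* D1 (u + u) = D1 u / 8 + O(1) forces the u^-3 part of D1 at 0 to be a multiple of u^-3,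
   and that multiple vanishes, so that D1 is bounded near 0. *)
Lemma D1_cube : forall e : R, 0 < e -> exists2 r : R, 0 < r &
  forall u, u != 0 -> cabs u < r -> cabs (u ^+ 3 * D1 u) <= e.
Proof.
move=> e e0.
have [K K0 [r r0 H]] := g3_bound O0 0.
have reg u : cabs u < r -> cabs (Z3 w1 w2 u - u ^- 3) <= K ^+ 3 * 16.
  move=> ur; have h := has_sumB (Z3P O0 u) (has_sum_single ((0, 0) : int * int) (u ^- 3)).
  apply: (has_sum_bound h (g := fun mn => K ^+ 3 * size2 R mn ^- 3)); last first.
    by have K3 : 0 <= K ^+ 3; [rewrite exprn_ge0 // ltW|exact: (size2_sum K3)].
  move=> mn; have [->|n0] := eqVneq mn (0, 0).
    rewrite /g3 lat00 subr0 subrr cabs0 mulr_ge0 ?exprn_ge0 ?invr_ge0 ?exprn_ge0 ?ltW //.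
    by apply: lt_le_trans (size2_ge1 _ _).
  by rewrite subr0; apply: (H 0%N); rewrite ?lat_eq0 // subr0.
pose t1 := th 1 0.
(* The quotient theta_11(v) / v, completed at 0, cancels the cube in the denominator of [pd11]: -
   v^3 pd11 v = G v, which tends to 2. *)
pose q (v : C) := if v == 0 then t1 else th 0 v / v.
pose N v := TT' Om v * th 0 v - 2 * TT11 Om v * th 1 v.
pose G v := N v / (q v * q v * q v).
have q0 : q 0 = t1 by rewrite /q eqxx.
have N0 : N 0 = 2 * t1 ^+ 3 by rewrite /N /TT11 !th00 // /t1; ring.
have G0 : G 0 = 2 by rewrite /G N0 q0; field.
have cG : {for 0, continuous G}.
  have qc : q @ nbhs (0 : C) --> q 0.
    apply/contC => e' e'0; have e2 : 0 < e' / 2 by rewrite divr_gt0.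
    have /derP /(_ _ e2)[d d0 Hd] := der_th O0 0 0.
    rewrite q0; exists d => // u; rewrite subr0 => ud; rewrite /q.
    have [_|u0] := eqVneq u 0; first by rewrite subrr cabs0.
    have := Hd u ud; rewrite add0r th00 // subr0 -/t1 => hh.
    have -> : th 0 u / u - t1 = (th 0 u - t1 * u) / u by field.
    rewrite cabsM cabsV; have cu : 0 < cabs u by rewrite cabs_gt0.
    rewrite ltr_pdivrMr //; apply: le_lt_trans hh _.
    by rewrite ltr_pM2r //; lra.
  have Nc : N @ nbhs (0 : C) --> N 0.
    have hT := der_TT O0 0.
    have hT' : der (TT' Om) 0 (th 4 0 * th 0 0 - th 2 0 ^+ 2).
      by rewrite /TT'; apply: der_eq; [dt|rewrite /=; ring].
    have dN : der N 0 ((th 4 0 * th 0 0 - th 2 0 ^+ 2) * th 0 0 + TT' Om 0 * th 1 0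
       - (2 * (TT' Om 0 * th 1 0 + TT11 Om 0 * th 2 0))).
      by rewrite /N; apply: der_eq; [apply: derB; [apply: derM; dt|apply: derM; [dt|dt]]|rewrite /=; ring].
    exact: (der_cont dN).
  have q3 : (fun v => q v * q v * q v) @ nbhs (0 : C) --> q 0 * q 0 * q 0.
    apply: (cvgM (f := fun v => q v * q v) (g := q)); last exact: qc.
    by apply: (cvgM (f := q) (g := q)); exact: qc.
  have qi : (fun v => (q v * q v * q v)^-1) @ nbhs (0 : C) --> (q 0 * q 0 * q 0)^-1.
    by apply: (cvgV (f := fun v => q v * q v * q v)); [rewrite q0 !mulf_neq0|exact: q3].
  have Gc : (fun v => N v * (q v * q v * q v)^-1) @ nbhs (0 : C) --> N 0 * (q 0 * q 0 * q 0)^-1.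
    by apply: (cvgM (f := N)); [exact: Nc|exact: qi].
  exact: Gc.
have e2 : 0 < e / 2 by rewrite divr_gt0.
have /contC /(_ _ e2)[d d0 Hd] := cG.
have [d' d'0 Hd'] := lat_discrete O0 0.
pose B := 2 * (K ^+ 3 * 16) + 1.
have K3 : 0 <= K ^+ 3 * 16 by rewrite mulr_ge0 ?exprn_ge0 // ltW.
have B0 : 0 < B by rewrite /B; lra.
have cw : 0 < cabs w1 by rewrite cabs_gt0.
pose rr := Num.min (Num.min r 1) (Num.min (Num.min d' (d * cabs w1)) (e / 2 / B)).
have rr0 : 0 < rr by rewrite !lt_min r0 ltr01 d'0 mulr_gt0 // divr_gt0.
exists rr => // u u0; rewrite !lt_min => /andP[/andP[ur u1] /andP[/andP[ud' ud] ue]].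
have lu : ~ inL u by apply: Hd' => //; rewrite subr0.
have hv := th_neq0 O0 (nlat_scale lu).
have v0 : u / w1 != 0 by rewrite mulf_neq0 // invr_neq0.
have -> : u ^+ 3 * D1 u = - (2 * (u ^+ 3 * (Z3 w1 w2 u - u ^- 3))) + (G (u / w1) - 2).
  rewrite /D1 /G /q (negbTE v0) /pd11 -/(N (u / w1)).
  by move: (N (u / w1)) => X; field; rewrite w10 hv u0.
have b1 : cabs (G (u / w1) - 2) <= e / 2.
  have := Hd (u / w1); rewrite subr0 G0 cabsM cabsV ltr_pdivrMr // => /(_ ud).
  exact: ltW.
have b2 : cabs (- (2 * (u ^+ 3 * (Z3 w1 w2 u - u ^- 3)))) <= e / 2.
  rewrite cabsN cabsM cabs_nat cabsM cabsX.
  have c0 : 0 <= cabs u := cabs_ge0 _.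
  have c3 : cabs u ^+ 3 <= cabs u.
    by rewrite -[leRHS]expr1; apply: ler_wiXn2l => //; exact: ltW.
  have := reg u ur; set Q := cabs _ => hQ; have Q0 : 0 <= Q by exact: cabs_ge0.
  apply: (@le_trans _ _ (cabs u * B)).
    rewrite mulrCA; apply: ler_pM => //; rewrite ?exprn_ge0 ?mulr_ge0 //.
    by rewrite /B; lra.
  by rewrite -ler_pdivlMr //; exact: ltW.
by rewrite [e]splitr; apply: le_trans (cabsD _ _) _; exact: lerD.
Qed.

Lemma D1_half_bd : exists2 B : R, 0 <= B & exists2 r : R, 0 < r &
  forall u, cabs u < r -> cabs (\sum_nu D1 (u + hp nu)) <= B.
Proof.
have X nu : exists M : R, exists2 r : R, 0 < r & forall u, cabs u < r -> cabs (D1 (u + hp nu)) <= M.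
  have [M [r r0 H]] := D1_locbd (half_nlat O0 (nu := nu)).
  by exists M, r => // u ur; apply: H; rewrite addrK.
have [M0 [r0 r00 H0]] := X ord0; have [M1 [r1 r10 H1]] := X (lift ord0 ord0).
have [M2 [r2 r20 H2]] := X (lift ord0 (lift ord0 ord0)).
have M00 : 0 <= M0 by apply: le_trans (cabs_ge0 _) (H0 0 _); rewrite cabs0.
have M10 : 0 <= M1 by apply: le_trans (cabs_ge0 _) (H1 0 _); rewrite cabs0.
have M20 : 0 <= M2 by apply: le_trans (cabs_ge0 _) (H2 0 _); rewrite cabs0.
exists (M0 + (M1 + M2)); first by rewrite !addr_ge0.
exists (Num.min r0 (Num.min r1 r2)); first by rewrite !lt_min r00 r10.
move=> u; rewrite !lt_min => /andP[u0 /andP[u1 u2]].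
rewrite !big_ord_recl big_ord0 addr0.
apply: le_trans (cabsD _ _) _; apply: lerD; first exact: H0.
by apply: le_trans (cabsD _ _) _; apply: lerD; [exact: H1|exact: H2].
Qed.

(** Halving n times gives |D1 u| <= |D1 (u / 2^n)| / 8^n + B. By [D1_cube], applied with the bound
    |u|^3, the first term is at most 1 for large n. *)
Lemma D1_near0 : exists M : R, exists2 r : R, 0 < r &
  forall u, u != 0 -> cabs u < r -> cabs (D1 u) <= M.
Proof.
have [B B0 [r r0 HB]] := D1_half_bd; have [d d0 Hd] := lat_discrete O0 0.
pose s := Num.min r d; have s0 : 0 < s by rewrite lt_min r0.
have half_lt (u : C) : cabs (u / 2) = cabs u / 2 by rewrite cabsM cabsV cabs_nat.
have step u : u != 0 -> cabs u < s -> cabs (D1 u) <= (cabs (D1 (u / 2)) + B) / 8.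
  rewrite lt_min => u0 /andP[ur ud]; have uu : u / 2 + u / 2 = u by field.
  have lu : ~ inL (u / 2 + u / 2) by rewrite uu; apply: Hd => //; rewrite subr0.
  have := D1_distr lu; rewrite uu => h.
  rewrite ler_pdivlMr // mulrC -(cabs_nat R 8) -cabsM h.
  apply: le_trans (cabsD _ _) _; rewrite lerD2l; apply: HB.
  by rewrite half_lt; have := cabs_ge0 u; lra.
have it n : forall u, u != 0 -> cabs u < s -> cabs (D1 u) <= cabs (D1 (u / 2 ^+ n)) / 8 ^+ n + B.
  elim: n => [|n IH] u u0 us; first by rewrite !expr0 !divr1 lerDl.
  apply: le_trans (step u u0 us) _.
  have us2 : cabs (u / 2) < s by rewrite half_lt; have := cabs_ge0 u; lra.
  have u20 : u / 2 != 0 by rewrite mulf_neq0 // invr_neq0 // pnatr_eq0.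
  have := IH _ u20 us2; rewrite -mulrA -invfM -exprS.
  have -> : cabs (D1 (u / 2 ^+ n.+1)) / 8 ^+ n.+1 = cabs (D1 (u / 2 ^+ n.+1)) / 8 ^+ n / 8.
    by rewrite (exprSr 8) invfM mulrA.
  by lra.
exists (1 + B), s => // u u0 us.
have cu : 0 < cabs u by rewrite cabs_gt0.
have cu3 : 0 < cabs u ^+ 3 by rewrite exprn_gt0.
have [t t0 Ht] := D1_cube cu3.
pose n := Num.bound (cabs u / t).
have hn : cabs (u / 2 ^+ n) < t.
  rewrite cabsM cabsV cabsX cabs_nat ltr_pdivrMr ?exprn_gt0 // mulrC -ltr_pdivrMr //.
  have h := archi_boundP (divr_ge0 (ltW cu) (ltW t0)).
  apply: lt_le_trans h _; rewrite -natrX ler_nat; exact/ltnW/ltn_expl.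
have n0 : u / 2 ^+ n != 0 by rewrite mulf_neq0 // invr_neq0 // expf_neq0 // pnatr_eq0.
apply: le_trans (it n u u0 us) _; rewrite lerD2r.
have := Ht _ n0 hn; rewrite cabsM cabsX cabsM cabsV cabsX cabs_nat exprMn exprVn -exprM mulnC exprM.
have -> : (2 : R) ^+ 3 = 8 by rewrite -natrX.
rewrite -mulrA -ler_pdivlMl // mulVf ?gt_eqF // mulrC; exact.
Qed.

(** Periodicity reduces to the closed unit square of real coordinates, where local bounds suffice;
    at lattice points they come from [D1_near0]. *)
Lemma D1_bounded : exists M : R, forall u, ~ inL u -> cabs (D1 u) <= M.
Proof.
have [||M HM] := @box_bound R (fun M x y => ~ inL (plan w1 w2 x y) -> cabs (D1 (plan w1 w2 x y)) <= M).
- by move=> M M' x y MM' h lu; apply: le_trans MM'; exact: h.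
- move=> x y; have [M [r r0 H]] : exists M : R, exists2 r : R, 0 < r &
    forall u, cabs (u - plan w1 w2 x y) < r -> ~ inL u -> cabs (D1 u) <= M.
    have [[kl e]|lx] := pselect (inL (plan w1 w2 x y)); last first.
      by have [M [r r0 H]] := D1_locbd lx; exists M, r => // u ur _; exact: H.
    have [M [r r0 H]] := D1_near0; exists M, r => // u; rewrite e => ur lu.
    rewrite -(D1_per u (- kl.1, - kl.2)) latN; apply: H => //.
    by apply/eqP => h; apply: lu; exists kl; apply/eqP; rewrite -subr_eq0; apply/eqP.
  pose A := cabs w1 + cabs w2; have A0 : 0 < A by rewrite ltr_wpDr ?cabs_ge0 // cabs_gt0.
  exists M, (r / (2 * A)); first by rewrite divr_gt0 // mulr_gt0.
  move=> x' y' hx hy lu; apply: H => //; rewrite planB.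
  apply: le_lt_trans (plan_le _ _ _ _) _; rewrite -/A -ltr_pdivlMl //.
  have -> : A^-1 * r = r / (2 * A) + r / (2 * A) by field; rewrite gt_eqF.
  exact: ltrD.
exists M => u lu.
pose m := Num.floor (cx w1 w2 u); pose n := Num.floor (cy w1 w2 u).
have hu : plan w1 w2 (cx w1 w2 u - m%:~R) (cy w1 w2 u - n%:~R) = u + l (- m, - n).
  by rewrite -planB plan_c // (latN w1 w2 (m, n)) (latE w1 w2 (m, n)).
rewrite -(D1_per u (- m, - n)) -hu; apply: HM.
- have /andP[h1 h2] := floor_itv (cx w1 w2 u).
  by move: h1 h2; rewrite -/m intrD => h1 h2; apply/andP; split; lra.
- have /andP[h1 h2] := floor_itv (cy w1 w2 u).
  by move: h1 h2; rewrite -/n intrD => h1 h2; apply/andP; split; lra.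
by rewrite hu; apply: nlatD => //; exact: in_lat_lat.
Qed.

(** Four values bounded by M give 8 |D1| <= 4 M, so any bound may be halved, and again, without
    end. *)
Lemma D1_zero u : ~ inL u -> D1 u = 0.
Proof.
have [M HM] := D1_bounded.
have M0 : 0 <= M by apply: le_trans (cabs_ge0 _) (HM _ (center_nlat O0)).
have it n : forall v, ~ inL v -> cabs (D1 v) <= M / 2 ^+ n.
  elim: n => [|n IH] v lv; first by rewrite expr0 divr1; exact: HM.
  have vv : v / 2 + v / 2 = v by field.
  have l2 : ~ inL (v / 2 + v / 2) by rewrite vv.
  have l1 : ~ inL (v / 2) by move=> h; apply: l2; exact: in_latD.
  have := D1_distr l2; rewrite vv => h.
  have : cabs (8 * D1 v) <= 4 * (M / 2 ^+ n).
    rewrite h !big_ord_recl big_ord0 addr0.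
    have -> : 4 * (M / 2 ^+ n) = M / 2 ^+ n + (M / 2 ^+ n + (M / 2 ^+ n + M / 2 ^+ n)) by ring.
    apply: le_trans (cabsD _ _) _; apply: lerD; first exact: IH.
    apply: le_trans (cabsD _ _) _; apply: lerD; first by apply: IH; exact: half_nlatD.
    by apply: le_trans (cabsD _ _) _; apply: lerD; apply: IH; exact: half_nlatD.
  rewrite cabsM cabs_nat exprSr invfM mulrA => h8.
  by move: h8; lra.
move=> lu; apply/eqP; rewrite -cabs_eq0 eq_le cabs_ge0 andbT leNgt; apply/negP => d0.
pose n := Num.bound (M / cabs (D1 u)).
have h := archi_boundP (divr_ge0 M0 (cabs_ge0 (D1 u))).
have := it n u lu; apply/negP; rewrite -ltNge ltr_pdivrMr ?exprn_gt0 // mulrC -ltr_pdivrMr //.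
apply: lt_le_trans h _; rewrite -natrX ler_nat; exact/ltnW/ltn_expl.
Qed.

Lemma der_scale (f : C -> C) u m : der f (u / w1) m -> der (fun v => f (v / w1)) u (m / w1).
Proof.
by move=> h; apply: (der_comp (f := f) (g := fun v => v / w1)) h; apply: der_eq; [apply: derMc; dt|rewrite mul1r].
Qed.

Lemma der_wp_pd u : ~ inL u -> der (wp w1 w2) u (w1 ^- 3 * pd (u / w1)).
Proof.
move=> lu; apply: der_eq (der_wp O0 lu) _; have := D1_zero lu.
by rewrite /D1 => /eqP; rewrite subr_eq0 => /eqP.
Qed.

Hypothesis HS : \sum_nu wp w1 w2 (hp nu) = 0.

(** The difference is constant off the lattice. The constant is found by summing over the three
    half-periods: both sides add up to 0, on the left by [HS] and on the right by [EE_rel]. *)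
Lemma wp_pp u : ~ inL u -> wp w1 w2 u = w1 ^- 2 * pp (u / w1).
Proof.
move=> lu; pose f v := wp w1 w2 v - w1 ^- 2 * pp (v / w1).
have fc v : ~ inL v -> der f v 0.
  move=> lv; have h := der_scale (der_pp O0 (th_neq0 O0 (nlat_scale lv))).
  rewrite /f; apply: der_eq; first by apply: derB; [exact: der_wp_pd|apply: dercM; exact: h].
  by rewrite /=; field.
have fK v : ~ inL v -> f v = f u by move=> lv; apply: (offlat_const O0 fc).
have : \sum_nu f (hp nu) = 0.
  rewrite /f sumrB HS sub0r; apply/eqP; rewrite oppr_eq0 -mulr_sumr; apply/eqP.
  have [s _] := EE_rel O0 T1; rewrite !big_ord_recl big_ord0 !half_scale -!/(EE _ _).
  rewrite (_ : lift ord0 (lift ord0 ord0) = Ordinal (isT : (2 < 3)%N)); last exact: val_inj.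
  rewrite (_ : lift ord0 ord0 = Ordinal (isT : (1 < 3)%N) :> 'I_3); last exact: val_inj.
  by rewrite addr0 addrA s mulr0.
rewrite (eq_bigr (fun=> f u)) => [|nu _]; last by apply: fK; exact: half_nlat.
rewrite sumr_const card_ord => /eqP; rewrite -mulr_natl mulf_eq0 pnatr_eq0 /= /f subr_eq0.
by move=> /eqP.
Qed.

(** The constant of integration is 0 because both sides are odd. *)
Lemma wzeta_L1 u : ~ inL u -> wzeta w1 w2 u = L1 (u / w1) / w1 - cc / w1 ^+ 2 * u.
Proof.
move=> lu; pose f v := wzeta w1 w2 v - (L1 (v / w1) / w1 - cc / w1 ^+ 2 * v).
have fc v : ~ inL v -> der f v 0.
  move=> lv; have h := der_scale (der_L1 O0 (th_neq0 O0 (nlat_scale lv))).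
  rewrite /f; apply: der_eq.
    by apply: derB; [exact: der_wzeta|apply: derB; [apply: derMc; exact: h|dt]].
  by rewrite /= wp_pp //; field.
have : f (- u) = f u by apply: (offlat_const O0 fc) => //; exact: nlatN.
rewrite /f wzeta_opp // (mulNr u) L1_opp // => /eqP; rewrite -subr_eq0 => /eqP h.
apply/eqP; rewrite -subr_eq0 -/(f u); apply/eqP.
have : f u + f u = 0 by apply: oppr_inj; rewrite oppr0 -h /f; ring.
by move=> /eqP; rewrite -mulr2n -mulr_natl mulf_eq0 pnatr_eq0 /= => /eqP.
Qed.

End Weierstrass.

(** * A Gronwall estimate along segments *)

Section Gronwall.
Variable R : realType.
Local Notation C := (Cx R).

Lemma pt_sub (a b : C) (c s : R) : pt a (pt a b c) s = pt a b (s * c).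
Proof. by rewrite /pt ofrM; ring. Qed.

Lemma cabs_slice_cont (f : C -> C) (a b : C) (s : R) : {for pt a b s, continuous f} ->
  {for s, continuous (fun s => cabs (f (pt a b s)))}.
Proof.
move=> /contC H; apply/cvgrPdist_lt => e e0.
have [d d0 Hd] := H e e0.
have L0 : 0 < cabs (b - a) + 1 by rewrite ltr_wpDl ?cabs_ge0.
apply/nbhs_ballP; exists (d / (cabs (b - a) + 1)) => [|h]; first by rewrite /= divr_gt0.
rewrite /ball_ /= ltr_pdivlMr // => hd.
have hh : cabs (pt a b h - pt a b s) < d.
  have -> : pt a b h - pt a b s = ofr (h - s) * (b - a) by rewrite /pt ofrD ofrN; ring.
  rewrite cabsM cabs_ofr distrC; apply: le_lt_trans hd.
  by rewrite ler_wpM2l // lerDl.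
apply: le_lt_trans (Hd _ hh); rewrite distrC ler_norml; apply/andP; split.
  by rewrite lerNl opprB cabsBC; exact: cabs_lowB.
exact: cabs_lowB.
Qed.

(** Let M be the maximum of |f| on the segment. Then M <= |f a| + eps M, so M <= 2 |f a|, and the
    mean value inequality concludes. *)
Lemma gronwall (f f' : C -> C) (a b : C) (eps : R) : 0 <= eps <= 2^-1 ->
  (forall s : R, 0 <= s <= 1 -> {for pt a b s, continuous f}) ->
  (forall s : R, 0 < s < 1 -> der f (pt a b s) (f' (pt a b s))) ->
  (forall s : R, 0 < s < 1 -> cabs (f' (pt a b s) * (b - a)) <= eps * cabs (f (pt a b s))) ->
  cabs (f b - f a) <= 2 * eps * cabs (f a).
Proof.
move=> /andP[e0 e1] hc hd hb.
have [||c cI Hc] := @EVT_max R (fun s => cabs (f (pt a b s))) 0 1; first exact: ler01.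
  apply: continuous_in_subspaceT => s; rewrite inE /= in_itv /= => sI.
  by apply: cabs_slice_cont; exact: hc.
move: cI; rewrite in_itv /= => /andP[c0 c1].
set M := cabs (f (pt a b c)) in Hc.
have HM s : 0 <= s <= 1 -> cabs (f (pt a b s)) <= M by move=> h; apply: Hc; rewrite in_itv.
have M0 : 0 <= M by exact: cabs_ge0.
have sub : cabs (f (pt a b c) - f a) <= eps * M.
  have [cz|cz] := eqVneq c 0; first by rewrite cz pt0 subrr cabs0 mulr_ge0.
  have cp : 0 < c by rewrite lt_def cz.
  apply: (seg_bound (f' := f')) => s sI; rewrite pt_sub.
  - by apply: hc; move: sI => /andP[? ?]; rewrite mulr_ge0 //= -[leRHS]mulr1 ler_pM.
  - apply: hd; move: sI => /andP[? ?]; rewrite mulr_gt0 //=.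
    by apply: lt_le_trans c1; rewrite -[ltRHS]mul1r ltr_pM2r.
  have sc : 0 < s * c < 1.
    move: sI => /andP[? ?]; rewrite mulr_gt0 //=.
    by apply: lt_le_trans c1; rewrite -[ltRHS]mul1r ltr_pM2r.
  have -> : pt a b c - a = ofr c * (b - a) by rewrite /pt; ring.
  rewrite mulrCA cabsM cabs_ofr ger0_norm //.
  apply: (@le_trans _ _ (1 * (eps * M))); last by rewrite mul1r.
  apply: ler_pM; rewrite ?cabs_ge0 //; apply: le_trans (hb _ sc) _.
  by apply: ler_wpM2l => //; apply: HM; move: sc => /andP[? ?]; rewrite !ltW.
have M2 : M <= 2 * cabs (f a).
  have h := cabs_lowB (f (pt a b c)) (f a).
  have h2 : eps * M <= 2^-1 * M by rewrite ler_wpM2r.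
  by rewrite -/M in h; lra.
apply: (@le_trans _ _ (eps * M)).
  apply: (seg_bound (f' := f')) => // s sI; apply: le_trans (hb s sI) _.
  by apply: ler_wpM2l => //; apply: HM; move: sI => /andP[? ?]; rewrite !ltW.
by rewrite -mulrA mulrCA ler_wpM2l.
Qed.

Lemma unit_quot_cont (f : C -> C) : f 0 = 0 -> der f 0 1 ->
  {for 0, continuous (fun u : C => if u == 0 then 1 else u / f u : C)}.
Proof.
move=> f0 /derP hf; apply/contC => e e0.
pose e' := Num.min (2^-1) (e / 4); have e'0 : 0 < e' by rewrite lt_min invr_gt0 ltr0n divr_gt0.
have [d d0 Hd] := hf e' e'0; exists d => // u; rewrite subr0 => ud; rewrite eqxx.
have [_|u0] := eqVneq u 0; first by rewrite subrr cabs0.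
have cu : 0 < cabs u by rewrite cabs_gt0.
have := Hd u ud; rewrite add0r f0 subr0 mul1r => h.
have e1 : e' <= 2^-1 by rewrite ge_min lexx.
have e2 : e' <= e / 4 by rewrite ge_min lexx orbT.
have hb : 2^-1 * cabs u <= cabs (f u).
  have := cabs_lowB u (f u); rewrite cabsBC => h'.
  have : e' * cabs u <= 2^-1 * cabs u by rewrite ler_wpM2r // ltW.
  by move: h h'; lra.
have fp : 0 < cabs (f u) by apply: lt_le_trans hb; rewrite mulr_gt0 // invr_gt0.
have fn : f u != 0 by rewrite -cabs_gt0.
have -> : u / f u - 1 = (u - f u) / f u by field.
rewrite cabsM cabsV ltr_pdivrMr // cabsBC; apply: le_lt_trans h _.
apply: (@le_lt_trans _ _ (e / 2 * cabs (f u))).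
  apply: (@le_trans _ _ (e / 4 * cabs u)); first by rewrite ler_wpM2r // ltW.
  have -> : e / 4 * cabs u = e / 2 * (2^-1 * cabs u) by field.
  by rewrite ler_wpM2l // ltW // divr_gt0.
by rewrite ltr_pM2r //; lra.
Qed.

End Gronwall.

(** * The product for sigma and its theta expression *)

Section Sigma.
Variable R : realType.
Local Notation C := (Cx R).
Variables (w1 w2 eta1 : C).
Hypothesis O0 : 0 < complex.Im (w2 / w1).
Local Notation l := (lat w1 w2).
Local Notation inL := (in_lat w1 w2).
Local Notation Om := (w2 / w1).
Local Notation th := (th11 Om).
Local Notation hp := (half_period w1 w2).
Hypothesis T1 : th 1 0 != 0.
Hypothesis HS : \sum_nu wp w1 w2 (hp nu) = 0.
Hypothesis Heta : forall u, ~ inL u -> wzeta w1 w2 (u + w1) = wzeta w1 w2 u + eta1.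
Local Notation L1 := (logder11 Om).
Local Notation cc := (cc Om).
Let w10 : w1 != 0 := w1_neq0 O0.

Ltac dleaf ::= lazymatch goal with
  | |- der (fun u => cexp (@?f u)) _ _ => apply: der_cexpf; dt
  | |- der (fun u => th11 _ ?k (@?f u)) _ _ => apply: (der_thf O0); dt
  | |- der (th11 _ _) _ _ => exact: (der_th O0)
  end.

(** In [wzeta_L1] the theta part has period w1, so only the linear part changes between u and u +
    w1. *)
Lemma eta1E : eta1 = - (cc / w1).
Proof.
have lc := center_nlat O0; have lw : inL w1 by exists (1, 0); rewrite /lat /= mul0r addr0 mul1r.
have := Heta lc; rewrite !(wzeta_L1 O0 T1 HS) //; last exact: nlatD.
rewrite mulrDl divff // L1_add1 // => /eqP; rewrite -subr_eq0 => /eqP h.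
by apply/eqP; rewrite -subr_eq0; apply/eqP/oppr_inj; rewrite oppr0 -h; field.
Qed.

Definition sigma11 (u : C) : C := w1 / th 1 0 * cexp (eta1 / (2 * w1) * u ^+ 2) * th 0 (u / w1).

Lemma sg_neq0 u : ~ inL u -> sigma11 u != 0.
Proof.
move=> lu; rewrite /sigma11 !mulf_neq0 ?invr_neq0 ?cexp_neq0 //.
by apply: (th_neq0 O0); exact: nlat_scale.
Qed.

Lemma sg_lat u : inL u -> sigma11 u = 0.
Proof. by move=> /(in_lat_scale O0)/(th_zeroP O0) h; rewrite /sigma11 h mulr0. Qed.

Lemma der_sg u : der sigma11 u (w1 / th 1 0 * cexp (eta1 / (2 * w1) * u ^+ 2) *
   (eta1 / w1 * u * th 0 (u / w1) + th 1 (u / w1) / w1)).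
Proof.
have hw : der (fun u => u / w1) u (w1^-1) by apply: der_eq; [apply: derMc; dt|rewrite mul1r].
have h0 := der_thf O0 0 hw.
rewrite /sigma11; apply: der_eq; first by apply: derM; [apply: dercM; dt|exact: h0].
by rewrite /=; field; rewrite w10 T1.
Qed.

Lemma der_sg_zeta u : ~ inL u -> der sigma11 u (sigma11 u * wzeta w1 w2 u).
Proof.
move=> lu; apply: der_eq (der_sg u) _; rewrite (wzeta_L1 O0 T1 HS) // /sigma11 eta1E /logder11.
have h := th_neq0 O0 (nlat_scale O0 lu).
by field; rewrite w10 T1 h.
Qed.

Definition Fac (mn : int * int) (u : C) : C := (1 - u / l mn) * cexp (u / l mn + (u / l mn) ^+ 2 / 2).
Definition PN (N : nat) (u : C) : C := \prod_(mn <- latbox N) Fac mn u.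

Lemma der_Fac mn u : l mn != 0 -> l mn != u -> der (Fac mn) u (Fac mn u * gz w1 w2 mn u).
Proof.
move=> l0 lu; have n0 : u - l mn != 0 by rewrite subr_eq0 eq_sym.
have hw : der (fun u => u / l mn) u ((l mn)^-1) by apply: der_eq; [apply: derMc; dt|rewrite mul1r].
rewrite /Fac; apply: der_eq.
  apply: derM; first by apply: derB; [exact: der_cst|exact: hw].
  apply: der_cexpf; apply: derD; first exact: hw.
  by apply: derMc; apply: derX; exact: hw.
by rewrite /gz /=; field; rewrite n0 l0.
Qed.

Lemma der_prod_Fac (s : seq (int * int)) u :
  (forall mn, mn \in s -> l mn != 0 /\ l mn != u) ->
  der (fun u => \prod_(mn <- s) Fac mn u) u ((\prod_(mn <- s) Fac mn u) * \sum_(mn <- s) gz w1 w2 mn u).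
Proof.
elim: s => [|mn s IH] H.
  apply: (der_ext (f := fun=> 1)); first by move=> v; rewrite big_nil.
  by apply: der_eq (der_cst _ _) _; rewrite !big_nil mulr0.
apply: (der_ext (f := fun v => Fac mn v * \prod_(mn <- s) Fac mn v)); first by move=> v; rewrite big_cons.
have [l0 lu] := H mn (mem_head _ _).
have Hs kl : kl \in s -> l kl != 0 /\ l kl != u by move=> h; apply: H; rewrite inE h orbT.
have IH' := IH Hs.
apply: der_eq; first by apply: derM; [exact: der_Fac|exact: IH'].
by rewrite !big_cons; ring.
Qed.

Lemma mem_latbox N mn : mn \in latbox N -> l mn != 0.
Proof. by rewrite mem_filter lat_eq0 // => /andP[]. Qed.

Definition good u := u = 0 \/ ~ inL u.

Lemma der_PN N u : good u -> der (PN N) u (PN N u * \sum_(mn <- latbox N) gz w1 w2 mn u).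
Proof.
move=> gu; apply: der_prod_Fac => mn hmn; have l0 := mem_latbox hmn; split => //.
by case: gu => [->|/nlat_neq].
Qed.

Lemma sum_boxes N (f : int * int -> C) :
  \sum_(mn <- boxes N) f mn = f (0, 0) + \sum_(mn <- latbox N) f mn.
Proof.
have h : (0, 0) \in boxes N by rewrite mem_boxes.
by rewrite (bigD1_seq _ h (boxes_uniq N)) /= /latbox big_filter.
Qed.

(** Uniform in |u| <= rho, however close u is to the lattice: outside a large box |u / l| <= 1/2,
    hence |u - l|^-1 <= 2 |l|^-1, and the lattice points near u lie inside the box. *)
Lemma gz_tail (rho e : R) : 0 <= rho -> 0 < e -> exists N0 : nat, forall N, (N0 <= N)%N ->
  forall u, ~ inL u -> cabs u <= rho -> cabs (\sum_(mn <- boxes N) gz w1 w2 mn u - wzeta w1 w2 u) <= e.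
Proof.
move=> rho0 e0; have [K K0 [r r0 H]] := inv_bound O0 0.
pose c := 2 * rho ^+ 2 * K ^+ 3.
have c0 : 0 <= c by rewrite !mulr_ge0 ?exprn_ge0 // ltW.
have gp i : 0 <= c * size2 R i ^- 3.
  by rewrite mulr_ge0 // invr_ge0 exprn_ge0 //; apply: le_trans (size2_ge1 _ _).
have [s0 us0 Hs0] := sum_tail gp (size2_sum c0) e0.
have [N1 HN1] := boxes_exhaust s0.
pose N2 := Num.bound (2 * rho * K).
have hN2 : 2 * rho * K < N2%:R by apply: archi_boundP; rewrite !mulr_ge0 // ltW.
exists (maxn N1 N2) => N; rewrite geq_max => /andP[n1 n2] u lu ur.
apply: (has_sum_tail (gz_sum O0 lu) (g := fun mn => c * size2 R mn ^- 3) (s0 := s0) (M := c * 16)) => //.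
- move=> mn; rewrite mem_boxes negb_and -!ltnNge => hmn.
  have n00 : mn != (0, 0) by apply/eqP => z; move: hmn; rewrite z /= !ltn0.
  have l0 : l mn != 0 by rewrite lat_eq0.
  have sN : (N%:R : R) <= size2 R mn.
    rewrite /size2 -[1]/(1%:R) -natrD ler_nat add1n.
    by case/orP: hmn => h; apply: leqW; apply: leq_trans (ltnW h) _; [exact: leq_addr|exact: leq_addl].
  have s0' : 0 < size2 R mn by apply: lt_le_trans (size2_ge1 _ _).
  have sK : 2 * rho * K <= size2 R mn.
    by apply: le_trans sN; apply: le_trans (ltW hN2) _; rewrite ler_nat.
  have b1 : cabs ((l mn)^-1) <= K / size2 R mn.
    have := H mn l0 0; rewrite subrr cabs0 => /(_ r0); rewrite sub0r invrN cabsN; exact.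
  have lu' := nlat_neq mn lu; have aN : u - l mn != 0 by rewrite subr_eq0 eq_sym.
  have ul : cabs (u / l mn) <= 2^-1.
    rewrite cabsM; apply: (@le_trans _ _ (rho * (K / size2 R mn))).
      by apply: ler_pM; rewrite ?cabs_ge0.
    rewrite mulrA ler_pdivrMr // -ler_pdivrMl ?invr_gt0 // invrK.
    by move: sK; rewrite -mulrA.
  have a1 : cabs ((u - l mn)^-1) <= 2 * cabs ((l mn)^-1).
    have -> : (u - l mn)^-1 = (l mn)^-1 * (u / l mn - 1)^-1.
      have -> : u / l mn - 1 = (u - l mn) / l mn by field.
      by rewrite invfM invrK mulrA mulrAC mulVf // mul1r.
    have h : 2^-1 <= cabs (u / l mn - 1).
      by have := cabs_lowB 1 (u / l mn); rewrite cabs1 cabsBC; lra.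
    rewrite cabsM (cabsV (u / l mn - 1)) mulrC ler_wpM2r ?cabs_ge0 //.
    rewrite -[leRHS]invrK lef_pV2 ?posrE // ?invr_gt0 //.
    by apply: lt_le_trans h; rewrite invr_gt0.
  have -> : gz w1 w2 mn u = u ^+ 2 * ((u - l mn)^-1 * ((l mn)^-1 * (l mn)^-1)).
    by rewrite /gz; field; rewrite aN l0.
  rewrite cabsM cabsX !cabsM.
  have Q : cabs ((u - l mn)^-1) * (cabs ((l mn)^-1) * cabs ((l mn)^-1)) <= 2 * (K ^+ 3 * size2 R mn ^- 3).
    apply: (@le_trans _ _ (2 * (K / size2 R mn) * (K / size2 R mn * (K / size2 R mn)))).
      apply: ler_pM; rewrite ?mulr_ge0 ?cabs_ge0 //.
        by apply: le_trans a1 _; rewrite ler_wpM2l.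
      by apply: ler_pM; rewrite ?cabs_ge0.
    by rewrite le_eqVlt; apply/orP; left; apply/eqP; field; rewrite gt_eqF.
  apply: (@le_trans _ _ (rho ^+ 2 * (2 * (K ^+ 3 * size2 R mn ^- 3)))).
    apply: ler_pM => //; rewrite ?mulr_ge0 ?exprn_ge0 ?cabs_ge0 //.
    by apply: lerXn2r; rewrite ?nnegrE ?cabs_ge0.
  by rewrite le_eqVlt; apply/orP; left; apply/eqP; rewrite /c; ring.
- exact: boxes_uniq.
- exact: HN1.
exact: size2_sum.
Qed.

Definition kq (u : C) : C := if u == 0 then 1 else u / sigma11 u.
(** The partial product of sigma divided by [sigma11]. Its value at 0 is 1 and its logarithmic
    derivative is the truncation error of the zeta series, so it tends to 1 along any path from 0 on
    which [gronwall] applies. *)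
Definition RN (N : nat) (u : C) : C := PN N u * kq u.

Lemma nlat_n0 u : ~ inL u -> u != 0.
Proof. by move=> h; apply/eqP => e; apply: h; rewrite e; exact: in_lat0. Qed.

Lemma der_kq u : ~ inL u -> der kq u (kq u * (u^-1 - wzeta w1 w2 u)).
Proof.
move=> lu; have u0 := nlat_n0 lu; have s0 := sg_neq0 lu.
apply: (der_near (f := fun v => v / sigma11 v)).
  have := near_nlat O0 (c := 0) (a := u); rewrite addr0 => /(_ lu); apply: filterS => v.
  by rewrite addr0 => /nlat_n0 v0; rewrite /kq (negbTE v0).
apply: der_eq; first exact: (der_div s0 (der_id u) (der_sg_zeta lu)).
by rewrite /kq (negbTE u0); field; rewrite u0 s0.
Qed.

Lemma kq_cont u : good u -> {for u, continuous kq}.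
Proof.
case=> [->|lu]; last exact: (der_cont (der_kq lu)).
apply: unit_quot_cont; first by apply: sg_lat; exact: in_lat0.
apply: der_eq (der_sg 0) _.
by rewrite mul0r th00 // expr0n /= !mulr0 cexp0; field; rewrite w10 T1.
Qed.

Lemma RN_cont N u : good u -> {for u, continuous (RN N)}.
Proof. by move=> gu; apply: continuousM; [exact: (der_cont (der_PN N gu))|exact: kq_cont]. Qed.

Lemma der_RN N u : ~ inL u ->
  der (RN N) u (RN N u * (\sum_(mn <- boxes N) gz w1 w2 mn u - wzeta w1 w2 u)).
Proof.
move=> lu; have gu : good u by right.
rewrite /RN; apply: der_eq; first by apply: derM; [exact: der_PN|exact: der_kq].
rewrite sum_boxes; have -> : gz w1 w2 (0, 0) u = u^-1.
  by rewrite /gz lat00 subr0 expr0n /= invr0 mulr0 !addr0.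
by ring.
Qed.

Lemma RN_step (a b : C) :
  (forall s : R, 0 <= s <= 1 -> good (pt a b s)) ->
  (forall s : R, 0 < s < 1 -> ~ inL (pt a b s)) ->
  RN N a @[N --> \oo] --> (1 : C) -> RN N b @[N --> \oo] --> (1 : C).
Proof.
move=> hg hl /cvgC ha; apply/cvgC => e e0.
pose rho := cabs a + cabs (b - a); pose c := cabs (b - a) + 1.
have rho0 : 0 <= rho by rewrite addr_ge0 ?cabs_ge0.
have c0 : 0 < c by rewrite ltr_wpDl ?cabs_ge0.
pose eps := Num.min 2^-1 (e / 8).
have eps0 : 0 < eps by rewrite lt_min invr_gt0 ltr0n divr_gt0.
have eps1 : eps <= 2^-1 by rewrite ge_min lexx.
have eps2 : eps <= e / 8 by rewrite ge_min lexx orbT.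
have [N0 HN0] := gz_tail rho0 (divr_gt0 eps0 c0).
have e2 : 0 < Num.min 1 (e / 2) by rewrite lt_min ltr01 divr_gt0.
have := ha _ e2; case=> N1 _ HN1.
exists (maxn N0 N1) => // N /=; rewrite geq_max => /andP[n0 n1].
have := HN1 N n1; rewrite /= lt_min => /andP[h1 h2].
have G : cabs (RN N b - RN N a) <= 2 * eps * cabs (RN N a).
  apply: (gronwall (f' := fun u => RN N u * (\sum_(mn <- boxes N) gz w1 w2 mn u - wzeta w1 w2 u))).
  - by rewrite ltW.
  - by move=> s sI; apply: RN_cont; exact: hg.
  - by move=> s sI; apply: der_RN; exact: hl.
  move=> s sI; rewrite -mulrA cabsM mulrC ler_wpM2r ?cabs_ge0 // cabsM.
  have ps : cabs (pt a b s) <= rho.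
    rewrite /pt; apply: le_trans (cabsD _ _) _; rewrite lerD2l cabsM cabs_ofr.
    move: sI => /andP[s0 s1]; rewrite gtr0_norm // -[leRHS]mul1r ler_wpM2r ?cabs_ge0 //.
    exact: ltW.
  have := HN0 N n0 _ (hl s sI) ps => h.
  apply: (@le_trans _ _ (eps / c * c)); last by rewrite divfK // gt_eqF.
  by apply: ler_pM; rewrite ?cabs_ge0 // /c lerDl.
have h3 : cabs (RN N a) <= 2.
  by have := cabs_lowB (RN N a) 1; rewrite cabs1; lra.
have h4 : 2 * eps * cabs (RN N a) <= 4 * eps.
  have : eps * cabs (RN N a) <= eps * 2 by rewrite ler_wpM2l // ltW.
  by lra.
apply: le_lt_trans (cabsDB _ _ (RN N a)) _; lra.
Qed.

(** The path leads from 0 to the center of the cell and from there to u as in [offlat_path]; its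
    starting point is its only lattice point. *)
Lemma RN_lim u : ~ inL u -> RN N u @[N --> \oo] --> (1 : C).
Proof.
move=> lu; have [v [h1 h2]] := offlat_path O0 lu.
have it (s : R) : 0 < s < 1 -> 0 <= s <= 1 by move=> /andP[? ?]; rewrite !ltW.
apply: (RN_step (a := v)) => [s sI|s sI|]; first by right; exact: h2.
  by apply: h2; exact: it.
apply: (RN_step (a := lat_center w1 w2)) => [s sI|s sI|]; first by right; exact: h1.
  by apply: h1; exact: it.
have seg (s : R) : 0 < s <= 1 -> ~ inL (pt 0 (lat_center w1 w2) s).
  move=> /andP[s0 s1]; have -> : (0 : C) = plan w1 w2 0 0 by rewrite /plan /= !mul0r addr0.
  rewrite /lat_center plan_pt => /(in_lat_plan O0)[m [n [hm _]]].
  move: hm; rewrite add0r subr0 => hm.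
  have h0 : 0 < (m%:~R : R) by rewrite -hm; lra.
  have h3 : (m%:~R : R) < 1 by rewrite -hm; lra.
  move: h0 h3; rewrite ltr0z ltrz1; lia.
apply: (RN_step (a := 0)) => [s /andP[s0 s1]|s /andP[s0 s1]|].
- have [->|sn] := eqVneq s 0; first by left; rewrite pt0.
  by right; apply: seg; rewrite lt_def sn s0.
- by apply: seg; rewrite s0 ltW.
apply: cvg_near_cst; near=> N; rewrite /RN /kq eqxx mulr1 /PN big1_seq // => mn _.
by rewrite /Fac mul0r subr0 expr0n /= mul0r addr0 cexp0 mulr1.
Unshelve. all: by end_near. Qed.

Lemma wsigmaE u : wsigma w1 w2 u = sigma11 u.
Proof.
rewrite /wsigma; have [lu|lu] := pselect (inL u); last first.
  have u0 := nlat_n0 lu; have s0 := sg_neq0 lu.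
  have /(cvg_lim) h : PN N u @[N --> \oo] --> sigma11 u / u.
    have := RN_lim lu => /cvgC H; apply/cvgC => e e0.
    have cs : 0 < cabs (sigma11 u / u) by rewrite cabs_gt0 mulf_neq0 // invr_neq0.
    have := H _ (divr_gt0 e0 cs); apply: filterS => N.
    rewrite /RN /kq (negbTE u0) ltr_pdivlMr // -cabsM.
    by have -> : (PN N u * (u / sigma11 u) - 1) * (sigma11 u / u) = PN N u - sigma11 u / u by field; rewrite s0 u0.
  by rewrite /PN /Fac in h; rewrite h // mulrC divfK.
rewrite sg_lat //; have [->|u0] := eqVneq u 0; first by rewrite mul0r.
have [kl e] := lu; have k0 : kl != (0, 0) by rewrite -(lat_eq0 O0) -e.
have /cvg_lim h : PN N u @[N --> \oo] --> (0 : C).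
  apply: cvg_near_cst; have [N0 H] := boxes_exhaust [:: kl].
  exists N0 => // N /= /H hN; have kN := hN kl (mem_head _ _).
  have kb : kl \in latbox N by rewrite mem_filter k0.
  rewrite /PN (big_rem _ kb) /= {1}/Fac e divff ?subrr ?mul0r //.
  by rewrite -e.
by rewrite /PN /Fac in h; rewrite h // mulr0.
Qed.

Lemma theta11'E : theta11' Om = th 1 0.
Proof.
rewrite /theta11'; apply: der_derive1.
by apply: (der_ext _ (der_th O0 0 0)) => v; rewrite thetaE.
Qed.

Lemma sigma_pqE p q u : sigma_pq w1 w2 eta1 p q u =
  w1 / th 1 0 * cexp (eta1 / (2 * w1) * u ^+ 2) * Th 0 p q (u / w1) Om.
Proof. by rewrite /sigma_pq theta11'E thetaE //; ring. Qed.

End Sigma.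

(** * Primitives and integrals of complex functions of a real variable *)

Section RealPrimitive.
Variable R : realType.
Local Notation C := (Cx R).

Definition rder (G : R -> C) (x : R) (l : C) := forall e : R, 0 < e ->
  exists2 d : R, 0 < d & forall h, `|h| < d -> cabs (G (x + h) - G x - l * ofr h) <= e * `|h|.
Definition rcont (g : R -> C) := forall x e : R, 0 < e ->
  exists2 d : R, 0 < d & forall y, `|y - x| < d -> cabs (g y - g x) < e.

Lemma rderB G H x l m : rder G x l -> rder H x m -> rder (fun y => G y - H y) x (l - m).
Proof.
move=> hG hH e e0; have e2 : 0 < e / 2 by rewrite divr_gt0.
have [d d0 Hd] := hG _ e2; have [d' d'0 Hd'] := hH _ e2.
exists (Num.min d d'); first by rewrite lt_min d0.
move=> h; rewrite lt_min => /andP[h1 h2].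
have -> : G (x + h) - H (x + h) - (G x - H x) - (l - m) * ofr h =
  (G (x + h) - G x - l * ofr h) - (H (x + h) - H x - m * ofr h) by ring.
apply: le_trans (cabsB _ _) _; rewrite [e]splitr mulrDl; apply: lerD; [exact: Hd|exact: Hd'].
Qed.

Lemma rderZ c G x l : rder G x l -> rder (fun y => c * G y) x (c * l).
Proof.
move=> hG e e0; have c0 : 0 < cabs c + 1 by rewrite ltr_wpDl ?cabs_ge0.
have [d d0 Hd] := hG _ (divr_gt0 e0 c0); exists d => // h hd.
have -> : c * G (x + h) - c * G x - c * l * ofr h = c * (G (x + h) - G x - l * ofr h) by ring.
rewrite cabsM; apply: (@le_trans _ _ ((cabs c + 1) * (e / (cabs c + 1) * `|h|))).
  by apply: ler_pM; rewrite ?cabs_ge0 ?lerDl //; exact: Hd.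
by rewrite mulrA mulrCA divff ?mulr1 // gt_eqF.
Qed.

Lemma rder_re G w x l : rder G x l ->
  is_derive x 1 (fun y => complex.Re (w * G y)) (complex.Re (w * l)).
Proof.
move=> hG; apply: is_derive_realP => e e0.
have [d d0 Hd] := rderZ w hG e0; exists d => // h hd.
apply: le_trans (Hd h hd).
have -> : complex.Re (w * G (x + h)) - complex.Re (w * G x) - complex.Re (w * l) * h =
  complex.Re (w * G (x + h) - w * G x - w * l * ofr h).
  by rewrite !cReD !cReN [complex.Re (w * l * ofr h)]cReM /=; ring.
exact: Re_le.
Qed.

Lemma rseg (G g : R -> C) (a b M : R) : a <= b ->
  (forall x, a <= x <= b -> rder G x (g x)) -> (forall x, a <= x <= b -> cabs (g x) <= M) ->
  cabs (G b - G a) <= M * (b - a).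
Proof.
rewrite le_eqVlt => /orP[/eqP <- _ _|ab hd hM]; first by rewrite !subrr cabs0 mulr0.
pose v := G b - G a; have [v0|v0] := eqVneq v 0.
  rewrite -/v v0 cabs0 mulr_ge0 ?subr_ge0 ?(ltW ab) //.
  by apply: le_trans (cabs_ge0 (g a)) (hM _ _); rewrite lexx ltW.
pose w := (v^*)%C * ofr (cabs v)^-1.
have v1 : 0 < cabs v by rewrite cabs_gt0.
have w1 : cabs w = 1.
  rewrite cabsM cabs_ofr normfV (ger0_norm (cabs_ge0 _)).
  have -> : cabs ((v^*)%C : C) = cabs v by rewrite /cabs normcJ.
  by rewrite mulfV // gt_eqF.
have wv : w * v = ofr (cabs v) by rewrite /w mulrAC conjM -ofrM expr2 mulfK // gt_eqF.
have [||c cI H] := @MVT R (fun s => complex.Re (w * G s)) (fun s => complex.Re (w * g s)) a b ab.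
- move=> s; rewrite in_itv /= => /andP[h1 h2]; apply: rder_re; apply: hd.
  by rewrite !ltW.
- apply: derivable_within_continuous => s; rewrite in_itv /= => sI.
  by have [] := rder_re w (hd s sI).
move: H; have -> : complex.Re (w * G b) - complex.Re (w * G a) = complex.Re (w * v).
  by rewrite /v mulrBr cReD cReN.
rewrite wv /= -/v => ->; rewrite ler_wpM2r ?subr_ge0 ?(ltW ab) //.
apply: (le_trans (ler_norm _)); apply: (le_trans (Re_le _)).
rewrite cabsM w1 mul1r; apply: hM; move: cI; rewrite in_itv /= => /andP[h1 h2].
by rewrite !ltW.
Qed.

Lemma rder_rcont G g : (forall x, rder G x (g x)) -> rcont G.
Proof.
move=> hG x e e0; have [d d0 Hd] := hG x 1 ltr01.
have c0 : 0 < cabs (g x) + 1 by rewrite ltr_wpDl ?cabs_ge0.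
exists (Num.min d (e / (cabs (g x) + 1))); first by rewrite lt_min d0 divr_gt0.
move=> y; rewrite lt_min ltr_pdivlMr // => /andP[h1 h2].
have := Hd (y - x) h1; rewrite (addrC x) subrK mul1r => h.
have := cabs_lowB (G y - G x) (g x * ofr (y - x)); rewrite cabsM cabs_ofr => h3.
apply: le_lt_trans h2; rewrite mulrDr mulr1 mulrC; lra.
Qed.

Lemma rder_of_der (F : C -> C) (p : R -> C) (v l : C) x :
  (forall h, p (x + h) = p x + ofr h * v) -> der F (p x) l -> rder (fun s => F (p s)) x (l * v).
Proof.
move=> hp /derP hF e e0; have c0 : 0 < cabs v + 1 by rewrite ltr_wpDl ?cabs_ge0.
have [d d0 Hd] := hF _ (divr_gt0 e0 c0); exists (d / (cabs v + 1)); first by rewrite divr_gt0.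
move=> h; rewrite ltr_pdivlMr // => hd.
have hv : cabs (ofr h * v) <= `|h| * (cabs v + 1).
  by rewrite cabsM cabs_ofr ler_wpM2l // lerDl.
have := Hd (ofr h * v) (le_lt_trans hv hd); rewrite -hp.
have -> : l * (ofr h * v) = l * v * ofr h by ring.
move=> /le_trans; apply; rewrite mulrAC ler_pdivrMr // -mulrA ler_wpM2l // ltW //.
Qed.

Lemma prim_ex_re (A : R) (g : R -> R) : continuous g ->
  exists G : R -> R, forall x, A < x -> is_derive x 1 G (g x).
Proof.
move=> gc; exists (fun x => (\int[lebesgue_measure]_(t in [set` `[A, x]]) (g t))%R) => x Ax.
have xu : x < x + 1 by rewrite ltrDl.
have [|h1 h2] := @continuous_FTC1_closed R g A x (x + 1) xu _ Ax (gc x).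
  apply: continuous_compact_integrable; first exact: segment_compact.
  exact: continuous_subspaceT.
by apply: DeriveDef; [exact: h1|rewrite -derive1E; exact: h2].
Qed.

Lemma prim_ex (A : R) (g : R -> C) : rcont g -> exists G : R -> C, forall x, A < x -> rder G x (g x).
Proof.
move=> gc.
have cre : continuous (fun x => complex.Re (g x)).
  move=> x; apply/cvgrPdist_lt => e e0; have [d d0 Hd] := gc x e e0.
  apply/nbhs_ballP; exists d => // y; rewrite /ball_ /= distrC => /Hd h.
  apply: le_lt_trans h; rewrite distrC -cReN -cReD; exact: Re_le.
have cim : continuous (fun x => complex.Im (g x)).
  move=> x; apply/cvgrPdist_lt => e e0; have [d d0 Hd] := gc x e e0.
  apply/nbhs_ballP; exists d => // y; rewrite /ball_ /= distrC => /Hd h.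
  apply: le_lt_trans h; rewrite distrC -cImN -cImD; exact: Im_le.
have [G1 H1] := prim_ex_re A cre; have [G2 H2] := prim_ex_re A cim.
exists (fun x => Complex (G1 x) (G2 x)) => x Ax e e0.
have e2 : 0 < e / 2 by rewrite divr_gt0.
have [d d0 Hd] := is_derive_realE (H1 x Ax) e2; have [d' d'0 Hd'] := is_derive_realE (H2 x Ax) e2.
exists (Num.min d d'); first by rewrite lt_min d0.
move=> h; rewrite lt_min => /andP[h1 h2].
apply: le_trans (cabs_le _) _; rewrite [e]splitr mulrDl; apply: lerD.
  apply: le_trans (Hd h h1); rewrite !cReD !cReN cReM /= mulr0 subr0; exact: lexx.
apply: le_trans (Hd' h h2); rewrite !cImD !cImN cImM /= mulr0 add0r; exact: lexx.
Qed.

Section Integral.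
Variable A : R.

Definition prim (g G : R -> C) := forall x, A < x -> rder G x (g x).
(** The integral is the increment of a chosen primitive on the half-line beyond A. Additivity over
    intervals is then immediate, and existence is the fundamental theorem of calculus for the real
    and imaginary parts. *)
Definition cint (g : R -> C) (a b : R) : C :=
  let G := xget (fun=> 0) [set G | prim g G] in G b - G a.

Lemma prim_uniq g G H a b : prim g G -> prim g H -> A < a -> A < b -> G b - G a = H b - H a.
Proof.
move=> hG hH Aa Ab; wlog ab : a b Aa Ab / a <= b => [W|].
  have [/W|/ltW /W W'] := leP a b; first exact.
  by rewrite -[LHS]opprB -[RHS]opprB W'.
apply/eqP; rewrite -subr_eq0 -cabs_eq0 eq_le cabs_ge0 andbT.
have -> : G b - G a - (H b - H a) = (G b - H b) - (G a - H a) by ring.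
have X : cabs ((fun y => G y - H y) b - (fun y => G y - H y) a) <= 0 * (b - a).
  apply: (rseg (G := fun y => G y - H y) (g := fun y => g y - g y)) => // x /andP[ax _]; last by rewrite subrr cabs0.
  have Ax : A < x by apply: lt_le_trans ax.
  by apply: rderB; [exact: hG|exact: hH].
by move: X; rewrite mul0r.
Qed.

Lemma cint_fund g G a b : prim g G -> A < a -> A < b -> cint g a b = G b - G a.
Proof.
move=> hG Aa Ab; rewrite /cint; case: xgetP => [H _ hH|/(_ G)]; last by case.
exact: (prim_uniq hH hG).
Qed.

Lemma cint_prim g : rcont g -> exists2 G, prim g G & forall a b, cint g a b = G b - G a.
Proof.
move=> /(prim_ex A)[G0 hG0]; rewrite /cint; case: xgetP => [G _ hG|/(_ G0)]; last by case.
by exists G.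
Qed.

Lemma cint_cat g a m b : cint g a m + cint g m b = cint g a b.
Proof. by rewrite /cint addrC addrA subrK. Qed.

Lemma cint_bound g a b M : rcont g -> A < a -> a <= b ->
  (forall x, a <= x <= b -> cabs (g x) <= M) -> cabs (cint g a b) <= M * (b - a).
Proof.
move=> /cint_prim[G hG ->] Aa ab hM; apply: (rseg (g := g)) => // x /andP[ax _].
by apply: hG; apply: lt_le_trans ax.
Qed.

Lemma cintB f g a b : rcont f -> rcont g -> A < a -> A < b ->
  cint (fun x => f x - g x) a b = cint f a b - cint g a b.
Proof.
move=> /cint_prim[F hF ->] /cint_prim[G hG ->] Aa Ab.
rewrite (cint_fund (G := fun x => F x - G x)) //; first by ring.
by move=> x Ax; apply: rderB; [exact: hF|exact: hG].
Qed.

Lemma cintZ c g a b : rcont g -> A < a -> A < b -> cint (fun x => c * g x) a b = c * cint g a b.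
Proof.
move=> /cint_prim[G hG ->] Aa Ab.
rewrite (cint_fund (G := fun x => c * G x)) //; first by ring.
by move=> x Ax; apply: rderZ; exact: hG.
Qed.

End Integral.

Lemma rcontB f g : rcont f -> rcont g -> rcont (fun x => f x - g x).
Proof.
move=> hf hg x e e0; have e2 : 0 < e / 2 by rewrite divr_gt0.
have [d d0 Hd] := hf x _ e2; have [d' d'0 Hd'] := hg x _ e2.
exists (Num.min d d'); first by rewrite lt_min d0.
move=> y; rewrite lt_min => /andP[h1 h2].
have -> : f y - g y - (f x - g x) = (f y - f x) - (g y - g x) by ring.
by apply: le_lt_trans (cabsB _ _) _; rewrite [e]splitr; apply: ltrD; [exact: Hd|exact: Hd'].
Qed.

Lemma rcontZ c f : rcont f -> rcont (fun x => c * f x).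
Proof.
move=> hf x e e0; have c0 : 0 < cabs c + 1 by rewrite ltr_wpDl ?cabs_ge0.
have [d d0 Hd] := hf x _ (divr_gt0 e0 c0); exists d => // y /Hd hy.
rewrite -mulrBr cabsM; move: hy; rewrite ltr_pdivlMr // => hy; apply: le_lt_trans hy.
by rewrite mulrC ler_wpM2l ?cabs_ge0 // lerDl.
Qed.

Lemma rder_quad (u v : C) x : rder (fun x => ofr x * u + ofr (x ^+ 2) * v) x (u + 2 * (ofr x * v)).
Proof.
move=> e e0; have c0 : 0 < cabs v + 1 by rewrite ltr_wpDl ?cabs_ge0.
exists (e / (cabs v + 1)); first by rewrite divr_gt0.
move=> h; rewrite ltr_pdivlMr // => hd.
have -> : ofr (x + h) * u + ofr ((x + h) ^+ 2) * v - (ofr x * u + ofr (x ^+ 2) * v)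
   - (u + 2 * (ofr x * v)) * ofr h = ofr h * ofr h * v.
  by rewrite !expr2 !ofrM !ofrD; ring.
rewrite !cabsM !cabs_ofr mulrAC; apply: ler_wpM2r => //.
by apply: le_trans (ltW hd); rewrite ler_wpM2l // lerDl.
Qed.

Lemma rcont_aff (u v : C) : rcont (fun x => u + ofr x * v).
Proof.
move=> x e e0; have c0 : 0 < cabs v + 1 by rewrite ltr_wpDl ?cabs_ge0.
exists (e / (cabs v + 1)); first by rewrite divr_gt0.
move=> y; rewrite ltr_pdivlMr // => hd.
have -> : u + ofr y * v - (u + ofr x * v) = ofr (y - x) * v by rewrite ofrD ofrN; ring.
rewrite cabsM cabs_ofr; apply: le_lt_trans hd.
by rewrite ler_wpM2l // lerDl.
Qed.

Lemma cint_aff A (u v : C) a b : A < a -> A < b ->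
  cint A (fun x => u + ofr x * v) a b =
  (ofr b * u + ofr (b ^+ 2) * (v / 2)) - (ofr a * u + ofr (a ^+ 2) * (v / 2)).
Proof.
move=> Aa Ab; apply: (cint_fund (G := fun x => ofr x * u + ofr (x ^+ 2) * (v / 2))) => // x _.
have -> : u + ofr x * v = u + 2 * (ofr x * (v / 2)) by field.
exact: rder_quad.
Qed.

End RealPrimitive.

(** * Goursat's theorem for rectangles *)

Section Goursat.
Variable R : realType.
Local Notation C := (Cx R).
Variables (A B : R) (V : R -> R -> C).
Hypothesis Vx : forall y, rcont (V^~ y).
Hypothesis Vy : forall x, rcont (V x).
Local Notation iC := (Complex 0 1 : C).

(** The counterclockwise integral of V dz, with dz = i dy on the vertical sides. *)
Definition bdry (a b c d : R) : C :=
  cint A (V^~ c) a b + iC * cint B (V b) c d - cint A (V^~ d) a b - iC * cint B (V a) c d.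

Lemma bdry_split_x a m b c d : bdry a b c d = bdry a m c d + bdry m b c d.
Proof. by rewrite /bdry -(cint_cat A (V^~ c) a m b) -(cint_cat A (V^~ d) a m b); ring. Qed.

Lemma bdry_split_y a b c m d : bdry a b c d = bdry a b c m + bdry a b m d.
Proof. by rewrite /bdry -(cint_cat B (V b) c m d) -(cint_cat B (V a) c m d); ring. Qed.

(** The affine part integrates exactly to 0 around the rectangle; the remainder is at most e s on a
    boundary of length 2 s. *)
Lemma bdry_local (a b c d x0 y0 e s : R) (al be : C) :
  A < a -> B < c -> a <= x0 <= b -> c <= y0 <= d -> 0 <= e -> s = (b - a) + (d - c) ->
  (forall x y, a <= x <= b -> c <= y <= d ->
     cabs (V x y - (al + be * (ofr x + iC * ofr y))) <= e * s) ->
  cabs (bdry a b c d) <= 2 * e * s ^+ 2.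
Proof.
move=> Aa Bc /andP[ax xb] /andP[cy yd] e0 es H.
have ab : a <= b by apply: le_trans xb. have cd : c <= d by apply: le_trans yd.
have Ab : A < b by apply: lt_le_trans ab. have Bd : B < d by apply: lt_le_trans cd.
pose hx y := fun x => (al + be * (iC * ofr y)) + ofr x * be.
pose hy x := fun y => (al + be * ofr x) + ofr y * (be * iC).
have Ex y : a <= a -> cint A (V^~ y) a b = cint A (fun x => V x y - hx y x) a b + cint A (hx y) a b.
  by move=> _; rewrite cintB ?subrK //; exact: rcont_aff.
have Ey x : cint B (V x) c d = cint B (fun y => V x y - hy x y) c d + cint B (hy x) c d.
  by rewrite cintB ?subrK //; exact: rcont_aff.
have bx y : c <= y <= d -> cabs (cint A (fun x => V x y - hx y x) a b) <= e * s * (b - a).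
  move=> hy'; apply: cint_bound => //; first by apply: rcontB => //; exact: rcont_aff.
  move=> x hx'; apply: le_trans (H x y hx' hy'); rewrite /hx.
  by rewrite le_eqVlt; apply/orP; left; apply/eqP; congr cabs; ring.
have bY x : a <= x <= b -> cabs (cint B (fun y => V x y - hy x y) c d) <= e * s * (d - c).
  move=> hx'; apply: cint_bound => //; first by apply: rcontB => //; exact: rcont_aff.
  move=> y hy'; apply: le_trans (H x y hx' hy'); rewrite /hy.
  by rewrite le_eqVlt; apply/orP; left; apply/eqP; congr cabs; ring.
have -> : bdry a b c d = cint A (fun x => V x c - hx c x) a b
   + iC * cint B (fun y => V b y - hy b y) c d
   - cint A (fun x => V x d - hx d x) a b - iC * cint B (fun y => V a y - hy a y) c d.
  by rewrite /bdry !Ex // !Ey !cint_aff //; field.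
have ci z : cabs (iC * z) = cabs z.
  rewrite cabsM; have -> : cabs iC = 1; last by rewrite mul1r.
  by apply/eqP; rewrite -(@eqrXn2 _ 2) ?cabs_ge0 // cabs_sq /= expr0n expr1n add0r.
have I1 : c <= c <= d by rewrite lexx. have I2 : c <= d <= d by rewrite cd lexx.
have I3 : a <= a <= b by rewrite lexx. have I4 : a <= b <= b by rewrite ab lexx.
have T4 (p q r v : C) : cabs (p + iC * q - r - iC * v) <= cabs p + cabs q + cabs r + cabs v.
  have := cabsB (p + iC * q - r) (iC * v); have := cabsB (p + iC * q) r; have := cabsD p (iC * q).
  by rewrite !ci; lra.
apply: le_trans (T4 _ _ _ _) _.
apply: (@le_trans _ _ (e * s * (b - a) + e * s * (d - c) + e * s * (b - a) + e * s * (d - c))).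
  apply: lerD; last exact: bY.
  apply: lerD; last exact: bx.
  by apply: lerD; [exact: bx|exact: bY].
by rewrite le_eqVlt; apply/orP; left; apply/eqP; rewrite es; ring.
Qed.

Variables (a0 b0 c0 d0 : R).
Hypotheses (Aa : A < a0) (Bc : B < c0) (ab : a0 <= b0) (cd : c0 <= d0).
Hypothesis HD : forall x0 y0, a0 <= x0 <= b0 -> c0 <= y0 <= d0 -> exists al be : C,
  forall e : R, 0 < e -> exists2 dl : R, 0 < dl & forall x y, a0 <= x <= b0 -> c0 <= y <= d0 ->
    `|x - x0| + `|y - y0| < dl ->
    cabs (V x y - (al + be * (ofr x + iC * ofr y))) <= e * (`|x - x0| + `|y - y0|).

Let wd (n : nat) : R := (b0 - a0) / 2 ^+ n.
Let ht (n : nat) : R := (d0 - c0) / 2 ^+ n.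
Let Q n (p : R * R) : C := bdry p.1 (p.1 + wd n) p.2 (p.2 + ht n).

Let halfE (X : R) n : X / 2 ^+ n = X / 2 ^+ n.+1 + X / 2 ^+ n.+1.
Proof. by rewrite exprS; field; rewrite expf_neq0. Qed.

Let quarter n p : exists q : R * R,
  [/\ p.1 <= q.1, q.1 + wd n.+1 <= p.1 + wd n, p.2 <= q.2, q.2 + ht n.+1 <= p.2 + ht n
    & cabs (Q n p) <= 4 * cabs (Q n.+1 q)].
Proof.
case: p => x y; have w0 : 0 <= wd n.+1 by rewrite divr_ge0 ?subr_ge0.
have h0 : 0 <= ht n.+1 by rewrite divr_ge0 ?subr_ge0.
have wE : wd n = wd n.+1 + wd n.+1 := halfE _ _. have hE : ht n = ht n.+1 + ht n.+1 := halfE _ _.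
have E : Q n (x, y) = Q n.+1 (x, y) + Q n.+1 (x, y + ht n.+1) +
   (Q n.+1 (x + wd n.+1, y) + Q n.+1 (x + wd n.+1, y + ht n.+1)).
  rewrite /Q /= wE hE (bdry_split_x x (x + wd n.+1)).
  rewrite (bdry_split_y x (x + wd n.+1) y (y + ht n.+1)).
  by rewrite (bdry_split_y (x + wd n.+1) _ y (y + ht n.+1)) !addrA.
apply: contrapT => no.
have lt i j : i \in [:: 0; wd n.+1] -> j \in [:: 0; ht n.+1] ->
    4 * cabs (Q n.+1 (x + i, y + j)) < cabs (Q n (x, y)).
  move=> hi hj; rewrite ltNge; apply/negP => h; apply: no; exists (x + i, y + j).
  move: hi hj h; rewrite !inE => /orP[] /eqP -> /orP[] /eqP -> h; split => //=; rewrite ?wE ?hE; lra.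
have m1 : 0 \in [:: 0; wd n.+1] by rewrite mem_head.
have m2 : wd n.+1 \in [:: 0; wd n.+1] by rewrite !inE eqxx orbT.
have m3 : 0 \in [:: 0; ht n.+1] by rewrite mem_head.
have m4 : ht n.+1 \in [:: 0; ht n.+1] by rewrite !inE eqxx orbT.
have := lt _ _ m1 m3; have := lt _ _ m1 m4; have := lt _ _ m2 m3; have := lt _ _ m2 m4.
rewrite !addr0 => h1 h2 h3 h4.
have := cabsD (Q n.+1 (x, y) + Q n.+1 (x, y + ht n.+1))
  (Q n.+1 (x + wd n.+1, y) + Q n.+1 (x + wd n.+1, y + ht n.+1)); rewrite -E.
have := cabsD (Q n.+1 (x, y)) (Q n.+1 (x, y + ht n.+1)).
have := cabsD (Q n.+1 (x + wd n.+1, y)) (Q n.+1 (x + wd n.+1, y + ht n.+1)).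
by move: h1 h2 h3 h4; lra.
Qed.

Let nxt n p : R * R := projT1 (cid (quarter n p)).
Let pos : nat -> R * R := fix pos n := if n is m.+1 then nxt m (pos m) else (a0, c0).

Let posP n : [/\ (pos n).1 <= (pos n.+1).1, (pos n.+1).1 + wd n.+1 <= (pos n).1 + wd n,
  (pos n).2 <= (pos n.+1).2, (pos n.+1).2 + ht n.+1 <= (pos n).2 + ht n
  & cabs (Q n (pos n)) <= 4 * cabs (Q n.+1 (pos n.+1))].
Proof. by rewrite /= /nxt; case: cid. Qed.

Lemma nested_point (u w : nat -> R) : (forall n, u n <= u n.+1) ->
  (forall n, u n.+1 + w n.+1 <= u n + w n) -> (forall n, 0 <= w n) ->
  exists x, forall n, u n <= x <= u n + w n.
Proof.
move=> hu hw w0.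
have mu n k : u n <= u (n + k)%N.
  by elim: k => [|k IH]; rewrite ?addn0 // addnS; apply: le_trans IH (hu _).
have mw n k : u (n + k)%N + w (n + k)%N <= u n + w n.
  by elim: k => [|k IH]; rewrite ?addn0 // addnS; apply: le_trans (hw _) IH.
have key n m : u n <= u m + w m.
  apply: le_trans (mu n m) _; apply: (@le_trans _ _ (u (n + m)%N + w (n + m)%N)).
    by rewrite lerDl.
  by rewrite addnC; exact: mw.
pose S : set R := [set u n | n in setT].
have ubS m : ubound S (u m + w m) by move=> _ [n _ <-].
exists (sup S) => n; apply/andP; split.
  by apply: ub_le_sup; [exists (u 0%N + w 0%N); exact: ubS|exists n].
by apply: ge_sup; [exists (u 0%N), 0%N|exact: ubS].
Qed.

(** The factor 4^n collected by the quartering cancels against the square of the side lengths in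
    [bdry_local], which leaves a bound proportional to an arbitrary e. *)
Lemma goursat : bdry a0 b0 c0 d0 = 0.
Proof.
have wd0 n : 0 <= wd n by rewrite divr_ge0 ?subr_ge0 // exprn_ge0.
have ht0 n : 0 <= ht n by rewrite divr_ge0 ?subr_ge0 // exprn_ge0.
have [x0 hx0] := @nested_point (fun n => (pos n).1) wd (fun n => let: And5 h _ _ _ _ := posP n in h)
  (fun n => let: And5 _ h _ _ _ := posP n in h) wd0.
have [y0 hy0] := @nested_point (fun n => (pos n).2) ht (fun n => let: And5 _ _ h _ _ := posP n in h)
  (fun n => let: And5 _ _ _ h _ := posP n in h) ht0.
have inx n : a0 <= (pos n).1 /\ (pos n).1 + wd n <= b0.
  elim: n => [|n [IH1 IH2]]; first by rewrite /= /wd expr0 divr1 lexx addrC subrK.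
  by have [h1 h2 _ _ _] := posP n; split; [apply: le_trans h1|apply: le_trans h2 _].
have iny n : c0 <= (pos n).2 /\ (pos n).2 + ht n <= d0.
  elim: n => [|n [IH1 IH2]]; first by rewrite /= /ht expr0 divr1 lexx addrC subrK.
  by have [_ _ h1 h2 _] := posP n; split; [apply: le_trans h1|apply: le_trans h2 _].
have QE n : cabs (bdry a0 b0 c0 d0) <= 4 ^+ n * cabs (Q n (pos n)).
  elim: n => [|n IH].
    by rewrite expr0 mul1r /Q /= /wd /ht !expr0 !divr1 !(addrC _ (_ - _)) !subrK.
  have [_ _ _ _ h] := posP n; apply: le_trans IH _.
  by rewrite exprSr -mulrA ler_wpM2l // exprn_ge0.
have I1 : a0 <= x0 <= b0.
  have /andP[h1 h2] := hx0 0%N; have [h3 h4] := inx 0%N.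
  by rewrite (le_trans h3 h1) (le_trans h2 h4).
have I2 : c0 <= y0 <= d0.
  have /andP[h1 h2] := hy0 0%N; have [h3 h4] := iny 0%N.
  by rewrite (le_trans h3 h1) (le_trans h2 h4).
have [al [be H]] := HD I1 I2.
pose S := (b0 - a0) + (d0 - c0); have S0 : 0 <= S by rewrite addr_ge0 // subr_ge0.
have fin (e : R) : 0 < e -> cabs (bdry a0 b0 c0 d0) <= 2 * e * S ^+ 2.
  move=> e0; have [dl dl0 Hd] := H e e0.
  pose n := Num.bound (S / dl).
  have p2 : 0 < 2 ^+ n :> R by rewrite exprn_gt0.
  have sn : wd n + ht n < dl.
    rewrite /wd /ht -mulrDl -/S ltr_pdivrMr // mulrC -ltr_pdivrMr //.
    have h := archi_boundP (divr_ge0 S0 (ltW dl0)).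
    by apply: lt_le_trans h _; rewrite -natrX ler_nat; exact/ltnW/ltn_expl.
  have [ix1 ix2] := inx n; have [iy1 iy2] := iny n.
  have /andP[hx1 hx2] := hx0 n; have /andP[hy1 hy2] := hy0 n.
  have L : cabs (Q n (pos n)) <= 2 * e * (wd n + ht n) ^+ 2.
    apply: (@bdry_local _ _ _ _ x0 y0 e (wd n + ht n) al be); rewrite ?hx0 ?hy0 ?(ltW e0) //.
    - exact: lt_le_trans ix1.
    - exact: lt_le_trans iy1.
    - by ring.
    move=> x y /andP[hxx hxx'] /andP[hyy hyy'].
    have dd : `|x - x0| + `|y - y0| <= wd n + ht n.
      by apply: lerD; rewrite ler_norml; apply/andP; split; lra.
    apply: (@le_trans _ _ (e * (`|x - x0| + `|y - y0|))); last by rewrite ler_wpM2l // ltW.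
    apply: Hd; last exact: le_lt_trans sn.
      by rewrite (le_trans ix1 hxx) (le_trans hxx' ix2).
    by rewrite (le_trans iy1 hyy) (le_trans hyy' iy2).
  apply: le_trans (QE n) _.
  apply: (@le_trans _ _ (4 ^+ n * (2 * e * (wd n + ht n) ^+ 2))).
    by rewrite ler_wpM2l // exprn_ge0.
  rewrite /wd /ht -mulrDl -/S expr_div_n -exprM mulnC exprM.
  have -> : (2 : R) ^+ 2 = 4 by rewrite -natrX.
  have q0 : (4 : R) ^+ n != 0 by rewrite expf_neq0.
  by rewrite le_eqVlt; apply/orP; left; apply/eqP; field.
apply/eqP; rewrite -cabs_eq0 eq_le cabs_ge0 andbT leNgt; apply/negP => p0.
have k0 : 0 < 4 * (S ^+ 2 + 1) by rewrite mulr_gt0 // ltr_wpDl // sqr_ge0.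
have := fin _ (divr_gt0 p0 k0); apply/negP; rewrite -ltNge.
set q := cabs _ in p0 *; have s2 : 0 <= S ^+ 2 by rewrite sqr_ge0.
have -> : 2 * (q / (4 * (S ^+ 2 + 1))) * S ^+ 2 = q * (S ^+ 2 / (2 * (S ^+ 2 + 1))).
  by field; rewrite gt_eqF // ltr_wpDl.
rewrite -[ltRHS]mulr1 ltr_pM2l // ltr_pdivrMr ?mulr_gt0 ?ltr_wpDl //; lra.
Qed.

End Goursat.

(** * Cauchy's formula and differentiability of the derivative *)

Section CauchyDerivative.
Variable R : realType.
Local Notation C := (Cx R).
Local Notation pi2 := (pi *+ 2 : R).

Let cpl (s : R) (t : R) : C := Complex s t.

Lemma cplE (s t : R) : cpl s t = ofr s + Complex 0 1 * ofr t.
Proof. by apply: c_eqP; rewrite /= ?cReD ?cImD ?cReM ?cImM /=; ring. Qed.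

Lemma cexp_per2 (z : C) : cexp (z + Complex 0 pi2) = cexp z.
Proof.
rewrite cexpD; have -> : Complex 0 pi2 = 2 * ipi R * (1%:~R) :> C.
  by apply: c_eqP; rewrite ?cReM ?cImM /=; ring.
by rewrite cexp_2ipi_int mulr1.
Qed.

Lemma clamp_min (s2 x y : R) : `|Num.min x s2 - Num.min y s2| <= `|x - y|.
Proof.
have [h1|h1] := leP x s2; have [h2|h2] := leP y s2 => //; last by rewrite subrr normr0.
  by rewrite !ler0_norm; lra.
by rewrite !ger0_norm; lra.
Qed.

(* For U holomorphic and 2 pi i-periodic on a left half-plane, the integral over a vertical
   period does not depend on the real part: horizontal sides cancel in Goursat's theorem. *)
Lemma period_const (U U' : C -> C) (X : R) (s1 s2 : R) :
  (forall xi, complex.Re xi < X -> der U xi (U' xi)) ->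
  (forall xi, U (xi + Complex 0 pi2) = U xi) -> s1 <= s2 -> s2 < X ->
  cint (-1) (fun t => U (cpl s1 t)) 0 pi2 = cint (-1) (fun t => U (cpl s2 t)) 0 pi2.
Proof.
(* Replacing x by min(x, s2) extends U continuously to all x, as the integrals ask, and changes
   nothing on the rectangle. *)
move=> hU hper s12 s2X; pose V x y := U (cpl (Num.min x s2) y).
have Ucont x y e : 0 < e -> exists2 d : R, 0 < d & forall x' y',
    `|x' - x| + `|y' - y| < d -> cabs (V x' y' - V x y) < e.
  move=> e0; have h : complex.Re (cpl (Num.min x s2) y) < X.
    by rewrite /= gt_min s2X orbT.
  have /contC /(_ e e0)[d d0 Hd] := der_cont (hU _ h).
  exists d => // x' y' hd; apply: Hd; apply: le_lt_trans hd.
  apply: le_trans (cabs_le _) _; rewrite cReD cReN cImD cImN /= lerD2r; exact: clamp_min.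
have Vx y : rcont (V^~ y).
  move=> x e e0; have [d d0 Hd] := Ucont x y e e0; exists d => // x' hx.
  by apply: Hd; rewrite subrr normr0 addr0.
have Vy x : rcont (V x).
  move=> y e e0; have [d d0 Hd] := Ucont x y e e0; exists d => // y' hy.
  by apply: Hd; rewrite subrr normr0 add0r.
have p0 : 0 <= pi2 by rewrite mulrn_wge0 // pi_ge0.
have := @goursat R (s1 - 1) (-1) V Vx Vy s1 s2 0 pi2.
have B1 : s1 - 1 < s1 by rewrite ltrBlDr ltrDl.
have B2 : -1 < 0 :> R by rewrite oppr_lt0.
move=> /(_ B1 B2 s12 p0) G.
have : bdry (s1 - 1) (-1) V s1 s2 0 pi2 = 0.
  apply: G => x0 y0 /andP[hx1 hx2] _.
  have hre : complex.Re (cpl x0 y0) < X by apply: le_lt_trans s2X.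
  have /derP hd := hU _ hre; exists (U (cpl x0 y0) - U' (cpl x0 y0) * cpl x0 y0), (U' (cpl x0 y0)).
  move=> e e0; have [d d0 Hd] := hd e e0; exists d => // x y /andP[_ xs2] _ hd'.
  pose h := cpl (x - x0) (y - y0).
  have hh : cabs h <= `|x - x0| + `|y - y0| by exact: cabs_le.
  have := Hd h (le_lt_trans hh hd').
  have -> : cpl x0 y0 + h = cpl x y by apply: c_eqP; rewrite ?cReD ?cImD /= addrC subrK.
  have -> : V x y = U (cpl x y) by rewrite /V; congr (U (cpl _ _)); apply/min_idPl.
  rewrite -cplE => hb; apply: (@le_trans _ _ (e * cabs h)); last by rewrite ler_wpM2l // ltW.
  apply: le_trans hb; rewrite le_eqVlt; apply/orP; left; apply/eqP; congr cabs.
  have -> : h = cpl x y - cpl x0 y0 by apply: c_eqP; rewrite ?cReD ?cImD ?cReN ?cImN /=.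
  ring.
have Vp : V^~ pi2 = V^~ 0.
  apply/funext => x; rewrite /V -[RHS]hper; congr U.
  by apply: c_eqP; rewrite ?cReD ?cImD /= ?addr0 ?add0r.
have E1 : V s1 = (fun t => U (cpl s1 t)).
  by apply/funext => t; rewrite /V; congr (U (cpl _ _)); apply/min_idPl.
have E2 : V s2 = (fun t => U (cpl s2 t)).
  by apply/funext => t; rewrite /V; congr (U (cpl _ _)); apply/min_idPl.
rewrite /bdry Vp E1 E2; set I := cint (s1 - 1) _ _ _; set J := cint _ _ _ _; set K := cint _ _ _ _.
have -> : I + Complex 0 1 * J - I - Complex 0 1 * K = Complex 0 1 * (J - K) by ring.
have i0 : (Complex 0 1 : C) != 0.
  by apply/eqP => /(congr1 (fun z : C => complex.Im z)) /eqP; rewrite /= oner_eq0.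
by move=> /eqP; rewrite mulf_eq0 (negbTE i0) /= subr_eq0 => /eqP ->.
Qed.

Definition rcirc (rho t : R) : C := ofr rho * cexp (Complex 0 t).

Lemma cabs_rcirc rho t : 0 < rho -> cabs (rcirc rho t) = rho.
Proof. by move=> h; rewrite /rcirc cabsM cabs_ofr cabs_cexp /= expR0 mulr1 gtr0_norm. Qed.

Lemma rcirc_neq0 rho t : 0 < rho -> rcirc rho t != 0.
Proof. by move=> h; rewrite -cabs_gt0 cabs_rcirc. Qed.

Lemma rder_rcirc rho (t : R) : rder (rcirc rho) t (rcirc rho t * Complex 0 1).
Proof.
rewrite /rcirc -mulrA; apply: rderZ.
have hp h : (Complex 0 (t + h) : C) = Complex 0 t + ofr h * Complex 0 1.
  by apply: c_eqP; rewrite ?cReD ?cImD ?cReM ?cImM /=; ring.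
exact: (@rder_of_der R (@cexp R) (fun t => Complex 0 t : C) (Complex 0 1) _ t hp (der_cexp _)).
Qed.

Lemma rcont_cst (c : C) : rcont (fun=> c).
Proof. by move=> x e e0; exists 1 => // y _; rewrite subrr cabs0. Qed.

Lemma rcirc_inv rho t : (rcirc rho t)^-1 = (ofr rho)^-1 * cexp (Complex 0 (- t)).
Proof.
rewrite /rcirc invfM -cexpN; congr (_ * cexp _).
by apply: c_eqP; rewrite ?cReN ?cImN /= ?oppr0.
Qed.

Lemma rcircE rho t : rcirc rho t = ofr rho * cexp (Complex 0 t). Proof. by []. Qed.

Local Opaque rcirc.

Lemma cint_rcirc_inv (c : C) rho : rho != 0 -> cint (-1) (fun t => c / rcirc rho t) 0 pi2 = 0.
Proof.
move=> r0; have m1 : -1 < 0 :> R by rewrite oppr_lt0.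
have mp : -1 < pi2 :> R by apply: lt_le_trans m1 _; rewrite mulrn_wge0 // pi_ge0.
pose G t := c * ((ofr rho)^-1 * (Complex 0 1 * cexp (Complex 0 (- t)))).
rewrite (cint_fund (G := G)) //.
  rewrite /G; have -> : Complex 0 (- pi2) = - Complex 0 pi2 :> C.
    by apply: c_eqP; rewrite ?cReN ?cImN /= ?oppr0.
  rewrite cexpN -[Complex 0 pi2]add0r cexp_per2 cexp0 invr1.
  have -> : Complex 0 (- 0) = 0 :> C by rewrite oppr0.
  by rewrite cexp0 subrr.
move=> t _; rewrite rcirc_inv.
have hp h : (Complex 0 (- (t + h)) : C) = Complex 0 (- t) + ofr h * - Complex 0 1.
  by apply: c_eqP; rewrite ?cReD ?cImD ?cReM ?cImM ?cReN ?cImN /=; ring.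
have := @rder_of_der R (@cexp R) (fun t => Complex 0 (- t) : C) (- Complex 0 1) _ t hp (der_cexp _).
move=> /(rderZ (Complex 0 1)) /(rderZ (ofr rho)^-1) /(rderZ c).
have ii : Complex 0 1 * Complex 0 1 = -1 :> C.
  by apply: c_eqP; rewrite ?cReN ?cImN /= ; ring.
have -> : c * ((ofr rho)^-1 * (Complex 0 1 * (cexp (Complex 0 (- t)) * - Complex 0 1)))
  = - (Complex 0 1 * Complex 0 1) * (c * ((ofr rho)^-1 * cexp (Complex 0 (- t)))) by ring.
by rewrite ii opprK mul1r.
Qed.

Lemma rcont_circ (f : C -> C) (z : C) rho : (forall t, {for z + rcirc rho t, continuous f}) ->
  rcont (fun t => f (z + rcirc rho t)).
Proof.
move=> hf t e e0; have /contC /(_ e e0)[d d0 Hd] := hf t.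
have [d' d'0 Hd'] := rder_rcont (rder_rcirc rho) t d0.
exists d' => // y hy; apply: Hd; rewrite opprD addrACA subrr add0r; exact: Hd'.
Qed.

Lemma rcontM_circ (g : R -> C) rho : 0 < rho -> rcont g -> rcont (fun t => g t / rcirc rho t).
Proof.
move=> r0 hg t e e0.
have k0 : 0 < cabs (g t) + 1 by rewrite ltr_wpDl ?cabs_ge0.
have e1 : 0 < e * rho / 2 by rewrite !mulr_gt0 // invr_gt0.
have e2 : 0 < e * rho ^+ 2 / (2 * (cabs (g t) + 1)).
  by rewrite divr_gt0 ?mulr_gt0 // exprn_gt0.
have [d d0 Hd] := hg t _ e1; have [d' d'0 Hd'] := rder_rcont (rder_rcirc rho) t e2.
exists (Num.min d d'); first by rewrite lt_min d0.
move=> y; rewrite lt_min => /andP[/Hd h1 /Hd' h2].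
have n1 := rcirc_neq0 y r0; have n2 := rcirc_neq0 t r0.
have -> : g y / rcirc rho y - g t / rcirc rho t =
  (g y - g t) / rcirc rho y - g t * (rcirc rho y - rcirc rho t) / (rcirc rho y * rcirc rho t).
  by field; rewrite n1 n2.
move: h1 h2 (cabs_rcirc y r0) (cabs_rcirc t r0); move: (rcirc rho y) (rcirc rho t) => P Q h1 h2 hP hQ.
apply: le_lt_trans (cabsB _ _) _; rewrite !cabsM !cabsV !cabsM hP hQ.
have a1 : cabs (g y - g t) / rho < e / 2.
  by rewrite ltr_pdivrMr // mulrAC.
have a2 : cabs (g t) * cabs (P - Q) / (rho * rho) <= e / 2.
  rewrite ler_pdivrMr ?mulr_gt0 //.
  apply: (@le_trans _ _ ((cabs (g t) + 1) * (e * rho ^+ 2 / (2 * (cabs (g t) + 1))))).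
    by apply: ler_pM; rewrite ?cabs_ge0 ?lerDl // ltW.
  by rewrite le_eqVlt; apply/orP; left; apply/eqP; field; rewrite gt_eqF.
by rewrite [e]splitr; apply: ltr_leD.
Qed.

(** In the variable xi with w = z + exp xi the integrand is 2 pi i-periodic, so the integral does
    not depend on the radius. As the radius tends to 0 the term f z integrates to 0 and f' z
    remains. *)
Lemma cauchy_der (f f' : C -> C) (z : C) (r rho : R) :
  (forall w, cabs (w - z) < r -> der f w (f' w)) -> 0 < rho -> rho < r ->
  cint (-1) (fun t => f (z + rcirc rho t) / rcirc rho t) 0 pi2 = ofr pi2 * f' z.
Proof.
move=> hf rho0 rr; have r0 : 0 < r by apply: lt_trans rr.
pose U xi := f (z + cexp xi) * cexp (- xi).
have reX xi : complex.Re xi < ln r -> cabs (cexp xi) < r.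
  by move=> h; rewrite cabs_cexp -[ltRHS]lnK ?posrE // ltr_expR.
have hU xi : complex.Re xi < ln r ->
   der U xi (f (z + cexp xi) * (cexp (- xi) * -1) + f' (z + cexp xi) * cexp xi * cexp (- xi)).
  move=> h; apply: derM; last by apply: der_cexpf; apply: der_eq; [dt|].
  apply: (der_comp (f := f) (g := fun u => z + cexp u)).
    by apply: der_eq; [apply: derD; [exact: der_cst|exact: der_cexp]|rewrite add0r].
  by apply: hf; rewrite addrAC subrr add0r; exact: reX.
have Uper xi : U (xi + Complex 0 pi2) = U xi.
  by rewrite /U !cexpN cexp_per2.
have UE s t : U (cpl s t) = f (z + rcirc (expR s) t) / rcirc (expR s) t.
  have E : cexp (cpl s t) = rcirc (expR s) t.
    rewrite rcircE /cpl; have -> : Complex s t = ofr s + Complex 0 t :> C.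
      by apply: c_eqP; rewrite ?cReD ?cImD /= ?addr0 ?add0r.
    rewrite cexpD; congr (_ * _).
    by apply: c_eqP; rewrite /= ?cos0 ?sin0 ?mulr1 ?mulr0.
  by rewrite /U cexpN E.
have p0 : 0 <= pi2 by rewrite mulrn_wge0 // pi_ge0.
have p1 : 0 < pi2 by rewrite mulrn_wgt0 // pi_gt0.
have m1 : -1 < 0 :> R by rewrite oppr_lt0.
have mp : -1 < pi2 :> R by apply: lt_le_trans p0.
pose I := cint (-1) (fun t => f (z + rcirc rho t) / rcirc rho t) 0 pi2.
rewrite -/I.
have IE s : s <= ln rho -> I = cint (-1) (fun t => f (z + rcirc (expR s) t) / rcirc (expR s) t) 0 pi2.
  move=> hs; have hX : ln rho < ln r by rewrite ltr_ln ?posrE.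
  have := period_const hU Uper hs hX.
  have F s' : (fun t => U (cpl s' t)) = (fun t => f (z + rcirc (expR s') t) / rcirc (expR s') t).
    by apply/funext => t; exact: UE.
  by rewrite !F lnK ?posrE // => ->.
have bnd (e : R) : 0 < e -> cabs (I - ofr pi2 * f' z) <= e * pi2.
  move=> e0; have /derP /(_ e e0)[d d0 Hd] : der f z (f' z) by apply: hf; rewrite subrr cabs0.
  pose rh := Num.min rho (d / 2); have rh0 : 0 < rh by rewrite lt_min rho0 divr_gt0.
  have rhr : rh < r by apply: le_lt_trans rr; rewrite ge_min lexx.
  have rhd : rh < d by apply: (@le_lt_trans _ _ (d / 2)); [rewrite ge_min lexx orbT|lra].
  have hl : ln rh <= ln rho by rewrite ler_ln ?posrE // ge_min lexx.
  have IEh := IE _ hl; rewrite lnK ?posrE // in IEh.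
  have c1 : rcont (fun t => f (z + rcirc rh t) / rcirc rh t).
    apply: rcontM_circ => //; apply: rcont_circ => t; apply: der_cont; apply: hf.
    by rewrite addrAC subrr add0r cabs_rcirc.
  have c2 : rcont (fun t => f z / rcirc rh t) by apply: rcontM_circ => //; exact: rcont_cst.
  have E : I - ofr pi2 * f' z = cint (-1) (fun t => f (z + rcirc rh t) / rcirc rh t
      - f z / rcirc rh t - f' z) 0 pi2.
    rewrite (cintB (rcontB c1 c2) (rcont_cst (f' z))) // (cintB c1 c2) //.
    rewrite cint_rcirc_inv ?gt_eqF // subr0 -IEh.
    have -> : (fun=> f' z) = (fun t : R => f' z + ofr t * 0) :> (R -> C).
      by apply/funext => t; rewrite mulr0 addr0.
    by rewrite cint_aff // mul0r !mulr0 !addr0 mul0r subr0.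
  rewrite E -[X in e * X]subr0; apply: cint_bound => //.
    by apply: rcontB; [exact: rcontB|exact: rcont_cst].
  move=> t _; have n0 := rcirc_neq0 t rh0.
  have -> : f (z + rcirc rh t) / rcirc rh t - f z / rcirc rh t - f' z =
     (f (z + rcirc rh t) - f z - f' z * rcirc rh t) / rcirc rh t by field.
  have := Hd (rcirc rh t); rewrite cabs_rcirc // => /(_ rhd) hb.
  by rewrite cabsM cabsV cabs_rcirc // ler_pdivrMr.
apply/eqP; rewrite -subr_eq0 -cabs_eq0 eq_le cabs_ge0 andbT leNgt; apply/negP => q0.
have k0 : 0 < 2 * pi2 by rewrite mulr_gt0.
have := bnd _ (divr_gt0 q0 k0); set q := cabs _ in q0 *.
have G (P : R) : 0 < P -> q / (2 * P) * P = q / 2 by move=> P0; field; rewrite gt_eqF.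
rewrite (G _ p1).
lra.
Qed.

Lemma pi2_gt0 : 0 < pi2. Proof. by rewrite mulrn_wgt0 // pi_gt0. Qed.

Lemma cint_circ_bound (F : C -> C) (z : C) rho M : 0 < rho ->
  (forall t, {for z + rcirc rho t, continuous F}) -> (forall t, cabs (F (z + rcirc rho t)) <= M) ->
  cabs (cint (-1) (fun t => F (z + rcirc rho t) / rcirc rho t) 0 pi2) <= M / rho * pi2.
Proof.
move=> r0 hF hM; rewrite -[X in _ * X]subr0; apply: cint_bound.
- by apply: rcontM_circ => //; exact: rcont_circ.
- by rewrite oppr_lt0.
- exact/ltW/pi2_gt0.
by move=> t _; rewrite cabsM cabsV cabs_rcirc // ler_wpM2r // invr_ge0 ltW.
Qed.

(** The integral formula first bounds f', then its differences, so that f' is Lipschitz. This gives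
    f a quadratic remainder uniform in the base point, and the difference quotients of the integral
    formula converge. *)
Lemma holo_der_ball (f f' : C -> C) (z0 : C) (r : R) : 0 < r ->
  (forall w, cabs (w - z0) < r -> der f w (f' w)) ->
  exists2 r' : R, 0 < r' & forall z, cabs (z - z0) < r' -> exists l, der f' z l.
Proof.
move=> r00 hf0; have z00 : cabs (z0 - z0) < r by rewrite subrr cabs0.
have /contC /(_ 1 ltr01)[d d0 Hd] := der_cont (hf0 z0 z00).
pose s := Num.min r d; have s0 : 0 < s by rewrite lt_min r00.
have hf w : cabs (w - z0) < s -> der f w (f' w) by rewrite lt_min => /andP[h _]; exact: hf0.
pose M := 1 + cabs (f z0).
have hM w : cabs (w - z0) < s -> cabs (f w) <= M.
  rewrite lt_min => /andP[_ /Hd h]; have := cabs_lowB (f w) (f z0); rewrite /M; lra.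
have M0 : 0 <= M by rewrite addr_ge0 ?cabs_ge0.
have tri (z c : C) (a b k : R) : cabs (z - z0) < a -> cabs c <= b -> a + b <= k -> cabs (z + c - z0) < k.
  move=> h1 h2 h3; rewrite addrAC; apply: le_lt_trans (cabsD _ _) _; apply: lt_le_trans h3.
  exact: ltr_leD.
have sub (z : C) (a b : R) w : cabs (z - z0) < a -> a + b <= s -> cabs (w - z) < b -> cabs (w - z0) < s.
  move=> h1 h2 h3; apply: le_lt_trans (cabsDB _ _ z) _; lra.
have pp := pi2_gt0; have cpi : cabs (ofr pi2) = pi2 by rewrite cabs_ofr gtr0_norm.
pose rho := s / 4; have rho0 : 0 < rho by rewrite divr_gt0.
have b1 z : cabs (z - z0) < s / 2 -> cabs (f' z) <= M / rho.
  move=> hz; have hw w : cabs (w - z) < s / 2 -> der f w (f' w).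
    by move=> h; apply: hf; apply: (sub z (s / 2) (s / 2)) => //; lra.
  have rl : rho < s / 2 by rewrite /rho; lra.
  have h := cauchy_der hw rho0 rl.
  have in_t t : cabs (z + rcirc rho t - z0) < s.
    by apply: (tri z _ (s / 2) rho) => //; [rewrite cabs_rcirc|rewrite /rho; lra].
  have := @cint_circ_bound f z rho M rho0 (fun t => der_cont (hf _ (in_t t))) (fun t => hM _ (in_t t)).
  by rewrite h cabsM cpi mulrC ler_pM2r.
have lip a b : cabs (a - z0) < s / 8 -> cabs (b - z0) < s / 8 ->
    cabs (f' b - f' a) <= M / rho / rho * cabs (b - a).
  move=> ha hb; have hw c w : cabs (c - z0) < s / 8 -> cabs (w - c) < s / 2 -> der f w (f' w).
    by move=> h1 h; apply: hf; apply: (sub c (s / 8) (s / 2)) => //; lra.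
  have rl : rho < s / 2 by rewrite /rho; lra.
  have eA := cauchy_der (fun w => hw a w ha) rho0 rl; have eB := cauchy_der (fun w => hw b w hb) rho0 rl.
  have in_t c t : cabs (c - z0) < s / 8 -> cabs (c + rcirc rho t - z0) < s / 2.
    by move=> hc; apply: (tri c _ (s / 8) rho) => //; [rewrite cabs_rcirc|rewrite /rho; lra].
  have ss : s / 2 < s by lra.
  have fc c t : cabs (c - z0) < s / 8 -> {for c + rcirc rho t, continuous f}.
    by move=> hc; apply: der_cont; apply: hf; apply: lt_trans (in_t c t hc) ss.
  have rc c : cabs (c - z0) < s / 8 -> rcont (fun t => f (c + rcirc rho t) / rcirc rho t).
    by move=> hc; apply: rcontM_circ => //; apply: rcont_circ => t; exact: fc.
  have : cabs (ofr pi2 * (f' b - f' a)) <= M / rho * cabs (b - a) / rho * (pi2 - 0).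
    rewrite mulrBr -eA -eB -cintB; [|exact: rc|exact: rc|by rewrite oppr_lt0|]; last first.
      by apply: lt_trans pp; rewrite oppr_lt0.
    apply: cint_bound; [apply: rcontB; exact: rc|by rewrite oppr_lt0|exact: ltW|] => t _.
    have -> : f (b + rcirc rho t) / rcirc rho t - f (a + rcirc rho t) / rcirc rho t =
       (f (b + rcirc rho t) - f (a + rcirc rho t)) / rcirc rho t by rewrite mulrBl.
    rewrite cabsM cabsV cabs_rcirc // ler_wpM2r ?invr_ge0 ?(ltW rho0) //.
    have -> : b - a = (b + rcirc rho t) - (a + rcirc rho t) by ring.
    apply: (ball_bound (f' := f') (x := z0) (r := s / 2)) => [w hw'|w hw'||].
    - by apply: hf; apply: lt_trans ss.
    - exact: b1.
    - exact: in_t.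
    exact: in_t.
  by rewrite subr0 cabsM cpi mulrC ler_pM2r // [leRHS]mulrAC.
pose L := M / rho / rho; have L0 : 0 <= L by rewrite !divr_ge0 // ltW.
have quad w h : cabs (w - z0) < s / 8 -> cabs (w + h - z0) < s / 8 ->
    cabs (f (w + h) - f w - f' w * h) <= L * cabs h ^+ 2.
  move=> hw hwh; pose g u := f u - f' w * u.
  have -> : f (w + h) - f w - f' w * h = g (w + h) - g w by rewrite /g; ring.
  have dg (t : R) : 0 <= t <= 1 -> der g (pt w (w + h) t) (f' (pt w (w + h) t) - f' w).
    move=> ht; have hp := pt_dist ht hw hwh.
    apply: derB; last by apply: der_eq; [dt|rewrite ?mulr1].
    by apply: hf; apply: lt_trans hp _; lra.
  apply: (seg_bound (f' := fun u => f' u - f' w)) => [t ht|t /andP[t0 t1]|t /andP[t0 t1]].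
  - exact: (der_cont (dg t ht)).
  - by apply: dg; rewrite !ltW.
  have ht : 0 <= t <= 1 by rewrite !ltW.
  have := lip _ _ hw (pt_dist ht hw hwh).
  have -> : pt w (w + h) t - w = ofr t * h by rewrite /pt; ring.
  rewrite cabsM cabs_ofr gtr0_norm // addrAC subrr add0r cabsM -/L => hl.
  rewrite expr2 mulrA; apply: ler_pM; rewrite ?cabs_ge0 //; apply: le_trans hl _.
  rewrite ler_wpM2l // -[leRHS]mul1r ler_wpM2r ?cabs_ge0 // ltW //.
(* Points within 2 rh of z0 and the circles of radius rh about them stay in the ball of radius s /
   8, where f' is Lipschitz. *)
pose rh := s / 32; have rh0 : 0 < rh by rewrite divr_gt0.
exists rh => // z hz.
have in_t c t : cabs (c - z0) < 2 * rh -> cabs (c + rcirc rh t - z0) < s / 8.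
  by move=> hc; apply: (tri c _ (2 * rh) rh) => //; [rewrite cabs_rcirc|rewrite /rh; lra].
have f'c w : cabs (w - z0) < s / 8 -> {for w, continuous f'}.
  move=> hw; apply/contC => e e0; have L1 : 0 < L + 1 by rewrite ltr_wpDl.
  exists (Num.min (s / 8 - cabs (w - z0)) (e / (L + 1))).
    by rewrite lt_min subr_gt0 hw divr_gt0.
  move=> u; rewrite lt_min ltr_pdivlMr // => /andP[u1 u2].
  have hu : cabs (u - z0) < s / 8 by apply: le_lt_trans (cabsDB _ _ w) _; lra.
  apply: le_lt_trans (lip _ _ hw hu) _; rewrite -/L; apply: le_lt_trans u2.
  by rewrite mulrC ler_wpM2l ?cabs_ge0 // lerDl.
have z2 : cabs (z - z0) < 2 * rh by lra.
have c2 : rcont (fun t => f' (z + rcirc rh t) / rcirc rh t).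
  by apply: rcontM_circ => //; apply: rcont_circ => t; apply: f'c; exact: in_t.
(* The candidate for the second derivative: the integral formula with f' in place of f. *)
exists ((ofr pi2)^-1 * cint (-1) (fun t => f' (z + rcirc rh t) / rcirc rh t) 0 pi2).
apply/derP => e e0; have K0 : 0 < L / rh + 1 by rewrite ltr_wpDl // divr_ge0 // ltW.
exists (Num.min rh (e / (L / rh + 1))); first by rewrite lt_min rh0 divr_gt0.
move=> h; rewrite lt_min => /andP[h1]; rewrite ltr_pdivlMr // => h2.
have zh : cabs (z + h - z0) < 2 * rh.
  have h3 : rh + cabs h <= 2 * rh by move: h1; rewrite /rh; lra.
  exact: (tri z h rh (cabs h) _ hz (lexx _) h3).
have hw c w : cabs (c - z0) < 2 * rh -> cabs (w - c) < s / 2 -> der f w (f' w).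
  by move=> hc h'; apply: hf; apply: (sub c (2 * rh) (s / 2)) => //; rewrite /rh; lra.
have rl : rh < s / 2 by rewrite /rh; lra.
have eA := cauchy_der (fun w => hw z w z2) rh0 rl; have eB := cauchy_der (fun w => hw _ w zh) rh0 rl.
have c1 c : cabs (c - z0) < 2 * rh -> rcont (fun t => f (c + rcirc rh t) / rcirc rh t).
  move=> hc; apply: rcontM_circ => //; apply: rcont_circ => t; apply: der_cont; apply: hf.
  by apply: lt_trans (in_t c t hc) _; lra.
have c3 : rcont (fun t => h * (f' (z + rcirc rh t) / rcirc rh t)).
  exact: rcontZ.
have m1 : -1 < 0 :> R by rewrite oppr_lt0. have mp : -1 < pi2 by apply: lt_trans pp.
have np : ofr pi2 != 0 by rewrite ofr_eq0 gt_eqF.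
have E : f' (z + h) - f' z - (ofr pi2)^-1 * cint (-1) (fun t => f' (z + rcirc rh t) / rcirc rh t) 0 pi2 * h
   = (ofr pi2)^-1 * cint (-1) (fun t => f (z + h + rcirc rh t) / rcirc rh t - f (z + rcirc rh t) / rcirc rh t
      - h * (f' (z + rcirc rh t) / rcirc rh t)) 0 pi2.
  rewrite (cintB (rcontB (c1 _ zh) (c1 _ z2)) c3) // (cintB (c1 _ zh) (c1 _ z2)) // (cintZ h c2) //.
  by rewrite eA eB; field.
rewrite E cabsM cabsV cpi.
apply: (@le_trans _ _ (pi2^-1 * (L * cabs h ^+ 2 / rh * (pi2 - 0)))).
  rewrite ler_wpM2l ?invr_ge0 ?(ltW pp) //; apply: cint_bound => //; first by apply: rcontB => //; apply: rcontB; exact: c1.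
    exact: ltW.
  move=> t _; have n0 := rcirc_neq0 t rh0.
  have -> : f (z + h + rcirc rh t) / rcirc rh t - f (z + rcirc rh t) / rcirc rh t - h * (f' (z + rcirc rh t) / rcirc rh t)
    = (f (z + rcirc rh t + h) - f (z + rcirc rh t) - f' (z + rcirc rh t) * h) / rcirc rh t.
    by rewrite (addrAC z h); field.
  rewrite cabsM cabsV cabs_rcirc // ler_wpM2r ?invr_ge0 ?(ltW rh0) //.
  by apply: quad; [exact: in_t|rewrite (addrAC z); exact: in_t].
have G (P x k : R) : 0 < P -> 0 < k -> P^-1 * (L * x ^+ 2 / k * (P - 0)) = L / k * x * x.
  by move=> P0 k0; field; rewrite !gt_eqF.
rewrite (G _ _ _ pp rh0) ler_wpM2r ?cabs_ge0 //; apply: le_trans (ltW h2).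
by rewrite mulrC ler_wpM2l ?cabs_ge0 // lerDl.
Qed.

Theorem derivable_derive1 (f : C -> C) (x : C) :
  (\forall z \near x, derivable f z 1) -> \forall z \near x, derivable (derive1 f) z 1.
Proof.
move=> /nearC[r r0 H].
have [r' r'0 H'] := holo_der_ball r0 (fun w hw => derivable_der (H w hw)).
by apply/nearC; exists r' => // z /H'[l hl]; exact: der_derivable hl.
Qed.

End CauchyDerivative.

(** * Uniqueness and computation of residues *)

Section Residue.
Variable R : realType.
Local Notation C := (Cx R).

Lemma near_derive_near (f : C -> C) (x : C) :
  (\forall z \near x, derivable f z 1) -> exists2 r : R, 0 < r & exists f1 f2 f3 : C -> C,
  [/\ forall z, cabs (z - x) < r -> der f z (f1 z),
      forall z, cabs (z - x) < r -> der f1 z (f2 z)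
    & forall z, cabs (z - x) < r -> der f2 z (f3 z)].
Proof.
move=> h0; have h1 := derivable_derive1 h0; have h2 := derivable_derive1 h1.
move/nearC: h0 => [r0 r00 H0]; move/nearC: h1 => [r1 r10 H1]; move/nearC: h2 => [r2 r20 H2].
exists (Num.min r0 (Num.min r1 r2)); first by rewrite !lt_min r00 r10.
exists (derive1 f), (derive1 (derive1 f)), (derive1 (derive1 (derive1 f))).
by split => z; rewrite !lt_min => /andP[z0 /andP[z1 z2]]; apply: derivable_der;
  [exact: H0|exact: H1|exact: H2].
Qed.

(** The divided difference at x, completed by l. With l the derivative at x, it is the regular part
    of f u / (u - x). *)
Definition ddiff (f : C -> C) (l x u : C) : C := if u == x then l else (f u - f x) / (u - x).

(** The only delicate point is u = x, where the derivative is f''(x) / 2: the mean value inequality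
    is applied to f minus its quadratic Taylor polynomial. *)
Lemma derivable_ddiff (f f1 f2 f3 : C -> C) (x : C) (r : R) : 0 < r ->
  (forall z, cabs (z - x) < r -> der f z (f1 z)) ->
  (forall z, cabs (z - x) < r -> der f1 z (f2 z)) ->
  (forall z, cabs (z - x) < r -> der f2 z (f3 z)) ->
  forall u, cabs (u - x) < r -> exists l, der (ddiff f (f1 x) x) u l.
Proof.
move=> r0 h1 h2 h3 u ur; have [->|ux] := eqVneq u x; last first.
  have ux' : u - x != 0 by rewrite subr_eq0.
  exists ((f1 u * (u - x) - (f u - f x) * 1) / (u - x) ^+ 2).
  apply: (der_near (f := fun u => (f u - f x) / (u - x))).
    apply/nearC; exists (cabs (u - x)); first by rewrite cabs_gt0.
    move=> v hv; rewrite /ddiff; case: eqP => // vx.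
    by move: hv; rewrite vx cabsBC ltxx.
  apply: der_div => //; first by apply: der_eq; [apply: derB; [exact: h1|exact: der_cst]|rewrite subr0].
  by apply: der_eq; [apply: derB; [exact: der_id|exact: der_cst]|rewrite subr0].
have xx : cabs (x - x) < r by rewrite subrr cabs0.
exists (f2 x / 2); apply/derP => e e0.
have /contC /(_ 1 ltr01)[d d0 Hd] := der_cont (h2 x xx).
have /derP /(_ (e) e0)[d' d'0 Hd'] := h2 x xx.
pose s := Num.min r d'; have s0 : 0 < s by rewrite lt_min r0.
exists s => // h hs; have [hr hd'] : cabs h < r /\ cabs h < d' by move: hs; rewrite lt_min => /andP.
rewrite /ddiff eqxx; have [->|hx] := eqVneq h 0; first by rewrite addr0 eqxx mulr0 !subrr cabs0 mulr0.
have -> : (x + h == x) = false by rewrite -subr_eq0 addrAC subrr add0r (negbTE hx).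
have ch : 0 < cabs h by rewrite cabs_gt0.
pose g u := f u - f1 x * u - f2 x / 2 * (u - x) ^+ 2.
have key : cabs (g (x + h) - g x) <= e * cabs h * cabs h.
  have dg (t : R) : 0 <= t <= 1 -> der g (pt x (x + h) t)
      (f1 (pt x (x + h) t) - f1 x - f2 x * (pt x (x + h) t - x)).
    move=> ht; have hp : cabs (pt x (x + h) t - x) < r.
      by apply: pt_dist => //; rewrite addrAC subrr add0r.
    have e1 := h1 _ hp; have dk : der (fun u => u - x) (pt x (x + h) t) (1 - 0).
      by apply: derB; [exact: der_id|exact: der_cst].
    rewrite /g; apply: der_eq.
      apply: derB; first by apply: derB; [exact: e1|apply: dercM; exact: der_id].
      by apply: dercM; apply: derX; exact: dk.
    by rewrite /=; field.
  apply: (seg_bound (f' := fun u => f1 u - f1 x - f2 x * (u - x))) => [t ht|t /andP[t0 t1]|t /andP[t0 t1]].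
  - exact: (der_cont (dg t ht)).
  - by apply: dg; rewrite !ltW.
  have -> : x + h - x = h by ring.
  have pe : pt x (x + h) t = x + ofr t * h by rewrite /pt; ring.
  have cl : cabs (ofr t * h) <= cabs h.
    by rewrite cabsM cabs_ofr gtr0_norm // -[leRHS]mul1r ler_wpM2r ?cabs_ge0 // ltW.
  have := Hd' (ofr t * h) (le_lt_trans cl hd'); rewrite pe.
  have -> : x + ofr t * h - x = ofr t * h by ring.
  move=> hb; rewrite cabsM; apply: ler_pM; rewrite ?cabs_ge0 //.
  by apply: le_trans hb _; rewrite ler_wpM2l // ltW.
have -> : (f (x + h) - f x) / (x + h - x) - f1 x - f2 x / 2 * h = (g (x + h) - g x) / h.
  have hxx : x + h - x = h by ring.
  by rewrite /g hxx; field.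
by rewrite cabsM cabsV ler_pdivrMr.
Qed.

(** Multiplied by (u - x)^(n+1), the bounded sum tends both to 0 and to its top coefficient, which
    therefore vanishes; the rest is induction. *)
Lemma polar_part_zero (n : nat) (d : nat -> C) (x : C) (M r : R) : 0 < r ->
  (forall u, u != x -> cabs (u - x) < r -> cabs (\sum_(k < n) d k / (u - x) ^+ k.+1) <= M) ->
  forall k, (k < n)%N -> d k = 0.
Proof.
move=> r0; elim: n => [//|n IH] H.
have M0 : 0 <= M.
  pose y := ofr (r / 2); have y0 : y != 0 by rewrite ofr_eq0 gt_eqF // divr_gt0.
  apply: le_trans (cabs_ge0 _) (H (x + y) _ _).
    by rewrite -subr_eq0 addrAC subrr add0r.
  by rewrite addrAC subrr add0r cabs_ofr gtr0_norm ?divr_gt0 //; lra.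
have dn : d n = 0.
  pose P (y : C) := \sum_(k < n.+1) d k * y ^+ (n - k).
  have [S [S0 HS]] : exists S : R, 0 <= S /\ forall y : C, cabs y < 1 -> cabs (P y - d n) <= S * cabs y.
    exists (\sum_(k < n) cabs (d k)); split; first by apply: sumr_ge0 => k _; exact: cabs_ge0.
    move=> y y1; rewrite /P big_ord_recr /= subnn expr0 mulr1 addrK.
    apply: le_trans (cabs_sum _ _) _; rewrite mulr_suml; apply: ler_sum => k _.
    rewrite cabsM ler_wpM2l ?cabs_ge0 // cabsX.
    have := ltn_ord k; case E : (n - k)%N => [|m] kn; first by lia.
    rewrite exprSr -[leRHS]mul1r ler_wpM2r ?cabs_ge0 //.
    by apply: exprn_ile1; rewrite ?cabs_ge0 // ltW.
  apply/eqP; rewrite -cabs_eq0 eq_le cabs_ge0 andbT leNgt; apply/negP => p0.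
  pose K := S + M + 1; have K0 : 0 < K by rewrite /K; lra.
  pose t := Num.min (Num.min (2^-1) (r / 2)) (cabs (d n) / 2 / K).
  have t0 : 0 < t by rewrite !lt_min invr_gt0 ltr0n !divr_gt0.
  have [t1 t2 t3] : [/\ t <= 2^-1, t <= r / 2 & t <= cabs (d n) / 2 / K].
    by split; rewrite !ge_min lexx ?orbT.
  have y0 : ofr t != 0 by rewrite ofr_eq0 gt_eqF.
  have cy : cabs (ofr t) = t by rewrite cabs_ofr gtr0_norm.
  have hx : x + ofr t != x by rewrite -subr_eq0 addrAC subrr add0r.
  have hr : cabs (x + ofr t - x) < r by rewrite addrAC subrr add0r cy; lra.
  have := H _ hx hr; have -> : x + ofr t - x = ofr t by ring.
  move=> h1; have PE : P (ofr t) = ofr t ^+ n.+1 * \sum_(k < n.+1) d k / ofr t ^+ k.+1.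
    rewrite /P mulr_sumr; apply: eq_bigr => k _; rewrite mulrCA; congr (_ * _).
    have kn : (k <= n)%N by rewrite -ltnS.
    have -> : ofr t ^+ n.+1 = ofr t ^+ (n - k) * ofr t ^+ k.+1.
      by rewrite -exprD addnS subnK.
    by rewrite mulfK // expf_neq0.
  have h2 : cabs (P (ofr t)) <= t * M.
    rewrite PE cabsM cabsX cy exprS -mulrA ler_wpM2l ?(ltW t0) //.
    rewrite -[leRHS]mul1r; apply: ler_pM; rewrite ?cabs_ge0 ?exprn_ge0 ?(ltW t0) //.
    by apply: exprn_ile1; rewrite ?(ltW t0) //; lra.
  have h3 := HS (ofr t); rewrite cy in h3; have {}h3 := h3 (le_lt_trans t1 _).
  have h4 : cabs (P (ofr t) - d n) <= S * t by apply: h3; rewrite invf_lt1 // ltr1n.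
  have := cabs_lowB (d n) (P (ofr t)); rewrite cabsBC => h5.
  have h6 : t * K <= cabs (d n) / 2 by rewrite -ler_pdivlMr.
  have h7 : t * K = t * S + t * M + t by rewrite /K; ring.
  by move: h2 h4 h5 h6; rewrite h7 [S * t]mulrC; lra.
move=> k; rewrite ltnS leq_eqVlt => /orP[/eqP -> //|kn].
by apply: IH kn => u ux ur; have := H u ux ur; rewrite big_ord_recr /= dn mul0r addr0.
Qed.

Lemma near_bounded (h : C -> C) (x : C) : (\forall u \near x, derivable h u 1) ->
  exists M : R, exists2 r : R, 0 < r & forall u, cabs (u - x) < r -> cabs (h u) <= M.
Proof.
move=> /nearC[r r0 H]; have xx : cabs (x - x) < r by rewrite subrr cabs0.
have /contC /(_ 1 ltr01)[d d0 Hd] := der_cont (derivable_der (H x xx)).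
exists (1 + cabs (h x)), d => // u /Hd hu.
by have := cabs_lowB (h u) (h x); lra.
Qed.

Lemma residue_uniq (f : C -> C) (x r r' : C) : is_residue f x r -> is_residue f x r' -> r = r'.
Proof.
move=> [n [c [h [hd /nearC'[d1 d10 H]]]]] [n' [c' [h' [hd' /nearC'[d2 d20 H']]]]].
have [M [b b0 hM]] := near_bounded hd; have [M' [b' b'0 hM']] := near_bounded hd'.
pose N := maxn n n'.
pose ex m (c : nat -> C) k := if (k < m)%N then c k else 0.
have exE m (e : nat -> C) (u : C) : (m <= N)%N ->
    \sum_(k < N) ex m e k / (u - x) ^+ k.+2 = \sum_(k < m) e k / (u - x) ^+ k.+2.
  move=> mN; rewrite (big_ord_widen N (fun k => e k / (u - x) ^+ k.+2) mN) [RHS]big_mkcond /=.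
  by apply: eq_bigr => k _; rewrite /ex; case: ifP => // _; rewrite mul0r.
pose D k := if k is j.+1 then ex n c j - ex n' c' j else r - r'.
pose q := Num.min (Num.min d1 d2) (Num.min b b').
have q0 : 0 < q by rewrite !lt_min d10 d20 b0.
suff : forall k, (k < N.+1)%N -> D k = 0 by move=> /(_ 0%N isT) /eqP; rewrite subr_eq0 => /eqP.
apply: (polar_part_zero (x := x) (r := q) (M := M + M')) => // u ux.
rewrite !lt_min => /andP[/andP[u1 u2] /andP[u3 u4]].
have E := H u ux u1; have E' := H' u ux u2.
rewrite big_ord_recl /= expr1.
have -> : \sum_(i < N) (ex n c i - ex n' c' i) / (u - x) ^+ (bump 0 i).+1 =
   \sum_(k < n) c k / (u - x) ^+ k.+2 - \sum_(k < n') c' k / (u - x) ^+ k.+2.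
  rewrite -(exE n c) ?leq_maxl // -(exE n' c') ?leq_maxr // -sumrB.
  by apply: eq_bigr => k _; rewrite mulrBl /bump leq0n add1n.
have -> : (r - r') / (u - x) + (\sum_(k < n) c k / (u - x) ^+ k.+2 - \sum_(k < n') c' k / (u - x) ^+ k.+2)
   = h' u - h u.
  move: E; rewrite E'; set X := r / _; set X' := r' / _; set S := \sum_(k < n) _; set S' := \sum_(k < n') _.
  move=> /eqP; rewrite -subr_eq0 => /eqP Z.
  apply/eqP; rewrite -subr_eq0; apply/eqP/oppr_inj; rewrite oppr0 -[RHS]Z mulrBl -/X -/X'; ring.
apply: le_trans (cabsB _ _) _; rewrite addrC; apply: lerD; [exact: hM|exact: hM'].
Qed.

Lemma residueE (f : C -> C) (x r : C) : is_residue f x r -> residue f x = r.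
Proof.
move=> h; rewrite /residue; case: xgetP => [r' _ h'|/(_ r)]; last by case.
exact: residue_uniq h' h.
Qed.

Lemma residue_simple (H f : C -> C) (m x : C) : (\forall u \near x, derivable H u 1) ->
  (\forall u \near x^', f u = m * (H u / (u - x))) -> residue f x = m * H x.
Proof.
move=> Hd fE; apply: residueE.
have [r r0 [f1 [f2 [f3 [h1 h2 h3]]]]] := near_derive_near Hd.
exists 0%N, (fun=> 0), (fun u => m * ddiff H (f1 x) x u); split.
  apply/nearC; exists r => // u ur; have [l hl] := derivable_ddiff r0 h1 h2 h3 ur.
  exact: (der_derivable (dercM m hl)).
move/nearC': fE => [d d0 Hd']; apply/nearC'; exists d => // u ux ud; rewrite Hd' // big_ord0 addr0.
have ux' : u - x != 0 by rewrite subr_eq0.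
by rewrite /ddiff (negbTE ux); field.
Qed.

End Residue.

(** * Two by two matrices, entrywise *)

Section Matrix2.
Variable R : realType.
Local Notation C := (Cx R).

Lemma mx2_tr (M : 'M[C]_2) : \tr M = M 0 0 + M 1 1.
Proof.
rewrite /mxtrace !big_ord_recl big_ord0 addr0; congr (_ + M _ _); exact: val_inj.
Qed.

Lemma mx2_mul (M N : 'M[C]_2) i j : (M *m N) i j = M i 0 * N 0 j + M i 1 * N 1 j.
Proof.
rewrite mxE !big_ord_recl big_ord0 addr0.
by have -> : lift ord0 ord0 = 1 :> 'I_2 by exact: val_inj.
Qed.

Lemma mx2_det (M : 'M[C]_2) : \det M = M 0 0 * M 1 1 - M 0 1 * M 1 0.
Proof.
rewrite (expand_det_row _ 0) !big_ord_recl big_ord0 addr0 /cofactor !det_mx11 !mxE.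
have l00 : lift ord0 ord0 = 1 :> 'I_2 by exact: val_inj.
have l10 : lift 1 ord0 = 0 :> 'I_2 by exact: val_inj.
by rewrite !l00 !l10 /= expr0 expr1 mul1r mulN1r mulrN.
Qed.

Lemma mx2_diagE (c d : C) : (diag2 c d 0 0 = c) * (diag2 c d 0 1 = 0) *
  (diag2 c d 1 0 = 0) * (diag2 c d 1 1 = d).
Proof. by rewrite /diag2 !mxE /= !mulr1n !mulr0n. Qed.

Lemma ord2_ind (P : 'I_2 -> Prop) : P 0 -> P 1 -> forall i, P i.
Proof.
move=> h0 h1 i; case: (unliftP 0 i) => [j ->|->] //.
by rewrite ord1; have -> : lift 0 0 = 1 :> 'I_2 by exact: val_inj.
Qed.

Lemma tr_inv_diag (A B : 'M[C]_2) (c d : C) : \det A != 0 ->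
  \tr (invmx A *m B *m diag2 c d) =
  ((A 1 1 * B 0 0 - A 0 1 * B 1 0) * c + (A 0 0 * B 1 1 - A 1 0 * B 0 1) * d)
    / (A 0 0 * A 1 1 - A 0 1 * A 1 0).
Proof.
move=> dA; have uA : A \in unitmx by rewrite unitmxE unitfE.
have AX : A *m (invmx A *m B) = B by rewrite mulmxA mulmxV // mul1mx.
move: AX; move: (invmx A *m B) => X AX.
have B00 := congr1 (fun M : 'M[C]_2 => M 0 0) AX; have B01 := congr1 (fun M : 'M[C]_2 => M 0 1) AX.
have B10 := congr1 (fun M : 'M[C]_2 => M 1 0) AX; have B11 := congr1 (fun M : 'M[C]_2 => M 1 1) AX.
move: B00 B01 B10 B11; rewrite !mx2_mul => <- <- <- <-.
rewrite mx2_tr !mx2_mul !mx2_diagE; move: dA; rewrite mx2_det => dA.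
by field.
Qed.

Lemma derivable_entry (M : C -> 'M[C]_2) (x : C) i j : derivable M x 1 ->
  der (fun u => M u i j) x (derive1 M x i j).
Proof.
move=> h.
have cv : (fun k : C => k^-1 *: (M (k *: (1 : C) + x) - M x)) @ (0 : C)^' --> derive1 M x.
  by rewrite derive1E; exact: h.
have cv2 : (fun k : C => (k^-1 *: (M (k *: (1 : C) + x) - M x)) i j) @ (0 : C)^' --> derive1 M x i j.
  by apply: (@continuous_cvg _ _ _ _ _ _ (fun A : 'M[C]_2 => A i j)); [exact: coord_continuous|exact: cv].
have E : (fun k : C => (k^-1 *: (M (k *: (1 : C) + x) - M x)) i j) =
    (fun k => k^-1 *: (M (k *: (1 : C) + x) i j - M x i j)).
  by apply/funext => k; rewrite !mxE.
rewrite E in cv2.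
apply/derP => e e0; move: cv2 => /cvgC /(_ e e0) hc; have /nearC'[d d0 H] := hc.
exists d => // k kd; have [->|k0] := eqVneq k 0; first by rewrite addr0 mulr0 !subrr !cabs0 mulr0.
have := H k k0; rewrite subr0 => /(_ kd); rewrite /GRing.scale /= mulr1 (addrC k) => hb.
have ck : 0 < cabs k by rewrite cabs_gt0.
have -> : M (x + k) i j - M x i j - derive1 M x i j * k =
   k * (k^-1 * (M (x + k) i j - M x i j) - derive1 M x i j) by field.
by rewrite cabsM mulrC ler_wpM2r ?cabs_ge0 // ltW.
Qed.

Lemma cont_eq (f g : C -> C) (x : C) : {for x, continuous f} -> {for x, continuous g} ->
  (\forall u \near x^', f u = g u) -> f x = g x.
Proof.
move=> /contC hf /contC hg /nearC'[d d0 H]; apply/eqP; rewrite -subr_eq0 -cabs_eq0 eq_le cabs_ge0 andbT.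
rewrite leNgt; apply/negP => p0; have p2 : 0 < cabs (f x - g x) / 2 by rewrite divr_gt0.
have [d1 d10 H1] := hf _ p2; have [d2 d20 H2] := hg _ p2.
pose s := Num.min d (Num.min d1 d2) / 2.
have s0 : 0 < s by rewrite divr_gt0 // !lt_min d0 d10.
have sd : s < Num.min d (Num.min d1 d2) by rewrite /s ltr_pdivrMr // mulr_natr mulr2n ltrDl !lt_min d0 d10.
move: sd; rewrite !lt_min => /andP[a1 /andP[a2 a3]].
have E : x + ofr s - x = ofr s by ring.
have ux : x + ofr s != x by rewrite -subr_eq0 E ofr_eq0 gt_eqF.
have cs : cabs (x + ofr s - x) = s by rewrite E cabs_ofr gtr0_norm.
have e1 := H _ ux; rewrite cs in e1; have {}e1 := e1 a1.
have e2 := H1 (x + ofr s); rewrite cs in e2; have {}e2 := e2 a2.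
have e3 := H2 (x + ofr s); rewrite cs in e3; have {}e3 := e3 a3.
rewrite e1 in e2; have := cabsDB (f x) (g x) (g (x + ofr s)); rewrite (cabsBC (f x) (g (x + ofr s))).
by move: e2 e3; lra.
Qed.

End Matrix2.

(** * The sections built from sigma[p,q] and sigma, and their minors *)

Section FixedCurve.
Variable R : realType.
Local Notation C := (Cx R).
Variables (w1 w2 eta1 p q t alpha : C).
Hypothesis O0 : 0 < complex.Im (w2 / w1).
Local Notation l := (lat w1 w2).
Local Notation inL := (in_lat w1 w2).
Local Notation Om := (w2 / w1).
Local Notation th := (th11 Om).
Local Notation hp := (half_period w1 w2).
Hypothesis T1 : th 1 0 != 0.
Hypothesis HS : \sum_nu wp w1 w2 (hp nu) = 0.
Hypothesis Heta : forall u, ~ inL u -> wzeta w1 w2 (u + w1) = wzeta w1 w2 u + eta1.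
Let w10 : w1 != 0 := w1_neq0 O0.
Local Notation sg := (sigma11 w1 w2 eta1).
Local Notation wpf := (wp w1 w2).
Local Notation zt := (wzeta w1 w2).
Local Notation T k u := (Th k p q (u / w1) Om).

Ltac dleaf ::= lazymatch goal with
  | |- der (fun u => cexp (@?f u)) _ _ => apply: der_cexpf; dt
  | |- der (fun u => th11 _ ?k (@?f u)) _ _ => apply: (der_thf O0); dt
  | |- der (fun u => Th ?k _ _ (@?f u) _) _ _ => apply: (der_Th _ _ _ O0); dt
  | |- der (th11 _ _) _ _ => exact: (der_th O0)
  end.

(** The Gaussian factor common to sigma and sigma[p,q]. Below, [s0], [s1], [s2] are sigma[p,q] with
    its first two derivatives, and [sg1] is the derivative of sigma. *)
Definition gE (u : C) : C := w1 / th 1 0 * cexp (eta1 / (2 * w1) * u ^+ 2).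
Definition s0 (u : C) : C := gE u * T 0 u.
Definition s1 (u : C) : C := gE u * (eta1 / w1 * u * T 0 u + T 1 u / w1).
Definition s2 (u : C) : C := gE u * ((eta1 / w1 + (eta1 / w1 * u) ^+ 2) * T 0 u
  + 2 * (eta1 / w1 * u) * T 1 u / w1 + T 2 u / w1 ^+ 2).
Definition sg1 (u : C) : C := gE u * (eta1 / w1 * u * th 0 (u / w1) + th 1 (u / w1) / w1).

Lemma gE_neq0 u : gE u != 0.
Proof. by rewrite /gE !mulf_neq0 ?invr_neq0 ?cexp_neq0. Qed.

Lemma der_gE u : der gE u (gE u * (eta1 / w1 * u)).
Proof. by rewrite /gE; apply: der_eq; [dt|rewrite /=; field; rewrite w10 T1]. Qed.

Lemma der_T k u : der (fun u => T k u) u (T k.+1 u / w1).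
Proof.
have hw : der (fun u => u / w1) u (w1^-1) by apply: der_eq; [apply: derMc; dt|rewrite mul1r].
exact: (der_Th k p q O0 hw).
Qed.

Lemma der_s0 u : der s0 u (s1 u).
Proof.
by rewrite /s0; apply: der_eq; [apply: derM; [exact: der_gE|exact: der_T]|rewrite /s1; ring].
Qed.

Lemma der_s1 u : der s1 u (s2 u).
Proof.
rewrite /s1; apply: der_eq.
  apply: derM; first exact: der_gE.
  apply: derD; last by apply: derMc; exact: der_T.
  by apply: derM; [apply: dercM; dt|exact: der_T].
by rewrite /s2 /=; field.
Qed.

Lemma sigma_pq_s0 u : sigma_pq w1 w2 eta1 p q u = s0 u.
Proof. by rewrite sigma_pqE. Qed.

Lemma der_sg1 u : der sg u (sg1 u).
Proof. by apply: der_eq (der_sg eta1 O0 T1 u) _; rewrite /sg1 /gE. Qed.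

Lemma sg1_zeta u : ~ inL u -> sg1 u = sg u * zt u.
Proof. by move=> lu; apply: (der_uniq (der_sg1 u)); exact: (der_sg_zeta O0 T1 HS Heta). Qed.

Lemma sg_opp u : sg (- u) = - sg u.
Proof. by rewrite /sigma11 sqrrN mulNr th_opp0 // mulrN. Qed.

(** The entry [phi] without its exponential of zeta functions, and [dgv] its derivative in u. *)
Definition gv (v u : C) : C := s0 (u + v + t) * sg (u - v).
Definition dgv (v u : C) : C := s1 (u + v + t) * sg (u - v) + s0 (u + v + t) * sg1 (u - v).

Lemma der_gv v u : der (gv v) u (dgv v u).
Proof.
have h1 : der (fun u => u + v + t) u 1.
  by apply: der_eq; [dt|rewrite !addr0].
have h2 : der (fun u => u - v) u 1 by apply: der_eq; [dt|rewrite subr0].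
rewrite /gv; apply: der_eq.
  apply: derM; first exact: (der_comp (f := s0) h1 (der_s0 _)).
  exact: (der_comp (f := sg) h2 (der_sg1 _)).
by rewrite /dgv !mulr1 addrC.
Qed.

(** A shift of the characteristic turns theta[p,q](x + y + s) into theta_11((x + h) + (y + h)),
    where h is half of the total shift; differences of arguments are unaffected, so [three_term]
    applies. The exponential factors [k] agree in the three products because they depend only on the
    sum of the arguments. *)
Lemma mixed_three (a b c d s : C) :
  Th 0 p q (a + b + s) Om * th 0 (a - b) * (Th 0 p q (c + d + s) Om * th 0 (c - d))
  - Th 0 p q (c + b + s) Om * th 0 (c - b) * (Th 0 p q (a + d + s) Om * th 0 (a - d))
  = Th 0 p q (b + d + s) Om * th 0 (b - d) * (Th 0 p q (a + c + s) Om * th 0 (a - c)).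
Proof.
have Sh z := Th_shift p q 2^-1 2^-1 z O0.
have [z0 z0E] : exists z0, z0 = (p - 2^-1) * Om + (q - 2^-1) by eexists.
have [h hE] : exists h, h + h = s + z0 by exists ((s + z0) / 2); field.
have [k kE] : exists k : C -> C, forall z,
    cexp (ipi R * (p - 2^-1) ^+ 2 * Om + 2 * ipi R * (p - 2^-1) * (z + q)) = k z by eexists.
have S2 x y : Th 0 p q (x + y + s) Om = k (x + y + s) * th 0 ((x + h) + (y + h)).
  rewrite (Sh (x + y + s)) -z0E kE.
  by have -> : x + h + (y + h) = x + y + s + z0; [transitivity (x + y + (h + h)); [ring|rewrite hE; ring]|].
have k2 x y z w : k (x + y + s) * k (z + w + s) = k (x + y + z + w + s) * k s.
  by rewrite -!kE -!cexpD; congr cexp; ring.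
have := three_term O0 (a + h) (b + h) (c + h) (d + h).
have m x y : x + h - (y + h) = x - y by ring.
rewrite !m => /eqP; rewrite -subr_eq0 subr0 => /eqP Z.
rewrite !S2.
have tbc : th 0 (b - c) = - th 0 (c - b) by rewrite -opprB th_opp0.
set K := k (a + b + c + d + s) * k s.
have K1 : k (a + b + s) * k (c + d + s) = K by exact: k2.
have K2 : k (c + b + s) * k (a + d + s) = K by rewrite k2; congr (k _ * _); ring.
have K3 : k (b + d + s) * k (a + c + s) = K by rewrite k2; congr (k _ * _); ring.
move: Z; rewrite tbc (addrC (b + h) (c + h)) => Z.
transitivity (K * (th 0 (a + h + (b + h)) * th 0 (a - b) * (th 0 (c + h + (d + h)) * th 0 (c - d))
   - th 0 (c + h + (b + h)) * th 0 (c - b) * (th 0 (a + h + (d + h)) * th 0 (a - d)))).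
  by rewrite mulrBr -{1}K1 -{1}K2; ring.
transitivity (K * (th 0 (b + h + (d + h)) * th 0 (b - d) * (th 0 (a + h + (c + h)) * th 0 (a - c)))).
  congr (K * _); apply/eqP; rewrite -subr_eq0; apply/eqP; rewrite -[RHS]Z; ring.
by rewrite -K3; ring.
Qed.

Variables (v w : C).
Definition KK : C := s0 (v + w + t) * sg (v - w).

(** Since v and w enter only through [KK], quotients of such minors do not depend on the choice of
    [uphi] and [upsi]. The Gaussian factors match because the sums of squares of the four arguments
    agree. *)
Lemma gv_det u u' : gv v u * gv w u' - gv v u' * gv w u = KK * (sg (u - u') * s0 (u + u' + t)).
Proof.
rewrite /gv /KK /s0 /sigma11 -!/(gE _).
have H4 x y z u1 : gE x * gE y * (gE z * gE u1) = (w1 / th 1 0) ^+ 4 *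
    cexp (eta1 / (2 * w1) * (x ^+ 2 + y ^+ 2 + z ^+ 2 + u1 ^+ 2)).
  rewrite /gE; move: (w1 / th 1 0) (eta1 / (2 * w1)) => K c.
  transitivity (K ^+ 4 * (cexp (c * x ^+ 2) * cexp (c * y ^+ 2) * (cexp (c * z ^+ 2) * cexp (c * u1 ^+ 2)))).
    by ring.
  by rewrite -!cexpD; congr (_ * cexp _); ring.
have E : gE (u + v + t) * gE (u - v) * (gE (u' + w + t) * gE (u' - w)) =
   gE (u' + v + t) * gE (u' - v) * (gE (u + w + t) * gE (u - w)).
  by rewrite !H4; congr (_ * cexp (_ * _)); ring.
have E2 : gE (v + w + t) * gE (v - w) * (gE (u - u') * gE (u + u' + t)) =
   gE (u' + v + t) * gE (u' - v) * (gE (u + w + t) * gE (u - w)).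
  by rewrite !H4; congr (_ * cexp (_ * _)); ring.
have d x y : (x - y) / w1 = x / w1 - y / w1 by rewrite mulrBl.
have e x y : (x + y + t) / w1 = x / w1 + y / w1 + t / w1 by rewrite !mulrDl.
have := mixed_three (u / w1) (v / w1) (u' / w1) (w / w1) (t / w1).
rewrite -!e -!d; set G := gE (u' + v + t) * gE (u' - v) * (gE (u + w + t) * gE (u - w)) in E E2.
move=> M; transitivity (G * (T 0 (u + v + t) * th 0 ((u - v) / w1) * (T 0 (u' + w + t) * th 0 ((u' - w) / w1))
   - T 0 (u' + v + t) * th 0 ((u' - v) / w1) * (T 0 (u + w + t) * th 0 ((u - w) / w1)))).
  by rewrite mulrBr -{1}E /G; ring.
by rewrite M -E2; ring.
Qed.

(** The derivative of [gv_det] in u. [gv_F2] is the one in u', by antisymmetry, and [gv_F12] the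
    mixed second derivative. *)
Lemma gv_F1 u u' : ~ inL (u - u') ->
  dgv v u * gv w u' - gv v u' * dgv w u =
  KK * (sg (u - u') * zt (u - u') * s0 (u + u' + t) + sg (u - u') * s1 (u + u' + t)).
Proof.
move=> lu; have h1 : der (fun u => u - u') u 1 by apply: der_eq; [dt|rewrite subr0].
have h2 : der (fun u => u + u' + t) u 1 by apply: der_eq; [dt|rewrite !addr0].
apply: (der_funeq (x := u) (f := fun u => gv v u * gv w u' - gv v u' * gv w u)
  (g := fun u => KK * (sg (u - u') * s0 (u + u' + t)))).
- by move=> x; exact: gv_det.
- by apply: derB; [apply: derMc; exact: der_gv|apply: dercM; exact: der_gv].
apply: der_eq.
  apply: dercM; apply: derM.
    exact: (der_comp (f := sg) h1 (der_sg1 _)).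
  exact: (der_comp (f := s0) h2 (der_s0 _)).
by rewrite !mulr1 (sg1_zeta lu); ring.
Qed.

Lemma gv_F2 u u' : ~ inL (u - u') ->
  gv v u * dgv w u' - dgv v u' * gv w u =
  KK * (- (sg (u - u') * zt (u - u')) * s0 (u + u' + t) + sg (u - u') * s1 (u + u' + t)).
Proof.
move=> lu; have lu' : ~ inL (u' - u) by rewrite -opprB; exact: nlatN.
have := gv_F1 lu'; rewrite -(opprB u u') sg_opp wzeta_opp // (addrC u' u) => h.
by rewrite -[LHS]opprB h; ring.
Qed.

Lemma gv_F12 u u' : ~ inL (u - u') ->
  dgv v u * dgv w u' - dgv v u' * dgv w u =
  KK * sg (u - u') * ((wpf (u - u') - zt (u - u') ^+ 2) * s0 (u + u' + t) + s2 (u + u' + t)).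
Proof.
move=> lu; have h1 : der (fun x => u - x) u' (-1) by apply: der_eq; [dt|rewrite sub0r].
have h2 : der (fun x => u + x + t) u' 1 by apply: der_eq; [dt|rewrite ?addr0 ?add0r].
have hz := der_wzeta O0 lu.
apply: (der_funeq_near (x := u') (f := fun x => dgv v u * gv w x - gv v x * dgv w u)
  (g := fun x => KK * (sg (u - x) * zt (u - x) * s0 (u + x + t) + sg (u - x) * s1 (u + x + t)))).
- have /nearC[r r0 H] : \forall x \near (u - u'), ~ inL x.
    have [r r0 H] := nlat_open O0 lu; apply/nearC; exists r => //.
  apply/nearC; exists r => // x hx; apply: gv_F1; apply: H.
  have -> : u - x - (u - u') = - (x - u') by ring.
  by rewrite cabsN.
- by apply: derB; [apply: dercM; exact: der_gv|apply: derMc; exact: der_gv].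
have d1 := der_comp (f := sg) h1 (der_sg1 _).
have d2 := der_comp (f := zt) h1 hz.
have d3 := der_comp (f := s0) h2 (der_s0 _).
have d4 := der_comp (f := s1) h2 (der_s1 _).
apply: der_eq.
  apply: dercM; apply: derD; first by apply: derM; [apply: derM; [exact: d1|exact: d2]|exact: d3].
  by apply: derM; [exact: d1|exact: d4].
by rewrite (sg1_zeta lu); ring.
Qed.

End FixedCurve.

(** * Addition and duplication formulas for wp and zeta *)

Section WeierstrassIdentities.
Variable R : realType.
Local Notation C := (Cx R).
Variables (w1 w2 : C).
Hypothesis O0 : 0 < complex.Im (w2 / w1).
Local Notation inL := (in_lat w1 w2).
Local Notation Om := (w2 / w1).
Local Notation hp := (half_period w1 w2).
Hypothesis T1 : th11 Om 1 0 != 0.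
Hypothesis HS : \sum_nu wp w1 w2 (hp nu) = 0.
Let w10 : w1 != 0 := w1_neq0 O0.
Local Notation wpf := (wp w1 w2).
Local Notation zt := (wzeta w1 w2).

Definition wp_deriv (u : C) : C := w1 ^- 3 * pd11 Om (u / w1).
Definition wpdd (u : C) : C := w1 ^- 4 * pdd Om (u / w1).

Lemma der_wpf u : ~ inL u -> der wpf u (wp_deriv u).
Proof. exact: (der_wp_pd O0 T1). Qed.

Lemma der_wpd u : ~ inL u -> der wp_deriv u (wpdd u).
Proof.
move=> lu; have h := der_scale (der_pd O0 T1 (th_neq0 O0 (nlat_scale O0 lu))).
by rewrite /wp_deriv; apply: der_eq; [apply: dercM; exact: h|rewrite /wpdd; field].
Qed.

Lemma scaleD a b : (a + b) / w1 = a / w1 + b / w1. Proof. exact: mulrDl. Qed.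
Lemma scaleB a b : (a - b) / w1 = a / w1 - b / w1. Proof. exact: mulrBl. Qed.

Lemma nscaleD a b : ~ inL (a + b) -> ~ in_lat 1 Om (a / w1 + b / w1).
Proof. by rewrite -scaleD; exact: nlat_scale. Qed.
Lemma nscaleB a b : ~ inL (a - b) -> ~ in_lat 1 Om (a / w1 - b / w1).
Proof. by rewrite -scaleB; exact: nlat_scale. Qed.

Lemma wp_neq a b : ~ inL a -> ~ inL b -> ~ inL (a + b) -> ~ inL (a - b) -> wpf b - wpf a != 0.
Proof.
move=> la lb lp lm; rewrite !(wp_pp O0 T1 HS) // -mulrBr mulf_neq0 ?invr_neq0 ?expf_neq0 //.
by apply: (pp_neq O0 T1); [exact: nlat_scale|exact: nlat_scale|exact: nscaleD|exact: nscaleB].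
Qed.

Lemma zeta_add a b : ~ inL a -> ~ inL b -> ~ inL (a + b) -> ~ inL (a - b) ->
  zt (a + b) - zt (a - b) = 2 * zt b + wp_deriv b / (wpf b - wpf a).
Proof.
move=> la lb lp lm; have n0 := wp_neq la lb lp lm.
have := add_formula_b O0 T1 (nlat_scale O0 la) (nlat_scale O0 lb) (nscaleD lp) (nscaleB lm) => E.
have m0 : pp Om (b / w1) - pp Om (a / w1) != 0.
  by apply: (pp_neq O0 T1); [exact: nlat_scale|exact: nlat_scale|exact: nscaleD|exact: nscaleB].
rewrite !(wzeta_L1 O0 T1 HS) // !(wp_pp O0 T1 HS) // scaleD scaleB /wp_deriv.
transitivity ((logder11 Om (a / w1 + b / w1) - logder11 Om (a / w1 - b / w1)) / w1 - 2 * (cc Om / w1 ^+ 2 * b)).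
  by ring.
rewrite E -mulrBr; field.
by rewrite w10 m0.
Qed.

Lemma wp_add a b : ~ inL a -> ~ inL b -> ~ inL (a + b) -> ~ inL (a - b) ->
  wpf (a + b) + wpf (a - b) = 2 * wpf a + wpdd a / (wpf b - wpf a) + wp_deriv a ^+ 2 / (wpf b - wpf a) ^+ 2.
Proof.
move=> la lb lp lm; have n0 := wp_neq la lb lp lm.
have := pp_add_formula O0 T1 (nlat_scale O0 la) (nlat_scale O0 lb) (nscaleD lp) (nscaleB lm) => E.
have m0 : pp Om (b / w1) - pp Om (a / w1) != 0.
  by apply: (pp_neq O0 T1); [exact: nlat_scale|exact: nlat_scale|exact: nscaleD|exact: nscaleB].
rewrite !(wp_pp O0 T1 HS) // scaleD scaleB /wp_deriv /wpdd -mulrDr E -mulrBr; field.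
by rewrite w10 m0.
Qed.

Lemma wpd_neq0 a : ~ inL (a + a) -> wp_deriv a != 0.
Proof.
move=> l2; have la : ~ inL a by move=> h; apply: l2; exact: in_latD.
rewrite /wp_deriv mulf_neq0 ?invr_neq0 ?expf_neq0 //.
by apply: (pd_neq0 O0 T1); [exact: nlat_scale|exact: nscaleD].
Qed.

Lemma wp_dbl a : ~ inL (a + a) -> wpf (a + a) = - (2 * wpf a) + 4^-1 * (wpdd a / wp_deriv a) ^+ 2.
Proof.
move=> l2; have la : ~ inL a by move=> h; apply: l2; exact: in_latD.
have n0 := pd_neq0 O0 T1 (nlat_scale O0 la) (nscaleD l2).
rewrite !(wp_pp O0 T1 HS) // scaleD (pp_dbl O0 T1 (nlat_scale O0 la) (nscaleD l2)) /wp_deriv /wpdd.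
field.
by rewrite w10 n0.
Qed.

Lemma wp_EE nu : wpf (hp nu) = w1 ^- 2 * EE Om nu.
Proof. by rewrite (wp_pp O0 T1 HS) ?half_scale //; exact: half_nlat. Qed.

Lemma wpd_sq u : ~ inL u -> wp_deriv u ^+ 2 = 4 * \prod_nu (wpf u - wpf (hp nu)).
Proof.
move=> lu; rewrite !big_ord_recl big_ord0 mulr1 !wp_EE (wp_pp O0 T1 HS) //.
have -> : lift ord0 (lift ord0 ord0) = Ordinal (isT : (2 < 3)%N) by apply: val_inj.
have -> : lift ord0 ord0 = Ordinal (isT : (1 < 3)%N) :> 'I_3 by apply: val_inj.
rewrite /wp_deriv exprMn (pd_sq O0 T1 (nlat_scale O0 lu)).
by field.
Qed.

(** The invariant g2 of the lattice spanned by w1 and w2. *)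
Definition g2h : C := w1 ^- 4 * (12 * cc Om ^+ 2 + 2 * AA Om).

Lemma wpddE u : ~ inL u -> wpdd u = 6 * wpf u ^+ 2 - g2h / 2.
Proof. by move=> lu; rewrite (wp_pp O0 T1 HS) // /wpdd /pdd /g2h; field. Qed.

Lemma wp_opp u : ~ inL u -> wpf (- u) = wpf u.
Proof. by move=> lu; rewrite !(wp_pp O0 T1 HS) ?mulNr ?pp_opp //; exact: nlatN. Qed.

Lemma wp_per u v : ~ inL u -> inL v -> wpf (u + v) = wpf u.
Proof.
move=> lu lv; rewrite !(wp_pp O0 T1 HS) //; last exact: nlatD.
by rewrite scaleD (pp_per O0) //; apply/(in_lat_scale O0).
Qed.

End WeierstrassIdentities.

(** * Smoothness of holomorphic matrix functions *)

Section MatrixSmooth.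
Variable R : realType.
Local Notation C := (Cx R).

Lemma mat_smooth (Yh : C -> 'M[C]_2) (x0 : C) :
  (\forall x \near x0, derivable Yh x 1) -> Yh x0 = 1%:M ->
  exists2 r : R, 0 < r & forall x, cabs (x - x0) < r ->
    [/\ forall i j, der (fun x => Yh x i j) x (derive1 Yh x i j),
        forall i j, exists l, der (fun x => derive1 Yh x i j) x l & \det (Yh x) != 0].
Proof.
move=> hd h1; have /nearC[r0 r00 H0] := hd.
have ent i j : exists2 r : R, 0 < r & forall x, cabs (x - x0) < r ->
    exists l, der (fun x => derive1 Yh x i j) x l.
  have [|r1 r10 [f1 [f2 [f3 [e1 e2 _]]]]] := @near_derive_near R (fun x => Yh x i j) x0.
    apply/nearC; exists r0 => // x hx; exact: (der_derivable (derivable_entry i j (H0 x hx))).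
  exists (Num.min r0 r1); first by rewrite lt_min r00.
  move=> x hx; have [hx0 hx1] : cabs (x - x0) < r0 /\ cabs (x - x0) < r1.
    by move: hx; rewrite lt_min => /andP.
  exists (f2 x); apply: (der_near (f := f1)); last exact: e2.
  have [d d0 Hd] : exists2 d : R, 0 < d & forall y, cabs (y - x) < d -> cabs (y - x0) < Num.min r0 r1.
    exists (Num.min r0 r1 - cabs (x - x0)); first by rewrite subr_gt0.
    by move=> y hy; apply: le_lt_trans (cabsDB _ _ x) _; rewrite -ltrBrDr.
  apply/nearC; exists d => // y /Hd; rewrite lt_min => /andP[y0 y1].
  exact: (der_uniq (e1 y y1) (derivable_entry i j (H0 y y0))).
have [r1 r10 H1] := ent 0 0; have [r2 r20 H2] := ent 0 1.
have [r3 r30 H3] := ent 1 0; have [r4 r40 H4] := ent 1 1.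
have xx : cabs (x0 - x0) < r0 by rewrite subrr cabs0.
pose dt' := fun x => Yh x 0 0 * Yh x 1 1 - Yh x 0 1 * Yh x 1 0.
have dd := derB (derM (derivable_entry 0 0 (H0 _ xx)) (derivable_entry 1 1 (H0 _ xx)))
  (derM (derivable_entry 0 1 (H0 _ xx)) (derivable_entry 1 0 (H0 _ xx))).
have /contC /(_ 1 ltr01)[r5 r50 H5] := der_cont dd.
exists (Num.min (Num.min r0 r5) (Num.min (Num.min r1 r2) (Num.min r3 r4))).
  by rewrite !lt_min r00 r10 r20 r30 r40 r50.
move=> x; rewrite !lt_min => /andP[/andP[x0' x5] /andP[/andP[x1 x2] /andP[x3 x4]]]; split.
- by move=> i j; apply: derivable_entry; exact: H0.
- move=> i j; move: i j; apply: ord2_ind; apply: ord2_ind; [exact: H1|exact: H2|exact: H3|exact: H4].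
apply/eqP => dz; have := H5 x x5; rewrite -!mx2_det dz h1 det1 sub0r cabsN cabs1.
by rewrite ltxx.
Qed.

Lemma trH_der (Yh : C -> 'M[C]_2) (x0 c d : C) (r : R) :
  (forall x, cabs (x - x0) < r ->
    [/\ forall i j, der (fun x => Yh x i j) x (derive1 Yh x i j),
        forall i j, exists l, der (fun x => derive1 Yh x i j) x l & \det (Yh x) != 0]) ->
  forall x, cabs (x - x0) < r ->
  exists l, der (fun x => \tr (invmx (Yh x) *m derive1 Yh x *m diag2 c d)) x l.
Proof.
move=> H x hx; have [h1 h2 h3] := H x hx.
have [l00 k00] := h2 0 0; have [l01 k01] := h2 0 1; have [l10 k10] := h2 1 0; have [l11 k11] := h2 1 1.
have n0 : Yh x 0 0 * Yh x 1 1 - Yh x 0 1 * Yh x 1 0 != 0 by rewrite -mx2_det.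
have dn := derD (derMc c (derB (derM (h1 1 1) k00) (derM (h1 0 1) k10)))
  (derMc d (derB (derM (h1 0 0) k11) (derM (h1 1 0) k01))).
have dd := derB (derM (h1 0 0) (h1 1 1)) (derM (h1 0 1) (h1 1 0)).
have dq := der_div (g := fun y => Yh y 0 0 * Yh y 1 1 - Yh y 0 1 * Yh y 1 0) n0 dn dd.
eexists; apply: (der_near _ dq); apply/nearC; exists (r - cabs (x - x0)); first by rewrite subr_gt0.
move=> y hy; have hy0 : cabs (y - x0) < r by apply: le_lt_trans (cabsDB _ _ x) _; rewrite -ltrBrDr.
by have [_ _ h] := H y hy0; rewrite tr_inv_diag.
Qed.

Lemma mxexp_diagE (M : 'M[C]_2) : (mxexp_diag M 0 0 = cexp (M 0 0)) * (mxexp_diag M 0 1 = 0) *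
  (mxexp_diag M 1 0 = 0) * (mxexp_diag M 1 1 = cexp (M 1 1)).
Proof. by rewrite /mxexp_diag !mxE /= !mulr1n !mulr0n. Qed.

End MatrixSmooth.

(** * The local form at a *)

Section LocalForms.
Variable R : realType.
Local Notation C := (Cx R).
Variables (w1 w2 eta1 p q t alpha : C).
Hypothesis O0 : 0 < complex.Im (w2 / w1).
Local Notation inL := (in_lat w1 w2).
Local Notation Om := (w2 / w1).
Local Notation hp := (half_period w1 w2).
Hypothesis T1 : th11 Om 1 0 != 0.
Hypothesis HS : \sum_nu wp w1 w2 (hp nu) = 0.
Hypothesis Heta : forall u, ~ inL u -> wzeta w1 w2 (u + w1) = wzeta w1 w2 u + eta1.
Hypothesis la : ~ inL alpha.
Let w10 : w1 != 0 := w1_neq0 O0.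
Local Notation sg := (sigma11 w1 w2 eta1).
Local Notation wpf := (wp w1 w2).
Local Notation zt := (wzeta w1 w2).
Local Notation wp_deriv := (wp_deriv w1 w2).
Local Notation wpdd := (wpdd w1 w2).
Local Notation s0 := (s0 w1 w2 eta1 p q).
Local Notation s1 := (s1 w1 w2 eta1 p q).
Local Notation s2 := (s2 w1 w2 eta1 p q).
Local Notation gv := (gv w1 w2 eta1 p q t).
Local Notation dgv := (dgv w1 w2 eta1 p q t).
Variables (v w : C).
Local Notation KK := (KK w1 w2 eta1 p q t v w).

Definition Ef (u : C) : C := cexp (- (t / 2) * (zt (u - alpha) + zt (u + alpha))).
(** The logarithmic derivative of [Ef], an even function of u. *)
Definition eps_shift (u : C) : C := t / 2 * (wpf (u - alpha) + wpf (u + alpha)).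
Variable Phi : C -> 'M[C]_2.
Hypothesis HPhi : forall u, [/\ Phi u 0 0 = gv v u * Ef u, Phi u 0 1 = gv v (- u) * Ef (- u),
  Phi u 1 0 = gv w u * Ef u & Phi u 1 1 = gv w (- u) * Ef (- u)].
Variables (N : 'M[C]_2) (sh : C).

Lemma Ef_opp u : ~ inL (u - alpha) -> ~ inL (u + alpha) -> Ef (- u) = (Ef u)^-1.
Proof.
move=> h1 h2; rewrite /Ef -cexpN; congr cexp.
have -> : - u - alpha = - (u + alpha) by ring.
have -> : - u + alpha = - (u - alpha) by ring.
by rewrite !(wzeta_opp O0) //; ring.
Qed.

Lemma Ef_neq0 u : Ef u != 0. Proof. exact: cexp_neq0. Qed.

Lemma der_shift (f : C -> C) (c u m : C) : der f (u + c) m -> der (fun x => f (x + c)) u m.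
Proof.
move=> h; apply: der_eq; first by apply: (der_comp (f := f) (g := fun x => x + c)) h; dt.
by rewrite ?addr0 mulr1.
Qed.

Lemma der_Ef u : ~ inL (u - alpha) -> ~ inL (u + alpha) -> der Ef u (Ef u * eps_shift u).
Proof.
move=> h1 h2; rewrite /Ef; apply: der_eq.
  apply: der_cexpf; apply: dercM; apply: derD.
    exact: (der_shift (c := - alpha) (der_wzeta O0 h1)).
  exact: (der_shift (c := alpha) (der_wzeta O0 h2)).
by rewrite /eps_shift; field.
Qed.

Lemma epsf_opp u : ~ inL (u - alpha) -> ~ inL (u + alpha) -> eps_shift (- u) = eps_shift u.
Proof.
move=> h1 h2; rewrite /eps_shift; have -> : - u - alpha = - (u + alpha) by ring.
have -> : - u + alpha = - (u - alpha) by ring.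
by rewrite !(wp_opp O0 T1 HS) // addrC.
Qed.

Lemma det_Phi u : \det (Phi u) = Ef u * Ef (- u) * (KK * (sg (u + u) * s0 t)).
Proof.
rewrite mx2_det; have [-> -> -> ->] := HPhi u.
have := gv_det eta1 p q t O0 v w u (- u); rewrite opprK subrr add0r => <-; ring.
Qed.

(** Here N stands for the inverse of G^(a), and sh for s/3. Near alpha the factor exp(-T^(a))
    combines with [Ef] into exp (chi u), regular at alpha by the addition theorem for zeta. In the
    trace against diag(1, -1) the constant matrix N and the root r drop out and only minors of the
    sections remain; the value at alpha itself follows by continuity. *)
Lemma local_a (r : C -> C) (Ya : C -> 'M[C]_2) (a m : C) :
  ~ inL (alpha + alpha) -> a = wpf alpha + sh -> m = wp_deriv alpha * t / 2 ->
  (\forall x \near a, derivable Ya x 1) -> Ya a = 1%:M ->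
  (\forall u \near alpha, derivable r u 1) ->
  (\forall u \near alpha^', r u *: (N *m Phi u) =
     Ya (wpf u + sh) *m mxexp_diag (- ((wpf u + sh - a)^-1 *: diag2 m (- m)))) ->
  let H x := \tr (invmx (Ya x) *m derive1 Ya x *m diag2 1 (-1)) in
  (\forall x \near a, derivable H x 1) /\
  H a * wp_deriv alpha = 2 * (s1 t / s0 t) + 2 * t * wpf (alpha + alpha).
Proof.
move=> l2 ea em hY Y1 /nearC[rr rr0 hr] /nearC'[rE rE0 hE] H.
have [ry ry0 HY] := mat_smooth hY Y1.
have Hd := trH_der 1 (-1) HY.
split; first by apply/nearC; exists ry => // x /Hd[k hk]; exact: (der_derivable hk).
have da := der_wpf O0 T1 la.
have /contC /(_ ry ry0)[rc rc0 hc] := der_cont da.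
have [rl rl0 hl] := nlat_open O0 la; have [rm rm0 hm] := nlat_open O0 l2.
have [rd rd0 hdis] := lat_discrete O0 0.
pose s := Num.min (Num.min rr rE) (Num.min (Num.min rc rl) (Num.min (rm / 2) rd)).
have s00 : 0 < s by rewrite !lt_min rr0 rE0 rc0 rl0 rd0 divr_gt0.
have base u : cabs (u - alpha) < s -> u != alpha ->
   [/\ cabs (u - alpha) < rr, cabs (u - alpha) < rE, cabs (wpf u + sh - a) < ry &
     [/\ ~ inL u, ~ inL (u + alpha) & ~ inL (u - alpha)]].
  rewrite !lt_min => /andP[/andP[u1 u2] /andP[/andP[u3 u4] /andP[u5 u6]]] ua; split => //.
    by rewrite ea opprD addrACA subrr addr0; exact: hc.
  split; first exact: hl.
    apply: hm; have -> : u + alpha - (alpha + alpha) = u - alpha by ring.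
    by apply: lt_le_trans u5 _; rewrite ler_pdivrMr //; have := ltW rm0; lra.
  by apply: hdis; rewrite ?subr0 // subr_eq0.
have l2u u : cabs (u - alpha) < s -> ~ inL (u + u).
  rewrite !lt_min => /andP[_ /andP[_ /andP[u5 _]]]; apply: hm.
  have -> : u + u - (alpha + alpha) = (u - alpha) + (u - alpha) by ring.
  by apply: le_lt_trans (cabsD _ _) _; rewrite [rm]splitr; exact: ltrD.
pose chi u := t * (zt alpha - zt (u + alpha)).
have entry u : cabs (u - alpha) < s -> u != alpha ->
  [/\ Ya (wpf u + sh) 0 0 = r u * (N 0 0 * gv v u + N 0 1 * gv w u) * cexp (chi u),
      Ya (wpf u + sh) 1 0 = r u * (N 1 0 * gv v u + N 1 1 * gv w u) * cexp (chi u),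
      Ya (wpf u + sh) 0 1 = r u * (N 0 0 * gv v (- u) + N 0 1 * gv w (- u)) * cexp (- chi u)
    & Ya (wpf u + sh) 1 1 = r u * (N 1 0 * gv v (- u) + N 1 1 * gv w (- u)) * cexp (- chi u)].
  move=> us ua; have [u1 u2 u3 [lu lp lm]] := base u us ua.
  have E := hE u ua u2; set M := Ya _ in E *; set c := (wpf u + sh - a)^-1 in E.
  have n0 := wp_neq O0 T1 HS lu la lp lm.
  have cE : c = (wpf u - wpf alpha)^-1 by rewrite /c ea; congr (_^-1); ring.
  have n1 : wpf u - wpf alpha != 0 by rewrite -opprB oppr_eq0.
  have z := zeta_add O0 T1 HS lu la lp lm.
  have X : Ef u * cexp (c * m) = cexp (chi u).
    rewrite /Ef -cexpD; congr cexp; rewrite /chi cE em.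
    have -> : (wpf u - wpf alpha)^-1 * (wp_deriv alpha * t / 2) = - (t / 2 * (wp_deriv alpha / (wpf alpha - wpf u))).
      by field; rewrite n0 n1.
    have -> : wp_deriv alpha / (wpf alpha - wpf u) = zt (u + alpha) - zt (u - alpha) - 2 * zt alpha.
      by rewrite z; ring.
    by field.
  have X' : Ef (- u) * cexp (- (c * m)) = cexp (- chi u).
    by rewrite Ef_opp // [cexp (- (c * m))]cexpN [RHS]cexpN -invfM X.
  have D0 : mxexp_diag (- (c *: diag2 m (- m))) 0 0 = cexp (- (c * m)) by rewrite mxexp_diagE !mxE /= mulr1n.
  have D1 : mxexp_diag (- (c *: diag2 m (- m))) 1 1 = cexp (c * m).
    by rewrite mxexp_diagE !mxE /= mulr1n mulrN opprK.
  have [p00 p01 p10 p11] := HPhi u.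
  have ex i : M i 0 * cexp (- (c * m)) = r u * ((N i 0 * gv v u + N i 1 * gv w u) * Ef u).
    have := congr1 (fun A : 'M[C]_2 => A i 0) E; rewrite /= mxE !mx2_mul D0 mxexp_diagE p00 p10 mulr0 addr0 => <-.
    by ring.
  have ey i : M i 1 * cexp (c * m) = r u * ((N i 0 * gv v (- u) + N i 1 * gv w (- u)) * Ef (- u)).
    have := congr1 (fun A : 'M[C]_2 => A i 1) E; rewrite /= mxE !mx2_mul D1 mxexp_diagE p01 p11 mulr0 add0r => <-.
    by ring.
  have q0 := cexp_neq0 (c * m).
  have fx i : M i 0 = r u * (N i 0 * gv v u + N i 1 * gv w u) * cexp (chi u).
    by rewrite -X; have := ex i; rewrite cexpN => h; rewrite -[LHS](divfK q0) h; ring.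
  have fy i : M i 1 = r u * (N i 0 * gv v (- u) + N i 1 * gv w (- u)) * cexp (- chi u).
    by rewrite -X' cexpN; have := ey i => h; rewrite -[LHS](mulfK q0) h; ring.
  by split; [exact: fx|exact: fx|exact: fy|exact: fy].
have key u : cabs (u - alpha) < s -> u != alpha ->
    H (wpf u + sh) * wp_deriv u = 2 * (s1 t / s0 t) + 2 * t * wpf (u + alpha).
  move=> us ua; have [u1 u2 u3 [lu lp lm]] := base u us ua.
  have [e1 e2 dY] := HY _ u3; have [y00 y10 y01 y11] := entry u us ua.
  have dr := derivable_der (hr u u1); set r' := derive1 r u in dr.
  have dc : der chi u (t * wpf (u + alpha)).
    rewrite /chi; apply: der_eq.
      by apply: dercM; apply: derB; [exact: der_cst|exact: (der_shift (der_wzeta O0 lp))].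
    by ring.
  have nb : \forall x \near u, cabs (x - alpha) < s /\ x != alpha.
    have ps : 0 < Num.min (s - cabs (u - alpha)) (cabs (u - alpha)).
      by rewrite lt_min subr_gt0 us cabs_gt0 subr_eq0.
    apply/nearC; exists (Num.min (s - cabs (u - alpha)) (cabs (u - alpha))) => // x.
    rewrite lt_min => /andP[x1 x2]; split.
      by apply: le_lt_trans (cabsDB _ _ u) _; rewrite -ltrBrDr.
    by apply/eqP => xa; move: x2; rewrite xa cabsBC ltxx.
  have dx : der (fun x => wpf x + sh) u (wp_deriv u).
    by apply: der_eq; [apply: derD; [exact: (der_wpf O0 T1 lu)|exact: der_cst]|rewrite addr0].
  have dg z : der (gv z) u (dgv z u) by exact: der_gv.
  have dgn z : der (fun x => gv z (- x)) u (- dgv z (- u)).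
    apply: der_eq; first by apply: (der_comp (f := gv z) (g := fun x => - x)); [dt|exact: der_gv].
    by ring.
  have b0 i : derive1 Ya (wpf u + sh) i 0 * wp_deriv u =
     (r' * (N i 0 * gv v u + N i 1 * gv w u) + r u * (N i 0 * dgv v u + N i 1 * dgv w u)
      + r u * (N i 0 * gv v u + N i 1 * gv w u) * (t * wpf (u + alpha))) * cexp (chi u).
    apply: (der_funeq_near (x := u) (f := fun x => Ya (wpf x + sh) i 0)
      (g := fun x => r x * (N i 0 * gv v x + N i 1 * gv w x) * cexp (chi x))).
    - apply: filterS nb => x [xs xa]; have [z00 z10 _ _] := entry x xs xa.
      by move: i; apply: ord2_ind.
    - exact: (der_comp (f := fun x => Ya x i 0) dx (e1 i 0)).
    apply: der_eq.
      apply: derM; last by apply: der_cexpf; exact: dc.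
      by apply: derM; [exact: dr|apply: derD; apply: dercM; exact: dg].
    by rewrite /=; ring.
  have b1 i : derive1 Ya (wpf u + sh) i 1 * wp_deriv u =
     (r' * (N i 0 * gv v (- u) + N i 1 * gv w (- u)) - r u * (N i 0 * dgv v (- u) + N i 1 * dgv w (- u))
      - r u * (N i 0 * gv v (- u) + N i 1 * gv w (- u)) * (t * wpf (u + alpha))) * cexp (- chi u).
    apply: (der_funeq_near (x := u) (f := fun x => Ya (wpf x + sh) i 1)
      (g := fun x => r x * (N i 0 * gv v (- x) + N i 1 * gv w (- x)) * cexp (- chi x))).
    - apply: filterS nb => x [xs xa]; have [_ _ z01 z11] := entry x xs xa.
      by move: i; apply: ord2_ind.
    - exact: (der_comp (f := fun x => Ya x i 1) dx (e1 i 1)).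
    apply: der_eq.
      apply: derM; last by apply: der_cexpf; apply: derN; exact: dc.
      by apply: derM; [exact: dr|apply: derD; apply: dercM; exact: dgn].
    by rewrite /=; ring.
  have l2' : ~ inL (u - - u) by rewrite opprK; exact: l2u.
  have F1 := gv_F1 p q t O0 T1 HS Heta v w l2'; have F2 := gv_F2 p q t O0 T1 HS Heta v w l2'.
  have F0 := gv_det eta1 p q t O0 v w u (- u).
  rewrite /H tr_inv_diag //; move: dY; rewrite mx2_det.
  rewrite opprK subrr add0r in F0 F1 F2.
  have := b0 0; have := b0 1; have := b1 0; have := b1 1; rewrite y00 y01 y10 y11 [cexp (- chi u)]cexpN.
  have q0 := cexp_neq0 (chi u).
  move: (cexp (chi u)) q0 => e q0 B11 B01 B10 B00.
  move: B00 B01 B10 B11; set P := wp_deriv u; set B := derive1 Ya _ => B00 B01 B10 B11 dY.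
  set F := gv v u * gv w (- u) - gv v (- u) * gv w u in F0.
  have dE : r u * (N 0 0 * gv v u + N 0 1 * gv w u) * e * (r u * (N 1 0 * gv v (- u) + N 1 1 * gv w (- u)) / e) -
     r u * (N 0 0 * gv v (- u) + N 0 1 * gv w (- u)) / e * (r u * (N 1 0 * gv v u + N 1 1 * gv w u) * e) =
     r u ^+ 2 * (N 0 0 * N 1 1 - N 0 1 * N 1 0) * F by rewrite /F; field.
  rewrite dE in dY *; have [rn Fn] : r u ^+ 2 * (N 0 0 * N 1 1 - N 0 1 * N 1 0) != 0 /\ F != 0.
    by move: dY; rewrite mulf_eq0 negb_or => /andP.
  (* The sum of [gv_F1] and [gv_F2] at u' = - u: the zeta terms cancel and the argument of
     sigma[p,q] is t. *)
  have S1 : (dgv v u * gv w (- u) - gv v (- u) * dgv w u) + (gv v u * dgv w (- u) - dgv v (- u) * gv w u)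
     = F * (2 * (s1 t / s0 t)).
    have kn : KK * sg (u + u) * s0 t != 0 by rewrite -mulrA -F0.
    have s0n : s0 t != 0 by apply/eqP => z; move: kn; rewrite z mulr0 eqxx.
    by rewrite F1 F2 F0; field.
  have num : (r u * (N 1 0 * gv v (- u) + N 1 1 * gv w (- u)) / e * (B 0 0 * P)
      - r u * (N 0 0 * gv v (- u) + N 0 1 * gv w (- u)) / e * (B 1 0 * P)) * 1
    + (r u * (N 0 0 * gv v u + N 0 1 * gv w u) * e * (B 1 1 * P)
      - r u * (N 1 0 * gv v u + N 1 1 * gv w u) * e * (B 0 1 * P)) * -1
    = r u ^+ 2 * (N 0 0 * N 1 1 - N 0 1 * N 1 0) * (
      (dgv v u * gv w (- u) - gv v (- u) * dgv w u) + (gv v u * dgv w (- u) - dgv v (- u) * gv w u)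
      + 2 * (t * wpf (u + alpha)) * F).
    by rewrite B00 B01 B10 B11 /F; field.
  rewrite S1 in num; set Kn := r u ^+ 2 * _ in num rn dY *.
  transitivity ((Kn * (F * (2 * (s1 t / s0 t)) + 2 * (t * wpf (u + alpha)) * F)) / (Kn * F)).
    rewrite -num; set Q := Kn * F.
    have G (a00 a01 a10 a11 b00 b01 b10 b11 P' : C) :
      ((a11 * b00 - a01 * b10) * 1 + (a00 * b11 - a10 * b01) * -1) / Q * P' =
      ((a11 * (b00 * P') - a01 * (b10 * P')) * 1 + (a00 * (b11 * P') - a10 * (b01 * P')) * -1) / Q by ring.
    exact: G.
  have G (K F' X Y : C) : K != 0 -> F' != 0 -> K * (F' * (2 * X) + 2 * (t * Y) * F') / (K * F') = 2 * X + 2 * t * Y.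
    by move=> K0 F0'; field; rewrite K0 F0'.
  exact: G.
have ca : cabs (wpf alpha + sh - a) < ry by rewrite ea subrr cabs0.
have [k hk] := Hd _ ca.
have dx : der (fun x => wpf x + sh) alpha (wp_deriv alpha).
  by apply: der_eq; [apply: derD; [exact: da|exact: der_cst]|rewrite addr0].
have d1 := derM (der_comp (f := H) dx hk) (der_wpd O0 T1 la).
have d2 : der (fun u => 2 * (s1 t / s0 t) + 2 * t * wpf (u + alpha)) alpha (2 * t * wp_deriv (alpha + alpha)).
  apply: der_eq; first by apply: derD; [exact: der_cst|apply: dercM; exact: (der_shift (der_wpf O0 T1 l2))].
  by rewrite add0r.
rewrite ea; apply: (cont_eq (f := fun u => H (wpf u + sh) * wp_deriv u)
  (g := fun u => 2 * (s1 t / s0 t) + 2 * t * wpf (u + alpha)) (x := alpha)).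
- exact: (der_cont d1).
- exact: (der_cont d2).
by apply/nearC'; exists s => // u ua us; exact: key.
Qed.

End LocalForms.

(** * The local forms at the branch points *)

Section LocalFormsE.
Variable R : realType.
Local Notation C := (Cx R).
Variables (w1 w2 eta1 p q t alpha : C).
Hypothesis O0 : 0 < complex.Im (w2 / w1).
Local Notation inL := (in_lat w1 w2).
Local Notation Om := (w2 / w1).
Local Notation hp := (half_period w1 w2).
Hypothesis T1 : th11 Om 1 0 != 0.
Hypothesis HS : \sum_nu wp w1 w2 (hp nu) = 0.
Hypothesis Heta : forall u, ~ inL u -> wzeta w1 w2 (u + w1) = wzeta w1 w2 u + eta1.
Hypothesis la : ~ inL alpha.
Local Notation sg := (sigma11 w1 w2 eta1).
Local Notation wpf := (wp w1 w2).
Local Notation zt := (wzeta w1 w2).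
Local Notation wpd := (wp_deriv w1 w2).
Local Notation wpdd := (wpdd w1 w2).
Local Notation s0 := (s0 w1 w2 eta1 p q).
Local Notation s1 := (s1 w1 w2 eta1 p q).
Local Notation s2 := (s2 w1 w2 eta1 p q).
Local Notation gv := (gv w1 w2 eta1 p q t).
Local Notation dgv := (dgv w1 w2 eta1 p q t).
Variables (v w : C).
Local Notation KK := (KK w1 w2 eta1 p q t v w).
Local Notation Ef := (Ef w1 w2 t alpha).
Local Notation epsf := (eps_shift w1 w2 t alpha).
Variable Phi : C -> 'M[C]_2.
Hypothesis HPhi : forall u, [/\ Phi u 0 0 = gv v u * Ef u, Phi u 0 1 = gv v (- u) * Ef (- u),
  Phi u 1 0 = gv w u * Ef u & Phi u 1 1 = gv w (- u) * Ef (- u)].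
Variables (N : 'M[C]_2) (sh : C).

Definition Phi1 (u : C) : 'M[C]_2 := \matrix_(i < 2, j < 2)
  if j == 0 then (dgv (if i == 0 then v else w) u + gv (if i == 0 then v else w) u * epsf u) * Ef u
  else - (dgv (if i == 0 then v else w) (- u) + gv (if i == 0 then v else w) (- u) * epsf u) * Ef (- u).

Lemma der_Phi u i j : ~ inL (u - alpha) -> ~ inL (u + alpha) ->
  der (fun x => Phi x i j) u (Phi1 u i j).
Proof.
move=> h1 h2.
have dE := der_Ef t O0 h1 h2.
have h1' : ~ inL (- u - alpha).
  have -> : - u - alpha = - (u + alpha) by ring.
  exact: nlatN.
have h2' : ~ inL (- u + alpha).
  have -> : - u + alpha = - (u - alpha) by ring.
  exact: nlatN.
have dE' := der_Ef t O0 h1' h2'.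
have dneg (f : C -> C) m : der f (- u) m -> der (fun x => f (- x)) u (- m).
  move=> h; apply: der_eq; first by apply: (der_comp (f := f) (g := fun x => - x)); [dt|exact: h].
  by ring.
have c0 z : der (fun x => gv z x * Ef x) u ((dgv z u + gv z u * epsf u) * Ef u).
  by apply: der_eq; [apply: derM; [exact: der_gv|exact: dE]|rewrite /=; ring].
have c1 z : der (fun x => gv z (- x) * Ef (- x)) u (- (dgv z (- u) + gv z (- u) * epsf u) * Ef (- u)).
  apply: der_eq.
    by apply: derM; [exact: (dneg _ _ (der_gv eta1 p q t O0 T1 z _))|exact: (dneg _ _ dE')].
  by rewrite /= (epsf_opp t O0 T1 HS h1 h2); ring.
move: i j; apply: ord2_ind; apply: ord2_ind; rewrite /Phi1 mxE /=.
- by apply: (der_ext _ (c0 v)) => x; have [-> _ _ _] := HPhi x.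
- by apply: (der_ext _ (c1 v)) => x; have [_ -> _ _] := HPhi x.
- by apply: (der_ext _ (c0 w)) => x; have [_ _ -> _] := HPhi x.
by apply: (der_ext _ (c1 w)) => x; have [_ _ _ ->] := HPhi x.
Qed.

(** The determinant of the derivative of Phi / sqrt(det Phi) is - Wq, as [Phi_logs] shows; the
    normalization by the root accounts for the square of D' / det Phi there. *)
Definition Wq (u : C) : C := wpf (u + u) + s2 t / s0 t + 2 * epsf u * (s1 t / s0 t) + epsf u ^+ 2.

(** D' / det Phi equals 2 zeta(2u), and a quarter of its square cancels the zeta^2 of the mixed
    minor [gv_F12]; what survives is elliptic in u. *)
Lemma Phi_logs u : ~ inL (u + u) -> ~ inL (u - alpha) -> ~ inL (u + alpha) -> \det (Phi u) != 0 ->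
  exists D' : C, der (fun x => \det (Phi x)) u D' /\
   \det (Phi1 u) / \det (Phi u) - 4^-1 * (D' / \det (Phi u)) ^+ 2 = - Wq u /\
   Phi1 u 0 0 * Phi u 1 1 + Phi u 0 0 * Phi1 u 1 1 - Phi1 u 0 1 * Phi u 1 0 - Phi u 0 1 * Phi1 u 1 0 = D'.
Proof.
move=> l2 h1 h2 d0.
have lu2 : ~ inL (u - - u) by rewrite opprK.
have F1 := gv_F1 p q t O0 T1 HS Heta v w lu2; have F2 := gv_F2 p q t O0 T1 HS Heta v w lu2.
have F0 := gv_det eta1 p q t O0 v w u (- u); have F12 := gv_F12 p q t O0 T1 HS Heta v w lu2.
rewrite opprK subrr add0r in F0 F1 F2 F12.
have e0 := Ef_neq0 w1 w2 t alpha u; have eo := Ef_opp t O0 h1 h2.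
have dP i j := der_Phi i j h1 h2.
have dd : der (fun x => \det (Phi x)) u
  (Phi1 u 0 0 * Phi u 1 1 + Phi u 0 0 * Phi1 u 1 1 - Phi1 u 0 1 * Phi u 1 0 - Phi u 0 1 * Phi1 u 1 0).
  apply: (der_ext (f := fun x => Phi x 0 0 * Phi x 1 1 - Phi x 0 1 * Phi x 1 0)).
    by move=> x; rewrite mx2_det.
  apply: der_eq; first exact: (derB (derM (dP 0 0) (dP 1 1)) (derM (dP 0 1) (dP 1 0))).
  by rewrite /=; ring.
eexists; split; first exact: dd.
split=> //.
have [p00 p01 p10 p11] := HPhi u.
have dE : \det (Phi u) = gv v u * gv w (- u) - gv v (- u) * gv w u.
  by rewrite mx2_det p00 p01 p10 p11 eo; field.
have d1E : \det (Phi1 u) = - ((dgv v u * dgv w (- u) - dgv v (- u) * dgv w u)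
   + epsf u * ((dgv v u * gv w (- u) - gv v (- u) * dgv w u) + (gv v u * dgv w (- u) - dgv v (- u) * gv w u))
   + epsf u ^+ 2 * (gv v u * gv w (- u) - gv v (- u) * gv w u)).
  by rewrite mx2_det /Phi1 !mxE /= eo; field.
have DE : Phi1 u 0 0 * Phi u 1 1 + Phi u 0 0 * Phi1 u 1 1 - Phi1 u 0 1 * Phi u 1 0 - Phi u 0 1 * Phi1 u 1 0
   = (dgv v u * gv w (- u) - gv v (- u) * dgv w u) - (gv v u * dgv w (- u) - dgv v (- u) * gv w u).
  by rewrite p00 p01 p10 p11 /Phi1 !mxE /= eo; field.
rewrite DE d1E dE F0 F1 F2 F12; rewrite dE F0 mulrA mulf_eq0 negb_or in d0.
have {d0} [/andP[k0 g0] n0] : ((KK != 0) && (sg (u + u) != 0)) /\ s0 t != 0.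
  by move: d0 => /andP[]; rewrite mulf_eq0 negb_or.
rewrite /Wq; move: (KK) (sg (u + u)) (s0 t) (s1 t) (s2 t) (zt (u + u)) (wpf (u + u)) (epsf u) k0 g0 n0.
move=> K g S0 S1 S2 z W ep k0 g0 n0; field.
by rewrite k0 g0 n0.
Qed.

Variables (e eh fh hh : C).
Hypothesis ee : e = eh + sh.
Hypothesis Hcub : forall u, ~ inL u -> wpd u ^+ 2 = 4 * ((wpf u - eh) * (wpf u - fh) * (wpf u - hh)).
Hypothesis Hsum : eh + fh + hh = 0.
Hypothesis Hdd : forall u, ~ inL u -> wpdd u = 6 * wpf u ^+ 2 - 2 * (eh ^+ 2 + eh * fh + fh ^+ 2).
Hypothesis nf : eh - fh != 0.
Hypothesis nh : eh - hh != 0.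
Hypothesis na : wpf alpha - eh != 0.
Local Notation A := (wpf alpha).

(** In the coordinate y = x - e_nu one has wp'^2 = 4 y P1 y, and [epsr] is [eps_shift] as a rational
    function of y. [Rt] is designed for [Rt_key]: the determinant of the derivative of the
    normalized Phi with respect to log y equals - 1/16 - y Rt y, the exponents -1/4 and 1/4
    accounting for 1/16. *)
Definition P1 (y : C) : C := (y + (eh - fh)) * (y + (eh - hh)).
Definition P1' (y : C) : C := 2 * y + (eh - fh) + (eh - hh).
Definition epsr (y : C) : C := t / 2 * (2 * (eh + y) + 2 * (P1 y + y * P1' y) / (A - eh - y)
   + 4 * y * P1 y / (A - eh - y) ^+ 2).
Definition Rt (y : C) : C := P1' y / (8 * P1 y) + y * P1' y ^+ 2 / (16 * P1 y ^+ 2) - (eh + y) / (2 * P1 y)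
  + (s2 t / s0 t + 2 * epsr y * (s1 t / s0 t) + epsr y ^+ 2) / (4 * P1 y).

Lemma epsf_r u y : ~ inL u -> ~ inL (u - alpha) -> ~ inL (u + alpha) -> wpf u = eh + y ->
  epsf u = epsr y.
Proof.
move=> lu h1 h2 hy; have := wp_add O0 T1 HS lu la h2 h1; have := wp_neq O0 T1 HS lu la h2 h1.
rewrite /eps_shift (addrC (wpf (u - alpha))) => n0 ->; rewrite Hcub // Hdd // hy /epsr /P1 /P1'.
have h3 : hh = - eh - fh by have -> : hh = (eh + fh + hh) - eh - fh; [ring|rewrite Hsum sub0r].
rewrite hy in n0; rewrite h3; have -> : A - (eh + y) = A - eh - y by ring.
have n1 : A - eh - y != 0 by have -> : A - eh - y = A - (eh + y) by ring.
by field.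
Qed.

Lemma Rt_key u y : ~ inL (u + u) -> ~ inL (u - alpha) -> ~ inL (u + alpha) -> wpf u = eh + y ->
  (y / wpd u) ^+ 2 * Wq u - 16^-1 = y * Rt y.
Proof.
move=> l2 h1 h2 hy; have lu : ~ inL u by move=> h; apply: l2; exact: in_latD.
have d0 := wpd_neq0 O0 T1 l2; have c := Hcub lu.
rewrite /Wq (epsf_r lu h1 h2 hy) (wp_dbl O0 T1 HS l2) /Rt.
move: (epsr y) (s2 t / s0 t) (s1 t / s0 t) => ep X2 X1.
have h3 : hh = - eh - fh by have -> : hh = (eh + fh + hh) - eh - fh; [ring|rewrite Hsum sub0r].
have cE : wpd u ^+ 2 = 4 * y * P1 y by rewrite c hy /P1; ring.
have ddE : wpdd u = 2 * (P1 y + y * P1' y) by rewrite Hdd // hy /P1 /P1' h3; ring.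
have yP : 4 * y * P1 y != 0 by rewrite -cE expf_neq0.
have [y0 p0] : y != 0 /\ P1 y != 0.
  by move: yP; rewrite !mulf_eq0 !negb_or => /andP[/andP[_ ->] ->].
have -> : (wpdd u / wpd u) ^+ 2 = (2 * (P1 y + y * P1' y)) ^+ 2 / (4 * y * P1 y) by rewrite expr_div_n cE ddE.
rewrite expr_div_n cE hy; move: (P1' y) (P1 y) y0 p0 => Q' Q y0 p0; field.
by rewrite y0 p0.
Qed.

Lemma Rt0 : Rt 0 = ((eh - fh) + (eh - hh)) / (8 * ((eh - fh) * (eh - hh)))
  + (- (2 * eh) + s2 t / s0 t + 2 * (t * (eh + (eh - fh) * (eh - hh) / (A - eh))) * (s1 t / s0 t)
     + (t * (eh + (eh - fh) * (eh - hh) / (A - eh))) ^+ 2) / (4 * ((eh - fh) * (eh - hh))).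
Proof.
have -> : t * (eh + (eh - fh) * (eh - hh) / (A - eh)) = epsr 0.
  by rewrite /epsr /P1 /P1'; field.
rewrite /Rt; move: (epsr 0) (s2 t / s0 t) (s1 t / s0 t) => ep X2 X1; rewrite /P1 /P1'; field.
by rewrite nf nh.
Qed.

Lemma der_Rt0 : exists k, der Rt 0 k.
Proof.
have i1 : der (fun y : C => y + (eh - fh)) 0 1 by apply: der_eq; [dt|rewrite ?addr0].
have i2 : der (fun y : C => y + (eh - hh)) 0 1 by apply: der_eq; [dt|rewrite ?addr0].
have dP := derM i1 i2; rewrite -/P1 in dP.
have dP' : der P1' 0 2.
  rewrite /P1'; apply: der_eq; first by apply: derD; [apply: derD; [apply: dercM; dt|exact: der_cst]|exact: der_cst].
  by rewrite !addr0 mulr1.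
have p0 : P1 0 != 0 by rewrite /P1 !add0r mulf_neq0.
have a0 : A - eh - 0 != 0 by rewrite subr0.
have da : der (fun y : C => A - eh - y) 0 (-1) by apply: der_eq; [dt|rewrite sub0r].
have a2 : (A - eh - 0) ^+ 2 != 0 by rewrite expf_neq0.
have e1 := der_div (g := fun y => A - eh - y) a0 (dercM 2 (derD dP (derM (der_id 0) dP'))) da.
have e2 := der_div (g := fun y => (A - eh - y) ^+ 2) a2 (derM (dercM 4 (der_id 0)) dP) (derX 2 da).
have e3 := dercM (t / 2) (derD (derD (dercM 2 (derD (der_cst eh 0) (der_id 0))) e1) e2).
have p8 : 8 * P1 0 != 0 by rewrite mulf_neq0 ?pnatr_eq0.
have p16 : 16 * P1 0 ^+ 2 != 0 by rewrite mulf_neq0 ?expf_neq0 ?pnatr_eq0.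
have p2 : 2 * P1 0 != 0 by rewrite mulf_neq0 ?pnatr_eq0.
have p4 : 4 * P1 0 != 0 by rewrite mulf_neq0 ?pnatr_eq0.
have t1 := der_div (g := fun y => 8 * P1 y) p8 dP' (dercM 8 dP).
have t2 := der_div (g := fun y => 16 * P1 y ^+ 2) p16 (derM (der_id 0) (derX 2 dP')) (dercM 16 (derX 2 dP)).
have t3 := der_div (g := fun y => 2 * P1 y) p2 (derD (der_cst eh 0) (der_id 0)) (dercM 2 dP).
have t4 := der_div (g := fun y => 4 * P1 y) p4
  (derD (derD (der_cst (s2 t / s0 t) 0) (derMc (s1 t / s0 t) (dercM 2 e3))) (derX 2 e3)) (dercM 4 dP).
eexists; exact: (derD (derB (derD t1 t2) t3) t4).
Qed.

(** Both sides of the local form are differentiated in xi = log (x - e), and determinants are taken.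
    On the left r^2 det Phi is constant, which leads to - Wq (du/dxi)^2. On the right G and Cm
    contribute only their determinants, and the trace H enters linearly, next to - 1/16 and a term
    in y^2. Hence y H = y^2 J + y Rt off y = 0, and y tends to 0. *)
Lemma local_e (rho : R) (uf r : C -> C) (Ye : C -> 'M[C]_2) (G Cm : 'M[C]_2) (dal : C) :
  (\forall x \near e, derivable Ye x 1) -> Ye e = 1%:M -> G \in unitmx -> Cm \in unitmx ->
  (forall xi : C, complex.Re xi < rho ->
     [/\ derivable uf xi 1, derivable r xi 1, wpf (uf xi) + sh = e + cexp xi,
       r xi ^+ 2 = dal / \det (Phi (uf xi))
     & r xi *: (N *m Phi (uf xi)) = G *m Ye (e + cexp xi) *m
          mxexp_diag (xi *: diag2 (- 4^-1) 4^-1) *m Cm]) ->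
  let H x := \tr (invmx (Ye x) *m derive1 Ye x *m diag2 (- 4^-1) 4^-1) in
  (\forall x \near e, derivable H x 1) /\ H e = Rt 0.
Proof.
move=> hY Y1 uG uC hx H.
have [ry ry0 HY] := mat_smooth hY Y1.
have Hd := trH_der (- 4^-1) 4^-1 HY.
split; first by apply/nearC; exists ry => // x /Hd[k hk]; exact: (der_derivable hk).
pose s := Num.min (Num.min ry (cabs (A - eh))) (expR rho).
have s00 : 0 < s by rewrite !lt_min ry0 cabs_gt0 na expR_gt0.
(* The quotient of det Ye' by det Ye, which is the coefficient of y^2 in the determinant of [Wm]
   over that of [Ye]. *)
pose J x := (derive1 Ye x 0 0 * derive1 Ye x 1 1 - derive1 Ye x 0 1 * derive1 Ye x 1 0)
  / (Ye x 0 0 * Ye x 1 1 - Ye x 0 1 * Ye x 1 0).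
have key y : y != 0 -> cabs y < s -> H (e + y) = y * J (e + y) + Rt y.
  move=> y0; rewrite !lt_min => /andP[/andP[yr ya] yrho].
  have [xi xiE] := cexp_surj y0.
  have hre : complex.Re xi < rho by rewrite -ltr_expR -cabs_cexp xiE.
  have [du dr xm rt E] := hx xi hre; rewrite xiE in xm E; set u := uf xi in xm rt E.
  have exy : cabs (e + y - e) < ry by rewrite addrAC subrr add0r.
  have [y1 _ dY] := HY _ exy.
  set W0 := mxexp_diag _ in E.
  have W00 : W0 0 0 = cexp (- (xi / 4)) by rewrite /W0 mxexp_diagE !mxE /= mulr1n mulrN.
  have W11 : W0 1 1 = cexp (xi / 4) by rewrite /W0 mxexp_diagE !mxE /= mulr1n.
  have W01 : W0 0 1 = 0 by rewrite /W0 mxexp_diagE.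
  have W10 : W0 1 0 = 0 by rewrite /W0 mxexp_diagE.
  have dW : \det W0 = 1 by rewrite mx2_det W00 W11 W01 mul0r subr0 -cexpD addNr cexp0.
  have gn : \det G != 0 by move: uG; rewrite unitmxE unitfE.
  have cn : \det Cm != 0 by move: uC; rewrite unitmxE unitfE.
  have dL : \det (r xi *: (N *m Phi u)) = r xi ^+ 2 * (\det N * \det (Phi u)) by rewrite detZ det_mulmx.
  have dE : r xi ^+ 2 * (\det N * \det (Phi u)) = \det G * \det (Ye (e + y)) * \det Cm.
    by rewrite -dL E !det_mulmx dW mulr1.
  have rnz : r xi ^+ 2 * (\det N * \det (Phi u)) != 0 by rewrite dE !mulf_neq0.
  have r0 : r xi != 0 by apply/eqP => z; move: rnz; rewrite z expr0n mul0r eqxx.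
  have Nn : \det N != 0 by apply/eqP => z; move: rnz; rewrite z mul0r mulr0 eqxx.
  have Dn : \det (Phi u) != 0 by apply/eqP => z; move: rnz; rewrite z !mulr0 eqxx.
  (* If 2u were a period, sigma(2u) and with it det Phi would vanish. *)
  have lu2 : ~ inL (u + u).
    move=> /sg_lat z; move: Dn; rewrite (det_Phi O0 HPhi) z ?mul0r ?mulr0 ?eqxx //.
  have lu : ~ inL u by move=> h; apply: lu2; exact: in_latD.
  have uy : wpf u = eh + y.
    by apply: (addIr sh); rewrite xm ee; ring.
  have ne : wpf u <> A.
    move=> h; move: ya; rewrite -h uy; have -> : eh + y - eh = y by ring.
    by rewrite ltxx.
  have lm : ~ inL (u - alpha).
    move=> h; apply: ne; rewrite -(wp_per O0 T1 HS la h); congr wpf; ring.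
  have lp : ~ inL (u + alpha).
    move=> h; apply: ne; have hn := nlatN la; rewrite -(wp_opp O0 T1 HS la) -(wp_per O0 T1 HS hn h).
    by congr wpf; ring.
  have du' := derivable_der du; have dr' := derivable_der dr.
  set u' := derive1 uf xi in du'; set r' := derive1 r xi in dr'.
  have dce : der (fun z => e + cexp z) xi y.
    by apply: der_eq; [apply: derD; [exact: der_cst|exact: der_cexp]|rewrite add0r xiE].
  have nb : \forall z \near xi, complex.Re z < rho.
    apply/nearC; exists (rho - complex.Re xi); first by rewrite subr_gt0.
    move=> z hz; have := le_trans (ler_norm _) (Re_le (z - xi)); rewrite cReD cReN; lra.
  have u'E : wpd u * u' = y.
    apply: (der_funeq_near (x := xi) (f := fun z => wpf (uf z) + sh) (g := fun z => e + cexp z)).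
    - by apply: filterS nb => z /hx[].
    - apply: der_eq; first by apply: derD; [exact: (der_comp (f := wpf) du' (der_wpf O0 T1 lu))|exact: der_cst].
      by rewrite addr0.
    exact: dce.
  have [D' [dD [logs DE]]] := Phi_logs lu2 lm lp Dn.
  have dDu := der_comp (f := fun x => \det (Phi x)) du' dD.
  have nz : \forall z \near xi, \det (Phi (uf z)) != 0.
    have cD : 0 < cabs (\det (Phi u)) by rewrite cabs_gt0.
    have /contC /(_ _ cD)[d d0 H'] := der_cont dDu.
    apply/nearC; exists d => // z /H' hz; apply: contraTneq hz => ->.
    by rewrite sub0r cabsN ltxx.
  have r'E : 2 * r' * \det (Phi u) + r xi * (D' * u') = 0.
    apply: (mulfI r0); rewrite mulr0.
    apply: (der_funeq_near (x := xi) (f := fun z => r z ^+ 2 * \det (Phi (uf z))) (g := fun=> dal)).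
    - move: nb nz; apply: filterS2 => z /hx[_ _ _ rz _] dz; by rewrite rz divfK.
    - by apply: der_eq; [exact: (derM (derX 2 dr') dDu)|rewrite /= -/u; ring].
    exact: der_cst.
  (* The derivative in xi of Ye (e + y) times exp(xi diag(-1/4, 1/4)); since y = exp xi, it
     differentiates Ye as y d/dx. *)
  pose Wm : 'M[C]_2 := \matrix_(k < 2, m < 2)
    if m == 0 then (y * derive1 Ye (e + y) k 0 - 4^-1 * Ye (e + y) k 0) * W0 0 0
    else (y * derive1 Ye (e + y) k 1 + 4^-1 * Ye (e + y) k 1) * W0 1 1.
  have dYe k m : der (fun z => Ye (e + cexp z) k m) xi (derive1 Ye (e + y) k m * y).
    have h : der (fun x => Ye x k m) (e + cexp xi) (derive1 Ye (e + y) k m) by rewrite xiE; exact: y1.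
    exact: (der_comp (f := fun x => Ye x k m) (g := fun z => e + cexp z) dce h).
  have dw0 : der (fun z => cexp (- (z / 4))) xi (W0 0 0 * - 4^-1).
    rewrite W00; apply: der_cexpf; apply: derN.
    by apply: der_eq; [apply: derMc; exact: der_id|rewrite mul1r].
  have dw1 : der (fun z => cexp (z / 4)) xi (W0 1 1 * 4^-1).
    by rewrite W11; apply: der_cexpf; apply: der_eq; [apply: derMc; exact: der_id|rewrite mul1r].
  have M : r' *: (N *m Phi u) + (r xi * u') *: (N *m Phi1 u) = G *m Wm *m Cm.
    apply/matrixP => i j; rewrite !mxE.
    have -> : \sum_k N i k * Phi u k j = (N *m Phi u) i j by rewrite mxE.
    have -> : \sum_k N i k * Phi1 u k j = (N *m Phi1 u) i j by rewrite [RHS]mxE.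
    have -> : \sum_k (G *m Wm) i k * Cm k j = (G *m Wm *m Cm) i j by rewrite [RHS]mxE.
    rewrite !mx2_mul.
    have dp k := der_comp (f := fun x => Phi x k j) du' (der_Phi k j lm lp).
    have L := derM dr' (derD (dercM (N i 0) (dp 0)) (dercM (N i 1) (dp 1))).
    have R0 := derMc (Cm 0 j) (derM (derD (dercM (G i 0) (dYe 0 0)) (dercM (G i 1) (dYe 1 0))) dw0).
    have R1 := derMc (Cm 1 j) (derM (derD (dercM (G i 0) (dYe 0 1)) (dercM (G i 1) (dYe 1 1))) dw1).
    have X := der_funeq_near _ L (derD R0 R1).
    have {}X := X _.
    transitivity (r xi * (N i 0 * (Phi1 u 0 j * u') + N i 1 * (Phi1 u 1 j * u')) + r' * (N i 0 * Phi u 0 j + N i 1 * Phi u 1 j)).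
      by ring.
    rewrite X; last first.
      apply: filterS nb => z /hx[_ _ _ _ Ez].
      have := congr1 (fun B : 'M[C]_2 => B i j) Ez; rewrite mxE !mx2_mul => ->.
      rewrite !mxexp_diagE !mxE /= !mulr1n mulrN; ring.
    by rewrite xiE -W00 -W11 /Wm; move: (W0 0 0) (W0 1 1) => a b; rewrite !mxE /=; ring.
  have detL : \det (r' *: (N *m Phi u) + (r xi * u') *: (N *m Phi1 u)) =
     \det N * (r' ^+ 2 * \det (Phi u) + r' * (r xi * u') * D' + (r xi * u') ^+ 2 * \det (Phi1 u)).
    rewrite !scalemxAr -mulmxDr det_mulmx; congr (_ * _); rewrite -DE.
    by rewrite !mx2_det !mxE; ring.
  have ww : W0 0 0 * W0 1 1 = 1 by rewrite W00 W11 -cexpD addNr cexp0.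
  have dn : Ye (e + y) 0 0 * Ye (e + y) 1 1 - Ye (e + y) 0 1 * Ye (e + y) 1 0 != 0 by rewrite -mx2_det.
  have detW : \det Wm = (- 16^-1 + y ^+ 2 * J (e + y) - y * H (e + y)) * \det (Ye (e + y)).
    rewrite /H tr_inv_diag // /J !mx2_det /Wm.
    move: ww; move: (W0 0 0) (W0 1 1) => wa wb ww; rewrite !mxE /=.
    transitivity (wa * wb * ((y * derive1 Ye (e + y) 0 0 - 4^-1 * Ye (e + y) 0 0) *
       (y * derive1 Ye (e + y) 1 1 + 4^-1 * Ye (e + y) 1 1) -
       (y * derive1 Ye (e + y) 0 1 + 4^-1 * Ye (e + y) 0 1) *
       (y * derive1 Ye (e + y) 1 0 - 4^-1 * Ye (e + y) 1 0))); first by ring.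
    rewrite ww mul1r; move: dn; move: (Ye (e + y) 0 0) (Ye (e + y) 0 1) (Ye (e + y) 1 0) (Ye (e + y) 1 1).
    move: (derive1 Ye (e + y) 0 0) (derive1 Ye (e + y) 0 1) (derive1 Ye (e + y) 1 0) (derive1 Ye (e + y) 1 1).
    by move=> b00 b01 b10 b11 a00 a01 a10 a11 dn; field.
  have dM : \det N * (r' ^+ 2 * \det (Phi u) + r' * (r xi * u') * D' + (r xi * u') ^+ 2 * \det (Phi1 u))
     = \det G * \det Wm * \det Cm by rewrite -detL M !det_mulmx.
  have rt' := Rt_key lu2 lm lp uy.
  have wd0 := wpd_neq0 O0 T1 lu2.
  have u'y : u' = y / wpd u by rewrite -u'E mulrC mulKf.
  have fin : - (y / wpd u) ^+ 2 * Wq u = - 16^-1 + y ^+ 2 * J (e + y) - y * H (e + y).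
    move: dM dE logs r'E gn cn Nn Dn r0 dY; rewrite detW -u'y.
    move: (- 16^-1 + y ^+ 2 * J (e + y) - y * H (e + y)) (\det (Phi u)) (\det (Phi1 u)) (\det (Ye (e + y))) (\det G) (\det N) (\det Cm) (Wq u) (r xi).
    move=> Z D D2 yd g n c Q rr dM dE logs r'E gn cn Nn Dn rr0 yd0.
    have r1 : r' = - (rr * (D' * u')) / (2 * D).
      have : 2 * r' * D = - (rr * (D' * u')) by apply/eqP; rewrite -addr_eq0; apply/eqP.
      by move=> <-; field.
    have D2E : D2 = D * (4^-1 * (D' / D) ^+ 2 - Q).
      have : D2 / D = 4^-1 * (D' / D) ^+ 2 - Q by rewrite -logs; ring.
      by move=> <-; field.
    have X : r' ^+ 2 * D + r' * (rr * u') * D' + (rr * u') ^+ 2 * D2 = rr ^+ 2 * D * (- u' ^+ 2 * Q).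
      by rewrite r1 D2E; field.
    rewrite X in dM; apply: (@mulfI _ (rr ^+ 2 * (n * D))); first by rewrite !mulf_neq0 // expf_neq0.
    rewrite [in RHS]dE; transitivity (n * (rr ^+ 2 * D * (- u' ^+ 2 * Q))); first by ring.
    by rewrite dM; ring.
  apply: (mulfI y0); rewrite mulrDr -rt'.
  have -> : y * H (e + y) = y ^+ 2 * J (e + y) - 16^-1 - (- 16^-1 + y ^+ 2 * J (e + y) - y * H (e + y)) by ring.
  by rewrite -fin; ring.
have ce : cabs (e + 0 - e) < ry by rewrite addr0 subrr cabs0.
have [k hk] := Hd _ ce.
have [y1 y2 dY] := HY _ ce.
have [l00 k00] := y2 0 0; have [l01 k01] := y2 0 1; have [l10 k10] := y2 1 0; have [l11 k11] := y2 1 1.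
have n0 : Ye (e + 0) 0 0 * Ye (e + 0) 1 1 - Ye (e + 0) 0 1 * Ye (e + 0) 1 0 != 0 by rewrite -mx2_det.
have dJ := der_div (g := fun x => Ye x 0 0 * Ye x 1 1 - Ye x 0 1 * Ye x 1 0) n0
  (derB (derM k00 k11) (derM k01 k10)) (derB (derM (y1 0 0) (y1 1 1)) (derM (y1 0 1) (y1 1 0))).
have ds : der (fun y => e + y) 0 1 by apply: der_eq; [dt|rewrite ?add0r].
have dH' := der_comp (f := H) ds hk.
have [kr hr] := der_Rt0.
have dR := derD (derM (der_id 0) (der_comp (f := J) ds dJ)) hr.
have : H (e + 0) = 0 * J (e + 0) + Rt 0.
  apply: (cont_eq (f := fun y => H (e + y)) (g := fun y => y * J (e + y) + Rt y) (x := 0)).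
  - exact: (der_cont dH').
  - exact: (der_cont dR).
  by apply/nearC'; exists s => // y y0; rewrite subr0 => ys; exact: key.
by rewrite addr0 mul0r add0r.
Qed.

End LocalFormsE.

(** * Variation of the theta quantities with Omega *)

Section Variation.
Variable R : realType.
Local Notation C := (Cx R).
Variables (Omf : C -> C) (dOm : C).
Hypothesis O0 : 0 < complex.Im (Omf 0).
Hypothesis dO : der Omf 0 dOm.
Local Notation Om := (Omf 0).
Local Notation ipi := (ipi R).
Local Notation K := (dOm / (4 * ipi)).
Local Notation th := (th11 Om).
Hypothesis T1 : th 1 0 != 0.

(** By the heat equation a motion of Omega raises the order of a theta jet by two, with the factor
    [K]. *)
Lemma der_thv k (vf : C -> C) v' : der vf 0 v' ->
  der (fun s => th11 (Omf s) k (vf s)) 0 (th k.+1 (vf 0) * v' + th k.+2 (vf 0) * K).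
Proof.
move=> hv; apply: der_eq; first exact: (der_Th2 k 2^-1 2^-1 O0 hv dO).
by rewrite /th11 mulrA mulrAC.
Qed.

Lemma der_cc : der (fun s => cc (Omf s)) 0 (- (K * AA Om / 3)).
Proof.
have h3 := der_thv 3 (der_cst 0 0); have h1 := der_thv 1 (der_cst 0 0).
have n0 : 3 * th 1 0 != 0 by rewrite mulf_neq0 ?pnatr_eq0.
rewrite /cc; apply: der_eq.
  exact: (der_div (g := fun s => 3 * th11 (Omf s) 1 0) n0 h3 (dercM 3 h1)).
rewrite /AA !mulr0 !add0r; move: K (th 1 0) (th 3 0) (th 5 0) T1 => k t1 t3 t5 T1'; field.
by rewrite T1'.
Qed.

Lemma der_TTv (vf : C -> C) v' : der vf 0 v' -> der (fun s => TT11 (Omf s) (vf s)) 0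
  (TT' Om (vf 0) * v' + (th 4 (vf 0) * th 0 (vf 0) + th 2 (vf 0) ^+ 2 - 2 * th 1 (vf 0) * th 3 (vf 0)) * K).
Proof.
move=> hv; have h0 := der_thv 0 hv; have h1 := der_thv 1 hv; have h2 := der_thv 2 hv.
apply: der_eq; first exact: (derB (derM h2 h0) (derX 2 h1)).
by rewrite /TT' /=; ring.
Qed.

(** The half-period moves with Omega, but [pd11] vanishes there, so its velocity drops out. The
    fourth and third jets are eliminated by [th4_eq] and by that same vanishing. *)
Lemma der_EE nu : der (fun s => EE (Omf s) nu) 0
  (K * (4 * EE Om nu ^+ 2 + 4 * cc Om * EE Om nu - 2 / 3 * (12 * cc Om ^+ 2 + 2 * AA Om))).
Proof.
have [v' hv] : exists v', der (fun s => half_period 1 (Omf s) nu) 0 v'.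
  case: nu => [[|[|[|//]]] i]; rewrite /half_period /=.
  - by eexists; exact: der_cst.
  - by eexists; exact: (derMc 2^-1 (derD (der_cst 1 0) dO)).
  by eexists; exact: (derMc 2^-1 dO).
have OR : 0 < complex.Im (Om / 1) by rewrite divr1.
have nv := th_neq0 O0 (half_nlat OR (nu := nu)); have pz := pd_hp O0 nu.
have h0 := der_thv 0 hv; have hT := der_TTv hv.
have n2 : th 0 (half_period 1 Om nu) ^+ 2 != 0 by rewrite expf_neq0.
rewrite /EE /pp; apply: der_eq.
  exact: (derB der_cc (der_div (g := fun s => th11 (Omf s) 0 (half_period 1 (Omf s) nu) ^+ 2) n2 hT (derX 2 h0))).
rewrite (th4_eq O0 T1 nv) /= -/(pp Om (half_period 1 Om nu)).
have t3 : th 3 (half_period 1 Om nu) = (2 * TT11 Om (half_period 1 Om nu) * th 1 (half_period 1 Om nu)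
   / th 0 (half_period 1 Om nu) + th 1 (half_period 1 Om nu) * th 2 (half_period 1 Om nu)) / th 0 (half_period 1 Om nu).
  move: pz; rewrite /pd11 /TT' => /eqP; rewrite mulf_eq0 invr_eq0 expf_eq0 /= (negbTE nv) orbF oppr_eq0.
  by rewrite subr_eq0 => /eqP <-; field.
rewrite /TT' t3 /pp /TT11.
move: (K) (cc Om) (AA Om) (th 0 _) (th 1 _) (th 2 _) nv => k c A x0 x1 x2 nv; field.
by rewrite nv.
Qed.

(** Existence is what is wanted: the value for wp'(alpha) is read off from its square in
    [core_D]. *)
Lemma der_pdv (vf : C -> C) v' : der vf 0 v' -> th 0 (vf 0) != 0 ->
  exists l, der (fun s => pd11 (Omf s) (vf s)) 0 l.
Proof.
move=> hv nv; have h0 := der_thv 0 hv; have h1 := der_thv 1 hv; have h2 := der_thv 2 hv.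
have h3 := der_thv 3 hv; have hT := der_TTv hv.
have n3 : th 0 (vf 0) ^+ 3 != 0 by rewrite expf_neq0.
have hT' := derB (derM h3 h0) (derM h1 h2).
have hn := derN (derB (derM hT' h0) (derM (dercM 2 hT) h1)).
eexists; exact: (der_div (g := fun s => th11 (Omf s) 0 (vf s) ^+ 3) n3 hn (derX 3 h0)).
Qed.

End Variation.

(** * Linear systems for the period variation and closing rational identities *)

Section FinalAlgebra.
Variable F : numFieldType.
Implicit Types a b c g E G H : F.

Lemma neg_sum E G H : E + G + H = 0 -> H = - E - G.
Proof. by move=> h; have -> : H = (E + G + H) - E - G; [ring|rewrite h sub0r]. Qed.

(** Here a is - 2 d log omega_1 and b is omega_1^2 dOmega / (4 pi i), and the equations say how the
    e_nu - s/3 move when one e_nu moves with unit speed. The difference of the last two, divided by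
    G - H, gives a + 4 c b - 4 b E = 0. *)
Lemma solve_e (a b c g E G H : F) : E + G + H = 0 -> E - G != 0 -> E - H != 0 -> G - H != 0 ->
  1 - 1 / 3 = a * E + b * (4 * E ^+ 2 + 4 * c * E - 2 / 3 * g) ->
  0 - 1 / 3 = a * G + b * (4 * G ^+ 2 + 4 * c * G - 2 / 3 * g) ->
  0 - 1 / 3 = a * H + b * (4 * H ^+ 2 + 4 * c * H - 2 / 3 * g) ->
  b = ((E - G) * (E - H))^-1 / 4 /\ a = ((E - G) * (E - H))^-1 * (E - c).
Proof.
move=> /neg_sum hs n1 n2 n3 rE rG rH.
have k0 : a + 4 * c * b - 4 * b * E = 0.
  apply: (mulfI n3); rewrite mulr0.
  have : (0 - 1 / 3) - (0 - 1 / 3) = 0 :> F by rewrite subrr.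
  by rewrite {1}rG rH => <-; rewrite hs; ring.
have k1 : (E - G) * (E - H) * (4 * b) = 1.
  have e1 : a = 4 * b * E - 4 * c * b by apply/eqP; rewrite -subr_eq0; apply/eqP; rewrite -[RHS]k0; ring.
  transitivity ((1 - 1 / 3) - (0 - 1 / 3) : F); last by field.
  by rewrite rE rG e1 hs; ring.
have n12 : (E - G) * (E - H) != 0 by rewrite mulf_neq0.
have b4 : 4 * b = ((E - G) * (E - H))^-1 by apply: (mulfI n12); rewrite k1 mulfV.
split; first by rewrite -b4; field.
rewrite -b4; apply/eqP; rewrite -subr_eq0; apply/eqP; rewrite -[RHS]k0; ring.
Qed.

Lemma solve_t (a b c g E G H : F) : E + G + H = 0 -> E - G != 0 -> E - H != 0 -> G - H != 0 ->
  0 = a * E + b * (4 * E ^+ 2 + 4 * c * E - 2 / 3 * g) ->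
  0 = a * G + b * (4 * G ^+ 2 + 4 * c * G - 2 / 3 * g) ->
  0 = a * H + b * (4 * H ^+ 2 + 4 * c * H - 2 / 3 * g) -> b = 0 /\ a = 0.
Proof.
move=> /neg_sum hs n1 n2 n3 rE rG rH.
have k0 : a + 4 * c * b - 4 * b * E = 0.
  apply: (mulfI n3); rewrite mulr0.
  transitivity ((a * G + b * (4 * G ^+ 2 + 4 * c * G - 2 / 3 * g)) -
    (a * H + b * (4 * H ^+ 2 + 4 * c * H - 2 / 3 * g))); first by rewrite hs; ring.
  by rewrite -rG -rH subrr.
have k1 : a + 4 * c * b - 4 * b * G = 0.
  apply: (mulfI n2); rewrite mulr0.
  transitivity ((a * E + b * (4 * E ^+ 2 + 4 * c * E - 2 / 3 * g)) -
    (a * H + b * (4 * H ^+ 2 + 4 * c * H - 2 / 3 * g))); first by rewrite hs; ring.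
  by rewrite -rE -rH subrr.
have kb : 4 * (E - G) * b = 0.
  by rewrite -[RHS](subrr 0) -{1}k1 -{1}k0; ring.
have b0 : b = 0.
  apply/eqP; move: kb => /eqP; rewrite !mulf_eq0 pnatr_eq0 (negbTE n1) //=.
by split=> //; move: k0; rewrite b0 !mulr0 mul0r subr0 addr0.
Qed.

(** The function f in the variables A = a - s/3 and E, G, H = e_nu - s/3. By [fA_dbl] it equals 2
    wp(2 alpha), which is how it enters omega_a. *)
Definition fA (A E G H : F) : F :=
  - A + 2^-1 * ((A - E) * (A - G) * (A - H)) * ((A - E) ^- 2 + (A - G) ^- 2 + (A - H) ^- 2).

(* partial derivative of f_tau in e_j, with A = a - s/3 and E = e_j - s/3 *)
Definition fA' (A E G H : F) : F :=
  1 / 3 - 2^-1 * ((A - G) * (A - H)) * ((A - E) ^- 2 + (A - G) ^- 2 + (A - H) ^- 2)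
  + (A - E) * (A - G) * (A - H) * (A - E) ^- 3.

(** The coefficient of de_nu on both sides. X and X2 are the first two logarithmic jets theta'/theta
    and theta''/theta, divided by omega_1 and omega_1^2, at t / omega_1; c is cc / omega_1^2; S1 and
    S2 are the jets of sigma[p,q] at t. *)
Lemma final_e (t c X X2 A E G H : F) : E + G + H = 0 ->
  E - G != 0 -> E - H != 0 -> A - E != 0 -> A - G != 0 -> A - H != 0 ->
  let h := ((E - G) * (E - H))^-1 in
  let S1 := - c * t + X in
  let S2 := - c + c ^+ 2 * t ^+ 2 - 2 * c * t * X + X2 in
  X * (t * (h * (E - c)) / 2) + X2 * (h / 4) + h * (E - c) / 4
  - 8^-1 * ((E - G)^-1 + (E - H)^-1)
  + (t ^+ 2 * (h / 4) * (4 * (E ^+ 2 + E * G + G ^+ 2) - 12 * c ^+ 2) / 12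
     - c * t ^+ 2 * (h * (E - c)) / 2)
  + t ^+ 2 / 4 * fA' A E G H
  = - (t / (2 * (A - E))) * (S1 + t / 2 * fA A E G H)
  + (((E - G) + (E - H)) / (8 * ((E - G) * (E - H)))
  + (- (2 * E) + S2 + 2 * (t * (E + (E - G) * (E - H) / (A - E))) * S1
     + (t * (E + (E - G) * (E - H) / (A - E))) ^+ 2) / (4 * ((E - G) * (E - H)))).
Proof.
move=> /neg_sum -> n1 n2 n3 n4 n5; rewrite /fA /fA' /=; field.
by rewrite n1 n2 n3 n4 n5.
Qed.

Lemma fA_dbl (A E G H : F) : E + G + H = 0 -> A - E != 0 -> A - G != 0 -> A - H != 0 ->
  2 * (- (2 * A) + 4^-1 * ((6 * A ^+ 2 - 2 * (E ^+ 2 + E * G + G ^+ 2)) ^+ 2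
     / (4 * ((A - E) * (A - G) * (A - H))))) = fA A E G H.
Proof.
move=> /neg_sum -> n1 n2 n3; rewrite /fA; field.
by rewrite n1 n2 n3.
Qed.

End FinalAlgebra.

(** * Partial derivatives along coordinate lines and locally constant functions *)

Section Slices.
Variable R : realType.
Local Notation C := (Cx R).

Lemma slice_quot (V : normedModType C) (W : normedModType C) (f : V -> W) (v x : V) (s0 : C) :
  (fun h : C => h^-1 *: (f (h *: v + (s0 *: v + x)) - f (s0 *: v + x))) =
  (fun h : C => h^-1 *: ((fun s : C => f (s *: v + x)) (h *: (1 : C) + s0) - f (s0 *: v + x))).
Proof.
apply/funext => h; congr (_ *: (f _ - _)).
by rewrite addrA -scalerDl /GRing.scale /= mulr1.
Qed.

Lemma slice_der (V : normedModType C) (f : V -> C) (v x : V) (s0 : C) :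
  differentiable f (s0 *: v + x) ->
  der (fun s => f (s *: v + x)) s0 ('D_v f (s0 *: v + x)).
Proof.
move=> df; have hd : derivable f (s0 *: v + x) v by exact: diff_derivable.
have dd : derivable (fun s : C => f (s *: v + x)) s0 1.
  by move: hd; rewrite /derivable slice_quot.
apply: der_eq (derivable_der dd) _; rewrite derive1E /derive.
by rewrite -slice_quot.
Qed.

Lemma der_partial (V : normedModType C) (f : V -> C) (v x : V) l :
  der (fun s : C => f (s *: v + x)) 0 l -> 'D_v f x = l.
Proof.
move=> h; rewrite -(der_derive1 h) derive1E /derive.
have := slice_quot f v x 0; rewrite scale0r add0r => ->.
by [].
Qed.

Lemma der_partialZ (V : normedModType C) (f : V -> C) (K : 'M[C]_2) (v x : V) l :
  der (fun s : C => f (s *: v + x)) 0 l -> 'D_v (fun z => f z *: K : 'M[C]_2) x = l *: K.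
Proof.
move=> h; have fx : f (0 *: v + x) = f x by rewrite scale0r add0r.
have c : (fun k : C => k^-1 *: (f (k *: v + x) - f x)) @ (0 : C)^' --> l.
  apply/cvgC => e e0; have /derP /(_ _ (divr_gt0 e0 (ltr0n _ 2)))[d d0 H] := h.
  apply/nearC'; exists d => // k k0; rewrite subr0 => kd.
  have ck : 0 < cabs k by rewrite cabs_gt0.
  have := H k kd; rewrite add0r fx => hb; rewrite /GRing.scale /=.
  have -> : k^-1 * (f (k *: v + x) - f x) - l = (f (k *: v + x) - f x - l * k) / k by field.
  rewrite cabsM cabsV ltr_pdivrMr //; apply: le_lt_trans hb _.
  by rewrite ltr_pM2r //; lra.
have c2 : (fun k : C => k^-1 *: (f (k *: v + x) *: K - f x *: K)) @ (0 : C)^' --> l *: K.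
  have -> : (fun k : C => k^-1 *: (f (k *: v + x) *: K - f x *: K)) =
     (fun k : C => (k^-1 *: (f (k *: v + x) - f x)) *: K).
    by apply/funext => k; rewrite -scalerBl scalerA.
  by apply: (@continuous_cvg _ _ _ _ _ _ (fun c : C => c *: K)); [exact: scalel_continuous|exact: c].
rewrite /derive; exact: (cvg_lim (@norm_hausdorff _ _) c2).
Qed.

Lemma differentiable_near_eq (V : normedModType C) (f g : V -> C) (x : V) :
  (\forall z \near x, g z = f z) -> differentiable f x -> differentiable g x.
Proof.
move=> e df; have gx : g x = f x by exact: nbhs_singleton e.
have dr : differentiable (fun z => g z - f z) x.
  apply: differentiable_small => eps eps0.
  have : \forall h \near (0 : V), g (h + x) = f (h + x).
    have /nbhs_ballP[d d0 H] := e; apply/nbhs_ballP; exists d => // h.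
    rewrite -ball_normE /ball_ /= sub0r normrN => hd; apply: H.
    by rewrite -ball_normE /ball_ /= opprD addrCA subrr addr0 normrN.
  apply: filterS => h ->; rewrite gx !subrr normr0 mulr_ge0 //.
  by rewrite -[0]/(ofr 0) ofr_le ltW.
have -> : g = (fun z => f z) + (fun z => g z - f z) by apply/funext => z; rewrite !fctE addrC subrK.
exact: differentiableD.
Qed.

Local Notation P := 'rV[C]_4.
Local Notation dj j := (delta_mx 0 j : P).

Lemma open_box (D : set P) (z : P) : open D -> D z -> exists2 r : R, 0 < r &
  forall y : P, (forall j, cabs (y 0 j - z 0 j) < r) -> D y.
Proof.
move=> oD Dz; have /nbhs_ballP[e e0 H] : nbhs z D by apply: open_nbhs_nbhs.
have [r r0 er] := posC e0; exists r => // y hy; apply: H; split => // i j.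
by rewrite ord1 -ball_normE /ball_ /= er normE ofr_lt cabsBC.
Qed.

Definition box_const (D : set P) (f : P -> C) := forall z, D z -> exists2 r : R, 0 < r &
  forall y : P, (forall j, cabs (y 0 j - z 0 j) < r) -> f y = f z.

(** Inside a box contained in D one passes from z to y through the points [yk k], which change one
    coordinate at a time along a segment of zero derivative. *)
Lemma slice_box_const (D : set P) (f : P -> C) : open D ->
  (forall z j, D z -> der (fun s : C => f (s *: dj j + z)) 0 0) -> box_const D f.
Proof.
move=> oD hd z Dz; have [r r0 H] := open_box oD Dz; exists r => // y hy.
pose yk k : P := \row_j (if (j < k)%N then y 0 j else z 0 j).
have step k : (k <= 4)%N -> f (yk k) = f z.
  elim: k => [|k IH] k4; first by congr f; apply/rowP => j; rewrite mxE.
  rewrite -(IH (ltnW k4)); pose j0 : 'I_4 := Ordinal k4.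
  pose phi (s : C) := f (s *: dj j0 + yk k); pose b := y 0 j0 - z 0 j0.
  have -> : yk k = 0 *: dj j0 + yk k by rewrite scale0r add0r.
  have -> : yk k.+1 = b *: dj j0 + yk k.
    apply/rowP => j; rewrite !mxE eqxx /=.
    have [->|jn] := eqVneq j j0; first by rewrite ltnn ltnSn mulr1 /b subrK.
    rewrite mulr0 add0r ltnS leq_eqVlt.
    by have /negbTE -> : (j != k :> nat) by apply: contra jn => /eqP h; apply/eqP/val_inj.
  rewrite -/(phi b) -/(phi 0); symmetry; apply: (seg_const (f := phi)) => s /andP[s0 s1].
  have DD : D (pt 0 b s *: dj j0 + yk k).
    apply: H => j; rewrite !mxE eqxx /= /pt subr0 add0r.
    have [->|jn] := eqVneq j j0.
      rewrite ltnn mulr1 addrK cabsM cabs_ofr ger0_norm //.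
      apply: le_lt_trans (hy j0); rewrite -[leRHS]mul1r ler_wpM2r ?cabs_ge0 //.
    rewrite mulr0 add0r; case: ifP => _; first exact: hy.
    by rewrite subrr cabs0.
  have d0 := hd _ j0 DD.
  have ds : der (fun x => x - pt 0 b s) (pt 0 b s) 1 by apply: der_eq; [dt|rewrite subr0].
  have d0' : der (fun h : C => f (h *: dj j0 + (pt 0 b s *: dj j0 + yk k))) (pt 0 b s - pt 0 b s) 0.
    by rewrite subrr.
  have := der_comp (f := fun h : C => f (h *: dj j0 + (pt 0 b s *: dj j0 + yk k))) ds d0'.
  rewrite mul0r; apply: der_ext => u.
  by rewrite /phi addrA -scalerDl subrK.
rewrite -(step 4%N) //; congr f; apply/rowP => j; rewrite mxE.
by have -> : (j < 4)%N = true by exact: ltn_ord.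
Qed.

(** Composition with [clamp] extends a path on [0, 1] to the whole line, so that two-sided
    derivatives make sense at its ends. *)
Definition clamp (x : R) := Num.max 0 (Num.min x 1).

Lemma clamp_in x : 0 <= clamp x <= 1.
Proof. by rewrite /clamp le_max lexx ge_max ler01 ge_min lexx orbT. Qed.

Lemma clamp_id x : 0 <= x <= 1 -> clamp x = x.
Proof. by move=> /andP[x0 x1]; rewrite /clamp (min_idPl x1) (max_idPr x0). Qed.

Lemma clamp_lip x y : `|clamp x - clamp y| <= `|x - y|.
Proof.
apply: le_trans (clamp_min 1 x y); rewrite /clamp; move: (Num.min x 1) (Num.min y 1) => a b.
case: (leP 0 a) => h1; case: (leP 0 b) => h2 //.
- by rewrite subr0 (ger0_norm h1) ger0_norm; lra.
- by rewrite sub0r normrN (ger0_norm h2) distrC ger0_norm; lra.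
by rewrite subrr normr0.
Qed.

Lemma path_const (D : set P) (f : P -> C) (g : R -> P) : box_const D f ->
  {within `[0, 1], continuous g} -> g @` `[0, 1] `<=` D -> f (g 0) = f (g 1).
Proof.
move=> hf /subspace_continuousP gc gD.
pose h x := f (g (clamp x)).
have I (c : R) : 0 <= c <= 1 -> `[0, 1]%classic c by move=> hc; rewrite /= in_itv.
have hd x : rder h x 0.
  move=> e e0; have cx := clamp_in x; have Dx : D (g (clamp x)) by apply: gD; exists (clamp x) => //; exact: I.
  have [r r0 H] := hf _ Dx.
  have nb : nbhs (g (clamp x)) [set y : P | forall j, cabs (y 0 j - g (clamp x) 0 j) < r].
    apply/nbhs_ballP; exists (ofr r) => [|y [_ hy] j]; first by rewrite /= -[0]/(ofr 0) ofr_lt.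
    by have := hy 0 j; rewrite -ball_normE /ball_ /= normE ofr_lt cabsBC.
  have W : nbhs (clamp x) [set c | `[0, 1]%classic c ->
      [set y : P | forall j, cabs (y 0 j - g (clamp x) 0 j) < r] (g c)] := gc _ (I _ cx) _ nb.
  have /nbhs_ballP[d d0 Hd] := W; exists d => // k kd.
  have -> : h (x + k) = h x; last by rewrite subrr mul0r subrr cabs0 mulr_ge0 // ltW.
  apply: H; apply: (Hd (clamp (x + k))); last by apply: I; exact: clamp_in.
  rewrite /= -ball_normE /ball_ /= distrC; apply: le_lt_trans (clamp_lip _ _) _.
  by rewrite addrAC subrr add0r.
have := @rseg R h (fun=> 0) 0 1 0 ler01 (fun x _ => hd x) _.
rewrite mul0r => /(_ _) X.
have X0 : cabs (h 1 - h 0) <= 0 by apply: X => x _; rewrite cabs0.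
apply/eqP; rewrite eq_sym -subr_eq0 -cabs_eq0 eq_le cabs_ge0 andbT.
by move: X0; rewrite /h !clamp_id ?lexx ?ler01.
Qed.

End Slices.

(** * Bookkeeping for the three branch points *)

Section Three.
Variable R : realType.
Local Notation C := (Cx R).

Definition i0 : 'I_3 := ord0.
Definition i1 : 'I_3 := Ordinal (isT : (1 < 3)%N).
Definition i2 : 'I_3 := Ordinal (isT : (2 < 3)%N).

Lemma lift1 : lift ord0 ord0 = i1 :> 'I_3. Proof. exact: val_inj. Qed.
Lemma lift2 : lift ord0 (lift ord0 ord0) = i2 :> 'I_3. Proof. exact: val_inj. Qed.

Lemma I3_ind (Q : 'I_3 -> Prop) : Q i0 -> Q i1 -> Q i2 -> forall i, Q i.
Proof.
move=> h0 h1 h2 [[|[|[|//]]] i].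
- by have -> : Ordinal i = i0 by exact: val_inj.
- by have -> : Ordinal i = i1 by exact: val_inj.
by have -> : Ordinal i = i2 by exact: val_inj.
Qed.

Lemma sum3 (f : 'I_3 -> C) : \sum_nu f nu = f i0 + f i1 + f i2.
Proof. by rewrite !big_ord_recl big_ord0 addr0 lift2 lift1 addrA. Qed.

Lemma prod3 (f : 'I_3 -> C) : \prod_nu f nu = f i0 * f i1 * f i2.
Proof. by rewrite !big_ord_recl big_ord0 mulr1 lift2 lift1 mulrA. Qed.

Lemma prod_pairs (f : 'I_3 -> 'I_3 -> C) :
  \prod_(nu < 3) \prod_(mu < 3 | (nu < mu)%N) f nu mu = f i0 i1 * f i0 i2 * f i1 i2.
Proof.
rewrite prod3 !(big_mkcond (fun mu : 'I_3 => (_ < mu)%N)) /= !prod3 /=.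
by rewrite !mul1r !mulr1.
Qed.

(** Treats the three branch points at once: symmetric sums and products are rewritten with nu in
    front. *)
Lemma others (nu : 'I_3) : exists k l : 'I_3, [/\ nu != k, nu != l & k != l] /\
  (forall f : 'I_3 -> C, \prod_mu f mu = f nu * f k * f l /\ \sum_mu f mu = f nu + f k + f l) /\
  (forall f : 'I_3 -> 'I_3 -> C, (forall m n, f m n = f n m) ->
     f i0 i1 + f i0 i2 + f i1 i2 = f nu k + f nu l + f k l).
Proof.
move: nu; apply: I3_ind.
- exists i1, i2; split; first by [].
  by split=> [f|f _]; rewrite ?sum3 ?prod3.
- exists i0, i2; split; first by [].
  by split=> [f|f fs]; rewrite ?sum3 ?prod3; [split; ring|rewrite (fs i1 i0); ring].
exists i0, i1; split; first by [].
by split=> [f|f fs]; rewrite ?sum3 ?prod3; [split; ring|rewrite (fs i2 i0) (fs i2 i1); ring].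
Qed.

End Three.

(** * Consequences of the hypotheses at one point of the domain *)

Section Point.
Variable R : realType.
Local Notation C := (Cx R).
Local Notation P := 'rV[C]_4.
Variables (a p q : C) (om1 om2 eta1 alpha uphi upsi : P -> C) (z : P).
Local Notation w1 := (om1 z).
Local Notation w2 := (om2 z).
Local Notation t := (tpar z).
Local Notation inL := (in_lat w1 w2).
Local Notation Om := (w2 / w1).
Local Notation hp := (half_period w1 w2).
Local Notation wpf := (wp w1 w2).
Local Notation wpd := (wp_deriv w1 w2).
Local Notation sh := ((\sum_mu ebr z mu) / 3).
Hypothesis Hcp : canonical_periods (ebr z) w1 w2.
Hypothesis Heta : forall u, ~ inL u -> wzeta w1 w2 (u + w1) = wzeta w1 w2 u + eta1 z.
Hypothesis la : ~ inL (alpha z).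
Hypothesis xa : xmap om1 om2 z (alpha z) = a.
Hypothesis Hdet : detPhi_nonzero p q om1 om2 eta1 alpha uphi upsi z.
Hypothesis Hinj : injective (ebr z).
Hypothesis Hna : forall nu, ebr z nu != a.

Lemma pt_O0 : 0 < complex.Im Om. Proof. by case: Hcp. Qed.
Let O0 := pt_O0.
Let w10 : w1 != 0 := w1_neq0 O0.

Lemma pt_hp nu : wpf (hp nu) = ebr z nu - sh. Proof. by case: Hcp. Qed.

Lemma pt_HS : \sum_nu wpf (hp nu) = 0.
Proof.
rewrite (eq_bigr _ (fun nu _ => pt_hp nu)) !sum3; move: (ebr z _) (ebr z _) (ebr z _) => x y v.
have h3 : 3 != 0 :> C by rewrite pnatr_eq0.
by field.
Qed.
Let HS := pt_HS.

(** If theta_11'(0) were 0, the factor omega_1 / theta_11' of sigma[p,q] would read 0, so Phi would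
    vanish identically, against [Hdet]. *)
Lemma pt_T1 : th11 Om 1 0 != 0.
Proof.
apply/eqP => h; case: Hdet => u [_]; rewrite mx2_det !mxE /=.
have z0 v' x : phi p q om1 om2 eta1 alpha z v' x = 0.
  by rewrite /phi /sigma_pq (theta11'E O0) h invr0 !(mulr0, mul0r).
by rewrite !z0 mul0r subrr eqxx.
Qed.
Let T1 := pt_T1.

Lemma pt_A : wpf (alpha z) = a - sh.
Proof. by rewrite -xa /xmap addrK. Qed.

Lemma pt_an nu : wpf (alpha z) - wpf (hp nu) != 0.
Proof.
rewrite pt_A pt_hp opprD opprK addrACA [- sh + _]addrC subrr addr0 subr_eq0 eq_sym.
exact: Hna.
Qed.

(** If 2 alpha were a period, oddness would give wp'(alpha) = 0, and the cubic equation would make a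
    equal to some e_nu. *)
Lemma pt_al2 : ~ inL (alpha z + alpha z).
Proof.
move=> h; have /(in_lat_scale O0) h' := h.
have : pd11 Om (alpha z / w1) = - pd11 Om (alpha z / w1).
  have E : alpha z / w1 = - (alpha z / w1) + (alpha z + alpha z) / w1 by rewrite mulrDl addKr.
  by rewrite {1}E (pd_per O0 _ h') pd_opp.
move=> /eqP; rewrite -subr_eq0 opprK -mulr2n -mulr_natl mulf_eq0 pnatr_eq0 /= => /eqP z0.
have := wpd_sq O0 T1 HS la; rewrite /wp_deriv z0 mulr0 expr0n /= => /esym/eqP.
by rewrite mulf_eq0 pnatr_eq0 /= prod3 !mulf_eq0 !(negbTE (pt_an _)).
Qed.

Lemma pt_phi v u : phi p q om1 om2 eta1 alpha z v u =
  gv w1 w2 (eta1 z) p q t v u * Ef w1 w2 t (alpha z) u.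
Proof. by rewrite /phi (sigma_pq_s0 _ _ _ O0) (wsigmaE O0 T1 HS Heta). Qed.

Lemma pt_HPhi u : let F := Phi p q om1 om2 eta1 alpha uphi upsi z in
  let g v := gv w1 w2 (eta1 z) p q t v in
  let E := Ef w1 w2 t (alpha z) in
  [/\ F u 0 0 = g (uphi z) u * E u, F u 0 1 = g (uphi z) (- u) * E (- u),
    F u 1 0 = g (upsi z) u * E u & F u 1 1 = g (upsi z) (- u) * E (- u)].
Proof. by move=> F g E; split; rewrite /F !mxE /= pt_phi. Qed.

Lemma diag2_scale (m : C) : diag2 m (- m) = m *: diag2 1 (-1).
Proof.
apply/matrixP; apply: ord2_ind; apply: ord2_ind; rewrite [RHS]mxE !mx2_diagE; ring.
Qed.

Local Notation S1 := (s1 w1 w2 (eta1 z) p q t / s0 w1 w2 (eta1 z) p q t).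
Local Notation S2 := (s2 w1 w2 (eta1 z) p q t / s0 w1 w2 (eta1 z) p q t).

(** The differential of T^(a) is - dm / (x - a) times diag(1, -1), so the integrand is the trace of
    [local_a] with a simple pole, and the two signs cancel. *)
Lemma omega_aE (Ya : P -> C -> 'M[C]_2) j (dm : C) :
  local_form_a a p q om1 om2 eta1 alpha uphi upsi z (Ya z) ->
  der (fun s : C => wp' om1 om2 (s *: delta_mx 0 j + z) (alpha (s *: delta_mx 0 j + z))
    * tpar (s *: delta_mx 0 j + z) / 2) 0 dm ->
  omega_a a om1 om2 alpha Ya j z =
  dm * ((2 * S1 + 2 * t * wpf (alpha z + alpha z)) / wpd (alpha z)).
Proof.
move=> [hY Y1 [r [hr _ hE]]] hm.
have ea : a = wpf (alpha z) + sh by rewrite pt_A subrK.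
have wpE : wp' om1 om2 z (alpha z) = wpd (alpha z).
  exact: (der_derive1 (der_wpf O0 T1 la)).
have hE' : \forall u \near (alpha z)^', r u *: (invmx (Ga a p q om1 om2 eta1 alpha uphi upsi z)
     *m Phi p q om1 om2 eta1 alpha uphi upsi z u) =
   Ya z (wpf u + sh) *m mxexp_diag (- ((wpf u + sh - a)^-1 *: diag2 (wpd (alpha z) * t / 2) (- (wpd (alpha z) * t / 2)))).
  by apply: filterS hE => u [_]; rewrite /Y /Ta wpE.
have [hd hv] := local_a O0 T1 HS Heta la pt_HPhi pt_al2 ea (erefl _) hY Y1 hr hE'.
have wn := wpd_neq0 O0 T1 pt_al2.
rewrite -hv mulfK // /omega_a.
have pE x : partial j (fun z' => Ta a om1 om2 alpha z' x) z = dm *: (- (x - a)^-1 *: diag2 1 (-1)).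
  rewrite /partial; set F := (fun _ => _).
  have -> : F = fun z' => (wp' om1 om2 z' (alpha z') * tpar z' / 2) *: (- (x - a)^-1 *: diag2 1 (-1)).
    by apply/funext => z'; rewrite /F /Ta diag2_scale !scalerA -scaleNr mulrN mulrC.
  exact: der_partialZ hm.
set H := fun x => \tr _ in hd hv *.
rewrite (residue_simple (H := H) (m := - dm)); first by rewrite mulNr opprK.
- exact: hd.
apply: nearW => x; rewrite pE scalerA -scalemxAr mxtraceZ /H mulrN !mulNr.
by congr (- _); rewrite -mulrA; congr (_ * _); rewrite mulrC.
Qed.

Lemma pt_sum nu k l : (forall f : 'I_3 -> C, \prod_mu f mu = f nu * f k * f l /\ \sum_mu f mu = f nu + f k + f l) ->
  wpf (hp nu) + wpf (hp k) + wpf (hp l) = 0.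
Proof. by move=> h; rewrite -(h (fun mu => wpf (hp mu))).2 HS. Qed.

Lemma pt_g2 nu k l : (forall f : 'I_3 -> C, \prod_mu f mu = f nu * f k * f l /\ \sum_mu f mu = f nu + f k + f l) ->
  g2h w1 w2 = 4 * (wpf (hp nu) ^+ 2 + wpf (hp nu) * wpf (hp k) + wpf (hp k) ^+ 2).
Proof.
move=> h; have s0 := pt_sum h.
have s1 : wpf (hp i0) + wpf (hp i1) + wpf (hp i2) = 0 by rewrite -(sum3 (fun mu => wpf (hp mu))) HS.
have [_ e2] := EE_rel O0 T1.
have g : g2h w1 w2 = 4 * (wpf (hp i0) ^+ 2 + wpf (hp i0) * wpf (hp i1) + wpf (hp i1) ^+ 2).
  by rewrite /g2h e2 !(wp_EE O0 T1 HS); field; exact: w10.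
rewrite g; have q3 (x y u : C) : x + y + u = 0 -> 4 * (x ^+ 2 + x * y + y ^+ 2) = 2 * (x ^+ 2 + y ^+ 2 + u ^+ 2).
  by move=> /neg_sum ->; ring.
rewrite (q3 _ _ _ s0) (q3 _ _ _ s1); congr (2 * _).
by rewrite -(sum3 (fun mu => wpf (hp mu) ^+ 2)) (h (fun mu => wpf (hp mu) ^+ 2)).2.
Qed.

Lemma pt_diff nu k : nu != k -> wpf (hp nu) - wpf (hp k) != 0.
Proof.
move=> n; rewrite !pt_hp opprD opprK addrACA [- sh + _]addrC subrr addr0 subr_eq0.
by apply: contra n => /eqP /Hinj ->.
Qed.

(** The differential of log (x - e_nu) is - de_nu / (x - e_nu): again a simple pole, whose
    coefficient is supplied by [local_e]. *)
Lemma omega_eE (Ye : P -> C -> 'M[C]_2) nu k l (Ge Ce : 'M[C]_2) j (de : C) :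
  local_form_e a p q om1 om2 eta1 alpha uphi upsi nu z (Ye z) Ge Ce ->
  [/\ nu != k, nu != l & k != l] ->
  (forall f : 'I_3 -> C, \prod_mu f mu = f nu * f k * f l /\ \sum_mu f mu = f nu + f k + f l) ->
  der (fun s : C => ebr (s *: delta_mx 0 j + z) nu) 0 de ->
  omega_e nu Ye j z = de * Rt w1 w2 (eta1 z) p q t (alpha z) (wpf (hp nu)) (wpf (hp k)) (wpf (hp l)) 0.
Proof.
move=> [hY Y1 uG uC [rho [uf [r hx]]]] [nk nl kl] h hd.
have ee : ebr z nu = wpf (hp nu) + sh by rewrite pt_hp subrK.
have Hcub u : ~ inL u -> wpd u ^+ 2 = 4 * ((wpf u - wpf (hp nu)) * (wpf u - wpf (hp k)) * (wpf u - wpf (hp l))).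
  by move=> lu; rewrite (wpd_sq O0 T1 HS lu) (h (fun mu => wpf u - wpf (hp mu))).1.
have Hdd u : ~ inL u -> wpdd w1 w2 u = 6 * wpf u ^+ 2 - 2 * (wpf (hp nu) ^+ 2 + wpf (hp nu) * wpf (hp k) + wpf (hp k) ^+ 2).
  by move=> lu; rewrite (wpddE O0 T1 HS lu) (pt_g2 h); field.
have hx' xi : complex.Re xi < rho ->
  [/\ derivable uf xi 1, derivable r xi 1, wpf (uf xi) + sh = ebr z nu + cexp xi,
       r xi ^+ 2 = detPhi_alpha p q om1 om2 eta1 alpha uphi upsi z / \det (Phi p q om1 om2 eta1 alpha uphi upsi z (uf xi))
     & r xi *: (invmx (Ga a p q om1 om2 eta1 alpha uphi upsi z) *m Phi p q om1 om2 eta1 alpha uphi upsi z (uf xi)) =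
         Ge *m Ye z (ebr z nu + cexp xi) *m mxexp_diag (xi *: diag2 (- 4^-1) 4^-1) *m Ce].
  by move=> /hx[].
have [hdv hv] := local_e O0 T1 HS Heta la pt_HPhi ee Hcub (pt_sum h) Hdd (pt_diff nk) (pt_diff nl)
  (pt_an nu) hY Y1 uG uC hx'.
rewrite -hv /omega_e.
have dl x : dlog j (fun z' => x - ebr z' nu) z = - de / (x - ebr z nu).
  rewrite /dlog /partial; congr (_ / _); apply: der_partial.
  by apply: der_eq; [apply: derB; [exact: der_cst|exact: hd]|rewrite sub0r].
set H := fun x => \tr _ in hdv hv *.
rewrite (residue_simple (H := H) (m := - de)); first by rewrite mulNr opprK.
- exact: hdv.
apply: nearW => x; rewrite /dTe dl -scalemxAr mxtraceZ /H.
by rewrite -mulrA; congr (_ * _); rewrite mulrC.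
Qed.

Lemma pt_eta : eta1 z = - (cc Om / w1). Proof. exact: (eta1E O0 T1 HS Heta). Qed.

Hypothesis Th0 : theta p q (t / w1) Om != 0.
Local Notation T k := (Th k p q (t / w1) Om).

Lemma pt_T0 : T 0 != 0. Proof. by rewrite -thetaE. Qed.

Lemma pt_S1 : S1 = - (cc Om / w1 ^+ 2) * t + T 1 / (T 0 * w1).
Proof.
have g0 := gE_neq0 (eta1 z) O0 T1 t; have t0 := pt_T0.
rewrite /s1 /s0 pt_eta; rewrite pt_eta in g0; move: (gE _ _ _ _) g0 => g g0.
by field; rewrite g0 w10 t0.
Qed.

Lemma pt_S2 : S2 = - (cc Om / w1 ^+ 2) + (cc Om / w1 ^+ 2) ^+ 2 * t ^+ 2
   - 2 * (cc Om / w1 ^+ 2) * t * (T 1 / (T 0 * w1)) + T 2 / (T 0 * w1 ^+ 2).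
Proof.
have g0 := gE_neq0 (eta1 z) O0 T1 t; have t0 := pt_T0.
rewrite /s2 /s0 pt_eta; rewrite pt_eta in g0; move: (gE _ _ _ _) g0 => g g0.
by field; rewrite g0 w10 t0.
Qed.

Lemma pt_f k l nu : (forall f : 'I_3 -> C, \prod_mu f mu = f nu * f k * f l /\ \sum_mu f mu = f nu + f k + f l) ->
  2 * wpf (alpha z + alpha z) = fA (wpf (alpha z)) (wpf (hp nu)) (wpf (hp k)) (wpf (hp l)).
Proof.
move=> h; rewrite (wp_dbl O0 T1 HS pt_al2) -(fA_dbl (pt_sum h) (pt_an nu) (pt_an k) (pt_an l)).
rewrite expr_div_n (wpd_sq O0 T1 HS la) (h (fun mu => wpf (alpha z) - wpf (hp mu))).1.
rewrite (wpddE O0 T1 HS la) (pt_g2 h).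
by have -> (x : C) : 4 * x / 2 = 2 * x by field.
Qed.

Lemma pt_ftau k l nu : (forall f : 'I_3 -> C, \prod_mu f mu = f nu * f k * f l /\ \sum_mu f mu = f nu + f k + f l) ->
  f_tau a z = fA (wpf (alpha z)) (wpf (hp nu)) (wpf (hp k)) (wpf (hp l)).
Proof.
move=> h; rewrite /f_tau (h (fun mu => a - ebr z mu)).1 (h (fun mu => ((a - ebr z mu) ^+ 2)^-1)).2.
rewrite /fA; have E mu : wpf (alpha z) - wpf (hp mu) = a - ebr z mu by rewrite pt_A pt_hp; ring.
by rewrite !E pt_A; ring.
Qed.

End Point.

(** * Logarithmic derivatives at a point *)

Section LogDer.
Variable R : realType.
Local Notation C := (Cx R).

(** Written multiplied out, so that factors combine by addition without asking that they be
    nonzero. *)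
Definition lder (f : C -> C) (l : C) : Prop := der f 0 (l * f 0).

Lemma lderM (f g : C -> C) l m : lder f l -> lder g m -> lder (fun s => f s * g s) (l + m).
Proof. by move=> hf hg; apply: der_eq; [exact: derM hf hg|ring]. Qed.

Lemma lder_cexp (f : C -> C) l : der f 0 l -> lder (fun s => cexp (f s)) l.
Proof. by move=> hf; apply: der_eq; [exact: der_cexpf hf|rewrite /=; ring]. Qed.

Lemma lder_root n (f g : C -> C) f' g' : (0 < n)%N -> (\forall s \near (0 : C), g s ^+ n = (f s)^-1) ->
  f 0 != 0 -> der f 0 f' -> der g 0 g' -> lder g (- f' / (n%:R * f 0)).
Proof.
move=> n0 hn f0 hf hg; apply: der_eq; first exact: hg.
have e0 : g 0 ^+ n = (f 0)^-1 by exact: (nbhs_singleton hn).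
have g0 : g 0 != 0.
  by apply/eqP => h; move: e0; rewrite h expr0n gtn_eqF //= => /esym/eqP; rewrite invr_eq0 (negbTE f0).
have nn : n%:R != 0 :> C by rewrite pnatr_eq0 -lt0n.
have := der_uniq (der_near hn (derX n hg)) (derV f0 hf).
have -> : g 0 ^+ n.-1 = (f 0 * g 0)^-1.
  by apply: (mulIf g0); rewrite -exprSr prednK // e0 invfM mulfVK.
move=> h; have -> : g' = (n%:R * (f 0 * g 0)^-1 * g') * (f 0 * g 0 / n%:R).
  by field; rewrite nn f0 g0.
by rewrite h; field; rewrite nn f0.
Qed.

End LogDer.

(** * Logarithmic derivatives of the factors of tau along a line *)

Section Core.
Variable R : realType.
Local Notation C := (Cx R).
Local Notation ipi := (ipi R).
Variables (W1 W2 tf : C -> C) (d1 dOm t' : C) (eb : 'I_3 -> C -> C) (de : 'I_3 -> C).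
Local Notation Omf := (fun s => W2 s / W1 s).
Local Notation w1 := (W1 0).
Local Notation Om := (W2 0 / W1 0).
Hypothesis O0 : 0 < complex.Im Om.
Hypothesis T1 : th11 Om 1 0 != 0.
Hypothesis dW1 : der W1 0 d1.
Hypothesis dO : der Omf 0 dOm.
Hypothesis dt' : der tf 0 t'.
Hypothesis dee : forall nu, der (eb nu) 0 (de nu).
Let w10 : w1 != 0 := w1_neq0 O0.
Local Notation t := (tf 0).
Local Notation a0 := (- 2 * d1 / w1).
Local Notation b := (w1 ^+ 2 * dOm / (4 * ipi)).
Local Notation ch := (cc Om / w1 ^+ 2).
Local Notation g2 := (g2h w1 (W2 0)).
Let pn : ipi != 0 := ipi_neq0 R.

(** Both expressions of wp at a half-period are differentiated. The results are the equations solved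
    by [solve_e] and [solve_t]. *)
Lemma core_e nu : (\forall s \near (0 : C), W1 s ^- 2 * EE (Omf s) nu = eb nu s - (\sum_mu eb mu s) / 3) ->
  let E := w1 ^- 2 * EE Om nu in
  de nu - (\sum_mu de mu) / 3 = a0 * E + b * (4 * E ^+ 2 + 4 * ch * E - 2 / 3 * g2).
Proof.
move=> hn E.
have hn' : \forall s \near (0 : C), W1 s ^- 2 * EE (Omf s) nu = eb nu s - (eb i0 s + eb i1 s + eb i2 s) / 3.
  by apply: filterS hn => s h; rewrite h sum3.
have hR := derB (dee nu) (derMc 3^-1 (derD (derD (dee i0) (dee i1)) (dee i2))).
have w2n : w1 ^+ 2 != 0 by rewrite expf_neq0.
have hL := derM (derV (f := fun s => W1 s ^+ 2) w2n (derX 2 dW1)) (der_EE (Omf := Omf) O0 dO T1 nu).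
have := der_uniq (der_near hn' hL) hR; rewrite sum3 /E /g2h /= => <-.
move: (EE _ _) (cc _) (AA _) ipi pn => e c A pi' pn'; field.
by rewrite pn' w10.
Qed.

Variables (p q : C).
Local Notation T k := (Th k p q (t / w1) Om).
Hypothesis T0 : T 0 != 0.

Lemma core_th : lder (fun s => Th 0 p q (tf s / W1 s) (Omf s))
  (T 1 / (T 0 * w1) * (t' + t * a0 / 2) + T 2 / (T 0 * w1 ^+ 2) * b).
Proof.
apply: der_eq; first exact: (der_Th2 (g := Omf) 0 p q O0 (der_div w10 dt' dW1) dO).
move: (T 0) (T 1) (T 2) T0 ipi pn => x0 x1 x2 n0 pi' pn'; field.
by rewrite pn' w10 n0.
Qed.

Lemma core_q : lder (fun s => cexp (- (cc (Omf s) / W1 s) * tf s ^+ 2 / (2 * W1 s)))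
  (t ^+ 2 * b * (g2 - 12 * ch ^+ 2) / 12 - ch * t * t' - ch * t ^+ 2 * a0 / 2).
Proof.
apply: lder_cexp.
have n2 : 2 * w1 != 0 by rewrite mulf_neq0 ?pnatr_eq0.
have hc := derN (der_div w10 (der_cc (Omf := Omf) O0 dO T1) dW1).
apply: der_eq; first exact: (der_div (g := fun s => 2 * W1 s) n2 (derM hc (derX 2 dt')) (dercM 2 dW1)).
rewrite /g2h /=; move: (cc _) (AA _) ipi pn => c A pi' pn'; field.
by rewrite pn' w10.
Qed.

Lemma core_f (ff : C -> C) f' : der ff 0 f' ->
  lder (fun s => cexp (tf s ^+ 2 / 4 * ff s)) (t * t' * ff 0 / 2 + t ^+ 2 / 4 * f').
Proof.
move=> hf; apply: lder_cexp.
by apply: der_eq; [exact: (derM (derMc 4^-1 (derX 2 dt')) hf)|rewrite /=; field].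
Qed.

Variables (a : C) (nu k l : 'I_3) (dl : C).
Hypothesis hkl : forall f : 'I_3 -> C, \prod_mu f mu = f nu * f k * f l /\ \sum_mu f mu = f nu + f k + f l.
Hypothesis den : de nu = dl.
Hypothesis dek : de k = 0.
Hypothesis del : de l = 0.
Hypothesis ean : forall mu, a - eb mu 0 != 0.
Local Notation sh := ((\sum_mu eb mu 0) / 3).

Lemma core_ff : der (fun s => - a + (\sum_mu eb mu s) / 3
    + 2^-1 * (\prod_mu (a - eb mu s)) * \sum_mu ((a - eb mu s) ^+ 2)^-1) 0
  (dl * fA' (a - sh) (eb nu 0 - sh) (eb k 0 - sh) (eb l 0 - sh)).
Proof.
apply: (der_ext (f := fun s => - a + (eb nu s + eb k s + eb l s) / 3
    + 2^-1 * ((a - eb nu s) * (a - eb k s) * (a - eb l s)) *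
    (((a - eb nu s) ^+ 2)^-1 + ((a - eb k s) ^+ 2)^-1 + ((a - eb l s) ^+ 2)^-1))) => [s|].
  by rewrite (hkl (fun mu => eb mu s)).2 (hkl (fun mu => a - eb mu s)).1 (hkl (fun mu => ((a - eb mu s) ^+ 2)^-1)).2.
have hm mu := derB (der_cst a 0) (dee mu).
have n2 mu : (a - eb mu 0) ^+ 2 != 0 by rewrite expf_neq0.
have hi mu := derV (f := fun s => (a - eb mu s) ^+ 2) (n2 mu) (derX 2 (hm mu)).
apply: der_eq.
  exact: (derD (derD (der_cst (- a) 0) (derMc 3^-1 (derD (derD (dee nu) (dee k)) (dee l))))
    (derM (dercM 2^-1 (derM (derM (hm nu) (hm k)) (hm l))) (derD (derD (hi nu) (hi k)) (hi l)))).
have sE x : a - sh - (x - sh) = a - x by ring.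
rewrite /fA' !sE den dek del /=.
move: (eb nu 0) (eb k 0) (eb l 0) (ean nu) (ean k) (ean l) => x y u nx ny nu'; field.
by rewrite nx ny nu'.
Qed.

(** The derivative of wp'(alpha) is found from its square 4 prod (a - e_mu), without that of
    alpha. *)
Lemma core_D (Df : C -> C) (l' : C) : der Df 0 l' -> Df 0 != 0 ->
  (\forall s \near (0 : C), Df s ^+ 2 = 4 * \prod_mu (a - eb mu s)) ->
  l' = - dl / (2 * (a - eb nu 0)) * Df 0.
Proof.
move=> hD D0 hn.
have hn' : \forall s \near (0 : C), Df s ^+ 2 = 4 * ((a - eb nu s) * (a - eb k s) * (a - eb l s)).
  by apply: filterS hn => s ->; rewrite (hkl (fun mu => a - eb mu s)).1.
have hm mu := derB (der_cst a 0) (dee mu).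
have := der_uniq (der_near hn' (derX 2 hD)) (dercM 4 (derM (derM (hm nu) (hm k)) (hm l))).
have e0 : Df 0 ^+ 2 = _ := nbhs_singleton hn'.
rewrite den dek del /= => h.
apply: (mulfI (_ : 2 * Df 0 != 0)); first by rewrite mulf_neq0 ?pnatr_eq0.
transitivity (2 * Df 0 ^+ 1 * l'); first by rewrite expr1.
rewrite h; transitivity (- dl / (a - eb nu 0) * Df 0 ^+ 2); last by field; exact: ean.
by rewrite e0; field; exact: ean.
Qed.

End Core.

(** * Equality of the two sides for each coordinate *)

Section Balance.
Variable F : numFieldType.

(** The pair (dl, t') is (1, 0) for the direction e_nu and (0, 1) for the direction t. In the latter
    case the periods stand still by [solve_t], and the first summand on the right is all that
    remains there. *)
Lemma log_balance (dl t' t c X X2 A E G H a0 b g : F) : E + G + H = 0 ->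
  E - G != 0 -> E - H != 0 -> G - H != 0 -> A - E != 0 -> A - G != 0 -> A - H != 0 ->
  (dl = 1 /\ t' = 0) \/ (dl = 0 /\ t' = 1) -> g = 4 * (E ^+ 2 + E * G + G ^+ 2) ->
  dl - dl / 3 = a0 * E + b * (4 * E ^+ 2 + 4 * c * E - 2 / 3 * g) ->
  0 - dl / 3 = a0 * G + b * (4 * G ^+ 2 + 4 * c * G - 2 / 3 * g) ->
  0 - dl / 3 = a0 * H + b * (4 * H ^+ 2 + 4 * c * H - 2 / 3 * g) ->
  let S1 := - c * t + X in
  let S2 := - c + c ^+ 2 * t ^+ 2 - 2 * c * t * X + X2 in
  X * (t' + t * a0 / 2) + X2 * b + a0 / 4 + - (dl / 8) * ((E - G)^-1 + (E - H)^-1)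
  + (t ^+ 2 * b * (g - 12 * c ^+ 2) / 12 - c * t * t' - c * t ^+ 2 * a0 / 2)
  + (t * t' * fA A E G H / 2 + t ^+ 2 / 4 * (dl * fA' A E G H))
  = (- dl * t / (2 * (A - E)) + t') * (S1 + t / 2 * fA A E G H)
  + dl * (((E - G) + (E - H)) / (8 * ((E - G) * (E - H)))
  + (- (2 * E) + S2 + 2 * (t * (E + (E - G) * (E - H) / (A - E))) * S1
     + (t * (E + (E - G) * (E - H) / (A - E))) ^+ 2) / (4 * ((E - G) * (E - H)))).
Proof.
move=> hs n1 n2 n3 n4 n5 n6 hc hg rE rG rH S1 S2.
case: hc rE rG rH => [[-> ->]|[-> ->]] rE rG rH.
  have [-> ->] := solve_e hs n1 n2 n3 rE rG rH.
  have := final_e t c X X2 hs n1 n2 n4 n5 n6; rewrite /= -/S1 -/S2 -hg => h.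
  rewrite !mul1r; apply: etrans (etrans h _).
    by move: (fA _ _ _ _) (fA' _ _ _ _) (E - G)^-1 (E - H)^-1 ((E - G) * _)^-1 => u1 u2 u3 u4 u5; field.
  by congr (_ * _ + _); rewrite addr0 mulN1r mulNr.
rewrite !mul0r subrr in rE rG rH.
have [-> ->] := solve_t hs n1 n2 n3 rE rG rH.
rewrite /S1; move: (fA _ _ _ _) (fA' _ _ _ _) => u1 u2.
by rewrite !(oppr0, mul0r, mulr0, addr0, add0r) /S1; field.
Qed.

End Balance.

(** * The logarithmic differential of the right-hand side *)

Section Tau.
Variable R : realType.
Local Notation C := (Cx R).
Local Notation P := 'rV[C]_4.
Local Notation dj := (fun j : 'I_4 => (delta_mx 0 j : P)).
Variables (a p q : C) (D : set P) (om1 om2 eta1 alpha uphi upsi : P -> C).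
Variables (Ya : P -> C -> 'M[C]_2) (Ye : 'I_3 -> P -> C -> 'M[C]_2) (Ge Ce : 'I_3 -> P -> 'M[C]_2).
Variables (omr : P -> C) (er : 'I_3 -> 'I_3 -> P -> C).
Hypothesis oD : open D.
Hypothesis Hinj : forall z, D z -> injective (ebr z) /\ forall nu, ebr z nu != a.
Hypothesis HE : elliptic_data a om1 om2 eta1 alpha D.
Hypothesis Hth : forall z, D z -> theta p q (tpar z / om1 z) (om2 z / om1 z) != 0.
Hypothesis Hdet : forall z, D z -> detPhi_nonzero p q om1 om2 eta1 alpha uphi upsi z.
Hypothesis HYa : forall z, D z -> local_form_a a p q om1 om2 eta1 alpha uphi upsi z (Ya z).
Hypothesis HYe : forall nu z, D z ->
  local_form_e a p q om1 om2 eta1 alpha uphi upsi nu z (Ye nu z) (Ge nu z) (Ce nu z).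
Hypothesis Homr : is_inv_root D 2 om1 omr.
Hypothesis Her : forall nu mu : 'I_3, (nu < mu)%N ->
  is_inv_root D 8 (fun z => ebr z nu - ebr z mu) (er nu mu).

Let Hcp z : D z -> canonical_periods (ebr z) (om1 z) (om2 z).
Proof. by case: HE => _ _ h _ _; exact: h. Qed.
Let Heta z : D z -> forall u, ~ in_lat (om1 z) (om2 z) u ->
  wzeta (om1 z) (om2 z) (u + om1 z) = wzeta (om1 z) (om2 z) u + eta1 z.
Proof. by case: HE => _ _ _ h _; exact: h. Qed.
Let la z : D z -> ~ in_lat (om1 z) (om2 z) (alpha z).
Proof. by case: HE => _ _ _ _ h /h[]. Qed.
Let xa z : D z -> xmap om1 om2 z (alpha z) = a.
Proof. by case: HE => _ _ _ _ h /h[]. Qed.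
Let O0 z (Dz : D z) := pt_O0 (Hcp Dz).
Let T1 z (Dz : D z) := pt_T1 (Hcp Dz) (Hdet Dz).
Let HS z (Dz : D z) := pt_HS (Hcp Dz).
Let w10 z (Dz : D z) : om1 z != 0 := w1_neq0 (O0 Dz).

(** The formula with eta_1 replaced by - cc / omega_1: [elliptic_data] provides holomorphy of the
    periods, and that of eta_1 is deduced from this expression. *)
Definition tau_slice (s : P) : C :=
  Th 0 p q (tpar s / om1 s) (om2 s / om1 s) * omr s
  * (er i0 i1 s * er i0 i2 s * er i1 i2 s)
  * cexp (- (cc (om2 s / om1 s) / om1 s) * tpar s ^+ 2 / (2 * om1 s))
  * cexp (tpar s ^+ 2 / 4 * f_tau a s).

Lemma tau_sliceE z : D z -> tau_formula a p q om1 om2 eta1 omr er z = tau_slice z.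
Proof.
move=> Dz; have := prod_pairs (fun nu mu => er nu mu z); rewrite /= => hp.
rewrite /tau_formula /tau_slice (thetaE _ _ _ (O0 Dz)) (pt_eta (Hcp Dz) (Heta Dz) (Hdet Dz)).
by congr (_ * _ * _ * _); exact: hp.
Qed.

Lemma der_coord (z : P) j k : der (fun s : C => (s *: dj j + z) 0 k) 0 (k == j)%:R.
Proof.
apply: (der_ext (f := fun s => s * (k == j)%:R + z 0 k)) => [s|]; first by rewrite !mxE.
by apply: der_eq; [exact: (derD (derMc (k == j)%:R (der_id 0)) (der_cst (z 0 k) 0))|ring].
Qed.

Lemma near_slice z j (Q : P -> Prop) : D z -> (forall y, D y -> Q y) ->
  \forall s \near (0 : C), Q (s *: dj j + z).
Proof.
move=> Dz HQ; have [r r0 H] := open_box oD Dz.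
apply/nearC; exists r => // s hs; apply/HQ/H => k; rewrite !mxE addrK.
rewrite subr0 in hs; case: (k == j); rewrite /= ?mulr1 //.
by rewrite mulr0 cabs0.
Qed.

Lemma slice_hol z j f : D z -> holomorphic_on D f ->
  der (fun s : C => f (s *: dj j + z)) 0 ('D_(dj j) f z).
Proof.
move=> Dz hf; have e : 0 *: dj j + z = z by rewrite scale0r add0r.
by have := @slice_der _ _ f (dj j) z 0; rewrite e; apply; exact: hf.
Qed.

Lemma directions (j : 'I_4) : exists (nu : 'I_3) (dl t' : C),
  [/\ (dl = 1 /\ t' = 0) \/ (dl = 0 /\ t' = 1),
  (ord_max == j)%:R = t' & forall mu, (widen_ord (leqnSn 3) mu == j)%:R = dl * (mu == nu)%:R].
Proof.
have [h|h] := ltnP j 3.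
  exists (Ordinal h), 1, 0; split; first by left.
  - by rewrite -val_eqE /= gtn_eqF.
  by move=> mu; rewrite mul1r -val_eqE.
exists ord0, 0, 1; split; first by right.
- by have -> : ord_max == j by rewrite -val_eqE /= eqn_leq h -ltnS ltn_ord.
by move=> mu; rewrite mul0r -val_eqE /= ltn_eqF // (leq_trans (ltn_ord mu) h).
Qed.

Lemma wpd_slice z j : D z -> exists l',
  der (fun s : C => wp_deriv (om1 (s *: dj j + z)) (om2 (s *: dj j + z)) (alpha (s *: dj j + z))) 0 l'.
Proof.
move=> Dz; have [[h1 h2] h3 _ _ _] := HE.
have e : 0 *: dj j + z = z by rewrite scale0r add0r.
have d1 := slice_hol j Dz h1; have d2 := slice_hol j Dz h2; have d3 := slice_hol j Dz h3.
have n0 : om1 (0 *: dj j + z) != 0 by rewrite e; exact: w10.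
have dO := der_div n0 d2 d1; have dv := der_div n0 d3 d1.
have O0' : 0 < complex.Im (om2 (0 *: dj j + z) / om1 (0 *: dj j + z)) by rewrite e; exact: O0.
have nv : th11 (om2 (0 *: dj j + z) / om1 (0 *: dj j + z)) 0 (alpha (0 *: dj j + z) / om1 (0 *: dj j + z)) != 0.
  by rewrite e; apply: (th_neq0 (O0 Dz)); apply: (nlat_scale (O0 Dz)); exact: la.
have [l hl] := der_pdv O0' dO dv nv.
have n3 : om1 (0 *: dj j + z) ^+ 3 != 0 by rewrite expf_neq0.
by eexists; exact: (derM (derV (f := fun s => om1 (s *: dj j + z) ^+ 3) n3 (derX 3 d1)) hl).
Qed.

Lemma wp'E z : D z -> wp' om1 om2 z (alpha z) = wp_deriv (om1 z) (om2 z) (alpha z).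
Proof. by move=> Dz; exact: (der_derive1 (der_wpf (O0 Dz) (T1 Dz) (la Dz))). Qed.

Lemma near_wp z mu : D z ->
  om1 z ^- 2 * EE (om2 z / om1 z) mu = ebr z mu - (\sum_nu ebr z nu) / 3.
Proof. by move=> Dz; rewrite -(pt_hp (Hcp Dz)) (wp_EE (O0 Dz) (T1 Dz) (HS Dz)). Qed.

Lemma near_sq z : D z -> wp_deriv (om1 z) (om2 z) (alpha z) ^+ 2 = 4 * \prod_mu (a - ebr z mu).
Proof.
move=> Dz; rewrite (wpd_sq (O0 Dz) (T1 Dz) (HS Dz) (la Dz)).
congr (_ * _); apply: eq_bigr => mu _; rewrite (pt_A (xa Dz)) (pt_hp (Hcp Dz)); ring.
Qed.

Lemma wpd_alpha_neq0 z : D z -> wp_deriv (om1 z) (om2 z) (alpha z) != 0.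
Proof.
move=> Dz; apply: contraTN isT => /eqP h; have /esym/eqP := near_sq Dz.
rewrite h expr0n mulf_eq0 pnatr_eq0 /= prod3 !mulf_eq0 !subr_eq0 ![a == _]eq_sym.
by rewrite !(negbTE ((Hinj Dz).2 _)).
Qed.

Lemma omega_aE' z j nu k l dl t' : D z ->
  (forall f : 'I_3 -> C, \prod_mu f mu = f nu * f k * f l /\ \sum_mu f mu = f nu + f k + f l) ->
  [/\ nu != k, nu != l & k != l] ->
  (ord_max == j)%:R = t' -> (forall mu, (widen_ord (leqnSn 3) mu == j)%:R = dl * (mu == nu)%:R) ->
  let E mu := wp (om1 z) (om2 z) (half_period (om1 z) (om2 z) mu) in
  let A := wp (om1 z) (om2 z) (alpha z) in
  omega_a a om1 om2 alpha Ya j z = (- dl * tpar z / (2 * (A - E nu)) + t') *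
   (s1 (om1 z) (om2 z) (eta1 z) p q (tpar z) / s0 (om1 z) (om2 z) (eta1 z) p q (tpar z)
    + tpar z / 2 * fA A (E nu) (E k) (E l)).
Proof.
move=> Dz hkl [nk nl kl] ht' he E A.
have e : 0 *: dj j + z = z by rewrite scale0r add0r.
have [l' hl] := wpd_slice j Dz.
have ht : der (fun s => tpar (s *: dj j + z)) 0 t' by rewrite -ht'; exact: der_coord.
have hee mu : der (fun s => ebr (s *: dj j + z) mu) 0 (dl * (mu == nu)%:R).
  by rewrite -he; exact: der_coord.
have hn : \forall s \near (0 : C), wp_deriv (om1 (s *: dj j + z)) (om2 (s *: dj j + z)) (alpha (s *: dj j + z)) ^+ 2
   = 4 * \prod_mu (a - ebr (s *: dj j + z) mu).
  exact: (near_slice (Q := fun y => wp_deriv (om1 y) (om2 y) (alpha y) ^+ 2 = 4 * \prod_mu (a - ebr y mu)) j Dz near_sq).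
have ean mu : a - ebr (0 *: dj j + z) mu != 0.
  by rewrite e subr_eq0 eq_sym; exact: (Hinj Dz).2.
have dn : dl * (nu == nu)%:R = dl by rewrite eqxx mulr1.
have dk : dl * (k == nu)%:R = 0 by rewrite eq_sym (negbTE nk) mulr0.
have dl0 : dl * (l == nu)%:R = 0 by rewrite eq_sym (negbTE nl) mulr0.
have D0 : wp_deriv (om1 (0 *: dj j + z)) (om2 (0 *: dj j + z)) (alpha (0 *: dj j + z)) != 0.
  by rewrite e; exact: wpd_alpha_neq0.
have := core_D (eb := fun mu s => ebr (s *: dj j + z) mu) hee hkl dn dk dl0 ean hl D0 hn.
rewrite e => l'E.
have hm : der (fun s : C => wp' om1 om2 (s *: dj j + z) (alpha (s *: dj j + z)) * tpar (s *: dj j + z) / 2) 0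
    ((wp_deriv (om1 z) (om2 z) (alpha z) * t' + l' * tpar z) / 2).
  apply: (der_near (f := fun s => wp_deriv (om1 (s *: dj j + z)) (om2 (s *: dj j + z)) (alpha (s *: dj j + z))
      * tpar (s *: dj j + z) / 2)).
    apply: (near_slice (Q := fun y => wp_deriv (om1 y) (om2 y) (alpha y) * tpar y / 2 =
      wp' om1 om2 y (alpha y) * tpar y / 2) j Dz) => y Dy.
    by rewrite wp'E.
  by have := derMc 2^-1 (derM hl ht); rewrite e.
rewrite (omega_aE (Hcp Dz) (Heta Dz) (la Dz) (xa Dz) (Hdet Dz) (Hinj Dz).2 (HYa Dz) hm).
have hf := pt_f (Hcp Dz) (la Dz) (xa Dz) (Hdet Dz) (Hinj Dz).2 hkl.
have aE : a - ebr z nu = A - E nu by rewrite /A /E (pt_A (xa Dz)) (pt_hp (Hcp Dz)); ring.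
have n1 : A - E nu != 0 by rewrite -aE; have := ean nu; rewrite e.
rewrite l'E aE -/A -/(E nu) -/(E k) -/(E l) -hf; have := wpd_alpha_neq0 Dz.
by move: (wp_deriv _ _ _) (_ / s0 _ _ _ _ _ _) (wp _ _ (_ + _)) => W S1 W2 nW; field; rewrite nW n1.
Qed.

Lemma tau_formula_neq0 z : D z -> tau_formula a p q om1 om2 eta1 omr er z != 0.
Proof.
have rn n f g : (0 < n)%N -> is_inv_root D n f g -> forall z, D z -> f z != 0 -> g z != 0.
  move=> n0 [_ h] y Dy f0; apply/eqP => g0; move: (h y Dy); rewrite g0 expr0n gtn_eqF //= => /esym/eqP.
  by rewrite invr_eq0 (negbTE f0).
move=> Dz; rewrite tau_sliceE // /tau_slice -(thetaE _ _ _ (O0 Dz)).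
have ne (i j : 'I_3) : (i < j)%N -> er i j z != 0.
  move=> ij; apply: (rn 8 _ _ _ (Her ij) z Dz) => //; rewrite subr_eq0.
  by apply: contraTneq ij => /(Hinj Dz).1 ->; rewrite ltnn.
have n1 := rn 2 _ _ isT Homr z Dz (w10 Dz).
by rewrite !mulf_neq0 ?cexp_neq0 ?(Hth Dz) // ?n1 // ?(ne i0 i1) ?(ne i0 i2) ?(ne i1 i2).
Qed.

Lemma tau_formula_der z j : D z ->
  der (fun s : C => tau_formula a p q om1 om2 eta1 omr er (s *: dj j + z)) 0
    (omega a om1 om2 alpha Ya Ye j z * tau_formula a p q om1 om2 eta1 omr er z).
Proof.
move=> Dz; have [[h1 h2] _ _ _ _] := HE.
have [nu [dl [t' [hc ht' he]]]] := directions j.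
have [k [l [nkl [hkl hsym]]]] := others R nu; have [nk nl kl] := nkl.
have e : 0 *: dj j + z = z by rewrite scale0r add0r.
have d1 := slice_hol j Dz h1; have d2 := slice_hol j Dz h2.
set W1 := fun s : C => om1 (s *: dj j + z) in d1 *.
set W2 := fun s : C => om2 (s *: dj j + z) in d2 *.
have W1E : W1 0 = om1 z by rewrite /W1 e.
have W2E : W2 0 = om2 z by rewrite /W2 e.
have n0 : W1 0 != 0 by rewrite W1E; exact: w10.
have dO := der_div n0 d2 d1.
have OO : 0 < complex.Im (W2 0 / W1 0) by rewrite W1E W2E; exact: O0.
have TT : th11 (W2 0 / W1 0) 1 0 != 0 by rewrite W1E W2E; exact: T1.
set tf := fun s : C => tpar (s *: dj j + z).
have tE : tf 0 = tpar z by rewrite /tf e.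
have ht : der tf 0 t' by rewrite -ht'; exact: der_coord.
set eb := fun mu (s : C) => ebr (s *: dj j + z) mu.
have eE mu : eb mu 0 = ebr z mu by rewrite /eb e.
have hee mu : der (eb mu) 0 (dl * (mu == nu)%:R) by rewrite -he; exact: der_coord.
have ean mu : a - eb mu 0 != 0 by rewrite eE subr_eq0 eq_sym; exact: (Hinj Dz).2.
have dn : dl * (nu == nu)%:R = dl by rewrite eqxx mulr1.
have dk : dl * (k == nu)%:R = 0 by rewrite eq_sym (negbTE nk) mulr0.
have dl0 : dl * (l == nu)%:R = 0 by rewrite eq_sym (negbTE nl) mulr0.
have T0n : Th 0 p q (tf 0 / W1 0) (W2 0 / W1 0) != 0 by have := Hth Dz; rewrite (thetaE _ _ _ (O0 Dz)) -tE -W1E -W2E.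
have hff : der (fun s => f_tau a (s *: dj j + z)) 0 _ := core_ff hee hkl dn dk dl0 ean.
have lth := core_th OO d1 dO ht T0n.
have lq := core_q OO TT d1 dO ht.
have lf := core_f ht hff.
have hnW : \forall s \near (0 : C), omr (s *: dj j + z) ^+ 2 = (W1 s)^-1.
  exact: (near_slice (Q := fun y => omr y ^+ 2 = (om1 y)^-1) j Dz Homr.2).
have lom := lder_root (n := 2) isT hnW n0 d1 (slice_hol j Dz Homr.1).
have ler (m n : 'I_3) (mn : (m < n)%N) : lder (fun s => er m n (s *: dj j + z))
    (- (dl * (m == nu)%:R - dl * (n == nu)%:R) / (8 * (eb m 0 - eb n 0))).
  apply: (lder_root (n := 8) (f := fun s => eb m s - eb n s) isT _ _ (derB (hee m) (hee n))
    (slice_hol j Dz (Her mn).1)).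
    exact: (near_slice (Q := fun y => er m n y ^+ 8 = (ebr y m - ebr y n)^-1) j Dz (Her mn).2).
  by rewrite !eE subr_eq0; apply: contraTneq mn => /(Hinj Dz).1 ->; rewrite ltnn.
(* Theta, omega_1^(-1/2), the three roots of differences, and the two exponentials, in the order of
   [tau_slice]. *)
have L := lderM (lderM (lderM (lderM lth lom)
  (lderM (lderM (ler i0 i1 isT) (ler i0 i2 isT)) (ler i1 i2 isT))) lq) lf.
have hee0 : dl * (nu == nu)%:R + dl * (k == nu)%:R + dl * (l == nu)%:R = dl.
  by rewrite dn dk dl0 !addr0.
have hsum : \sum_mu dl * (mu == nu)%:R = dl by rewrite (hkl (fun mu => dl * (mu == nu)%:R)).2.
have hnear mu : \forall s \near (0 : C), W1 s ^- 2 * EE (W2 s / W1 s) mu = eb mu s - (\sum_mu' eb mu' s) / 3.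
  apply: (near_slice (Q := fun y => om1 y ^- 2 * EE (om2 y / om1 y) mu =
    ebr y mu - (\sum_mu' ebr y mu') / 3) j Dz) => y; exact: near_wp.
have ce mu := core_e OO TT d1 dO hee (hnear mu); rewrite hsum in ce.
pose A := wp (om1 z) (om2 z) (alpha z).
pose E mu := wp (om1 z) (om2 z) (half_period (om1 z) (om2 z) mu).
have EW mu : om1 z ^- 2 * EE (om2 z / om1 z) mu = E mu by rewrite (near_wp mu Dz) -(pt_hp (Hcp Dz)).
rewrite W1E W2E in ce.
have shE : \sum_mu eb mu 0 = \sum_mu ebr z mu by apply: eq_bigr => mu _; exact: eE.
have AE : a - (\sum_mu eb mu 0) / 3 = A by rewrite shE -(pt_A (xa Dz)).
have eeE mu : eb mu 0 - (\sum_mu eb mu 0) / 3 = E mu by rewrite shE eE -(pt_hp (Hcp Dz)).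
have eD m n : eb m 0 - eb n 0 = E m - E n by rewrite -!eeE; ring.
(* Only the differences containing e_nu move, each with exponent -1/8. Their orientation is
   irrelevant, as numerator and denominator change sign together. *)
have hs : - (dl * (i0 == nu)%:R - dl * (i1 == nu)%:R) / (8 * (eb i0 0 - eb i1 0))
    + - (dl * (i0 == nu)%:R - dl * (i2 == nu)%:R) / (8 * (eb i0 0 - eb i2 0))
    + - (dl * (i1 == nu)%:R - dl * (i2 == nu)%:R) / (8 * (eb i1 0 - eb i2 0))
    = - (dl / 8) * ((E nu - E k)^-1 + (E nu - E l)^-1).
  have sym m n : - (dl * (m == nu)%:R - dl * (n == nu)%:R) / (8 * (eb m 0 - eb n 0)) =
      - (dl * (n == nu)%:R - dl * (m == nu)%:R) / (8 * (eb n 0 - eb m 0)).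
    by rewrite -(opprB (dl * (m == nu)%:R)) -(opprB (eb m 0)) mulrN invrN mulrNN.
  rewrite (hsym (fun m n => - (dl * (m == nu)%:R - dl * (n == nu)%:R) / (8 * (eb m 0 - eb n 0))) sym).
  by rewrite dn dk dl0 !eD !subr0 oppr0 mul0r addr0 !invfM; ring.
have homr : - ('D_(dj j) om1 z) / (2%:R * W1 0) = - 2 * 'D_(dj j) om1 z / om1 z / 4.
  by rewrite W1E; have := w10 Dz; move: ('D_ _ _ _) (om1 z) => x y ny; field.
have oe mu k' l' (nn : [/\ mu != k', mu != l' & k' != l'])
    (hh : forall f : 'I_3 -> C, \prod_mu f mu = f mu * f k' * f l' /\ \sum_mu f mu = f mu + f k' + f l') :=
  omega_eE (Hcp Dz) (Heta Dz) (la Dz) (xa Dz) (Hdet Dz) (Hinj Dz).1 (Hinj Dz).2 (HYe mu Dz) nn hh (hee mu).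
(* A branch point that does not move in the direction j contributes nothing to omega. *)
have oe0 mu : dl * (mu == nu)%:R = 0 -> omega_e mu (Ye mu) j z = 0.
  move=> h0; have [k' [l' [nn [hh _]]]] := others R mu.
  by rewrite (oe mu k' l' nn hh) h0 mul0r.
have nf := pt_diff (Hcp Dz) (Hinj Dz).1 nk; have nh := pt_diff (Hcp Dz) (Hinj Dz).1 nl.
have nm := pt_diff (Hcp Dz) (Hinj Dz).1 kl.
have na mu := pt_an (Hcp Dz) (xa Dz) (Hinj Dz).2 mu.
have cn := ce nu; have ck := ce k; have cl := ce l; rewrite !EW in cn ck cl.
rewrite dn in cn; rewrite dk in ck; rewrite dl0 in cl.
have key := log_balance (tpar z) (Th 1 p q (tpar z / om1 z) (om2 z / om1 z)
     / (Th 0 p q (tpar z / om1 z) (om2 z / om1 z) * om1 z))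
  (Th 2 p q (tpar z / om1 z) (om2 z / om1 z) / (Th 0 p q (tpar z / om1 z) (om2 z / om1 z) * om1 z ^+ 2))
  (pt_sum (Hcp Dz) hkl) nf nh nm (na nu) (na k) (na l) hc (pt_g2 (Hcp Dz) (Hdet Dz) hkl) cn ck cl.
apply: (der_near (f := fun s => tau_slice (s *: dj j + z))).
  by apply: (near_slice (Q := fun y => tau_slice y = tau_formula a p q om1 om2 eta1 omr er y) j Dz) => y Dy;
    rewrite tau_sliceE.
apply: der_eq; first exact: L.
rewrite (tau_sliceE Dz) /= !e; congr (_ * _); last by rewrite W1E W2E tE.
rewrite /omega (omega_aE' Dz hkl nkl ht' he) (hkl (fun mu => omega_e mu (Ye mu) j z)).2.
rewrite (oe nu k l nkl hkl) (oe0 k dk) (oe0 l dl0) !addr0 dn.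
rewrite (Rt0 (eta1 z) p q (tpar z) nf nh (na nu)).
rewrite (pt_S2 (Hcp Dz) (Heta Dz) (Hdet Dz) (Hth Dz)) (pt_S1 (Hcp Dz) (Heta Dz) (Hdet Dz) (Hth Dz)).
rewrite hs homr AE !eeE (pt_ftau (Hcp Dz) (xa Dz) hkl) W1E W2E tE.
exact: key.
Qed.

End Tau.

(** * Differentiability in several complex variables *)

Section Holomorphy.
Variable R : realType.
Local Notation C := (Cx R).
Variables (V : normedModType C) (x : V).
Implicit Types f g : V -> C.

Lemma dfD f g : differentiable f x -> differentiable g x -> differentiable (fun y => f y + g y) x.
Proof. by move=> hf hg; exact: differentiableD. Qed.

Lemma dfN f : differentiable f x -> differentiable (fun y => - f y) x.
Proof. by move=> hf; exact: differentiableN. Qed.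

Lemma dfM f g : differentiable f x -> differentiable g x -> differentiable (fun y => f y * g y) x.
Proof. by move=> hf hg; exact: differentiableM. Qed.

Lemma dfV f : differentiable f x -> f x != 0 -> differentiable (fun y => (f y)^-1) x.
Proof. by move=> hf h0; exact: differentiableV. Qed.

Lemma dfC (c : C) : differentiable (fun _ : V => c) x.
Proof. exact: differentiable_cst. Qed.

Lemma df_cexp f : differentiable f x -> differentiable (fun y => cexp (f y)) x.
Proof.
move=> hf; apply: (differentiable_comp (g := @cexp R) hf).
by apply/derivable1_diffP; exact: der_derivable (der_cexp _).
Qed.

Lemma df_cc f : 0 < complex.Im (f x) -> th11 (f x) 1 0 != 0 -> differentiable f x ->
  differentiable (fun y => cc (f y)) x.
Proof.
move=> O0 T1 hf; have ht k : differentiable (fun y => th11 (f y) k 0) x.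
  exact: (differentiable_Th k 2^-1 2^-1 O0 (dfC 0) hf).
apply: (dfM (ht 3) (dfV (dfM (dfC 3) (ht 1)) _)).
by rewrite mulf_neq0 ?pnatr_eq0.
Qed.

End Holomorphy.

(** * Holomorphy of the right-hand side *)

Section TauHolomorphic.
Variable R : realType.
Local Notation C := (Cx R).
Local Notation P := 'rV[C]_4.

Lemma df_tpar (z : P) : differentiable (@tpar R) z.
Proof. exact: differentiable_coord. Qed.

Lemma df_ebr (z : P) nu : differentiable (fun y : P => ebr y nu) z.
Proof. exact: differentiable_coord. Qed.

Lemma df_f_tau (a : C) (z : P) : (forall nu, ebr z nu != a) -> differentiable (f_tau a) z.
Proof.
move=> hn; have -> : f_tau a = fun y : P => - a + (ebr y i0 + ebr y i1 + ebr y i2) / 3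
    + 2^-1 * ((a - ebr y i0) * (a - ebr y i1) * (a - ebr y i2)) *
    (((a - ebr y i0) * (a - ebr y i0))^-1 + ((a - ebr y i1) * (a - ebr y i1))^-1 + ((a - ebr y i2) * (a - ebr y i2))^-1).
  by apply/funext => y; rewrite /f_tau !sum3 prod3.
have he nu := df_ebr z nu.
have hm nu : differentiable (fun y : P => a - ebr y nu) z := dfD (dfC _ a) (dfN (he nu)).
have hi nu : differentiable (fun y : P => ((a - ebr y nu) * (a - ebr y nu))^-1) z.
  by apply: (dfV (dfM (hm nu) (hm nu))); rewrite mulf_neq0 // subr_eq0 eq_sym.
exact: (dfD (dfD (dfC _ (- a)) (dfM (dfD (dfD (he i0) (he i1)) (he i2)) (dfC _ _)))
  (dfM (dfM (dfC _ _) (dfM (dfM (hm i0) (hm i1)) (hm i2))) (dfD (dfD (hi i0) (hi i1)) (hi i2)))).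
Qed.

Lemma df_tau_slice (a p q : C) (om1 om2 omr : P -> C) (er : 'I_3 -> 'I_3 -> P -> C) (z : P) :
  0 < complex.Im (om2 z / om1 z) -> th11 (om2 z / om1 z) 1 0 != 0 -> (forall nu, ebr z nu != a) ->
  differentiable om1 z -> differentiable om2 z -> differentiable omr z ->
  (forall nu mu : 'I_3, (nu < mu)%N -> differentiable (er nu mu) z) ->
  differentiable (tau_slice a p q om1 om2 omr er) z.
Proof.
move=> O0 T1 hn h1 h2 hr he; have w10 : om1 z != 0 := w1_neq0 O0.
have hO : differentiable (fun y => om2 y / om1 y) z := dfM h2 (dfV h1 w10).
have ht : differentiable (@tpar R) z := df_tpar z.
have h2w : 2 * om1 z != 0 by rewrite mulf_neq0 ?pnatr_eq0.
have hth := @differentiable_Th R _ 0 p q (fun y : P => tpar y / om1 y) (fun y : P => om2 y / om1 y) z O0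
  (dfM ht (dfV h1 w10)) hO.
have hE := df_cexp (dfM (dfM (dfN (dfM (df_cc (f := fun y : P => om2 y / om1 y) O0 T1 hO) (dfV h1 w10))) (dfM ht ht)) (dfV (dfM (dfC _ 2) h1) h2w)).
have hF := df_cexp (dfM (dfM (dfM ht ht) (dfC _ 4^-1)) (df_f_tau hn)).
exact: (dfM (dfM (dfM (dfM hth hr) (dfM (dfM (he i0 i1 isT) (he i0 i2 isT)) (he i1 i2 isT))) hE) hF).
Qed.

End TauHolomorphic.

(** * The tau functions are the nonzero multiples of the formula *)

Theorem theorem1p1 (R : realType) (a p q : Cx R) (D : set 'rV[Cx R]_4)
    (om1 om2 eta1 alpha uphi upsi : 'rV[Cx R]_4 -> Cx R)
    (B1 B0 : 'rV[Cx R]_4 -> 'M[Cx R]_2) (A : 'rV[Cx R]_4 -> 'I_3 -> 'M[Cx R]_2)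
    (Ya : 'rV[Cx R]_4 -> Cx R -> 'M[Cx R]_2)
    (Ye : 'I_3 -> 'rV[Cx R]_4 -> Cx R -> 'M[Cx R]_2)
    (Ge Ce : 'I_3 -> 'rV[Cx R]_4 -> 'M[Cx R]_2)
    (omr : 'rV[Cx R]_4 -> Cx R) (er : 'I_3 -> 'I_3 -> 'rV[Cx R]_4 -> Cx R)
    (tau : 'rV[Cx R]_4 -> Cx R) :
  open D -> simply_connected R D ->
  (forall z, D z -> injective (ebr z) /\ forall nu, ebr z nu != a) ->
  elliptic_data a om1 om2 eta1 alpha D ->
  (forall z, D z -> theta p q (tpar z / om1 z) (om2 z / om1 z) != 0) ->
  (forall z, D z -> detPhi_nonzero p q om1 om2 eta1 alpha uphi upsi z) ->
  (forall z, D z ->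
     solves_system a p q om1 om2 eta1 alpha uphi upsi (B1 z) (B0 z) (A z) z) ->
  (forall z, D z ->
     local_form_a a p q om1 om2 eta1 alpha uphi upsi z (Ya z)) ->
  (forall nu z, D z ->
     local_form_e a p q om1 om2 eta1 alpha uphi upsi nu z
       (Ye nu z) (Ge nu z) (Ce nu z)) ->
  is_inv_root D 2 om1 omr ->
  (forall nu mu : 'I_3, (nu < mu)%N ->
     is_inv_root D 8 (fun z => ebr z nu - ebr z mu) (er nu mu)) ->
  is_tau D (omega a om1 om2 alpha Ya Ye) tau <->
  exists2 c : Cx R, c != 0 &
    forall z, D z -> tau z = c * tau_formula a p q om1 om2 eta1 omr er z.
Proof.
move=> oD [[x Dx] pc _] Hinj HE Hth Hdet _ HYa HYe Homr Her.
set F := tau_formula a p q om1 om2 eta1 omr er.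
have Fn z (Dz : D z) : F z != 0 := tau_formula_neq0 Hinj HE Hth Hdet Homr Her Dz.
have Fd z j (Dz : D z) := tau_formula_der oD Hinj HE Hth Hdet HYa HYe Homr Her j Dz.
have [[h1 h2] _ Hcp Heta _] := HE.
have near_D z : D z -> \forall y \near z, D y by move=> Dz; exact: open_nbhs_nbhs.
have Fh z : D z -> differentiable F z.
  move=> Dz; apply: (@differentiable_near_eq _ _ (tau_slice a p q om1 om2 omr er)).
    by apply: filterS (near_D z Dz) => y Dy; exact: (tau_sliceE omr er HE Hdet).
  apply: df_tau_slice (Hinj z Dz).2 (h1 z Dz) (h2 z Dz) (Homr.1 z Dz) _.
  - exact: pt_O0 (Hcp z Dz).
  - exact: pt_T1 (Hcp z Dz) (Hdet z Dz).
  by move=> nu mu lt; exact: (Her nu mu lt).1.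
split=> [[th0 ht]|[c c0 hc]].
  (* Numerator and denominator have the same logarithmic derivative along each coordinate, so the
     quotient is constant on small boxes and hence along every path in D. *)
  pose Q y := tau y / F y.
  have bc : box_const D Q.
    apply: slice_box_const oD _ => z j Dz; have e : 0 *: delta_mx 0 j + z = z by rewrite scale0r add0r.
    have [tn /(_ j) hl] := ht z Dz.
    have dt := slice_hol j Dz th0; have dF := Fd z j Dz.
    have Fn0 : F (0 *: delta_mx 0 j + z) != 0 by rewrite e; exact: Fn.
    apply: der_eq; first exact: (der_div (f := fun s => tau (s *: delta_mx 0 j + z))
      (g := fun s => F (s *: delta_mx 0 j + z)) Fn0 dt dF).
    have -> : 'D_(delta_mx 0 j) tau z = omega a om1 om2 alpha Ya Ye j z * tau z.
      by rewrite -hl /dlog /partial mulfVK.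
    by rewrite e -/F; rewrite (_ : _ - _ = 0) ?mul0r //; ring.
  have Qc z : D z -> Q z = Q x.
    by move=> Dz; have [g [gc gD <- <-]] := pc z x Dz Dx; exact: path_const bc gc gD.
  exists (Q x); first by rewrite mulf_neq0 ?invr_neq0 ?Fn //; exact: (ht x Dx).1.
  by move=> z Dz; rewrite -(Qc z Dz) /Q mulfVK ?Fn.
have hol : holomorphic_on D tau.
  move=> z Dz; apply: (@differentiable_near_eq _ _ (fun y => c * F y)).
    by apply: filterS (near_D z Dz) => y; exact: hc.
  exact: dfM (dfC _ c) (Fh z Dz).
split=> // z Dz; have tn : tau z != 0 by rewrite hc // mulf_neq0 ?Fn.
split=> // j; rewrite /dlog /partial.
rewrite (der_partial (l := omega a om1 om2 alpha Ya Ye j z * tau z)) ?mulfK //.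
apply: (der_near (f := fun s => c * F (s *: delta_mx 0 j + z))).
  by apply: (near_slice (Q := fun y => c * F y = tau y) oD j Dz) => y Dy; rewrite hc.
by apply: der_eq; [exact: (dercM (f := fun s => F (s *: delta_mx 0 j + z)) c (Fd z j Dz))|rewrite (hc z Dz) mulrCA].
Qed.
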